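(* Let $J$ be an almost complex structure on $\mathbb{R}^{2n}$ and $\delta>0$. Let $u_+\colon(-\infty,0]\times I\to\mathbb{R}^{2n}$ and $u_-\colon[0,\infty)\times I\to\mathbb{R}^{2n}$ be fixed $H^3_\delta$-maps with common asymptotic constant $0$, and let $\lambda$ be the perturbation determined by compactly supported smooth vector fields $\xi_\pm\colon\mathbb{R}^{2n}\to\mathbb{R}^{2n}$ and cut-off functions $\gamma_\pm$ as described in the context. Let $(v_{\alpha,+},v_{\alpha,-},c_\alpha,\rho_\alpha)\to(v_+,v_-,c,\infty)$, let $w_\alpha\colon[-\rho_\alpha,\rho_\alpha]\times I\to\mathbb{R}^{2n}$ be the corresponding preglued maps, and let $(w_+,w_-)=(u_++v_++c,\,u_-+v_-+c)$, so that $w_\alpha\rightsquigarrow(w_+,w_-)$ is a nodal degeneration of cylinders. Suppose additionally that $\bar\partial_Jw_\alpha=\lambda(w_\alpha)$. Then: (1) $\|\bar\partial_Jw_\alpha|_{[-1,1]\times I}\|_0=o(e^{-2\pi\rho_\alpha})$; (2) for some $\delta'>0$ there exist $\xi_{\alpha,\pm}\in\mathbb{R}^{2n}$ such that, with $w_{\alpha,\pm}(s,t)=w_\alpha(s\pm\rho_\alpha,t)$, $$\|(\bar\partial_Jw_{\alpha,+}-\xi_{\alpha,+}\otimes d\bar z)|_{[-\rho_\alpha+1,0]\times I}\|_{2,2\pi+\delta'}+\|(\bar\partial_Jw_{\alpha,-}-\xi_{\alpha,-}\otimes d\bar z)|_{[0,\rho_\alpha-1]\times I}\|_{2,2\pi+\delta'}=\mathcal{O}(1);$$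 (3) for some $\delta''>\pi$, $\|\bar\partial_Jw_\alpha|_{[-1,1]\times I}\|_2=\mathcal{O}(e^{-\delta''\rho_\alpha})$.
   Context: $I=\mathbb{R}/\mathbb{Z}$, $\bar\partial_Ju=\frac12(du+J\circ du\circ i)$. For $f$ on $U\subset\mathbb{R}\times I$: $\|f|_U\|_k=\big(\int_U\sum_{j=0}^k|d^jf|^2\,ds\,dt\big)^{1/2}$ and $\|f|_U\|_{k,\delta}=\big(\int_U\sum_{j=0}^k|d^jf|^2e^{2\delta|s|}\,ds\,dt\big)^{1/2}$; $H^k_\delta$ is the space of functions with finite norm $\|\cdot\|_{k,\delta}$. The convergence $(v_{\alpha,+},v_{\alpha,-},c_\alpha,\rho_\alpha)\to(v_+,v_-,c,\infty)$ means $v_{\alpha,\pm}\to v_\pm$ in $H^3_\delta$, $c_\alpha\to c$, $\rho_\alpha\to\infty$. Nodal degeneration of cylinders $w_\alpha\rightsquigarrow(w_+,w_-)$: maps $w_+$ on $(-\infty,0]\times I$, $w_-$ on $[0,\infty)\times I$, $w_\alpha$ on $[-\rho_\alpha,\rho_\alpha]\times I$, $\rho_\alpha\to\infty$, into a ball $B(\epsilon)\subset\mathbb{R}^{2n}$, such that the asymptotic constants $\lim_{s\to-\infty}w_+=\lim_{s\to\infty}w_-$ exist and agree, $w_\alpha(s\pm\rho_\alpha,t)\to w_\pm$ in $C^1$ on compact subsets, and $w_\pm(s,t)=w_\pm^{\mathrm{disk}}(e^{\pm2\pi(s+it)})$ for $C^{1,\gamma}$ maps $w_\pm^{\mathrm{disk}}$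 on the unit disk, some $\gamma>0$. Pregluing. Fix a smooth $\beta\colon\mathbb{R}\to[0,1]$ equal to $1$ on $[1,\infty)$ and $0$ on $(-\infty,-1]$. To $(v_+,v_-,c,\rho)\in H^3_\delta((-\infty,0]\times I,\mathbb{R}^{2n})\times H^3_\delta([0,\infty)\times I,\mathbb{R}^{2n})\times\mathbb{R}^{2n}\times[\rho_0,\infty)$ associate $w\colon[-\rho,\rho]\times I\to\mathbb{R}^{2n}$, $$w(s,t)=\beta(s)\big(u_+(s-\rho,t)+v_+(s-\rho,t)\big)+(1-\beta(s))\big(u_-(s+\rho,t)+v_-(s+\rho,t)\big)+c.$$ The forms $d\bar z$. In the coordinate $s\in(-\infty,0]$ of the plus end, $\xi\otimes d\bar z=\xi\otimes e^{2\pi(s-it)}(ds-i\,dt)$; in the coordinate $s\in[0,\infty)$ of the minus end, $\xi\otimes d\bar z=-\xi\otimes e^{-2\pi(s-it)}(ds-i\,dt)$. On $[-\rho,\rho]\times I$ these are transported by the shifts: the plus coordinate is $s-\rho$, the minus coordinate is $s+\rho$. Perturbation. Fix cut-off functions $\gamma_\pm\colon[-\rho,\rho]\times I\to[0,1]$ such that $\gamma_+=1$ on $[1,\rho]\times I$, $\gamma_+=0$ on $[-\rho,0]\times I$, and $d\gamma_+$ is supported in $[1-\frac1\rho,1]\times I$; $\gamma_-=1$ on $[-\rho,-1]\times I$, $\gamma_-=0$ on $[0,\rho]\times I$, and $d\gamma_-$ is supported in $[-1,-1+\frac1\rho]\times I$. Define $$\lambda(w)=\gamma_+(s,t)\,\xi_+(w(s,t))\otimes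 d\bar z+\gamma_-(s,t)\,\xi_-(w(s,t))\otimes d\bar z,$$ where in the first term $d\bar z$ is that of the plus end and in the second that of the minus end.
   Formalization: The cut-off functions γ_± are additionally assumed to have derivatives of each order growing at most polynomially in ρ, as for the usual choice of transition width 1/ρ; without any such bound part (3) fails for small δ. *)

(* Defs.v *)
From HB Require Import structures.
From mathcomp Require Import all_boot all_order all_algebra.
From mathcomp Require Import all_classical all_reals all_analysis.
Set Implicit Arguments.
Unset Strict Implicit.
Unset Printing Implicit Defensive.
Import Order.TTheory GRing.Theory Num.Theory.
Import numFieldNormedType.Exports.
Local Open Scope classical_set_scope.
Local Open Scope ring_scope.

Section Calculus.
Variable R : realType.

(* Class C^k: in finite dimension, having a differential all of whose
   directional derivatives are of class C^(k-1) *)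
Fixpoint Ck (V W : normedModType R) (k : nat) (f : V -> W) : Prop :=
  match k with
  | 0 => continuous f
  | k'.+1 => (forall x, differentiable f x) /\
             (forall v, Ck k' (fun x => 'D_v f x))
  end.

Definition smooth (V W : normedModType R) (f : V -> W) : Prop :=
  forall k, Ck k f.

End Calculus.

(* The cylinder R x (R/Z), with coordinate p = (s, t), is encoded by maps on
   R * R that are 1-periodic in t; subsets are of the form A x (R/Z) with
   A : set R, and integrals over A x (R/Z) are integrals over A x [0, 1].
   Only the values of such a map at points with s in A are meaningful. *)
Section Cylinder.
Variable R : realType.

Definition cyl_periodic (T : Type) (A : set R) (f : R * R -> T) : Prop :=
  forall s t, A s -> f (s, t + 1) = f (s, t).

Definition cyl_shift (T : Type) (r : R) (f : R * R -> T) : R * R -> T :=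
  fun p => f (p.1 + r, p.2).

Definition partial_st (W : normedModType R) (i j : nat) (f : R * R -> W)
  : R * R -> W :=
  iter i (fun g p => 'D_((1, 0) : R * R) g p)
    (iter j (fun g p => 'D_((0, 1) : R * R) g p) f).

(* The first column of [dmap f p] is f_s, the second one is f_t. *)
Definition dmap (m : nat) (f : R * R -> 'cV[R]_m) (p : R * R) : 'M[R]_(m, 1 + 1) :=
  row_mx ('D_((1, 0) : R * R) f p) ('D_((0, 1) : R * R) f p).

(* C^1 up to the boundary: the differential, which is taken in the interior
   only, extends continuously. *)
Definition cyl_C1 (m : nat) (A : set R) (f : R * R -> 'cV[R]_m) : Prop :=
  [/\ {within A `*` [set: R], continuous f},
      forall p, (A°) p.1 -> differentiable f p &
      exists2 g : R * R -> 'M[R]_(m, 1 + 1),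
        {within A `*` [set: R], continuous g} &
        forall p, (A°) p.1 -> dmap f p = g p].

(* Squared Euclidean (Frobenius) norm; the library norm on matrices is the
   maximum norm. *)
Definition normsq (m n : nat) (x : 'M[R]_(m, n)) : R :=
  \sum_(a < m) \sum_(b < n) x a b ^+ 2.

Definition leb2 := (@lebesgue_measure R \x @lebesgue_measure R)%E.

Definition test_fun (A : set R) (phi : R * R -> R) : Prop :=
  [/\ smooth phi, cyl_periodic [set: R] phi &
      exists K : set R, [/\ compact K, K `<=` A° &
        forall s t, ~ K s -> phi (s, t) = 0]].

Definition cyl_loc_integrable (m n : nat) (A : set R)
    (f : R * R -> 'M[R]_(m, n)) : Prop :=
  forall (K : set R), compact K -> K `<=` A° -> forall a b,
    leb2.-integrable (K `*` `[0%R, 1%R]) (fun p => (f p a b)%:E).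

(* g is the weak derivative d^(i+j) f / ds^i dt^j on A° x (R/Z) *)
Definition weak_partial (m n : nat) (A : set R) (i j : nat)
    (f g : R * R -> 'M[R]_(m, n)) : Prop :=
  [/\ cyl_loc_integrable A f, cyl_loc_integrable A g &
      forall phi, test_fun A phi -> forall a b,
        (\int[leb2]_(p in (A°) `*` `[0%R, 1%R]%classic)
            (f p a b * partial_st i j phi p)%:E =
         ((-1) ^+ (i + j))%:E *
         \int[leb2]_(p in (A°) `*` `[0%R, 1%R]%classic) (g p a b * phi p)%:E)%E].

(* |d^l f|^2 summed over l <= k, where D i j is d^(i+j) f / ds^i dt^j; the
   tensor d^l f has 'C(l, i) entries equal to D i (l - i). *)
Definition jet_normsq (m n k : nat) (D : nat -> nat -> R * R -> 'M[R]_(m, n))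
    (p : R * R) : R :=
  \sum_(l < k.+1) \sum_(i < l.+1) 'C(l, i)%:R * normsq (D i (l - i)%N p).

(* || f |_(A x I) ||_(k, delta). The weak derivatives being unique almost
   everywhere, the infimum is over at most one value; it is +oo if f does not
   have weak derivatives up to order k. *)
Definition sob_norm (m n k : nat) (delta : R) (A : set R)
    (f : R * R -> 'M[R]_(m, n)) : \bar R :=
  ereal_inf [set x : \bar R | exists2 D : nat -> nat -> R * R -> 'M[R]_(m, n),
    (forall i j, (i + j <= k)%N -> weak_partial A i j f (D i j)) &
    x = ((\int[leb2]_(p in A `*` `[0%R, 1%R]%classic)
      (jet_normsq k D p * expR (2 * delta * `|p.1|))%:E) `^ 2^-1)%E].

(* An element of H^3_delta(A x I, R^m), given by its continuous
   representative (Sobolev embedding in dimension 2). *)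
Definition H3_map (m : nat) (delta : R) (A : set R) (f : R * R -> 'cV[R]_m)
  : Prop :=
  [/\ cyl_periodic A f, {within A `*` [set: R], continuous f} &
      (sob_norm 3 delta A f < +oo)%E].

Definition H3_cvg (m : nat) (delta : R) (A : set R)
    (f_ : nat -> R * R -> 'cV[R]_m) (f : R * R -> 'cV[R]_m) : Prop :=
  (fun k => sob_norm 3 delta A (fun p => f_ k p - f p)) @ \oo --> 0%E.

Definition asymptotic_const (m : nat) (F : set_system R)
    (f : R * R -> 'cV[R]_m) (a : 'cV[R]_m) : Prop :=
  forall e, 0 < e -> \forall s \near F, forall t, `|f (s, t) - a| < e.

(* The complex number e^(a + i theta) *)
Definition cexp (a theta : R) : R * R :=
  (expR a * cos theta, expR a * sin theta).

Definition odisk : set (R * R) := [set z | z.1 ^+ 2 + z.2 ^+ 2 < 1].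
Definition cdisk : set (R * R) := [set z | z.1 ^+ 2 + z.2 ^+ 2 <= 1].

(* C^{1, h} on the closed unit disk; a Hoelder continuous differential on the
   open disk extends to the closed one. *)
Definition disk_C1h (m : nat) (h : R) (f : R * R -> 'cV[R]_m) : Prop :=
  [/\ {within cdisk, continuous f},
      forall z, odisk z -> differentiable f z &
      exists C : R, forall z z', odisk z -> odisk z' ->
        `|dmap f z - dmap f z'| <= C * `|z - z'| `^ h].

(* C^1 convergence on compact subsets of A x I, A an interval, for maps that
   are C^1 up to the boundary; f_ k need only be defined on a set exhausting
   A x I as k grows. *)
Definition C1_cvg_compacts (m : nat) (A : set R)
    (f_ : nat -> R * R -> 'cV[R]_m) (f : R * R -> 'cV[R]_m) : Prop :=
  forall K : set R, compact K -> K `<=` A -> forall e, 0 < e ->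
    \forall k \near \oo, forall s t, K s ->
      `|f_ k (s, t) - f (s, t)| < e /\
      ((A°) s -> `|dmap (f_ k) (s, t) - dmap f (s, t)| < e).

Definition nodal_degeneration (m : nat) (eps : R) (rho : nat -> R)
    (w : nat -> R * R -> 'cV[R]_m) (wp wm : R * R -> 'cV[R]_m) : Prop :=
  [/\ rho k @[k --> \oo] --> +oo%R,
      [/\ forall k, cyl_periodic `[- rho k, rho k] (w k) /\
                    cyl_C1 `[- rho k, rho k] (w k),
          cyl_periodic `]-oo, 0] wp /\ cyl_C1 `]-oo, 0] wp &
          cyl_periodic `[0, +oo[ wm /\ cyl_C1 `[0, +oo[ wm],
      [/\ forall k s t, - rho k <= s <= rho k -> normsq (w k (s, t)) < eps ^+ 2,
          forall s t, s <= 0 -> normsq (wp (s, t)) < eps ^+ 2 &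
          forall s t, 0 <= s -> normsq (wm (s, t)) < eps ^+ 2],
      exists a, asymptotic_const -oo%R wp a /\ asymptotic_const +oo%R wm a &
      [/\ C1_cvg_compacts `]-oo, 0] (fun k => cyl_shift (rho k) (w k)) wp,
          C1_cvg_compacts `[0, +oo[ (fun k => cyl_shift (- rho k) (w k)) wm &
          exists (h : R) (dp dm : R * R -> 'cV[R]_m),
            [/\ 0 < h, disk_C1h h dp, disk_C1h h dm,
                forall s t, s <= 0 ->
                  wp (s, t) = dp (cexp (2 * pi * s) (2 * pi * t)) &
                forall s t, 0 <= s ->
                  wm (s, t) = dm (cexp (- (2 * pi * s)) (- (2 * pi * t)))]]].

Definition gluing_cutoff (beta : R -> R) : Prop :=
  [/\ smooth beta, forall s, 0 <= beta s <= 1,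
      forall s, 1 <= s -> beta s = 1 & forall s, s <= -1 -> beta s = 0].

Definition preglue (m : nat) (beta : R -> R)
    (up um vp vm : R * R -> 'cV[R]_m) (c : 'cV[R]_m) (rho : R) (p : R * R)
    : 'cV[R]_m :=
  beta p.1 *: (cyl_shift (- rho) up p + cyl_shift (- rho) vp p) +
  (1 - beta p.1) *: (cyl_shift rho um p + cyl_shift rho vm p) + c.

Definition gamma_plus_spec (rho : R) (g : R * R -> R) : Prop :=
  [/\ smooth g /\ cyl_periodic `[- rho, rho] g,
      forall s t, - rho <= s <= rho -> 0 <= g (s, t) <= 1,
      forall s t, 1 <= s <= rho -> g (s, t) = 1,
      forall s t, - rho <= s <= 0 -> g (s, t) = 0 &
      forall s t, - rho <= s <= rho -> ~~ (1 - rho^-1 <= s <= 1) ->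
        forall v, 'D_v g (s, t) = 0].

Definition gamma_minus_spec (rho : R) (g : R * R -> R) : Prop :=
  [/\ smooth g /\ cyl_periodic `[- rho, rho] g,
      forall s t, - rho <= s <= rho -> 0 <= g (s, t) <= 1,
      forall s t, - rho <= s <= -1 -> g (s, t) = 1,
      forall s t, 0 <= s <= rho -> g (s, t) = 0 &
      forall s t, - rho <= s <= rho -> ~~ (-1 <= s <= -1 + rho^-1) ->
        forall v, 'D_v g (s, t) = 0].

(* The standing normalization for cut-offs whose transition region has width
   1/rho: derivatives grow at most polynomially in rho (as they do for
   s |-> chi (rho * (s - 1)) with chi fixed). Nothing else prevents the
   derivatives from growing exponentially in rho. *)
Definition poly_derivs (rho0 : R) (gamma : R -> R * R -> R) : Prop :=
  forall i j, exists (C : R) (N : nat), forall rho s t,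
    rho0 <= rho -> - rho <= s <= rho ->
    `|partial_st i j (gamma rho) (s, t)| <= C * rho ^+ N.

Definition compact_support (m : nat) (xi : 'cV[R]_m -> 'cV[R]_m) : Prop :=
  exists2 K : set 'cV[R]_m, compact K & forall x, ~ K x -> xi x = 0.

End Cylinder.

Section CauchyRiemann.
Variables (R : realType) (n : nat).
Local Notation vec := ('cV[R]_(n.*2)).
Local Notation form := ('M[R]_(n.*2, 1 + 1)).

Definition almost_complex (J : vec -> 'M[R]_(n.*2)) : Prop :=
  smooth J /\ forall x, J x *m J x = - 1%:M.

(* i (d/ds) = d/dt and i (d/dt) = - d/ds *)
Definition i_mx : 'M[R]_(1 + 1) := block_mx 0 (- 1%:M) 1%:M 0.

Definition dbar (J : vec -> 'M[R]_(n.*2)) (u : R * R -> vec) (p : R * R) : form :=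
  2^-1 *: (dmap u p + J (u p) *m dmap u p *m i_mx).

(* Complex scalars act on the fibre at w(s, t) of the (0,1)-forms along w by
   J (w (s, t)), which is the argument [Jw] below. *)
Definition cexp_scale (Jw : 'M[R]_(n.*2)) (a theta : R) (eta : form) : form :=
  expR a *: (cos theta *: eta + sin theta *: (Jw *m eta)).

(* x \otimes (ds - i dt) *)
Definition tens_ds_idt (Jw : 'M[R]_(n.*2)) (x : vec) : form :=
  row_mx x (- (Jw *m x)).

(* x \otimes dzbar in the coordinates of the plus and of the minus end;
   s - i t in the exponent gives the angles -2 pi t and 2 pi t. *)
Definition dzbar_plus (Jw : 'M[R]_(n.*2)) (x : vec) (p : R * R) : form :=
  cexp_scale Jw (2 * pi * p.1) (- (2 * pi * p.2)) (tens_ds_idt Jw x).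

Definition dzbar_minus (Jw : 'M[R]_(n.*2)) (x : vec) (p : R * R) : form :=
  - cexp_scale Jw (- (2 * pi * p.1)) (2 * pi * p.2) (tens_ds_idt Jw x).

Definition perturbation (J : vec -> 'M[R]_(n.*2)) (xip xim : vec -> vec)
    (gammap gammam : R -> R * R -> R) (rho : R) (w : R * R -> vec) (p : R * R)
    : form :=
  gammap rho p *: cyl_shift (- rho) (dzbar_plus (J (w p)) (xip (w p))) p +
  gammam rho p *: cyl_shift rho (dzbar_minus (J (w p)) (xim (w p))) p.

End CauchyRiemann.

Section Asymptotics.
Variable R : realType.

Definition is_littleo (N : nat -> \bar R) (g : nat -> R) : Prop :=
  forall e : R, 0 < e -> \forall k \near \oo, (N k <= (e * g k)%:E)%E.

Definition is_bigO (N : nat -> \bar R) (g : nat -> R) : Prop :=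
  exists C : R, \forall k \near \oo, (N k <= (C * g k)%:E)%E.

End Asymptotics.

(* Main.v *)
(* On each end the equation gives dbar w - xi(c) dzbar = (xi(w) - xi(c)) dzbar,
   so xi_alpha = xi(c_alpha) and delta' = delta will do: the weight e^(4 pi |s|)
   of the squared norm cancels |dzbar|^2, and it remains to bound xi(w) - xi(c)
   in H^2_delta by w - c in H^2_delta.  The second derivatives of xi(w) contain
   |dw|^2; as w is bounded, the weighted integral of |dw|^4 is bounded by that of
   |dw|^2 + |d^2 w|^2 (Gagliardo-Nirenberg along horizontal and vertical lines),
   so no Sobolev embedding is used.

   On the neck [-1, 1] x I, dbar w is a cut-off of xi(w) times a form of size
   e^(-2 pi rho).  The derivatives of the cut-offs grow polynomially in rho, hence
   any delta'' < 2 pi will do, and 3 pi / 2 is taken.  The cut-offs vanish on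
   [-1, 1] x I outside two strips of total area 2 / rho, which turns the
   O(e^(-2 pi rho)) of the L^2 norm into o(e^(-2 pi rho)).

   To compute with weak derivatives, test with products of bump functions: a
   continuous function with integrable weak derivatives is absolutely continuous
   on almost every line. *)
Require Import Defs.
From HB Require Import structures.
From mathcomp Require Import all_boot all_order all_algebra.
From mathcomp Require Import all_classical all_reals all_analysis.
From mathcomp Require Import measurable_realfun.
From mathcomp Require Import ring lra.
Set Implicit Arguments.
Unset Strict Implicit.
Unset Printing Implicit Defensive.
Import Order.TTheory GRing.Theory Num.Theory.
Import numFieldNormedType.Exports.
Local Open Scope classical_set_scope.
Local Open Scope ring_scope.

(** The obstacle is regularity: [sob_norm] is an infimum over weak derivatives, whereas dbar w has
    to be differentiated twice through the nonlinear maps J(w) and xi(w). The proof therefore works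
    with jets [D i j] that are classical to first order and absolutely continuous on almost every
    line to second order. The first-order part comes from the C^1 clause of the nodal degeneration,
    the second-order part from H^3_delta. Such jets are closed under sums, products and smooth
    composition, and integration by parts turns them back into weak derivatives. To bound the
    infimum it is then enough to write down one explicit jet of the perturbation. Uniformity in
    alpha rests on two facts. Where the pregluing cut-off is 1, w - c_alpha is exactly u + v_alpha
    in the coordinate of the end, and its weighted energy is eventually bounded because v_alpha
    converges. Every constant depends only on sup bounds for w, J, xi and on that energy: the
    interpolation inequality holds with one constant on all intervals of length at least 1. *)

(** * Fubini's theorem for real-valued integrands on product sets *)

Section PlaneIntegrals.
Variable R : realType.
Local Notation RR := (measurableTypeR R).
Local Notation mu := (@lebesgue_measure R).
Local Notation leb2 := (@leb2 R).
Implicit Types (D E : set RR) (f g : RR * RR -> R).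

Let patchX1 (T : pointedType) D E (F : RR * RR -> T) x : D x ->
  (fun y => (F \_ (D `*` E)) (x, y)) = (fun y => F (x, y)) \_ E.
Proof.
move=> Dx; apply/funext => y; rewrite !patchE.
by rewrite in_setX/= (mem_set Dx).
Qed.

Let patchX2 (T : pointedType) D E (F : RR * RR -> T) y : E y ->
  (fun x => (F \_ (D `*` E)) (x, y)) = (fun x => F (x, y)) \_ D.
Proof.
move=> Ey; apply/funext => x; rewrite !patchE.
by rewrite in_setX/= (mem_set Ey) andbT.
Qed.

Lemma leb2_ae_slice2 f D E : measurable D -> measurable E ->
  leb2.-integrable (D `*` E) (EFin \o f) ->
  {ae mu, forall y, E y -> mu.-integrable D (fun x => (f (x, y))%:E)}.
Proof.
move=> mD mE /(integrable_mkcond _ (measurableX mD mE)) fi.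
have := @ae_integrable2 _ _ RR RR R mu mu _ fi.
apply: filterS => y /= fy Ey.
by apply/(integrable_mkcond _ mD); rewrite patchX2 in fy.
Qed.

Lemma leb2_ae_slice1 f D E : measurable D -> measurable E ->
  leb2.-integrable (D `*` E) (EFin \o f) ->
  {ae mu, forall x, D x -> mu.-integrable E (fun y => (f (x, y))%:E)}.
Proof.
move=> mD mE /(integrable_mkcond _ (measurableX mD mE)) fi.
have := @ae_integrable1 _ _ RR RR R mu mu _ fi.
apply: filterS => x /= fx Dx.
by apply/(integrable_mkcond _ mE); rewrite patchX1 in fx.
Qed.

Let restrXE D E (F : RR * RR -> \bar R) :
  (fun x => \int[mu]_y (F \_ (D `*` E)) (x, y))%E =
   (fun x => \int[mu]_(y in E) F (x, y))%E \_ D.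
Proof.
apply/funext => x; rewrite [RHS]patchE; case: ifPn => [/set_mem Dx|nDx].
  by rewrite patchX1// -integral_mkcond.
by rewrite integral0_eq// => y _; rewrite patchE in_setX/= (negbTE nDx).
Qed.

Let restrXE' D E (F : RR * RR -> \bar R) :
  (fun y => \int[mu]_x (F \_ (D `*` E)) (x, y))%E =
   (fun y => \int[mu]_(x in D) F (x, y))%E \_ E.
Proof.
apply/funext => y; rewrite [RHS]patchE; case: ifPn => [/set_mem Ey|nEy].
  by rewrite patchX2// -integral_mkcond.
by rewrite integral0_eq// => x _; rewrite patchE in_setX/= (negbTE nEy) andbF.
Qed.

(** Fubini makes inner integrals finite only almost everywhere; [fine] replaces the infinite values,
    which sit on a null set, so that real integrals can be iterated. *)
Lemma ae_fineK D (F : RR -> \bar R) : measurable D -> mu.-integrable D F ->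
  mu.-integrable D (EFin \o (fine \o F)) /\
  (\int[mu]_(x in D) (fine (F x))%:E = \int[mu]_(x in D) F x)%E.
Proof.
move=> mD Fi.
have aeF : ae_eq mu D (fun x => (fine (F x))%:E) F.
  have := integrable_ae mD Fi; apply: filterS => x /= Fx Dx.
  by rewrite fineK//; exact: Fx.
have mF := measurable_int mu Fi.
have mfF : measurable_fun D (EFin \o (fine \o F)).
  by apply/measurable_EFinP; apply: measurableT_comp.
split; last by apply: ae_eq_integral.
apply/integrableP; split => //; have /integrableP[_] := Fi.
move=> h; apply: le_lt_trans h; rewrite le_eqVlt; apply/orP; left; apply/eqP.
apply: ae_eq_integral => //.
- exact: (measurableT_comp (@abse_measurable R setT) mfF).
- exact: (measurableT_comp (@abse_measurable R setT) mF).
- exact: (ae_eq_abse aeF).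
Qed.

Let integrable_fubini_G' (F : RR * RR -> \bar R) :
  leb2.-integrable setT F -> mu.-integrable setT (fun y => \int[mu]_x F (x, y))%E.
Proof.
move=> fi; have mF := measurable_int _ fi.
have mG := @measurable_fubini_G _ _ RR RR R mu mu _ fi.
apply/integrableP; split => //.
apply: le_lt_trans ((@integrable21ltyP _ _ RR RR R mu mu F mF).1 fi).
apply: ge0_le_integral => //.
- exact: (measurableT_comp (@abse_measurable R setT) mG).
- apply: (@measurable_fun_fubini_tonelli_G _ _ RR RR R mu (fun z => `|F z|%E)) => //.
  exact: (measurableT_comp (@abse_measurable R setT) mF).
- move=> y _; apply: le_abse_integral => //.
  by apply: measurableT_comp => //; exact: measurable_pair2.
Qed.

Lemma integrable_inner1 f D E : measurable D -> measurable E ->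
  leb2.-integrable (D `*` E) (EFin \o f) ->
  mu.-integrable D (fun x => (\int[mu]_(y in E) f (x, y))%:E).
Proof.
move=> mD mE /(integrable_mkcond _ (measurableX mD mE)) fi.
have := @integrable_fubini_F _ _ RR RR R mu mu _ fi.
rewrite /fubini_F restrXE.
by move=> /(integrable_mkcond _ mD) /(ae_fineK mD)[].
Qed.

Lemma integrable_inner2 f D E : measurable D -> measurable E ->
  leb2.-integrable (D `*` E) (EFin \o f) ->
  mu.-integrable E (fun y => (\int[mu]_(x in D) f (x, y))%:E).
Proof.
move=> mD mE /(integrable_mkcond _ (measurableX mD mE)) fi.
have := integrable_fubini_G' fi.
rewrite restrXE'.
by move=> /(integrable_mkcond _ mE) /(ae_fineK mE)[].
Qed.

Lemma Rintegral_fubini1 f D E : measurable D -> measurable E ->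
  leb2.-integrable (D `*` E) (EFin \o f) ->
  \int[leb2]_(p in D `*` E) f p =
  \int[mu]_(x in D) \int[mu]_(y in E) f (x, y).
Proof.
move=> mD mE /(integrable_mkcond _ (measurableX mD mE)) fi.
rewrite [in LHS]/Rintegral integral_mkcond.
rewrite -(@integral12_prod_meas1 _ _ RR RR R mu mu _ fi) /fubini_F.
rewrite restrXE.
have := @integrable_fubini_F _ _ RR RR R mu mu _ fi.
rewrite /fubini_F restrXE.
move=> /(integrable_mkcond _ mD) /(ae_fineK mD)[_ eF].
by rewrite -integral_mkcond -eF.
Qed.

Lemma Rintegral_fubini2 f D E : measurable D -> measurable E ->
  leb2.-integrable (D `*` E) (EFin \o f) ->
  \int[leb2]_(p in D `*` E) f p =
  \int[mu]_(y in E) \int[mu]_(x in D) f (x, y).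
Proof.
move=> mD mE /(integrable_mkcond _ (measurableX mD mE)) fi.
rewrite [in LHS]/Rintegral integral_mkcond.
rewrite -(@integral21_prod_meas1 _ _ RR RR R mu mu _ fi) /fubini_G.
rewrite restrXE'.
have := integrable_fubini_G' fi.
rewrite restrXE'.
move=> /(integrable_mkcond _ mE) /(ae_fineK mE)[_ eF].
by rewrite -integral_mkcond -eF.
Qed.

End PlaneIntegrals.

Lemma integrable_patch d (T : measurableType d) (R : realType)
    (m : {measure set T -> \bar R}) (D E : set T) (f : T -> R) :
  measurable D -> measurable E -> m.-integrable D (EFin \o f) ->
  m.-integrable D (EFin \o (f \_ E)).
Proof.
move=> mD mE fi; have mDE := measurableI _ _ mD mE.
have := integrableS mD mDE (@subIsetl _ _ _) fi.
move=> /(integrable_mkcond _ mDE) h; apply/(integrable_mkcond _ mD).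
apply: eq_integrable h => // x _.
by rewrite !patchE in_setI/= patchE; case: (x \in D); case: (x \in E).
Qed.

Section TensorIntegrable.
Variable R : realType.
Local Notation RR := (measurableTypeR R).
Local Notation mu := (@lebesgue_measure R).
Local Notation leb2 := (@leb2 R).

Lemma integrable_tensor (D E : set RR) (f g : RR -> R) :
  measurable D -> measurable E ->
  mu.-integrable D (EFin \o f) -> mu.-integrable E (EFin \o g) ->
  leb2.-integrable (D `*` E) (fun p => (f p.1 * g p.2)%:E).
Proof.
move=> mD mE /(integrable_mkcond _ mD) fi /(integrable_mkcond _ mE) gi.
apply/(integrable_mkcond _ (measurableX mD mE)).
rewrite !restrict_EFin in fi gi.
have -> : (fun p : RR * RR => (f p.1 * g p.2)%:E) \_ (D `*` E) =
    (fun p => ((f \_ D) p.1 * (g \_ E) p.2)%:E).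
  apply/funext => -[x y]; rewrite !patchE in_setX/=.
  by case: (x \in D); case: (y \in E); rewrite /= ?mulr0 ?mul0r.
set F := f \_ D in fi *; set G := g \_ E in gi *.
have mF : measurable_fun setT F by apply/measurable_EFinP; exact: measurable_int fi.
have mG : measurable_fun setT G by apply/measurable_EFinP; exact: measurable_int gi.
have mFG : measurable_fun setT (fun p : RR * RR => (F p.1 * G p.2)%:E).
  apply/measurable_EFinP; apply: measurable_funM.
    exact: measurableT_comp.
  exact: measurableT_comp.
apply/(@integrable12ltyP _ _ RR RR R mu mu _ mFG) => /=.
have /integrableP[_ Goo] := gi; have /integrableP[_ Foo] := fi.
pose C := fine (\int[mu]_y `|(G y)%:E|)%E.
have GC : (\int[mu]_y `|(G y)%:E|)%E = C%:E.
  by rewrite fineK// ge0_fin_numE//; exact: integral_ge0.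
have HI : mu.-integrable setT (fun x => C%:E * (F x)%:E)%E by exact: integrableZl.
have /integrableP[_] := HI; apply: le_lt_trans; rewrite le_eqVlt; apply/orP; left.
apply/eqP; apply: eq_integral => x _.
under eq_integral do rewrite normrM EFinM.
rewrite ge0_integralZl//; last first.
  by apply/measurable_EFinP; apply: measurableT_comp.
have -> : (\int[mu]_y (`|G y|)%:E)%E = C%:E by [].
rewrite abseM muleC; congr (_ * _)%E.
by rewrite gee0_abs// -GC integral_ge0.
Qed.

End TensorIntegrable.

(** * Absolutely continuous functions of one variable *)

Section AbsolutelyContinuous.
Variable R : realType.
Local Notation RR := (measurableTypeR R).
Local Notation mu := (@lebesgue_measure R).
Local Notation leb2 := (@leb2 R).

(* g is absolutely continuous on [a, b], with derivative h *)
Definition ac1 (a b : R) (g h : R -> R) : Prop :=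
  mu.-integrable `[a, b] (EFin \o h) /\
  forall x, a <= x <= b -> g x = g a + \int[mu]_(y in `[a, x]) h y.

Lemma integrable_itvS (a b c d : R) (h : R -> R) : a <= c -> d <= b ->
  mu.-integrable `[a, b] (EFin \o h) -> mu.-integrable `[c, d] (EFin \o h).
Proof.
move=> ac db; apply: integrableS => //=.
by apply: subset_itv; rewrite bnd_simp.
Qed.

Lemma Rintegral_itv_cat (a b c : R) (h : R -> R) : a <= b -> b <= c ->
  mu.-integrable `[a, c] (EFin \o h) ->
  \int[mu]_(y in `[a, c]) h y =
  \int[mu]_(y in `[a, b]) h y + \int[mu]_(y in `[b, c]) h y.
Proof.
move=> ab bc hi.
have := @Rintegral_itvB R h (BLeft a) (BRight c) b hi; rewrite !bnd_simp.
move=> /(_ ab bc) e.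
rewrite -(Rintegral_itv_obnd_cbnd (r := b)).
  by rewrite -e addrC subrK.
by apply: integrableS hi => //=; apply: subset_itv; rewrite bnd_simp.
Qed.

Lemma ac1_sub (a b c d : R) g h : a <= c -> d <= b ->
  ac1 a b g h -> ac1 c d g h.
Proof.
move=> ac db [hi gE]; split; first exact: integrable_itvS hi.
move=> x /andP[cx xd].
rewrite (gE x) ?(le_trans ac)//=; last by rewrite (le_trans xd).
rewrite (gE c) ?ac//=; last by rewrite (le_trans cx)// (le_trans xd).
rewrite -addrA -Rintegral_itv_cat//.
by apply: integrable_itvS hi => //; rewrite (le_trans xd).
Qed.

Lemma ac1_int (a b x y : R) g h : ac1 a b g h -> a <= x -> x <= y -> y <= b ->
  g y - g x = \int[mu]_(z in `[x, y]) h z.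
Proof.
move=> + ax xy yb => /(ac1_sub ax yb)[_ gE].
by rewrite (gE y) ?xy ?lexx// addrAC subrr add0r.
Qed.

Lemma ac1_cst (a b c : R) : ac1 a b (fun=> c) (fun=> 0).
Proof.
split => [|x _]; last by rewrite Rintegral_cst//= mul0r addr0.
exact: (@integrable0 _ _ _ mu `[a, b]).
Qed.

Lemma ac1D (a b : R) g1 h1 g2 h2 : ac1 a b g1 h1 -> ac1 a b g2 h2 ->
  ac1 a b (fun x => g1 x + g2 x) (fun x => h1 x + h2 x).
Proof.
move=> [i1 e1] [i2 e2]; split => [|x xab]; first exact: (integrableD _ i1 i2).
have xb : x <= b by case/andP: xab.
rewrite (e1 _ xab) (e2 _ xab) RintegralD//; first by rewrite addrACA.
  exact: integrable_itvS i1.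
exact: integrable_itvS i2.
Qed.

Lemma ac1_continuous (a b : R) g h : a <= b -> ac1 a b g h ->
  {within `[a, b], continuous g}.
Proof.
move=> ab [hi gE].
suff: {within `[a, b], continuous (fun x => g a + \int[mu]_(y in `[a, x]) h y)}.
  apply: subspace_eq_continuous.
  by move=> x; rewrite inE/= in_itv/= => xab; symmetry; exact: gE.
move=> x; apply: cvgD; first exact: cvg_cst.
exact: (@parameterized_integral_continuous R a b h ab hi).
Qed.

Lemma continuous_itv_bounded (a b : R) (g : R -> R) :
  {within `[a, b], continuous g} -> [bounded g x | x in (`[a, b] : set R)].
Proof.
move=> cg; have /compact_bounded := continuous_compact cg (@segment_compact R a b).
move=> [M [Mr MM]]; exists M; split => // x Mx y yab.
by apply: MM => //; exists y.
Qed.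

Lemma continuous_itv_measurable (a b : R) (g : R -> R) :
  {within `[a, b], continuous g} -> measurable_fun (`[a, b] : set RR) g.
Proof. by move=> cg; apply: subspace_continuous_measurable_fun. Qed.

Lemma integrable_cM (a b : R) (g h : R -> R) :
  {within `[a, b], continuous g} -> mu.-integrable `[a, b] (EFin \o h) ->
  mu.-integrable `[a, b] (EFin \o (fun x => g x * h x)).
Proof.
move=> cg hi.
exact: (integrableMr _ (continuous_itv_measurable cg) (continuous_itv_bounded cg) hi).
Qed.

(* Fubini on the two halves of the square [a, x] x [a, x]. *)
Lemma Rintegral_triangles (a x : R) (h1 h2 : R -> R) : a <= x ->
  mu.-integrable `[a, x] (EFin \o h1) -> mu.-integrable `[a, x] (EFin \o h2) ->
  (\int[mu]_(y in `[a, x]) h1 y) * (\int[mu]_(y in `[a, x]) h2 y) =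
  \int[mu]_(y in `[a, x]) (h1 y * \int[mu]_(z in `[a, y]) h2 z +
                           (\int[mu]_(z in `[a, y]) h1 z) * h2 y).
Proof.
move=> ax i1 i2.
pose D : set RR := `[a, x]%classic.
have mD : measurable D by exact: measurable_itv.
have i12 := integrable_tensor mD mD i1 i2.
pose T : set (RR * RR) := [set p | p.2 <= p.1].
have mT : measurable T.
  have := @measurable_fun_le _ _ _ setT (fun p : RR * RR => p.2) (fun p => p.1)
    measurableT measurable_snd measurable_fst.
  by rewrite setTI.
pose F1 (p : RR * RR) := ((fun p => h1 p.1 * h2 p.2) \_ T) p.
pose F2 (p : RR * RR) := ((fun p => h1 p.1 * h2 p.2) \_ (~` T)) p.
have mDD : measurable (D `*` D) by exact: measurableX.
have iF1 : leb2.-integrable (D `*` D) (EFin \o F1) by exact: integrable_patch.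
have iF2 : leb2.-integrable (D `*` D) (EFin \o F2).
  by apply: integrable_patch => //; exact: measurableC.
transitivity (\int[leb2]_(p in D `*` D) (F1 p + F2 p)).
  transitivity (\int[leb2]_(p in D `*` D) (h1 p.1 * h2 p.2)).
    rewrite (Rintegral_fubini1 mD mD)//= -RintegralZr//.
    by apply: eq_Rintegral => y _; rewrite RintegralZl.
  apply: eq_Rintegral => p _; rewrite /F1 /F2 !patchE in_setC.
  by case: (p \in T); rewrite /= ?addr0 ?add0r.
rewrite RintegralD// (Rintegral_fubini1 mD mD)// (Rintegral_fubini2 mD mD iF2).
have memD y : (y \in D) = (a <= y <= x).
  by rewrite /D; apply/idP/idP; rewrite inE/= in_itv.
have memT y z : ((y, z) \in T) = (z <= y) by apply/idP/idP; rewrite inE.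
have e1 y : y \in D -> \int[mu]_(z in D) F1 (y, z) = h1 y * \int[mu]_(z in `[a, y]) h2 z.
  rewrite memD => /andP[ay yx].
  have i2y : mu.-integrable `[a, y] (EFin \o h2) by exact: integrable_itvS i2.
  rewrite -RintegralZl//.
  rewrite (Rintegral_mkcond mu D) (Rintegral_mkcond mu `[a, y]); apply: eq_Rintegral => z _.
  have memy : (z \in (`[a, y]%classic : set R)) = (a <= z <= y).
    by apply/idP/idP; rewrite inE/= in_itv.
  rewrite !patchE /F1 !patchE memD memT memy/=.
  by case: (leP a z) => //= az; case: (leP z y) => //= zy; case: (leP z x) => //= zx; lra.
have e2 z : z \in D -> \int[mu]_(y in D) F2 (y, z) = (\int[mu]_(y in `[a, z]) h1 y) * h2 z.
  rewrite memD => /andP[az zx].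
  have i1z : mu.-integrable `[a, z] (EFin \o h1) by exact: integrable_itvS i1.
  have i1z' : mu.-integrable `[a, z[ (EFin \o h1).
    by apply: integrableS i1z => //=; apply: subset_itv; rewrite bnd_simp.
  (* The diagonal belongs to [T], so the slice of the complement is half-open; the missing endpoint
     does not change the integral. *)
  rewrite -(Rintegral_itv_bndo_bndc (r := z))// -RintegralZr//.
  rewrite (Rintegral_mkcond mu D) (Rintegral_mkcond mu `[a, z[); apply: eq_Rintegral => y _.
  have memz : (y \in (`[a, z[%classic : set R)) = (a <= y < z).
    by apply/idP/idP; rewrite inE/= in_itv.
  rewrite !patchE /F2 !patchE in_setC memD memT memz/= -ltNge.
  by case: (leP a y) => //= ay; case: (ltP y z) => //= yz; case: (leP y x) => //= yx; lra.
rewrite -RintegralD//; last 2 first.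
- exact: integrable_inner1 iF1.
- exact: integrable_inner2 iF2.
by apply: eq_Rintegral => y yD; rewrite e1// e2.
Qed.

Lemma int_continuous (a b : R) (h : R -> R) : a <= b ->
  mu.-integrable `[a, b] (EFin \o h) ->
  {within `[a, b], continuous (fun x => \int[mu]_(y in `[a, x]) h y)}.
Proof. by move=> ab hi; exact: (@parameterized_integral_continuous R a b h ab hi). Qed.

(** Each factor is its value at a plus a primitive. The only term of the product that is not linear
    in the primitives is their product, and [Rintegral_triangles] writes it as a single integral. *)
Lemma ac1M (a b : R) g1 h1 g2 h2 : ac1 a b g1 h1 -> ac1 a b g2 h2 ->
  ac1 a b (fun x => g1 x * g2 x) (fun x => h1 x * g2 x + g1 x * h2 x).
Proof.
have [ba|ab] := ltP b a.
  move=> _ _; have e : (`[a, b]%classic : set R) = set0.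
    by rewrite set_itv_ge// bnd_simp -ltNge.
  split; first by rewrite e; exact: integrable_set0.
  by move=> x /andP[ax xb]; lra.
move=> ac_1 ac_2; have [i1 e1] := ac_1; have [i2 e2] := ac_2.
have c1 := ac1_continuous ab ac_1; have c2 := ac1_continuous ab ac_2.
have i12 : mu.-integrable `[a, b] (EFin \o (fun x => h1 x * g2 x)).
  by under [_ \o _]eq_fun do rewrite /= mulrC; exact: integrable_cM.
have i21 := integrable_cM c1 i2.
split => [|x xab]; first exact: (integrableD _ i12 i21).
have /andP[ax xb] := xab.
have i1x : mu.-integrable `[a, x] (EFin \o h1) by exact: integrable_itvS i1.
have i2x : mu.-integrable `[a, x] (EFin \o h2) by exact: integrable_itvS i2.
pose H1 y := \int[mu]_(z in `[a, y]) h1 z.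
pose H2 y := \int[mu]_(z in `[a, y]) h2 z.
have j1 : mu.-integrable `[a, x] (EFin \o (fun y => h1 y * H2 y)).
  under [_ \o _]eq_fun do rewrite /= mulrC.
  by apply: integrable_cM => //; exact: int_continuous.
have j2 : mu.-integrable `[a, x] (EFin \o (fun y => H1 y * h2 y)).
  by apply: integrable_cM => //; exact: int_continuous.
have -> : \int[mu]_(y in `[a, x]) (h1 y * g2 y + g1 y * h2 y) =
    \int[mu]_(y in `[a, x]) ((g2 a * h1 y + g1 a * h2 y) + (h1 y * H2 y + H1 y * h2 y)).
  apply: eq_Rintegral => y; rewrite inE/= in_itv/= => /andP[ay yx].
  rewrite (e1 y) ?ay ?(le_trans yx)// (e2 y) ?ay ?(le_trans yx)//.
  by rewrite -/(H1 y) -/(H2 y); ring.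
have k1 : mu.-integrable `[a, x] (EFin \o (fun y => g2 a * h1 y)).
  exact: (integrableZl _ _ i1x).
have k2 : mu.-integrable `[a, x] (EFin \o (fun y => g1 a * h2 y)).
  exact: (integrableZl _ _ i2x).
rewrite RintegralD//; [|exact: (integrableD _ k1 k2)|exact: (integrableD _ j1 j2)].
rewrite -Rintegral_triangles// RintegralD// !RintegralZl//.
rewrite (e1 x xab) (e2 x xab).
by rewrite -/(H1 x) -/(H2 x); ring.
Qed.

Lemma ac1_derive (a b : R) (F f : R -> R) :
  (forall x, a <= x <= b -> is_derive x 1 F (f x)) ->
  {within `[a, b], continuous f} -> ac1 a b F f.
Proof.
move=> dF cf; split; first exact: continuous_compact_integrable (@segment_compact R a b) cf.
move=> x /andP[]; rewrite le_eqVlt => /predU1P[<- _|ax xb].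
  by rewrite set_itv1 Rintegral_set1 addr0.
have dx y : a <= y <= x -> is_derive y 1 F (f y).
  by move=> /andP[ay yx]; apply: dF; rewrite ay (le_trans yx).
have cF y : a <= y <= x -> {for y, continuous F}.
  by move=> /dx [d _]; apply: differentiable_continuous; apply/derivable1_diffP.
rewrite /Rintegral (@continuous_FTC2 R f F a x)//=.
- by rewrite [RHS]addrC subrK.
- by apply: continuous_subspaceW cf; apply: subset_itv; rewrite bnd_simp.
- split.
  + by move=> y; rewrite in_itv/= => /andP[/ltW ay /ltW yx]; case: (dx y _); rewrite ?ay.
  + by apply: cvg_at_right_filter; apply: cF; rewrite lexx ltW.
  + by apply: cvg_at_left_filter; apply: cF; rewrite lexx ltW.
- move=> y; rewrite in_itv/= => /andP[/ltW ay /ltW yx].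
  by rewrite derive1E; have [_ ->] := dx y (introT andP (conj ay yx)).
Qed.

(** By Lebesgue differentiation h is almost everywhere the derivative of its primitive, which
    vanishes. The restriction [h'] of h to the interval is integrable on the whole line, the setting
    of [FTC1]. *)
Lemma ae_eq0_itv (a b : R) (h : R -> R) :
  mu.-integrable `[a, b] (EFin \o h) ->
  (forall x, a <= x <= b -> \int[mu]_(y in `[a, x]) h y = 0) ->
  {ae mu, forall x, a < x < b -> h x = 0}.
Proof.
move=> hi h0; pose h' := h \_ (`[a, b] : set R).
have hi' : mu.-integrable setT (EFin \o h').
  have mab : measurable (`[a, b]%classic : set RR) by exact: measurable_itv.
  move: hi => /(integrable_mkcond _ mab); rewrite restrict_EFin.
  exact.
have hy (y : R) : mu.-integrable `[a, y] (EFin \o h').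
  by apply: integrableS hi' => //; exact: measurable_itv.
have lh : locally_integrable [set: R] h'.
  by apply: (@integrable_locally R h `[a, b]) => //; exact: measurable_itv.
have /= := @FTC1 R h' (BLeft a) hy lh.
apply: (@filterS _ _ (ae_filter_ringOfSetsType (@lebesgue_measure R))).
move=> x /= + /andP[ax xb]; rewrite lte_fin => /(_ ax)[_].
have -> : h' x = h x.
  by rewrite /h' patchE mem_set//= in_itv/= !ltW.
move=> <-; rewrite derive1E.
rewrite (@near_eq_derive _ _ _ _ (cst 0)) ?derive_cst//.
have : \forall y \near x, a < y < b.
  by apply: near_in_itvoo; rewrite in_itv/= ax.
apply: filterS => y /andP[/ltW ay /ltW yb] /=; rewrite -(h0 y) ?ay//.
apply: eq_Rintegral => z; rewrite inE/= in_itv/= => /andP[az zy].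
by rewrite /h' patchE mem_set//= in_itv/= az (le_trans zy).
Qed.

End AbsolutelyContinuous.

(** * Smooth functions, products of functions of one variable, bumps *)

Section SmoothFunctions.
Variable R : realType.

Lemma slice1E (W : normedModType R) (f : R * R -> W) (s t : R) :
  (derivable f (s, t) ((1, 0) : R * R) = derivable (fun x => f (x, t)) s 1) *
  ('D_((1, 0) : R * R) f (s, t) = 'D_1 (fun x => f (x, t)) s).
Proof.
have e : (fun h : R => h^-1 *: ((f \o shift (s, t)) (h *: ((1, 0) : R * R)) - f (s, t))) =
         (fun h : R => h^-1 *: (((fun x => f (x, t)) \o shift s) (h *: (1 : R)) - f (s, t))).
  apply/funext => h; rewrite /= /shift /=; congr (_ *: (f _ - _)).
  by congr pair; rewrite /= scaler0 add0r.
by split; rewrite /derivable /derive e.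
Qed.

Lemma slice2E (W : normedModType R) (f : R * R -> W) (s t : R) :
  (derivable f (s, t) ((0, 1) : R * R) = derivable (fun x => f (s, x)) t 1) *
  ('D_((0, 1) : R * R) f (s, t) = 'D_1 (fun x => f (s, x)) t).
Proof.
have e : (fun h : R => h^-1 *: ((f \o shift (s, t)) (h *: ((0, 1) : R * R)) - f (s, t))) =
         (fun h : R => h^-1 *: (((fun x => f (s, x)) \o shift t) (h *: (1 : R)) - f (s, t))).
  apply/funext => h; rewrite /= /shift /=; congr (_ *: (f _ - _)).
  by congr pair; rewrite /= scaler0 add0r.
by split; rewrite /derivable /derive e.
Qed.

Lemma smooth_differentiable (V W : normedModType R) (f : V -> W) x :
  smooth f -> differentiable f x.
Proof. by move=> /(_ 1%N)[]. Qed.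

Lemma smooth_derive (V W : normedModType R) (f : V -> W) v :
  smooth f -> smooth (fun x => 'D_v f x).
Proof. by move=> sf k; have [_] := sf k.+1; exact. Qed.

Lemma smooth_continuous (V W : normedModType R) (f : V -> W) :
  smooth f -> continuous f.
Proof. by move=> /(_ 0%N). Qed.

Lemma smooth_is_derive (V W : normedModType R) (f : V -> W) x v :
  smooth f -> is_derive x v f ('D_v f x).
Proof.
by move=> /(@smooth_differentiable _ _ _ x) df; split => //; exact: diff_derivable.
Qed.

Lemma smooth_partial (W : normedModType R) (f : R * R -> W) i j :
  smooth f -> smooth (partial_st i j f).
Proof.
rewrite /partial_st => sf; elim: i => [|i ih] /=; last exact: smooth_derive.
by elim: j => [|j ih] //=; exact: smooth_derive.
Qed.

Lemma CkD (V W : normedModType R) k (f g : V -> W) :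
  Ck k f -> Ck k g -> Ck k (fun x => f x + g x).
Proof.
elim: k f g => [|k ih] f g /=; first by move=> cf cg x; apply: cvgD; [exact: cf|exact: cg].
move=> [df cf] [dg cg]; split => [x|v]; first exact: differentiableD.
have -> : (fun x => 'D_v (fun x => f x + g x) x) = (fun x => 'D_v f x + 'D_v g x).
  by apply/funext => x; apply: deriveD; exact: diff_derivable.
exact: ih.
Qed.

Lemma CkZ (V W : normedModType R) k c (f : V -> W) :
  Ck k f -> Ck k (fun x => c *: f x).
Proof.
elim: k f => [|k ih] f /=; first by move=> cf x; apply: cvgZ; [exact: cvg_cst|exact: cf].
move=> [df cf]; split => [x|v]; first exact: differentiableZ.
have -> : (fun x => 'D_v (fun x => c *: f x) x) = (fun x => c *: 'D_v f x).
  by apply/funext => x; apply: deriveZ; exact: diff_derivable.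
exact: ih.
Qed.

(** A smooth function of one variable travels together with its derivatives of all orders, so that
    bumps, products and exponentials have explicit derivatives instead of iterates of ['D_1]. *)
Definition dfamily (F : nat -> R -> R) : Prop :=
  forall k (x : R), is_derive x 1 (F k) (F k.+1 x).

Lemma smooth_dfamily (f : R -> R) : smooth f ->
  exists2 F, dfamily F & F 0%N = f.
Proof.
move=> sf; pose F k := iter k (fun g (x : R) => 'D_1 g x) f.
exists F => // k x; apply: smooth_is_derive; rewrite /F.
by elim: k => //= k ih; exact: smooth_derive.
Qed.

Lemma dfamily_continuous F k : dfamily F -> continuous (F k).
Proof.
move=> dF x; have [d _] := dF k x.
by apply: differentiable_continuous; apply/derivable1_diffP.
Qed.

Lemma fst_diff (p : R * R) :
  differentiable (fst : R * R -> R) p /\ forall v, 'd (fst : R * R -> R) p v = v.1.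
Proof.
have fl : linear (fst : R * R -> R) by [].
pose f : {linear (R * R)%type -> R} :=
  HB.pack (fst : R * R -> R) (GRing.isLinear.Build R (R * R)%type R *:%R fst fl).
have c : continuous f by move=> x; exact: cvg_fst.
split; first exact: (linear_differentiable (f := f) _ c).
by move=> v; have := @diff_lin R _ _ f p c; move=> /= ->.
Qed.

Lemma snd_diff (p : R * R) :
  differentiable (snd : R * R -> R) p /\ forall v, 'd (snd : R * R -> R) p v = v.2.
Proof.
have fl : linear (snd : R * R -> R) by [].
pose f : {linear (R * R)%type -> R} :=
  HB.pack (snd : R * R -> R) (GRing.isLinear.Build R (R * R)%type R *:%R snd fl).
have c : continuous f by move=> x; exact: cvg_snd.
split; first exact: (linear_differentiable (f := f) _ c).
by move=> v; have := @diff_lin R _ _ f p c; move=> /= ->.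
Qed.

Lemma is_derive_tensor (f g f' g' : R -> R) (p v : R * R) :
  is_derive p.1 1 f (f' p.1) -> is_derive p.2 1 g (g' p.2) ->
  differentiable (fun p : R * R => f p.1 * g p.2) p /\
  'D_v (fun p : R * R => f p.1 * g p.2) p =
    v.1 * (f' p.1 * g p.2) + v.2 * (f p.1 * g' p.2).
Proof.
move=> [/derivable1_diffP df ef] [/derivable1_diffP dg eg].
have [d1 e1] := fst_diff p; have [d2 e2] := snd_diff p.
have df1 : differentiable (f \o fst : R * R -> R) p by exact: differentiable_comp.
have dg1 : differentiable (g \o snd : R * R -> R) p by exact: differentiable_comp.
have D : differentiable (fun p : R * R => f p.1 * g p.2) p.
  exact: (differentiableM df1 dg1).
split => //.
have -> : (fun p : R * R => f p.1 * g p.2) = (f \o fst) * (g \o snd) by [].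
rewrite deriveM; [|exact: diff_derivable|exact: diff_derivable].
have -> : 'D_v (f \o fst) p = v.1 * f' p.1.
  by rewrite (deriveE v df1) diff_comp//= e1 (diff1E df)/= derive1E ef.
have -> : 'D_v (g \o snd) p = v.2 * g' p.2.
  by rewrite (deriveE v dg1) diff_comp//= e2 (diff1E dg)/= derive1E eg.
by rewrite /= /GRing.scale /=; ring.
Qed.

(** A directional derivative of F i (s) G j (t) is a combination of two such products with one index
    raised, hence the induction over all i and j at once. *)
Lemma smooth_tensor (F G : nat -> R -> R) i j : dfamily F -> dfamily G ->
  smooth (fun p : R * R => F i p.1 * G j p.2).
Proof.
move=> dF dG k; elim: k i j => [|k ih] i j /=.
  move=> p; apply: continuousM.
    by apply: continuous_comp; [exact: cvg_fst|exact: dfamily_continuous].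
  by apply: continuous_comp; [exact: cvg_snd|exact: dfamily_continuous].
have D p v := @is_derive_tensor _ _ _ _ p v (dF i p.1) (dG j p.2).
split => [x|v]; first exact: (D x 0).1.
have -> : (fun x : R * R => 'D_v (fun p : R * R => F i p.1 * G j p.2) x) =
    (fun p => v.1 *: (F i.+1 p.1 * G j p.2) + v.2 *: (F i p.1 * G j.+1 p.2)).
  by apply/funext => p; rewrite (D p v).2.
by apply: CkD; apply: CkZ; exact: ih.
Qed.

Lemma partial_tensor (F G : nat -> R -> R) i j : dfamily F -> dfamily G ->
  partial_st i j (fun p : R * R => F 0%N p.1 * G 0%N p.2) =
  (fun p : R * R => F i p.1 * G j p.2).
Proof.
move=> dF dG; rewrite /partial_st.
have -> : iter j (fun (g : R * R -> R) p => 'D_((0, 1) : R * R) g p)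
    (fun p : R * R => F 0%N p.1 * G 0%N p.2) = (fun p => F 0%N p.1 * G j p.2).
  elim: j => //= j ->; apply/funext => p.
  by rewrite (@is_derive_tensor _ _ _ _ p (0, 1) (dF 0%N p.1) (dG j p.2)).2/=; ring.
elim: i => //= i ->; apply/funext => p.
by rewrite (@is_derive_tensor _ _ _ _ p (1, 0) (dF i p.1) (dG j p.2)).2/=; ring.
Qed.

(** For a step B from 0 to 1 on [-1, 1], order k = 0 is a bump rising on [x1, x1 + 2 e] and falling
    on [x2, x2 + 2 e]; it tends to the indicator of ]x1, x2] as e tends to 0. Order k is its k-th
    derivative; for k = 1 it is an approximate Dirac mass at x1 minus one at x2. *)
Definition bumpf (B : nat -> R -> R) (x1 x2 e : R) (k : nat) (x : R) : R :=
  e^-1 ^+ k * (B k ((x - x1) / e - 1) - B k ((x - x2) / e - 1)).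

Lemma bumpf_dfamily B x1 x2 e : dfamily B -> dfamily (bumpf B x1 x2 e).
Proof.
move=> dB k x; rewrite /bumpf.
have aff (y : R) : is_derive x 1 (fun z : R => (z - y) / e - 1) e^-1.
  by apply: is_derive_eq; rewrite /GRing.scale/= ?mulr0 ?add0r ?addr0 ?subr0 ?mulr1 ?mul1r.
have dc (y : R) : is_derive x 1 (fun z : R => B k ((z - y) / e - 1))
    (e^-1 * B k.+1 ((x - y) / e - 1)).
  rewrite mulrC.
  exact: (@is_derive1_comp _ (B k) (fun z : R => (z - y) / e - 1) x _ _ (dB k _) (aff y)).
by apply: is_derive_eq; rewrite /GRing.scale/=; rewrite exprS; ring.
Qed.

Lemma step_left B k y : dfamily B -> (forall y, y <= -1 -> B 0%N y = 0) ->
  y < -1 -> B k y = 0.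
Proof.
move=> dB B0; elim: k y => [|k ih] y y1; first by rewrite B0// ltW.
have [_ <-] := dB k y; rewrite -(derive_cst 0 y 1).
by apply: near_eq_derive; apply: filterS (lt_nbhsl y1) => z; exact: ih.
Qed.

Lemma step_right B k y : dfamily B -> (forall y, 1 <= y -> B 0%N y = 1) ->
  1 < y -> B k y = (k == 0%N)%:R.
Proof.
move=> dB B1; elim: k y => [|k ih] y y1; first by rewrite B1// ltW.
have [_ <-] := dB k y; have -> : (k.+1 == 0%N)%:R = 'D_1 (cst (k == 0%N)%:R : R -> R) y.
  by rewrite derive_cst.
by apply: near_eq_derive; apply: filterS (lt_nbhsr y1) => z; exact: ih.
Qed.

Lemma bumpf_out B x1 x2 e k x : dfamily B -> 0 < e -> x1 <= x2 ->
  (forall y, 1 <= y -> B 0%N y = 1) -> (forall y, y <= -1 -> B 0%N y = 0) ->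
  x < x1 \/ x2 + 2 * e < x -> bumpf B x1 x2 e k x = 0.
Proof.
move=> dB e0 x12 B1 B0; rewrite /bumpf => -[hx|hx].
  rewrite !(step_left _ dB B0) ?subrr ?mulr0//;
    rewrite -subr_lt0 opprK subrK pmulr_llt0 ?invr_gt0//; lra.
rewrite !(step_right _ dB B1) ?subrr ?mulr0// ltrBrDr ltr_pdivlMr//; lra.
Qed.

End SmoothFunctions.

(** * Periodic extension and product test functions *)

Section Periodize.
Variable R : realType.

Definition perf (T : Type) (g : R -> T) (t : R) : T := g (t - (Num.floor t)%:~R).

Lemma perf_periodic (T : Type) (g : R -> T) t : perf g (t + 1) = perf g t.
Proof.
rewrite /perf; congr g.
by rewrite -[1]/(1%:~R) floorDrz ?intr_int// floor1 intrD; ring.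
Qed.

Lemma perfE (T : Type) (g : R -> T) (n : int) t : n%:~R <= t < n%:~R + 1 ->
  perf g t = g (t - n%:~R).
Proof. by move=> h; rewrite /perf (@floor_def _ _ n)// intrD. Qed.

Lemma perf01 (T : Type) (g : R -> T) t : g 0 = g 1 -> 0 <= t <= 1 -> perf g t = g t.
Proof.
move=> g01 /andP[t0]; rewrite le_eqVlt => /predU1P[->|t1].
  by rewrite (@perfE _ _ 1)/= ?subrr// lexx/= ltrDl.
by rewrite (@perfE _ _ 0)/= ?subr0// add0r t0.
Qed.

(** Translates of G are joined only at the integers, and there the support condition makes all of
    them vanish in a neighbourhood. *)
Lemma perf_dfamily (G : nat -> R -> R) lo hi : dfamily G -> 0 < lo -> hi < 1 ->
  (forall k x, x < lo \/ hi < x -> G k x = 0) -> dfamily (fun k => perf (G k)).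
Proof.
move=> dG lo0 hi1 G0 k t.
set n := Num.floor t; have nt : n%:~R <= t by exact: floor_le.
have tn : t < n%:~R + 1 by rewrite -[1]/(1%:~R) -intrD; exact: floorD1_gt.
have [e|nt'] := eqVneq t (n%:~R : R); last first.
  have {}nt : n%:~R < t by rewrite lt_neqAle eq_sym nt'.
  rewrite (@perfE _ _ n) ?tn ?ltW//.
  have H : is_derive t 1 (G k \o (fun x => x - n%:~R)) (G k.+1 (t - n%:~R) * 1).
    apply: is_derive1_comp; first exact: dG.
    by apply: is_derive_eq; rewrite subr0.
  rewrite mulr1 in H; apply: near_eq_is_derive H.
  apply: filterS2 (lt_nbhsr nt) (lt_nbhsl tn) => x nx xn.
  by rewrite (@perfE _ _ n) ?xn ?ltW.
have z : perf (G k.+1) t = 0.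
  by rewrite (@perfE _ _ n) ?nt// G0//; left; rewrite e subrr.
rewrite z; suff h : \near t, (cst 0 : R -> R) t = perf (G k) t.
  exact: near_eq_is_derive h (is_derive_cst (0 : R) t (1 : R)).
have h1 : t < n%:~R + lo by lra.
have h2 : n%:~R - (1 - hi) < t by lra.
have h3 : n%:~R - 1 < t by lra.
apply: filterS3 (lt_nbhsl h1) (lt_nbhsr h2) (filterI (lt_nbhsl tn) (lt_nbhsr h3)).
move=> x x1 x2 [x3 x4]; have [xn|nx] := ltP x n%:~R.
  rewrite (@perfE _ _ (n - 1)%R); rewrite intrD /=; last by apply/andP; split; lra.
  by rewrite G0//; right; lra.
by rewrite (@perfE _ _ n) ?nx// G0//; left; lra.
Qed.

(** Weak derivatives are unpacked with test functions of this kind only. *)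
Lemma test_tensor (A : set R) (F G : nat -> R -> R) x1 x2 :
  dfamily F -> dfamily G -> `[x1, x2] `<=` A° ->
  (forall s, s < x1 \/ x2 < s -> F 0%N s = 0) ->
  (forall t, G 0%N (t + 1) = G 0%N t) ->
  test_fun A (fun p => F 0%N p.1 * G 0%N p.2).
Proof.
move=> dF dG xA F0 pG; split; first exact: smooth_tensor.
  by move=> s t _ /=; rewrite pG.
exists `[x1, x2]%classic; split => //; first exact: segment_compact.
move=> s t /= /negP; rewrite in_itv/= negb_and -!ltNge => /orP[sx|xs].
  by rewrite F0 ?mul0r//; left.
by rewrite F0 ?mul0r//; right.
Qed.

End Periodize.

(** * Approximate Dirac masses *)

Section Delta.
Variable R : realType.
Local Notation RR := (measurableTypeR R).
Local Notation mu := (@lebesgue_measure R).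
Variable B : nat -> R -> R.
Hypothesis dB : dfamily B.
Hypothesis B1 : forall y, 1 <= y -> B 0%N y = 1.
Hypothesis B0 : forall y, y <= -1 -> B 0%N y = 0.

(** A rescaled derivative of the step: of integral 1, supported in [x0, x0 + 2 e], so it
    concentrates at x0 from the right. *)
Let deltaf (e x0 x : R) : R := e^-1 * B 1%N ((x - x0) / e - 1).

Lemma step_bounded k : exists2 C : R, 0 < C & forall x, `|B k x| <= C.
Proof.
have cB : {within `[(-2 : R), 2], continuous (B k)}.
  by apply: continuous_subspaceT => x; exact: dfamily_continuous.
have [M [Mr hM]] := continuous_itv_bounded cB.
exists (`|M| + 2) => [|x]; first by rewrite ltr_wpDl.
have M1 := ler_norm M; have M0 := normr_ge0 M.
have [x2|x2] := ltP x (-2); first by rewrite (step_left _ dB B0) ?normr0; lra.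
have [x3|x3] := ltP 2 x.
  by rewrite (step_right _ dB B1); [case: (k == 0%N); rewrite ?normr1 ?normr0; lra|lra].
by apply: (hM (`|M| + 2)); [lra|rewrite /= in_itv/= x2].
Qed.

Lemma Rintegral_supp (a b c d K : R) (f : R -> R) :
  a <= c -> c <= d -> d <= b -> mu.-integrable `[a, b] (EFin \o f) ->
  (forall x, c <= x <= d -> `|f x| <= K) -> (forall x, x < c \/ d < x -> f x = 0) ->
  `|\int[mu]_(x in `[a, b]) f x| <= K * (d - c).
Proof.
move=> ac cd db fi fK f0.
have e : \int[mu]_(x in `[a, b]) f x = \int[mu]_(x in `[c, d]) f x.
  rewrite (Rintegral_mkcond mu `[a, b]) (Rintegral_mkcond mu `[c, d]).
  apply: eq_Rintegral => x _; rewrite !patchE.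
  have mabE : (x \in (`[a, b]%classic : set R)) = (a <= x <= b).
    by apply/idP/idP; rewrite inE/= in_itv/=.
  have mcdE : (x \in (`[c, d]%classic : set R)) = (c <= x <= d).
    by apply/idP/idP; rewrite inE/= in_itv/=.
  rewrite mabE mcdE; case: (leP c x) => cx; last by rewrite f0; [case: ifP|left].
  case: (leP x d) => xd; last by rewrite f0; [case: ifP|right].
  by rewrite (le_trans ac cx) (le_trans xd db).
have fi' := integrable_itvS ac db fi.
rewrite e; apply: le_trans (le_normr_Rintegral _ fi') _ => //.
apply: (@le_trans _ _ (\int[mu]_(x in `[c, d]) K)).
  apply: le_Rintegral => //.
  - exact: integrable_norm fi'.
  - by apply: continuous_compact_integrable (@segment_compact R c d) _ => ?; exact: cvg_cst.
rewrite Rintegral_cst//= lebesgue_measure_itv/= lte_fin.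
case: ltP => cd'; first by [].
have -> : d = c by lra.
by rewrite subrr.
Qed.

Let deltaf_cont e x0 : continuous (deltaf e x0).
Proof.
move=> x; apply: cvgM; first exact: cvg_cst.
apply: (@continuous_comp _ _ _ (fun x => (x - x0) / e - 1) (B 1%N)); last exact: dfamily_continuous.
apply: cvgB; last exact: cvg_cst.
by apply: cvgM; [apply: cvgB; [exact: cvg_id|exact: cvg_cst]|exact: cvg_cst].
Qed.

Let deltaf_int (e x0 X0 X : R) : 0 < e -> X0 <= x0 -> x0 + 2 * e <= X ->
  \int[mu]_(x in `[X0, X]) deltaf e x0 x = 1.
Proof.
move=> e0 Xx xX.
have D x : X0 <= x <= X -> is_derive x 1 (fun x => B 0%N ((x - x0) / e - 1)) (deltaf e x0 x).
  move=> _; rewrite /deltaf mulrC.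
  apply: (@is_derive1_comp _ (B 0%N) (fun z : R => (z - x0) / e - 1) x); first exact: dB.
  by apply: is_derive_eq; rewrite /GRing.scale/= ?mulr0 ?add0r ?addr0 ?subr0 ?mulr1 ?mul1r.
have cd : {within `[X0, X], continuous (deltaf e x0)}.
  by apply: continuous_subspaceT => x; exact: deltaf_cont.
have := ac1_derive D cd.
move=> /ac1_int /(_ (lexx _) _ (lexx _)) <-; last by lra.
rewrite B1 ?B0 ?subr0//; first by rewrite -subr_le0 opprK subrK pmulr_lle0 ?invr_gt0//; lra.
by rewrite lerBrDr ler_pdivlMr//; lra.
Qed.

Let deltaf_out e x0 x : 0 < e -> x < x0 \/ x0 + 2 * e < x -> deltaf e x0 x = 0.
Proof.
move=> e0 [hx|hx]; rewrite /deltaf.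
  rewrite (step_left _ dB B0) ?mulr0//.
  by rewrite -subr_lt0 opprK subrK pmulr_llt0 ?invr_gt0//; lra.
by rewrite (step_right _ dB B1) ?mulr0// ltrBrDr ltr_pdivlMr//; lra.
Qed.

Let deltaf_mul_int (g : R -> R) (e x0 X0 X : R) : {within `[X0, X], continuous g} ->
  mu.-integrable `[X0, X] (EFin \o (fun x => g x * deltaf e x0 x)).
Proof.
move=> cg; apply: continuous_compact_integrable (@segment_compact R X0 X) _ => x.
by apply: cvgM; [exact: cg|apply: continuous_subspaceT => y; exact: deltaf_cont].
Qed.

Let deltaf_bound (C M : R) (g : R -> R) (e x0 X0 X : R) : (forall x, `|B 1%N x| <= C) ->
  0 < e -> X0 <= x0 -> x0 + 2 * e <= X -> {within `[X0, X], continuous g} ->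
  (forall x, x0 <= x <= x0 + 2 * e -> `|g x| <= M) ->
  `|\int[mu]_(x in `[X0, X]) (g x * deltaf e x0 x)| <= 2 * C * M.
Proof.
move=> hC e0 Xx xX cg gM.
(* Height [M * (C / e)] times the length [2 * e] of the support: e cancels. *)
have -> : 2 * C * M = (M * (C / e)) * ((x0 + 2 * e) - x0) by field; rewrite gt_eqF.
apply: Rintegral_supp => //; first by lra.
- exact: deltaf_mul_int.
- move=> x xx; rewrite normrM ler_pM// ?gM// /deltaf normrM normfV (gtr0_norm e0) mulrC.
  by rewrite ler_pM2r ?invr_gt0.
- by move=> x hx; rewrite deltaf_out ?mulr0.
Qed.

Let deltaf_cvg (g : R -> R) (x0 X0 X eta : R) : 0 < eta -> X0 <= x0 -> x0 < X ->
  {within `[X0, X], continuous g} -> {for x0, continuous g} ->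
  exists2 e0, 0 < e0 & forall e, 0 < e -> e < e0 ->
  `|\int[mu]_(x in `[X0, X]) (g x * deltaf e x0 x) - g x0| <= eta.
Proof.
move=> eta0 Xx xX cg cx.
have [C C0 hC] := step_bounded 1.
have eC : 0 < eta / (2 * C) by rewrite divr_gt0// mulr_gt0.
move/cvgrPdist_le : cx => /(_ _ eC) [r /= r0 hr].
(* The support has length [2 * e]: the first bound keeps it within r of x0, the second one inside
   the interval. *)
exists (Num.min (r / 4) ((X - x0) / 2)) => [|e e0].
  by rewrite lt_min !divr_gt0// subr_gt0.
rewrite lt_min => /andP[e1 e2].
have e3 : x0 + 2 * e <= X by lra.
have -> : g x0 = \int[mu]_(x in `[X0, X]) (g x0 * deltaf e x0 x).
  rewrite RintegralZl// ?deltaf_int ?mulr1//.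
  apply: continuous_compact_integrable (@segment_compact R X0 X) _.
  by apply: continuous_subspaceT => x; exact: deltaf_cont.
rewrite -RintegralB//; [|exact: deltaf_mul_int|].
  under eq_Rintegral do rewrite -mulrBl.
  have -> : eta = 2 * C * (eta / (2 * C)) by field; rewrite gt_eqF.
  apply: deltaf_bound => //.
    by move=> x; apply: cvgB; [exact: cg|exact: cvg_cst].
  move=> x /andP[x1 x2]; rewrite distrC; apply: hr => /=.
  by rewrite distrC ger0_norm; lra.
by apply: deltaf_mul_int => x; exact: cvg_cst.
Qed.

Let bumpf1E x1 x2 e x : bumpf B x1 x2 e 1 x = deltaf e x1 x - deltaf e x2 x.
Proof. by rewrite /bumpf /deltaf expr1 mulrBr. Qed.

(** The bound does not contain e, although the derivative of the bump blows up; it supplies the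
    dominating function in the limit e -> 0. *)
Lemma bump_deriv_bound (C M : R) (g : R -> R) (e x1 x2 X : R) : (forall x, `|B 1%N x| <= C) ->
  0 < e -> x1 <= x2 -> x2 + 2 * e <= X -> {within `[x1, X], continuous g} ->
  (forall x, x1 <= x <= X -> `|g x| <= M) ->
  `|\int[mu]_(x in `[x1, X]) (g x * bumpf B x1 x2 e 1 x)| <= 4 * C * M.
Proof.
move=> hC e0 x12 x2X cg gM.
under eq_Rintegral do rewrite bumpf1E mulrBr.
rewrite RintegralB//; [|exact: deltaf_mul_int|exact: deltaf_mul_int].
apply: le_trans (ler_normB _ _) _.
have -> : 4 * C * M = 2 * C * M + 2 * C * M by ring.
apply: lerD; apply: deltaf_bound => //; try lra.
- by move=> x xx; apply: gM; lra.
- by move=> x xx; apply: gM; lra.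
Qed.

Lemma bump_deriv_cvg (g : R -> R) (x1 x2 X eta : R) : 0 < eta -> x1 <= x2 -> x2 < X ->
  {within `[x1, X], continuous g} -> {for x1, continuous g} -> {for x2, continuous g} ->
  exists2 e0, 0 < e0 & forall e, 0 < e -> e < e0 ->
  `|\int[mu]_(x in `[x1, X]) (g x * bumpf B x1 x2 e 1 x) - (g x1 - g x2)| <= eta.
Proof.
move=> eta0 x12 x2X cg c1 c2; have eta2 : 0 < eta / 2 by rewrite divr_gt0.
have [||e1 e10 h1] := deltaf_cvg eta2 _ _ cg c1; [by []|exact: le_lt_trans x2X|].
have [||e2 e20 h2] := deltaf_cvg eta2 _ _ cg c2; [by []|by []|].
exists (Num.min e1 e2) => [|e e0]; first by rewrite lt_min e10.
rewrite lt_min => /andP[ee1 ee2].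
under eq_Rintegral do rewrite bumpf1E mulrBr.
rewrite RintegralB//; [|exact: deltaf_mul_int|exact: deltaf_mul_int].
have := h1 e e0 ee1; have := h2 e e0 ee2.
set a := Rintegral _ _ _; set b := Rintegral _ _ _ => H2 H1.
have -> : b - a - (g x1 - g x2) = (b - g x1) - (a - g x2) by ring.
by apply: le_trans (ler_normB _ _) _; lra.
Qed.

Lemma bump_bound (C : R) e x1 x2 x : (forall x, `|B 0%N x| <= C) -> `|bumpf B x1 x2 e 0 x| <= 2 * C.
Proof.
move=> hC; rewrite /bumpf expr0 mul1r; apply: le_trans (ler_normB _ _) _.
by have := hC ((x - x1) / e - 1); have := hC ((x - x2) / e - 1); lra.
Qed.

Lemma bump_cvg (x1 x2 x : R) : x1 <= x2 ->
  exists2 e0, 0 < e0 & forall e, 0 < e -> e < e0 ->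
  bumpf B x1 x2 e 0 x = (x1 < x <= x2)%R%:R.
Proof.
move=> x12.
have H y : exists2 e0, 0 < e0 & forall e, 0 < e -> e < e0 ->
    B 0%N ((x - y) / e - 1) = (y < x)%R%:R.
  case: (ltP y x) => xy.
    exists ((x - y) / 2) => [|e e0 ee]; first by rewrite divr_gt0// subr_gt0.
    by rewrite B1// lerBrDr ler_pdivlMr//; lra.
  exists 1 => // e e0 _; rewrite B0// -subr_le0 opprK subrK pmulr_lle0 ?invr_gt0//; lra.
have [e1 e10 h1] := H x1; have [e2 e20 h2] := H x2.
exists (Num.min e1 e2) => [|e e0]; first by rewrite lt_min e10.
rewrite lt_min => /andP[ee1 ee2]; rewrite /bumpf expr0 mul1r h1// h2// leNgt.
by case: (ltP x1 x) => h; case: (ltP x2 x) => h' //=; rewrite ?subr0 ?subrr//; lra.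
Qed.

End Delta.

(** * Measurability and integrability on rectangles *)

Section PlaneMeasurability.
Variable R : realType.
Local Notation RR := (measurableTypeR R).
Local Notation mu := (@lebesgue_measure R).
Local Notation leb2 := (@leb2 R).

Lemma cvg_pair2 (T : Type) (F : set_system T) (FF : Filter F) (f g : T -> R) (x y : R) :
  f @ F --> x -> g @ F --> y -> (fun t => (f t, g t)) @ F --> (x, y).
Proof. by move=> fx gy; exact: (@cvg_pair _ _ _ _ (nbhs x) (nbhs y)). Qed.

Lemma slice2_continuous (f : R * R -> R) (x y : R) : {for (x, y), continuous f} ->
  {for y, continuous (fun y => f (x, y))}.
Proof.
move=> cf; apply: (@cvg_comp _ _ _ (fun y : R => (x, y)) f _ _ _ _ cf).
by apply: cvg_pair2; [exact: cvg_cst|exact: cvg_id].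
Qed.

Lemma slice1_continuous (f : R * R -> R) (x y : R) : {for (x, y), continuous f} ->
  {for x, continuous (fun x => f (x, y))}.
Proof.
move=> cf; apply: (@cvg_comp _ _ _ (fun x : R => (x, y)) f _ _ _ _ cf).
by apply: cvg_pair2; [exact: cvg_id|exact: cvg_cst].
Qed.

(* f (x, y) is the limit of f (floor (n x) / n, y), which is a countable
   gluing of functions of y. *)
Lemma continuous_measurable2 (f : R * R -> R) : continuous f ->
  measurable_fun setT (f : RR * RR -> R).
Proof.
move=> cf.
pose q (n : nat) (x : R) : R := (Num.floor (x * n.+1%:R))%:~R / n.+1%:R.
pose fn n (p : RR * RR) : R := f (q n p.1, p.2).
apply: (@measurable_fun_cvg _ _ _ setT fn).
  move=> n _ A mA; rewrite setTI.
  have -> : fn n @^-1` A = \bigcup_(z : int)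
     ([set x | Num.floor (x * n.+1%:R) = z] `*` [set y | A (f (z%:~R / n.+1%:R, y))]).
    apply/seteqP; split => [[x y] /= Axy|[x y] [z _ [/= <-]]//].
    by exists (Num.floor (x * n.+1%:R)).
  apply: countable_bigcupT_measurable => [|z]; first exact: countableP.
  apply: measurableX.
    have -> : [set x : R | Num.floor (x * n.+1%:R) = z] =
        `[z%:~R / n.+1%:R, (z + 1)%:~R / n.+1%:R[%classic.
      apply/seteqP; split => x /=.
        move=> <-; rewrite in_itv/= ler_pdivrMr// ltr_pdivlMr// floor_le floorD1_gt//.
      by rewrite in_itv/= ler_pdivrMr// ltr_pdivlMr// => /floor_def ->.
    exact: measurable_itv.
  have cz : continuous (fun y : R => f (z%:~R / n.+1%:R, y)).
    by move=> y; apply: slice2_continuous; exact: cf.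
  by have := continuous_measurable_fun cz measurableT mA; rewrite setTI.
move=> [x y] _; rewrite /fn/=.
apply: (@continuous_cvg _ _ _ _ _ (fun n => (q n x, y)) f (x, y)); first exact: cf.
apply: cvg_pair2; last exact: cvg_cst.
apply/cvgrPdist_le => e e0.
near=> n.
have n0 : (0 : R) < n.+1%:R by [].
have h1 : (Num.floor (x * n.+1%:R))%:~R <= x * n.+1%:R by exact: floor_le.
have h2 : x * n.+1%:R < (Num.floor (x * n.+1%:R))%:~R + 1.
  by rewrite -[1]/(1%:~R) -intrD; exact: floorD1_gt.
have -> : x - q n x = (x * n.+1%:R - (Num.floor (x * n.+1%:R))%:~R) / n.+1%:R.
  by rewrite /q; field; rewrite gt_eqF.
rewrite normrM normfV (gtr0_norm n0) ler_pdivrMr// ger0_norm ?subr_ge0//.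
apply: (@le_trans _ _ 1); first by lra.
rewrite -ler_pdivrMl// mulr1.
apply: (@le_trans _ _ n%:R); last by rewrite ler_nat.
near: n; exact: nbhs_infty_ger.
Unshelve. all: end_near. Qed.

Let clamp (a b x : R) : R := Num.max a (Num.min b x).

Let clamp_id a b x : a <= x <= b -> clamp a b x = x.
Proof. by move=> /andP[ax xb]; rewrite /clamp min_r// max_r. Qed.

Let clamp_itv a b x : a <= b -> a <= clamp a b x <= b.
Proof. by move=> ab; rewrite /clamp le_max lexx/= ge_max ab ge_min lexx. Qed.

Let clamp_continuous a b : continuous (clamp a b).
Proof.
move=> x; apply: (@continuous_max R R (cst a)); first exact: cvg_cst.
by apply: (@continuous_min R R (cst b)); [exact: cvg_cst|exact: cvg_id].
Qed.

Definition rect (a b c d : R) : set (RR * RR) := `[a, b] `*` `[c, d].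

Lemma measurable_rect a b c d : measurable (rect a b c d).
Proof. by apply: measurableX; exact: measurable_itv. Qed.

(** Continuity is that of the plane at every point, boundary included; the rectangles used are
    compact pieces of an open strip. *)
Definition cont_rect a b c d (f : R * R -> R) : Prop :=
  forall x y, a <= x <= b -> c <= y <= d -> {for (x, y), continuous f}.

(** Composing f with the coordinatewise retraction onto the rectangle gives a function that is
    continuous on the whole plane and equal to f on the rectangle. *)
Lemma cont_rect_measurable a b c d (f : R * R -> R) : cont_rect a b c d f ->
  measurable_fun (rect a b c d) (f : RR * RR -> R).
Proof.
move=> cf; have [ab|ba] := leP a b; last first.
  rewrite /rect set_itv_ge ?set0X; first exact: measurable_fun_set0.
  by rewrite bnd_simp -ltNge.
have [cd|dc] := leP c d; last first.
  rewrite /rect [X in _ `*` X]set_itv_ge ?setX0; first exact: measurable_fun_set0.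
  by rewrite bnd_simp -ltNge.
apply: (@eq_measurable_fun _ _ _ _ _ (fun p : RR * RR => f (clamp a b p.1, clamp c d p.2))).
  move=> [x y]; rewrite inE => -[/=]; rewrite !in_itv/= => h1 h2.
  by rewrite !clamp_id.
apply: measurable_funTS; apply: continuous_measurable2 => -[x y].
have := cf (clamp a b x) (clamp c d y) (clamp_itv x ab) (clamp_itv y cd).
move=> h; apply: (@cvg_comp _ _ _ (fun p : R * R => (clamp a b p.1, clamp c d p.2)) f _ _ _ _ h).
apply: cvg_pair2.
- by apply: (@cvg_comp _ _ _ fst (clamp a b) _ (nbhs x)); [exact: cvg_fst|exact: clamp_continuous].
- by apply: (@cvg_comp _ _ _ snd (clamp c d) _ (nbhs y)); [exact: cvg_snd|exact: clamp_continuous].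
Qed.

Lemma cont_rect_bounded a b c d (f : R * R -> R) : cont_rect a b c d f ->
  exists M, forall x y, a <= x <= b -> c <= y <= d -> `|f (x, y)| <= M.
Proof.
move=> cf.
have cw : {within (`[a, b] `*` `[c, d] : set (R * R)), continuous f}.
  apply: continuous_in_subspaceT => -[x y]; rewrite inE => -[/=]; rewrite !in_itv/=.
  exact: cf.
have := continuous_compact cw (compact_setX (@segment_compact R a b) (@segment_compact R c d)).
move=> /compact_bounded[M [_ hM]]; exists (M + 1) => x y xab ycd.
apply: hM; first by rewrite ltrDl.
by exists (x, y) => //; split; rewrite /= in_itv.
Qed.

Lemma leb2_rect_fin a b c d : (leb2 (rect a b c d) < +oo)%E.
Proof.
rewrite /leb2 /rect product_measure1E ?measurable_itv//.
rewrite /= !lebesgue_measure_itv/=.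
by case: ifP; case: ifP; rewrite ?mul0e ?mule0 -?EFinB -?EFinM ?ltry.
Qed.

Lemma integrable_cMrect a b c d (g h : R * R -> R) : cont_rect a b c d g ->
  leb2.-integrable (rect a b c d) (EFin \o h) ->
  leb2.-integrable (rect a b c d) (EFin \o (fun p => g p * h p)).
Proof.
move=> cg hi; have [M hM] := cont_rect_bounded cg.
apply: (integrableMr (measurable_rect a b c d) (cont_rect_measurable cg) _ hi).
exists M; split; first exact: num_real.
move=> x Mx [y z] [/=]; rewrite !in_itv/= => h1 h2.
by apply: (le_trans (hM y z h1 h2)); exact: ltW.
Qed.

Lemma integrable_cst_rect a b c d (k : R) :
  leb2.-integrable (rect a b c d) (EFin \o (fun=> k)).
Proof.
apply: measurable_bounded_integrable; [exact: measurable_rect|exact: leb2_rect_fin| |].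
  exact: measurable_cst.
exists `|k|; split; first exact: num_real.
by move=> x kx y _; exact: ltW.
Qed.

Lemma cont_rect_integrable a b c d (f : R * R -> R) : cont_rect a b c d f ->
  leb2.-integrable (rect a b c d) (EFin \o f).
Proof.
move=> /integrable_cMrect /(_ (integrable_cst_rect a b c d 1)).
by under [_ \o _]eq_fun do rewrite /= mulr1.
Qed.

End PlaneMeasurability.

(** * Integrability of real functions and dominated convergence *)

Section RealIntegrable.
Context d (T : measurableType d) (R : realType) (m : {measure set T -> \bar R}).
Variables (D : set T) (mD : measurable D).
Implicit Types f g : T -> R.

Lemma integrable_funD f g : m.-integrable D (EFin \o f) -> m.-integrable D (EFin \o g) ->
  m.-integrable D (EFin \o (fun x => f x + g x)).
Proof. by move=> fi gi; exact: (integrableD mD fi gi). Qed.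

Lemma integrable_funB f g : m.-integrable D (EFin \o f) -> m.-integrable D (EFin \o g) ->
  m.-integrable D (EFin \o (fun x => f x - g x)).
Proof. by move=> fi gi; exact: (integrableB mD fi gi). Qed.

Lemma integrable_funZ (k : R) f : m.-integrable D (EFin \o f) ->
  m.-integrable D (EFin \o (fun x => k * f x)).
Proof. by move=> fi; exact: (integrableZl mD k fi). Qed.

End RealIntegrable.

Lemma continuous_itv_integrable (R : realType) (a b : R) (f : R -> R) :
  {within `[a, b], continuous f} ->
  (@lebesgue_measure R).-integrable `[a, b] (EFin \o f).
Proof. exact: continuous_compact_integrable (@segment_compact R a b). Qed.

Lemma Rintegral_dct d (T : measurableType d) (R : realType)
    (m : {measure set T -> \bar R}) (D : set T) (f_ : nat -> T -> R) (f g : T -> R) :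
  measurable D -> (forall n, measurable_fun D (f_ n)) ->
  (forall x, D x -> f_ ^~ x @ \oo --> f x) ->
  m.-integrable D (EFin \o g) -> (forall n x, D x -> `|f_ n x| <= g x) ->
  m.-integrable D (EFin \o f) /\
  (fun n => \int[m]_(x in D) f_ n x) @ \oo --> \int[m]_(x in D) f x.
Proof.
move=> mD mf_ f_f ig f_g.
have mf : measurable_fun D f by exact: measurable_fun_cvg f_f.
have [|||||fi _ c] := @dominated_convergence _ T R m D mD (fun n => EFin \o f_ n) (EFin \o f)
  (EFin \o g).
- by move=> n; apply/measurable_EFinP.
- by apply/measurable_EFinP.
- apply/aeW => x Dx; apply/fine_cvgP; split; first exact: nearW.
  exact: f_f.
- by apply: ig.
- by apply/aeW => x n Dx; rewrite /= lee_fin; exact: f_g.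
split => //; apply/fine_cvg; rewrite fineK//; exact: integrable_fin_num.
Qed.

Lemma ae_forall_count d (T : measurableType d) (R : realType)
    (m : {measure set T -> \bar R}) (I : countType) (P : I -> T -> Prop) :
  (forall i, {ae m, forall x, P i x}) -> {ae m, forall x, forall i, P i x}.
Proof.
move=> h; have := @ae_foralln _ T R m (fun n x => if unpickle n is Some i then P i x else True).
have H n : \forall x \ae m, (if unpickle n is Some i then P i x else True).
  by case: (unpickle n) => [i|]; [exact: h|exact: aeW].
move=> /(_ H); apply: (@filterS _ _ (ae_filter_ringOfSetsType m)) => x hx i.
by have := hx (pickle i); rewrite pickleK.
Qed.

(** * From weak derivatives to absolute continuity on lines *)

Section WeakToAC.
Variable R : realType.
Local Notation RR := (measurableTypeR R).
Local Notation mu := (@lebesgue_measure R).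
Local Notation leb2 := (@leb2 R).
Variable B : nat -> R -> R.
Hypothesis dB : dfamily B.
Hypothesis B1 : forall y, 1 <= y -> B 0%N y = 1.
Hypothesis B0 : forall y, y <= -1 -> B 0%N y = 0.

Let itv_trunc (a b c : R) (f : R -> R) : a <= b -> b <= c ->
  mu.-integrable `[a, c] (EFin \o f) ->
  \int[mu]_(x in `[a, c]) (f x * ((a < x <= b)%R : bool)%:R) = \int[mu]_(x in `[a, b]) f x.
Proof.
move=> ab bc fi.
have fab : mu.-integrable `[a, b] (EFin \o f) by exact: integrable_itvS fi.
have fab' : mu.-integrable `]a, b] (EFin \o f).
  by apply: integrableS fab => //=; apply: subset_itv; rewrite bnd_simp.
rewrite -[RHS](Rintegral_itv_obnd_cbnd (r := a))//.
rewrite (Rintegral_mkcond mu `[a, c]) (Rintegral_mkcond mu `]a, b]).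
apply: eq_Rintegral => x _; rewrite !patchE.
have macE : (x \in (`[a, c]%classic : set R)) = (a <= x <= c).
  by apply/idP/idP; rewrite inE/= in_itv/=.
have mabE : (x \in (`]a, b]%classic : set R)) = (a < x <= b).
  by apply/idP/idP; rewrite inE/= in_itv/=.
rewrite macE mabE; case: (ltP a x) => ax; case: (leP x b) => xb /=; rewrite ?mulr1 ?mulr0.
- by rewrite (le_trans xb bc) ltW.
- by case: ifP.
- by case: ifP.
- by case: ifP.
Qed.

Let bump_continuous x1 x2 e k : continuous (bumpf B x1 x2 e k).
Proof. by apply: dfamily_continuous; exact: bumpf_dfamily. Qed.

(** A sequence tending to 0; with [n.+2] even its first term is strictly below e0. *)
Let en (e0 : R) (n : nat) : R := e0 / n.+2%:R.

Let en_gt0 e0 n : 0 < e0 -> 0 < en e0 n.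
Proof. by move=> ?; rewrite divr_gt0. Qed.

Let en_lt e0 n : 0 < e0 -> en e0 n < e0.
Proof. by move=> ?; rewrite ltr_pdivrMr// ltr_pMr// ltr1n. Qed.

Let en_near e0 e1 : 0 < e0 -> 0 < e1 -> \forall n \near \oo, en e0 n < e1.
Proof.
move=> e00 e10; near=> n; rewrite ltr_pdivrMr// mulrC -ltr_pdivrMr//.
apply: (@le_lt_trans _ _ n%:R); last by rewrite ltr_nat ltnS leqnSn.
near: n; exact: nbhs_infty_ger.
Unshelve. all: end_near. Qed.

Let bump_en_cvg e0 x1 x2 x : 0 < e0 -> x1 <= x2 ->
  (fun n => bumpf B x1 x2 (en e0 n) 0 x) @ \oo --> (((x1 < x <= x2)%R : bool)%:R : R).
Proof.
move=> e00 x12; have [e1 e10 h] := bump_cvg B1 B0 x x12.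
apply: cvg_near_cst; near=> n; apply: h; first exact: en_gt0.
by near: n; exact: en_near.
Unshelve. all: end_near. Qed.

(** Limit e -> 0 of the identity for bumps. On the left the derivative of the first bump tends to
    the difference of the Dirac masses at x1 and x2, on the right the bumps tend to the indicator of
    the rectangle; convergence is dominated on both sides. *)
Lemma weak_rect (g h : R * R -> R) (x1 x2 X y1 y2 Y e0 : R) :
  x1 <= x2 -> x2 + 2 * e0 <= X -> y1 <= y2 -> y2 <= Y -> 0 < e0 ->
  cont_rect x1 X y1 Y g -> leb2.-integrable (rect x1 X y1 Y) (EFin \o h) ->
  (forall e, 0 < e -> e < e0 ->
    \int[leb2]_(p in rect x1 X y1 Y) (g p * (bumpf B x1 x2 e 1 p.1 * bumpf B y1 y2 e 0 p.2)) =
    - \int[leb2]_(p in rect x1 X y1 Y) (h p * (bumpf B x1 x2 e 0 p.1 * bumpf B y1 y2 e 0 p.2))) ->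
  \int[mu]_(y in `[y1, y2]) (g (x2, y) - g (x1, y)) =
  \int[mu]_(y in `[y1, y2]) \int[mu]_(x in `[x1, x2]) h (x, y).
Proof.
move=> x12 x2X y12 y2Y e00 cg hi H.
have x2X' : x2 < X by lra.
have mX : measurable (`[x1, X]%classic : set RR) by exact: measurable_itv.
have mY : measurable (`[y1, Y]%classic : set RR) by exact: measurable_itv.
have [C0 C00 hC0] := step_bounded dB B1 B0 0.
have [C1 C10 hC1] := step_bounded dB B1 B0 1.
have [M hM] := cont_rect_bounded cg.
pose bx n k (p : R * R) := bumpf B x1 x2 (en e0 n) k p.1.
pose by_ n (p : R * R) := bumpf B y1 y2 (en e0 n) 0 p.2.
have cbx n k : cont_rect x1 X y1 Y (bx n k).
  move=> x y _ _; apply: (@cvg_comp _ _ _ fst (bumpf B x1 x2 (en e0 n) k) _ (nbhs x)).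
    exact: cvg_fst.
  exact: bump_continuous.
have cby n : cont_rect x1 X y1 Y (by_ n).
  move=> x y _ _; apply: (@cvg_comp _ _ _ snd (bumpf B y1 y2 (en e0 n) 0) _ (nbhs y)).
    exact: cvg_snd.
  exact: bump_continuous.
pose I1 (p : R * R) : R := ((x1 < p.1 <= x2)%R : bool)%:R.
pose I2 (p : R * R) : R := ((y1 < p.2 <= y2)%R : bool)%:R.
have mrect := measurable_rect x1 X y1 Y.
have mh : measurable_fun (rect x1 X y1 Y) h.
  by apply/measurable_EFinP; exact: measurable_int hi.
have ikh (K : R) : leb2.-integrable (rect x1 X y1 Y) (EFin \o (fun p => K * `|h p|)).
  have := integrableZl mrect K (integrable_abse hi).
  by apply: eq_integrable.
have [ihI chI] : leb2.-integrable (rect x1 X y1 Y) (EFin \o (fun p => h p * (I1 p * I2 p))) /\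
    (fun n => \int[leb2]_(p in rect x1 X y1 Y) (h p * (bx n 0%N p * by_ n p))) @ \oo -->
    \int[leb2]_(p in rect x1 X y1 Y) (h p * (I1 p * I2 p)).
  apply: (@Rintegral_dct _ _ _ leb2 _ (fun n p => h p * (bx n 0%N p * by_ n p)) _
    (fun p => (2 * C0 * (2 * C0)) * `|h p|)) => //.
  - move=> n; apply: measurable_funM => //; apply: measurable_funM; exact: cont_rect_measurable.
  - move=> p _; apply: cvgM; first exact: cvg_cst.
    by apply: cvgM; exact: bump_en_cvg.
  - move=> n p _; rewrite normrM mulrC ler_wpM2r// normrM ler_pM//; exact: bump_bound.
have e1 : \int[leb2]_(p in rect x1 X y1 Y) (h p * (I1 p * I2 p)) =
    \int[mu]_(y in `[y1, y2]) \int[mu]_(x in `[x1, x2]) h (x, y).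
  rewrite (Rintegral_fubini2 mX mY ihI).
  transitivity (\int[mu]_(y in `[y1, Y])
      ((\int[mu]_(x in `[x1, X]) (h (x, y) * I1 (x, y))) * I2 (0, y))).
    apply: eq_Rintegral => y _; rewrite /I2/=; case: (_ < y <= _).
      by rewrite mulr1; apply: eq_Rintegral => x _; rewrite mulr1.
    rewrite mulr0; under eq_Rintegral do rewrite !mulr0.
    by rewrite Rintegral_cst// mul0r.
  have hxi : leb2.-integrable (rect x1 X y1 Y) (EFin \o (fun p => h p * I1 p)).
    have [] := @Rintegral_dct _ _ _ leb2 (rect x1 X y1 Y) (fun n p => h p * bx n 0%N p)
      (fun p => h p * I1 p) (fun p => (2 * C0) * `|h p|) mrect => //.
    - by move=> n; apply: measurable_funM => //; exact: cont_rect_measurable.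
    - move=> p _; apply: cvgM; first exact: cvg_cst.
      exact: bump_en_cvg.
    - move=> n p _; rewrite normrM mulrC ler_wpM2r//; exact: bump_bound.
  rewrite itv_trunc//; last exact: (integrable_inner2 mX mY hxi).
  have hxi' : leb2.-integrable (`[x1, X] `*` `[y1, y2]) (EFin \o h).
    apply: integrableS hi => //; first by apply: measurableX.
    by apply: setSX => //; apply: subset_itv; rewrite bnd_simp.
  have ae2 := leb2_ae_slice2 mX (measurable_itv `[y1, y2]) hxi'.
  congr fine; apply: ae_eq_integral => //.
  - apply/measurable_EFinP; apply: (measurable_funS mY).
      by apply: subset_itv; rewrite bnd_simp.
    by apply/measurable_EFinP; exact: measurable_int (integrable_inner2 mX mY hxi).
  - have hi' : leb2.-integrable (`[x1, x2] `*` `[y1, y2]) (EFin \o h).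
      apply: integrableS hi => //; first by apply: measurableX.
      by apply: setSX; apply: subset_itv; rewrite bnd_simp// ltW.
    by have /measurable_int := integrable_inner2 (measurable_itv `[x1, x2]) (measurable_itv `[y1, y2]) hi'.
  - apply: filterS ae2 => y /= hy yy; congr EFin.
    exact: (@itv_trunc x1 x2 X (fun x => h (x, y)) x12 (ltW x2X') (hy yy)).
have iG n : leb2.-integrable (rect x1 X y1 Y) (EFin \o (fun p => g p * (bx n 1%N p * by_ n p))).
  apply: cont_rect_integrable => x y xx yy; apply: cvgM; first exact: cg.
  by apply: cvgM; [exact: cbx|exact: cby].
have iG1 n : leb2.-integrable (rect x1 X y1 Y) (EFin \o (fun p => g p * bx n 1%N p)).
  apply: cont_rect_integrable => x y xx yy; apply: cvgM; [exact: cg|exact: cbx].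
pose G n y := \int[mu]_(x in `[x1, X]) (g (x, y) * bx n 1%N (x, y)).
have eG n : \int[leb2]_(p in rect x1 X y1 Y) (g p * (bx n 1%N p * by_ n p)) =
    \int[mu]_(y in `[y1, Y]) (G n y * bumpf B y1 y2 (en e0 n) 0 y).
  rewrite (Rintegral_fubini2 mX mY (iG n)); apply: eq_Rintegral => y; rewrite inE/= in_itv/= => yy.
  rewrite -RintegralZr//; first by apply: eq_Rintegral => x _; rewrite mulrA.
  apply: continuous_compact_integrable (@segment_compact R x1 X) _.
  apply: continuous_in_subspaceT => x; rewrite inE/= in_itv/= => xx.
  by apply: (@slice1_continuous _ (fun p => g p * bx n 1%N p)); apply: cvgM; [exact: cg|exact: cbx].
have cgy y : y1 <= y <= Y -> {within `[x1, X], continuous (fun x => g (x, y))}.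
  move=> yy; apply: continuous_in_subspaceT => x; rewrite inE/= in_itv/= => xx.
  exact/slice1_continuous/cg.
have [iL cL] : mu.-integrable `[y1, Y] (EFin \o (fun y => (g (x1, y) - g (x2, y)) * I2 (0, y))) /\
    (fun n => \int[mu]_(y in `[y1, Y]) (G n y * bumpf B y1 y2 (en e0 n) 0 y)) @ \oo -->
    \int[mu]_(y in `[y1, Y]) ((g (x1, y) - g (x2, y)) * I2 (0, y)).
  apply: (@Rintegral_dct _ _ _ mu _ (fun n y => G n y * bumpf B y1 y2 (en e0 n) 0 y) _
    (fun=> (4 * C1 * M) * (2 * C0))) => //.
  - move=> n; apply: measurable_funM.
      by apply/measurable_EFinP; exact: measurable_int (integrable_inner2 mX mY (iG1 n)).
    by apply: continuous_itv_measurable; apply: continuous_subspaceT => y; exact: bump_continuous.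
  - move=> y; rewrite /= in_itv/= => yy; apply: cvgM; last exact: bump_en_cvg.
    apply/cvgrPdist_le => eta eta0.
    have [||e1' e10' h1] := bump_deriv_cvg dB B1 B0 eta0 x12 x2X' (cgy y yy).
    + by apply/slice1_continuous/cg => //; rewrite lexx; lra.
    + by apply/slice1_continuous/cg => //; rewrite x12; lra.
    near=> n; rewrite distrC; apply: h1; first exact: en_gt0.
    by near: n; exact: en_near.
  - by apply: continuous_compact_integrable (@segment_compact R y1 Y) _ => ?; exact: cvg_cst.
  - move=> n y; rewrite /= in_itv/= => yy; rewrite normrM ler_pM//; last exact: bump_bound.
    apply: bump_deriv_bound => //; [exact: en_gt0| |exact: cgy|by move=> x xx; exact: hM].
    by have := en_lt n e00; lra.
have e2 : \int[mu]_(y in `[y1, Y]) ((g (x1, y) - g (x2, y)) * I2 (0, y)) =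
    - \int[mu]_(y in `[y1, y2]) \int[mu]_(x in `[x1, x2]) h (x, y).
  have cN : (fun n => - \int[leb2]_(p in rect x1 X y1 Y) (h p * (bx n 0%N p * by_ n p)))
      @ \oo --> - \int[leb2]_(p in rect x1 X y1 Y) (h p * (I1 p * I2 p)).
    exact: cvgN.
  rewrite -e1 -(cvg_lim (@Rhausdorff R) cL) -(cvg_lim (@Rhausdorff R) cN).
  congr (lim (_ @ \oo)); apply/funext => n.
  by rewrite -eG /= H// ?en_gt0// en_lt.
have cgg : {within `[y1, Y], continuous (fun y => g (x1, y) - g (x2, y))}.
  apply: continuous_in_subspaceT => y; rewrite inE/= in_itv/= => yy.
  by apply: cvgB; apply/slice2_continuous/cg => //; rewrite ?lexx ?x12 ?(le_trans x12 (ltW x2X')) ?(ltW x2X').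
have igg := continuous_itv_integrable cgg.
have e3 : \int[mu]_(y in `[y1, Y]) ((g (x1, y) - g (x2, y)) * I2 (0, y)) =
  \int[mu]_(y in `[y1, y2]) (g (x1, y) - g (x2, y)) := itv_trunc y12 y2Y igg.
move: e2; rewrite e3 => /(congr1 -%R); rewrite opprK => <-.
rewrite -mulN1r -RintegralZl//; last exact: integrable_itvS igg.
by apply: eq_Rintegral => y _; rewrite mulN1r opprB.
Unshelve. all: end_near. Qed.

Lemma dense_eq0 (a b : R) (F : R -> R) : {within `[a, b], continuous F} ->
  (forall q : rat, a < ratr q < b -> F (ratr q) = 0) -> forall x, a < x < b -> F x = 0.
Proof.
move=> cF F0 x xab.
have cx : {for x, continuous F}.
  have : {within `]a, b[, continuous F}.
    by apply: continuous_subspaceW cF; apply: subset_itv; rewrite bnd_simp.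
  rewrite continuous_open_subspace; last exact: interval_open.
  by apply; rewrite inE/= in_itv.
apply/eqP; apply: contraT => Fx.
have Fx0 : 0 < `|F x| by rewrite normr_gt0.
move/cvgrPdist_lt : cx => /(_ _ Fx0) [r /= r0 hr].
have [ax xb] := andP xab.
have /rat_in_itvoo[q] : x < Num.min b (x + r) by rewrite lt_min xb ltrDl.
rewrite in_itv/= lt_min => /andP[xq /andP[qb qr]].
have := hr (ratr q); rewrite /= F0 ?qb ?(lt_trans ax)// subr0 ltxx => -> //.
by rewrite distrC gtr0_norm; lra.
Qed.

(* Rectangles with rational corners exhaust the open rectangle. *)
Lemma weak_ac (g h : R * R -> R) (a b c d : R) :
  (forall x1 x2 y1 y2, a < x1 -> x2 < b -> c < y1 -> y2 < d ->
    cont_rect x1 x2 y1 y2 g /\ leb2.-integrable (rect x1 x2 y1 y2) (EFin \o h)) ->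
  (forall x1 x2 X y1 y2 Y e, a < x1 -> x1 <= x2 -> x2 + 2 * e <= X -> X < b ->
    c < y1 -> y1 <= y2 -> y2 + 2 * e <= Y -> Y < d -> 0 < e ->
    \int[leb2]_(p in rect x1 X y1 Y) (g p * (bumpf B x1 x2 e 1 p.1 * bumpf B y1 y2 e 0 p.2)) =
    - \int[leb2]_(p in rect x1 X y1 Y) (h p * (bumpf B x1 x2 e 0 p.1 * bumpf B y1 y2 e 0 p.2))) ->
  {ae mu, forall y, c < y < d -> forall x1 x2, a < x1 -> x1 <= x2 -> x2 < b ->
     ac1 x1 x2 (fun x => g (x, y)) (fun x => h (x, y))}.
Proof.
move=> reg H.
pose good (q1 q2 : R) y := ac1 q1 q2 (fun x => g (x, y)) (fun x => h (x, y)).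
pose int_eq (q1 q : R) y := g (q, y) - g (q1, y) = \int[mu]_(x in `[q1, q]) h (x, y).
(* For fixed q1 and q2 the identity of [weak_rect] holds on every interval [y1, y], so its integrand
   vanishes for almost every y. *)
have step (q1 q2 y1 y2 : R) : a < q1 -> q1 <= q2 -> q2 < b -> c < y1 -> y2 < d ->
    {ae mu, forall y, y1 < y < y2 -> int_eq q1 q2 y}.
  move=> aq q12 qb cy yd; have [y21|y12] := leP y2 y1.
    by apply: aeW => y /andP[h1 h2]; lra.
  pose X := (q2 + b) / 2; pose Y := (y2 + d) / 2.
  pose e0 := Num.min ((X - q2) / 2) ((Y - y2) / 2).
  have e00 : 0 < e0 by rewrite lt_min /X /Y; apply/andP; split; lra.
  have h1 : e0 <= (X - q2) / 2 by rewrite ge_min lexx.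
  have h2 : e0 <= (Y - y2) / 2 by rewrite ge_min lexx orbT.
  have e0X : q2 + 2 * e0 <= X by lra.
  have e0Y : y2 + 2 * e0 <= Y by lra.
  have q2X : q2 <= X by rewrite /X; lra.
  have y2Y : y2 <= Y by rewrite /Y; lra.
  have Xb : X < b by rewrite /X; lra.
  have Yd : Y < d by rewrite /Y; lra.
  have [cg hi] := reg q1 X y1 Y aq Xb cy Yd.
  pose k y := (g (q2, y) - g (q1, y)) - \int[mu]_(x in `[q1, q2]) h (x, y).
  have hi' : leb2.-integrable (`[q1, q2] `*` `[y1, y2]) (EFin \o h).
    apply: integrableS hi => //; [exact: measurable_rect|exact: measurable_rect|].
    by move=> [x y] [/=]; rewrite /rect/= !in_itv/= => /andP[-> h3] /andP[-> h4];
       rewrite (le_trans h3 q2X) (le_trans h4 y2Y).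
  have ih := integrable_inner2 (measurable_itv _) (measurable_itv _) hi'.
  have cgg : {within `[y1, y2], continuous (fun y => g (q2, y) - g (q1, y))}.
    apply: continuous_in_subspaceT => y; rewrite inE/= in_itv/= => /andP[? ?].
    by apply: cvgB; apply/slice2_continuous/cg; rewrite ?q12 ?lexx ?q2X ?(le_trans q12)//;
       apply/andP; split => //; exact: le_trans y2Y.
  have igg := continuous_itv_integrable cgg.
  have ik : mu.-integrable `[y1, y2] (EFin \o k).
    exact: (integrable_funB _ igg ih).
  have k0 y : y1 <= y <= y2 -> \int[mu]_(z in `[y1, y]) k z = 0.
    move=> /andP[y1y yy2].
    rewrite RintegralB//; [|exact: integrable_itvS igg|exact: integrable_itvS ih].
    apply/eqP; rewrite subr_eq0; apply/eqP.
    apply: (@weak_rect g h q1 q2 X y1 y Y e0) => //; first by lra.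
    move=> e e1 e2; apply: H => //; lra.
  have := ae_eq0_itv ik k0; apply: (@filterS _ _ (ae_filter_ringOfSetsType mu)) => y hy yy.
  by apply/eqP; rewrite -subr_eq0; apply/eqP; exact: hy.
have step2 (q1 q2 y1 y2 : R) : a < q1 -> q2 < b -> c < y1 -> y2 < d ->
    {ae mu, forall y, y1 < y < y2 -> mu.-integrable `[q1, q2] (fun x => (h (x, y))%:E)}.
  move=> aq qb cy yd; have [_ hi] := reg q1 q2 y1 y2 aq qb cy yd.
  have := leb2_ae_slice2 (measurable_itv _) (measurable_itv _) hi.
  apply: filterS => y hy /andP[yy1 yy2]; apply: hy.
  by rewrite /= in_itv/= !ltW.
have A : {ae mu, forall y, forall i : rat * rat * (rat * rat),
    a < ratr i.1.1 -> ratr i.1.2 < b -> c < ratr i.2.1 -> ratr i.2.2 < d ->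
    ratr i.2.1 < y < ratr i.2.2 -> ratr i.1.1 <= ratr i.1.2 :> R ->
    int_eq (ratr i.1.1) (ratr i.1.2) y /\
    mu.-integrable `[ratr i.1.1, ratr i.1.2] (fun x => (h (x, y))%:E)}.
  apply: ae_forall_count => -[[q1 q2] [r1 r2]] /=.
  have [h1|/negP h1] := pselect [&& a < ratr q1, ratr q2 < b, c < ratr r1, ratr r2 < d &
     ratr q1 <= ratr q2 :> R]; last first.
    by apply: aeW => y h2 h3 h4 h5 _ h6; case: h1; rewrite h2 h3 h4 h5 h6.
  have /and5P[h2 h3 h4 h5 h6] := h1.
  apply: (@filterS2 _ _ (ae_filter_ringOfSetsType mu) _ _ _ _ (step _ _ _ _ h2 h6 h3 h4 h5)
    (step2 _ _ _ _ h2 h3 h4 h5)).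
  by move=> y k1 k2 _ _ _ _ yy _; split; [exact: k1|exact: k2].
apply: (@filterS _ _ (ae_filter_ringOfSetsType mu) _ _ _ A) => y hy /andP[cy yd] x1 x2 ax x12 xb.
have /rat_in_itvoo[r1] := cy; rewrite in_itv/= => /andP[r1c r1y].
have /rat_in_itvoo[r2] := yd; rewrite in_itv/= => /andP[r2y r2d].
have /rat_in_itvoo[q1] := ax; rewrite in_itv/= => /andP[aq1 q1x].
have /rat_in_itvoo[q2] := xb; rewrite in_itv/= => /andP[xq2 q2b].
have q12 : ratr q1 <= ratr q2 :> R by lra.
have yr : ratr r1 < y < ratr r2 by rewrite r1y.
have [_ iq] := hy (q1, q2, (r1, r2)) aq1 q2b r1c r2d yr q12.
apply: (@ac1_sub _ x1 x2) => //.
(* So far the formula holds at rational x only; both sides are continuous in x, which gives all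
   x. *)
pose F x := g (x, y) - (g (ratr q1, y) + \int[mu]_(z in `[ratr q1, x]) h (z, y)).
have cF : {within `[ratr q1, ratr q2], continuous F}.
  move=> x; apply: cvgB.
    suff : {within `[ratr q1, ratr q2], continuous (fun x => g (x, y))} by apply.
    apply: continuous_in_subspaceT => z; rewrite inE/= in_itv/= => /andP[z1 z2].
    apply: slice1_continuous; apply: (reg (ratr q1) (ratr q2) (ratr r1) (ratr r2) _ _ _ _).1 => //.
      by rewrite z1.
    by rewrite !ltW.
  by apply: cvgD; [exact: cvg_cst|exact: (int_continuous q12 iq)].
have F0 : forall x, ratr q1 < x < ratr q2 -> F x = 0.
  apply: dense_eq0 cF _ => q /andP[q1q qq2].
  have [e _] := hy (q1, q, (r1, r2)) aq1 (lt_trans qq2 q2b) r1c r2d yr (ltW q1q).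
  by rewrite /F opprD addrA -[g _ - g _]/(_ - _) e subrr.
have E x : ratr q1 < x < ratr q2 ->
    g (x, y) = g (ratr q1, y) + \int[mu]_(z in `[ratr q1, x]) h (z, y).
  by move=> /F0/eqP; rewrite subr_eq0 => /eqP.
split; first exact: (integrable_itvS (ltW q1x) (ltW xq2) iq).
move=> x /andP[x1x xx2].
rewrite (E x) ?(lt_le_trans q1x x1x) ?(le_lt_trans xx2 xq2)//.
rewrite (E x1) ?q1x ?(le_lt_trans x12 xq2)//.
rewrite -addrA -Rintegral_itv_cat//; first exact: ltW.
by apply: integrable_itvS iq; [exact: lexx|exact: le_trans xx2 (ltW xq2)].
Qed.

End WeakToAC.

(** * Translations and iterated integrals of nonnegative functions *)

Section Translation.
Variable R : realType.
Local Notation RR := (measurableTypeR R).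
Local Notation mu := (@lebesgue_measure R).
Local Notation leb2 := (@leb2 R).

Definition shiftR (r : R) (x : RR) : RR := x + r.
Definition shift2 (r : R) (p : RR * RR) : RR * RR := (p.1 + r, p.2).

Let measurable_shiftR r : measurable_fun setT (shiftR r).
Proof. by apply: measurable_funD. Qed.

Lemma measurable_shift2 r : measurable_fun setT (shift2 r).
Proof.
by apply: measurable_fun_pair => //; apply: measurable_funD.
Qed.

(** By uniqueness of Lebesgue measure it is enough to compare the two measures on half-open
    intervals. *)
Lemma lebesgue_shift (r : R) (A : set RR) : measurable A ->
  mu (shiftR r @^-1` A) = mu A.
Proof.
pose phi : {mfun RR >-> RR} := HB.pack (shiftR r) (isMeasurableFun.Build _ _ _ _ _ (measurable_shiftR r)).
move=> mA; apply/esym.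
apply: (@lebesgue_measure_unique R (pushforward mu phi)) => // _ [[a b]] _ <-.
rewrite -[RHS]/(mu (shiftR r @^-1` `]a, b])).
have -> : shiftR r @^-1` `]a, b] = `]a - r, b - r]%classic.
  by apply/seteqP; split => x /=; rewrite /shiftR !in_itv/= => /andP[h1 h2]; apply/andP; split; lra.
rewrite !lebesgue_measure_itv/= !lte_fin ltrD2r.
by case: ifP => //; rewrite -!EFinB => _; congr EFin; ring.
Qed.

Lemma leb2_shift (r : R) (A : set (RR * RR)) : measurable A ->
  leb2 (shift2 r @^-1` A) = leb2 A.
Proof.
pose phi : {mfun (RR * RR)%type >-> (RR * RR)%type} :=
  HB.pack (shift2 r) (isMeasurableFun.Build _ _ _ _ _ (measurable_shift2 r)).
move=> mA; apply/esym.
apply: (@product_measure_unique _ _ RR RR R mu mu (pushforward leb2 phi)) => // B C mB mC.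
rewrite -[LHS]/(leb2 (shift2 r @^-1` (B `*` C))).
have -> : shift2 r @^-1` (B `*` C) = (shiftR r @^-1` B) `*` C by [].
have mB' : measurable (shiftR r @^-1` B).
  by rewrite -[X in measurable X]setTI; exact: measurable_shiftR.
transitivity (mu (shiftR r @^-1` B) * mu C)%E; first exact: product_measure1E.
by rewrite lebesgue_shift.
Qed.

Lemma ge0_integral_shift2 (r : R) (D : set (RR * RR)) (f : RR * RR -> \bar R) :
  measurable D -> measurable_fun D f -> (forall p, D p -> (0 <= f p)%E) ->
  (\int[leb2]_(p in shift2 r @^-1` D) f (shift2 r p) = \int[leb2]_(p in D) f p)%E.
Proof.
move=> mD mf f0.
pose phi : {mfun (RR * RR)%type >-> (RR * RR)%type} :=
  HB.pack (shift2 r) (isMeasurableFun.Build _ _ _ _ _ (measurable_shift2 r)).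
have := @ge0_integral_pushforward _ _ _ _ R phi (measurable_shift2 r) leb2 D f mD mf.
move=> <-; last by move=> p /set_mem; exact: f0.
by apply: eq_measure_integral => A mA _; rewrite /pushforward; exact: leb2_shift.
Qed.

Lemma integrable_shift2 (r : R) (D : set (RR * RR)) (f : RR * RR -> R) :
  measurable D -> leb2.-integrable D (EFin \o f) ->
  leb2.-integrable (shift2 r @^-1` D) (EFin \o (fun p => f (shift2 r p))).
Proof.
move=> mD fi; have mf := measurable_int _ fi.
have mD' : measurable (shift2 r @^-1` D).
  by rewrite -[X in measurable X]setTI; exact: measurable_shift2.
apply/integrableP; split.
  apply: (measurable_comp mD _ mf (measurable_funTS (measurable_shift2 r))).
  by move=> _ [p Dp <-].
have /integrableP[_] := fi; rewrite -(@ge0_integral_shift2 r)//.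
exact: (measurableT_comp (@abse_measurable R setT) mf).
Qed.

Lemma Rintegral_shift2 (r : R) (D : set (RR * RR)) (f : RR * RR -> R) :
  measurable D -> leb2.-integrable D (EFin \o f) ->
  \int[leb2]_(p in shift2 r @^-1` D) f (shift2 r p) = \int[leb2]_(p in D) f p.
Proof.
move=> mD fi; have mf := measurable_int _ fi.
have e1 := @ge0_integral_shift2 r D _ mD (measurable_funepos mf) (fun _ _ => funepos_ge0 _ _).
have e2 := @ge0_integral_shift2 r D _ mD (measurable_funeneg mf) (fun _ _ => funeneg_ge0 _ _).
transitivity (fine (\int[leb2]_(p in shift2 r @^-1` D) (EFin \o f)^\+ (shift2 r p) -
  \int[leb2]_(p in shift2 r @^-1` D) (EFin \o f)^\- (shift2 r p))%E).
  rewrite /Rintegral integralE; congr (fine (_ - _)); apply: eq_integral => p _.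
    by rewrite !funeposE.
  by rewrite !funenegE.
by rewrite e1 e2 /Rintegral [in RHS]integralE.
Qed.

End Translation.

Section IteratedNonneg.
Variable R : realType.
Local Notation RR := (measurableTypeR R).
Local Notation mu := (@lebesgue_measure R).
Local Notation leb2 := (@leb2 R).

Lemma ge0_integral_slice1 (D E : set RR) (f : RR * RR -> \bar R) :
  measurable D -> measurable E -> measurable_fun (D `*` E) f ->
  (forall p, (0 <= f p)%E) ->
  measurable_fun D (fun x => \int[mu]_(y in E) f (x, y))%E /\
  (\int[leb2]_(p in D `*` E) f p = \int[mu]_(x in D) \int[mu]_(y in E) f (x, y))%E.
Proof.
move=> mD mE mf f0.
have mDE := measurableX mD mE.
have mF : measurable_fun setT (f \_ (D `*` E)) by exact/(measurable_restrictT _ mDE).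
have F0 p : (0 <= (f \_ (D `*` E)) p)%E by rewrite patchE; case: ifP.
have e : (fun x => \int[mu]_y (f \_ (D `*` E)) (x, y))%E = (fun x => \int[mu]_(y in E) f (x, y))%E \_ D.
  apply/funext => x; rewrite [RHS]patchE; case: ifPn => [Dx|nDx].
    rewrite [RHS]integral_mkcond; apply: eq_integral => y _.
    by rewrite !patchE in_setX/= Dx.
  by rewrite integral0_eq// => y _; rewrite patchE in_setX/= (negbTE nDx).
split.
  apply/(measurable_restrictT _ mD); rewrite -e.
  by apply: (@measurable_fun_fubini_tonelli_F _ _ RR RR R mu (f \_ (D `*` E))).
rewrite integral_mkcond (@fubini_tonelli1 _ _ RR RR R mu mu _ mF F0) /fubini_F e.
by rewrite -integral_mkcond.
Qed.

Lemma ge0_integral_slice2 (D E : set RR) (f : RR * RR -> \bar R) :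
  measurable D -> measurable E -> measurable_fun (D `*` E) f ->
  (forall p, (0 <= f p)%E) ->
  measurable_fun E (fun y => \int[mu]_(x in D) f (x, y))%E /\
  (\int[leb2]_(p in D `*` E) f p = \int[mu]_(y in E) \int[mu]_(x in D) f (x, y))%E.
Proof.
move=> mD mE mf f0.
have mDE := measurableX mD mE.
have mF : measurable_fun setT (f \_ (D `*` E)) by exact/(measurable_restrictT _ mDE).
have F0 p : (0 <= (f \_ (D `*` E)) p)%E by rewrite patchE; case: ifP.
have e : (fun y => \int[mu]_x (f \_ (D `*` E)) (x, y))%E = (fun y => \int[mu]_(x in D) f (x, y))%E \_ E.
  apply/funext => y; rewrite [RHS]patchE; case: ifPn => [Ey|nEy].
    rewrite [RHS]integral_mkcond; apply: eq_integral => x _.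
    by rewrite !patchE in_setX/= Ey andbT.
  by rewrite integral0_eq// => x _; rewrite patchE in_setX/= (negbTE nEy) andbF.
split.
  apply/(measurable_restrictT _ mE); rewrite -e.
  by apply: (@measurable_fun_fubini_tonelli_G _ _ RR RR R mu (f \_ (D `*` E))).
rewrite integral_mkcond (@fubini_tonelli2 _ _ RR RR R mu mu _ mF F0) /fubini_G e.
by rewrite -integral_mkcond.
Qed.

End IteratedNonneg.

(** * A weighted Gagliardo-Nirenberg inequality on an interval *)

Section GagliardoNirenberg.
Variable R : realType.
Local Notation RR := (measurableTypeR R).
Local Notation mu := (@lebesgue_measure R).

(** Two completed squares, each taking a quarter of g^4. *)
Let young (K M g l h : R) : 0 <= K -> 0 <= M -> `|l| <= K -> `|h| <= 6 * M ->
  forall z : R, l * g ^+ 3 + h * (g ^+ 2 * z) <=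
     2^-1 * g ^+ 4 + (K ^+ 2 * g ^+ 2 + 36 * M ^+ 2 * z ^+ 2).
Proof.
move=> K0 M0 lK hM z.
have h1 : l * g ^+ 3 <= 4^-1 * g ^+ 4 + l ^+ 2 * g ^+ 2.
  have : 0 <= (2^-1 * g ^+ 2 - l * g) ^+ 2 by exact: sqr_ge0.
  have -> : (2^-1 * g ^+ 2 - l * g) ^+ 2 = 4^-1 * g ^+ 4 + l ^+ 2 * g ^+ 2 - l * g ^+ 3 by field.
  by rewrite subr_ge0.
have h2 : h * (g ^+ 2 * z) <= 4^-1 * g ^+ 4 + h ^+ 2 * z ^+ 2.
  have : 0 <= (2^-1 * g ^+ 2 - h * z) ^+ 2 by exact: sqr_ge0.
  have -> : (2^-1 * g ^+ 2 - h * z) ^+ 2 = 4^-1 * g ^+ 4 + h ^+ 2 * z ^+ 2 - h * (g ^+ 2 * z) by field.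
  by rewrite subr_ge0.
have h3 : l ^+ 2 * g ^+ 2 <= K ^+ 2 * g ^+ 2.
  by rewrite ler_wpM2r ?sqr_ge0// -(real_normK (num_real l)) lerXn2r// nnegrE.
have h4 : h ^+ 2 * z ^+ 2 <= 36 * M ^+ 2 * z ^+ 2.
  rewrite ler_wpM2r ?sqr_ge0// -(real_normK (num_real h)).
  have -> : 36 * M ^+ 2 = (6 * M) ^+ 2 by ring.
  by rewrite lerXn2r// nnegrE mulr_ge0.
have -> : 2^-1 * g ^+ 4 = 4^-1 * g ^+ 4 + 4^-1 * g ^+ 4 by field.
lra.
Qed.

(** Half of the left side reappears on the right and is moved back. *)
Let absorb (c x y : R) : x - 0 <= 2^-1 * x + (c / 2) * y -> x <= c * y.
Proof. by move=> h; lra. Qed.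

(* Subtracting from h the affine function with the same end values kills the
   boundary terms in the integration by parts of w (h - l) h'^3. *)
Lemma gagliardo_nirenberg (a b M k : R) (h g z w w' : R -> R) :
  a + 1 <= b -> 0 <= k ->
  ac1 a b h g -> ac1 a b g z -> ac1 a b w w' -> {within `[a, b], continuous w'} ->
  (forall x, a <= x <= b -> `|h x| <= M) ->
  (forall x, a <= x <= b -> 0 < w x /\ `|w' x| <= k * w x) ->
  (\int[mu]_(x in `[a, b]) (w x * g x ^+ 4)%:E <=
   (2 * ((2 * M * (1 + k)) ^+ 2 + 36 * M ^+ 2) + 1)%:E *
   \int[mu]_(x in `[a, b]) (w x * (g x ^+ 2 + z x ^+ 2))%:E)%E.
Proof.
move=> ab k0 ah ag aw cw' hM hw.
have ab' : a <= b by lra.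
have M0 : 0 <= M by apply: le_trans (hM a _); rewrite ?normr_ge0// lexx.
set C := 2 * _ + 1; pose K := 2 * M * (1 + k).
have K0 : 0 <= K by rewrite /K !mulr_ge0// addr_ge0.
have C0 : 0 < C by rewrite /C ltr_wpDl// mulr_ge0// addr_ge0 ?sqr_ge0// mulr_ge0// sqr_ge0.
have cg := ac1_continuous ab' ag.
have ch := ac1_continuous ab' ah.
have cw := ac1_continuous ab' aw.
have mab : measurable (`[a, b]%classic : set RR) by exact: measurable_itv.
have zi : mu.-integrable `[a, b] (EFin \o z) by case: ag.
have mz : measurable_fun (`[a, b] : set RR) z by apply/measurable_EFinP; exact: measurable_int zi.
have mg := continuous_itv_measurable cg.
have mw := continuous_itv_measurable cw.
pose e x := w x * (g x ^+ 2 + z x ^+ 2).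
have e0 x : `[a, b]%classic x -> 0 <= e x.
  by rewrite /= in_itv/= => /hw[/ltW w0 _]; rewrite mulr_ge0// addr_ge0 ?sqr_ge0.
have me : measurable_fun (`[a, b] : set RR) (EFin \o e).
  apply/measurable_EFinP; apply: measurable_funM => //.
  by apply: measurable_funD; exact: measurable_funX.
(* If the right side is infinite there is nothing to prove, as C > 0; otherwise [e] is integrable
   and the argument runs with real integrals. *)
have [eoo|] := ltP (\int[mu]_(x in `[a, b]) (e x)%:E)%E +oo%E; last first.
  by rewrite leye_eq => /eqP ->; rewrite gt0_muley ?lte_fin// leey.
have ei : mu.-integrable `[a, b] (EFin \o e).
  apply/integrableP; split => //.
  apply: le_lt_trans eoo; rewrite le_eqVlt; apply/orP; left; apply/eqP.
  by apply: eq_integral => x /set_mem xab; rewrite /= ger0_norm// e0.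
pose l' := (h b - h a) / (b - a); pose l x := h a + l' * (x - a).
have ba0 : 0 < b - a by lra.
have l'M : `|l'| <= 2 * M.
  rewrite normrM normfV (gtr0_norm ba0) ler_pdivrMr//.
  apply: le_trans (ler_normB _ _) _.
  have h1 : `|h b| <= M by apply: hM; rewrite lexx ab'.
  have h2 : `|h a| <= M by apply: hM; rewrite lexx ab'.
  apply: (@le_trans _ _ (2 * M)); first by lra.
  (* Here [a + 1 <= b] enters: division by b - a >= 1 keeps the slope of the affine function below 2
     M, whatever the length of the interval. *)
  by rewrite ler_peMr ?mulr_ge0//; lra.
have lM x : a <= x <= b -> `|l x| <= M.
  move=> /andP[ax xb].
  have -> : l x = ((b - x) / (b - a)) * h a + ((x - a) / (b - a)) * h b.
    by rewrite /l /l'; field; rewrite gt_eqF.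
  apply: le_trans (ler_normD _ _) _; rewrite !normrM.
  rewrite (ger0_norm (x := b - x)) ?subr_ge0// (ger0_norm (x := x - a)) ?subr_ge0//.
  rewrite normfV (gtr0_norm ba0).
  have h1 : `|h b| <= M by apply: hM; rewrite lexx ab'.
  have h2 : `|h a| <= M by apply: hM; rewrite lexx ab'.
  apply: (@le_trans _ _ ((b - x) / (b - a) * M + (x - a) / (b - a) * M)).
    by apply: lerD; apply: ler_wpM2l => //; rewrite divr_ge0 ?subr_ge0// ltW.
  by rewrite -mulrDl -mulrDl (_ : b - x + (x - a) = b - a) ?divff ?mul1r ?gt_eqF//; ring.
have al : ac1 a b l (fun=> l').
  apply: ac1_derive => [x _|]; last by move=> ?; exact: cvg_cst.
  rewrite /l; apply: is_derive_eq; rewrite /GRing.scale/=; ring.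
have aH : ac1 a b (fun x => h x - l x) (fun x => g x - l').
  have al' : ac1 a b (fun x => - l x) (fun=> - l').
    have := ac1M (ac1_cst a b (-1)) al.
    by under eq_fun do rewrite mulN1r; under [X in ac1 _ _ _ X]eq_fun do rewrite mul0r add0r mulN1r.
  exact: ac1D ah al'.
have ag3 := ac1M ag (ac1M ag ag).
have aT := ac1M aw (ac1M aH ag3).
(* The derivative [T'] of w (h - l) g^3 has integral zero, because h - l vanishes at a and b. *)
have [Ti _] := aT; have := ac1_int aT (lexx _) ab' (lexx _).
have Ha : h a - l a = 0 by rewrite /l subrr mulr0 addr0 subrr.
have Hb : h b - l b = 0 by rewrite /l /l' divfK ?gt_eqF//; ring.
rewrite Ha Hb !mul0r !mulr0 subrr; set T' := (X in Rintegral _ _ X) => T0.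
pose W4 x := w x * g x ^+ 4.
have cW4 : {within `[a, b], continuous W4}.
  have -> : W4 = (fun x => w x * (g x * g x * (g x * g x))).
    by apply/funext => x; rewrite /W4; ring.
  move=> x; apply: cvgM; first exact: cw.
  by apply: cvgM; apply: cvgM; exact: cg.
have W4i := continuous_itv_integrable cW4.
(* Subtracting [T'] cancels w g^4 and leaves a term in g^3 and one in g^2 z. The derivative of the
   weight enters only through the quotient q = w' / w, bounded by k. *)
have pt x : a <= x <= b -> W4 x - T' x <= 2^-1 * W4 x + (C / 2) * e x.
  move=> xab; have [w0 w'w] := hw x xab.
  pose q := w' x / w x.
  have qk : `|q| <= k by rewrite normrM normfV (gtr0_norm w0) ler_pdivrMr.
  have qw : w' x = q * w x by rewrite /q divfK// gt_eqF.
  have HM : `|h x - l x| <= 2 * M.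
    by apply: le_trans (ler_normB _ _) _; have := hM x xab; have := lM x xab; lra.
  have lK : `|l' - q * (h x - l x)| <= K.
    apply: le_trans (ler_normB _ _) _; rewrite (normrM q) /K.
    have : `|q| * `|h x - l x| <= k * (2 * M) by exact: ler_pM.
    by lra.
  have hK : `| - 3 * (h x - l x)| <= 6 * M.
    by rewrite normrM normrN (ger0_norm (x := 3))//; lra.
  have := young (g x) K0 M0 lK hK (z x).
  rewrite -(ler_pM2l w0) => Y.
  have -> : W4 x - T' x = w x * ((l' - q * (h x - l x)) * g x ^+ 3 +
      - 3 * (h x - l x) * (g x ^+ 2 * z x)).
    by rewrite /W4 /T' qw; ring.
  apply: le_trans Y _; rewrite /W4 /e.
  have -> : w x * (2^-1 * g x ^+ 4 + (K ^+ 2 * g x ^+ 2 + 36 * M ^+ 2 * z x ^+ 2)) =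
     2^-1 * (w x * g x ^+ 4) + w x * (K ^+ 2 * g x ^+ 2 + 36 * M ^+ 2 * z x ^+ 2) by ring.
  rewrite lerD2l (mulrCA (C / 2)) ler_pM2l// /C -/K.
  have a1 : 0 <= 36 * M ^+ 2 * g x ^+ 2.
    by apply: mulr_ge0; [apply: mulr_ge0 => //; exact: sqr_ge0|exact: sqr_ge0].
  have a2 : 0 <= K ^+ 2 * z x ^+ 2 by apply: mulr_ge0; exact: sqr_ge0.
  have a3 := sqr_ge0 (g x); have a4 := sqr_ge0 (z x).
  have -> : (2 * (K ^+ 2 + 36 * M ^+ 2) + 1) / 2 * (g x ^+ 2 + z x ^+ 2) =
    (K ^+ 2 * g x ^+ 2 + 36 * M ^+ 2 * z x ^+ 2) +
    (36 * M ^+ 2 * g x ^+ 2 + K ^+ 2 * z x ^+ 2 + 2^-1 * g x ^+ 2 + 2^-1 * z x ^+ 2) by field.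
  by rewrite lerDl; lra.
have R1 : \int[mu]_(x in `[a, b]) W4 x - 0 <=
    2^-1 * \int[mu]_(x in `[a, b]) W4 x + (C / 2) * \int[mu]_(x in `[a, b]) e x.
  rewrite [X in _ - X]T0 -RintegralB// -!RintegralZl// -RintegralD//; last 2 first.
  - exact: integrable_funZ.
  - exact: integrable_funZ.
  apply: le_Rintegral => //.
  - exact: integrable_funB.
  - by apply: integrable_funD => //; exact: integrable_funZ.
have EI (f : R -> R) : mu.-integrable `[a, b] (EFin \o f) ->
    (\int[mu]_(x in `[a, b]) (f x)%:E = (\int[mu]_(x in `[a, b]) f x)%:E)%E.
  by move=> fi; rewrite /Rintegral fineK//; exact: integrable_fin_num.
rewrite (EI W4 W4i) (EI e ei) -EFinM lee_fin; exact: absorb.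
Qed.

End GagliardoNirenberg.

(** * Products of derivative families, supports and exchange of coordinates *)

Section ProductFamily.
Variable R : realType.

(* k-th derivative of the product of F i and G j *)
Fixpoint leib (F G : nat -> R -> R) (k i j : nat) (x : R) : R :=
  match k with
  | 0 => F i x * G j x
  | k'.+1 => leib F G k' i.+1 j x + leib F G k' i j.+1 x
  end.

Lemma leib_dfamily F G i j : dfamily F -> dfamily G -> dfamily (fun k => leib F G k i j).
Proof.
move=> dF dG k; elim: k i j => [|k ih] i j x /=.
  have h1 := dF i x; have h2 := dG j x.
  by apply: is_derive_eq; rewrite /GRing.scale/=; ring.
have h1 := ih i.+1 j x; have h2 := ih i j.+1 x.
by apply: is_derive_eq.
Qed.

Lemma leib_out F G k i j x : (forall l, G l x = 0) -> leib F G k i j x = 0.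
Proof.
by move=> G0; elim: k i j => [|k ih] i j /=; rewrite ?G0 ?mulr0// !ih addr0.
Qed.

Lemma dfamilyS (F : nat -> R -> R) : dfamily F -> dfamily (fun k => F k.+1).
Proof. by move=> dF k x; exact: dF. Qed.

Lemma dfamily_shift (F : nat -> R -> R) r : dfamily F -> dfamily (fun k x => F k (x + r)).
Proof.
move=> dF k x; rewrite -[F k.+1 (x + r)]mulr1.
apply: (@is_derive1_comp _ (F k) (fun x => x + r)); first exact: dF.
by apply: is_derive_eq; rewrite addr0.
Qed.

End ProductFamily.

Section RectIntegrals.
Variable R : realType.
Local Notation RR := (measurableTypeR R).
Local Notation mu := (@lebesgue_measure R).
Local Notation leb2 := (@leb2 R).

Lemma integral_suppE (D E : set (RR * RR)) (f : RR * RR -> \bar R) :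
  D `<=` E -> (forall p, E p -> ~ D p -> f p = 0)%E ->
  (\int[leb2]_(p in E) f p = \int[leb2]_(p in D) f p)%E.
Proof.
move=> DE f0; rewrite integral_mkcond [RHS]integral_mkcond; apply: eq_integral => p _.
rewrite !patchE; case: ifPn => [/set_mem Ep|nE]; case: ifPn => [/set_mem Dp|nD] //.
  by rewrite f0// => /mem_set; exact/negP.
by have /mem_set := DE _ Dp; rewrite (negbTE nE).
Qed.

Lemma rect_suppE (a b c d a' b' c' d' : R) (f : RR * RR -> R) :
  a <= a' -> b' <= b -> c <= c' -> d' <= d ->
  (forall x y, x < a' \/ b' < x -> f (x, y) = 0) ->
  (forall x y, c <= y <= d -> y < c' \/ d' < y -> f (x, y) = 0) ->
  \int[leb2]_(p in rect a b c d) f p = \int[leb2]_(p in rect a' b' c' d') f p.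
Proof.
move=> aa bb cc dd fx fy; congr fine; apply: integral_suppE.
  move=> [x y] [/=]; rewrite /rect/= !in_itv/= => /andP[h1 h2] /andP[h3 h4].
  by rewrite (le_trans aa)// (le_trans h2)// (le_trans cc)// (le_trans h4).
move=> [x y] [_ /=]; rewrite in_itv/= => ycd nD; congr EFin.
have [h1|h1] := ltP x a'; first by apply: fx; left.
have [h2|h2] := ltP b' x; first by apply: fx; right.
have [h3|h3] := ltP y c'; first by apply: fy => //; left.
have [h4|h4] := ltP d' y; first by apply: fy => //; right.
by case: nD; split; rewrite /= in_itv/= ?h1 ?h3.
Qed.

Definition swap2 (p : RR * RR) : RR * RR := (p.2, p.1).

Lemma measurable_swap2 : measurable_fun setT swap2.
Proof. exact: measurable_fun_pair. Qed.

Lemma integrable_swap2 (D E : set RR) (f : RR * RR -> R) :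
  measurable D -> measurable E -> leb2.-integrable (D `*` E) (EFin \o f) ->
  leb2.-integrable (E `*` D) (EFin \o (fun p => f (swap2 p))).
Proof.
move=> mD mE fi; have mf := measurable_int _ fi.
have mDE := measurableX mD mE; have mED := measurableX mE mD.
have mfs : measurable_fun (E `*` D) (EFin \o (fun p => f (swap2 p))).
  apply: (measurable_comp mDE _ mf (measurable_funTS measurable_swap2)).
  by move=> _ [[y x] [/= Ey Dx] <-].
apply/integrableP; split => //.
have /integrableP[_] := fi.
have [_ ->] := @ge0_integral_slice2 R D E (fun p => `|(f p)%:E|)%E mD mE
  (measurableT_comp (@abse_measurable R setT) mf) (fun _ => abse_ge0 _).
have [_ ->] := @ge0_integral_slice1 R E D (fun p => `|(f (swap2 p))%:E|)%E mE mD
  (measurableT_comp (@abse_measurable R setT) mfs) (fun _ => abse_ge0 _).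
by [].
Qed.

Lemma Rintegral_swap2 (D E : set RR) (f : RR * RR -> R) :
  measurable D -> measurable E -> leb2.-integrable (D `*` E) (EFin \o f) ->
  \int[leb2]_(p in E `*` D) f (swap2 p) = \int[leb2]_(p in D `*` E) f p.
Proof.
move=> mD mE fi; rewrite (Rintegral_fubini1 mE mD (integrable_swap2 mD mE fi)).
by rewrite (Rintegral_fubini2 mD mE fi).
Qed.

End RectIntegrals.

(** * Weak derivatives tested against products *)

Section TensorWeak.
Variable R : realType.
Local Notation RR := (measurableTypeR R).
Local Notation mu := (@lebesgue_measure R).
Local Notation leb2 := (@leb2 R).
Implicit Types f g : R * R -> R.

Definition strip_int (a b : R) f : Prop := forall x1 x2, a < x1 -> x2 < b ->
  leb2.-integrable (rect x1 x2 0 1) (EFin \o f).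

(** A scalar weak derivative tested only on products F(s) G(t), whose partial derivatives are read
    off from the families F and G. The notion is stable under what pregluing does: translation in s,
    sums, and products with functions of s. *)
Definition tens_weak (a b : R) (i j : nat) f g : Prop :=
  [/\ strip_int a b f, strip_int a b g &
   forall F G x1 x2, dfamily F -> dfamily G -> a < x1 -> x2 < b ->
     (forall k s, s < x1 \/ x2 < s -> F k s = 0) ->
     (forall k t, G k (t + 1) = G k t) ->
     \int[leb2]_(p in rect x1 x2 0 1) (f p * (F i p.1 * G j p.2)) =
     (-1) ^+ (i + j) * \int[leb2]_(p in rect x1 x2 0 1) (g p * (F 0%N p.1 * G 0%N p.2))].

Lemma tens_cont_rect F G i j a b c d : dfamily F -> dfamily G ->
  cont_rect a b c d (fun p : R * R => F i p.1 * G j p.2).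
Proof. by move=> dF dG x y _ _; exact: (smooth_continuous (smooth_tensor i j dF dG)). Qed.

Lemma strip_int_tens a b f F G i j x1 x2 : strip_int a b f -> dfamily F -> dfamily G ->
  a < x1 -> x2 < b ->
  leb2.-integrable (rect x1 x2 0 1) (EFin \o (fun p => f p * (F i p.1 * G j p.2))).
Proof.
move=> fi dF dG ax xb.
have := integrable_cMrect (@tens_cont_rect F G i j x1 x2 0 1 dF dG) (fi _ _ ax xb).
by apply: eq_integrable => [|p _]; [exact: measurable_rect|rewrite /= mulrC].
Qed.

Lemma weak_partial_tens m n (A : set R) (a b : R) (i j : nat)
    (f g : R * R -> 'M[R]_(m, n)) (u : 'I_m) (v : 'I_n) :
  (forall s, a < s < b -> (A°) s) -> weak_partial A i j f g ->
  tens_weak a b i j (fun p => f p u v) (fun p => g p u v).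
Proof.
move=> abA [fi gi H].
have sub x1 x2 : a < x1 -> x2 < b -> `[x1, x2] `<=` A°.
  move=> ax xb x; rewrite /= in_itv/= => /andP[h1 h2]; apply: abA.
  by rewrite (lt_le_trans ax)// (le_lt_trans h2).
have si (h : R * R -> 'M[R]_(m, n)) : cyl_loc_integrable A h -> strip_int a b (fun p => h p u v).
  by move=> hi x1 x2 ax xb; exact: (hi _ (@segment_compact R x1 x2) (sub _ _ ax xb)).
split; [exact: si|exact: si|] => F G x1 x2 dF dG ax xb F0 pG.
have T := test_tensor dF dG (sub _ _ ax xb) (F0 0%N) (pG 0%N).
have := H _ T u v; rewrite partial_tensor//.
have sup (h : R * R -> R) k l : (\int[leb2]_(p in (A°) `*` `[0%R, 1%R]%classic)
      (h p * (F k p.1 * G l p.2))%:E =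
    \int[leb2]_(p in rect x1 x2 0 1) (h p * (F k p.1 * G l p.2))%:E)%E.
  apply: integral_suppE => [[x y] [/= h1 h2]|[x y] [/= h1 h2] nD].
    by split => //=; exact: (sub _ _ ax xb).
  rewrite F0 ?mul0r ?mulr0//.
  have [h3|h3] := ltP x x1; first by left.
  have [h4|h4] := ltP x2 x; first by right.
  by case: nD; split => //=; rewrite in_itv/= h3.
rewrite !sup => /(congr1 fine); rewrite fineM//.
by apply: integrable_fin_num; [exact: measurable_rect|exact: (@strip_int_tens a b _ F G 0 0 x1 x2 (si _ gi) dF dG ax xb)].
Qed.

Lemma shift2_rect (r x1 x2 c d : R) :
  shift2 (- r) @^-1` rect (x1 - r) (x2 - r) c d = rect x1 x2 c d.
Proof.
apply/seteqP; split => -[x y] [h1 h2]; split => //; move: h1;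
  rewrite /shift2/= !in_itv/= => /andP[? ?]; apply/andP; split; lra.
Qed.

Lemma strip_int_shift a b f r : strip_int a b f ->
  strip_int (a + r) (b + r) (fun p => f (p.1 - r, p.2)).
Proof.
move=> fi x1 x2 ax xb.
have H : leb2.-integrable (rect (x1 - r) (x2 - r) 0 1) (EFin \o f).
  by apply: fi; [rewrite ltrBrDr|rewrite ltrBlDr].
have := integrable_shift2 (- r) (measurable_rect _ _ _ _) H.
by rewrite shift2_rect.
Qed.

Lemma tens_weak_shift a b i j f g r : tens_weak a b i j f g ->
  tens_weak (a + r) (b + r) i j (fun p => f (p.1 - r, p.2)) (fun p => g (p.1 - r, p.2)).
Proof.
move=> [fi gi H]; split; [exact: strip_int_shift|exact: strip_int_shift|].
move=> F G x1 x2 dF dG ax xb F0 pG.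
have ax' : a < x1 - r by rewrite ltrBrDr.
have xb' : x2 - r < b by rewrite ltrBlDr.
have dF' := dfamily_shift r dF.
have F0' k s : s < x1 - r \/ x2 - r < s -> F k (s + r) = 0.
  by rewrite ltrBrDr ltrBlDr; exact: F0.
have S (h : R * R -> R) k l : strip_int a b h ->
    \int[leb2]_(p in rect x1 x2 0 1) (h (p.1 - r, p.2) * (F k p.1 * G l p.2)) =
    \int[leb2]_(p in rect (x1 - r) (x2 - r) 0 1) (h p * (F k (p.1 + r) * G l p.2)).
  move=> hi; rewrite -(Rintegral_shift2 (- r) (measurable_rect _ _ _ _)
    (@strip_int_tens a b h _ G k l _ _ hi dF' dG ax' xb')) shift2_rect.
  by apply: eq_Rintegral => -[x y] _ /=; rewrite subrK.
by rewrite !S// (H _ _ _ _ dF' dG ax' xb' F0' pG).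
Qed.

End TensorWeak.

(** * Product rule for weak derivatives *)

Section WeakLeibniz.
Variable R : realType.
Local Notation RR := (measurableTypeR R).
Local Notation mu := (@lebesgue_measure R).
Local Notation leb2 := (@leb2 R).
Implicit Types f g h : R * R -> R.

Lemma strip_intD a b f g : strip_int a b f -> strip_int a b g ->
  strip_int a b (fun p => f p + g p).
Proof.
move=> fi gi x1 x2 ax xb.
by apply: integrable_funD; [exact: measurable_rect|exact: fi|exact: gi].
Qed.

Lemma strip_intM a b (phi : R -> R) f : continuous phi -> strip_int a b f ->
  strip_int a b (fun p => phi p.1 * f p).
Proof.
move=> cphi fi x1 x2 ax xb.
apply: (@integrable_cMrect R x1 x2 0 1 (fun p => phi p.1)); last exact: fi.
move=> x y _ _; apply: (@cvg_comp _ _ _ fst phi _ (nbhs x)); first exact: cvg_fst.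
exact: cphi.
Qed.

Let pair x1 x2 h (phi psi : R -> R) : R :=
  \int[leb2]_(p in rect x1 x2 0 1) (h p * (phi p.1 * psi p.2)).

Let pair_int a b x1 x2 h (phi psi : R -> R) : strip_int a b h -> a < x1 -> x2 < b ->
  continuous phi -> continuous psi ->
  leb2.-integrable (rect x1 x2 0 1) (EFin \o (fun p => h p * (phi p.1 * psi p.2))).
Proof.
move=> hi ax xb cphi cpsi.
have c : cont_rect x1 x2 0 1 (fun p => phi p.1 * psi p.2).
  move=> x y _ _; apply: cvgM.
    by apply: (@cvg_comp _ _ _ fst phi _ (nbhs x)); [exact: cvg_fst|exact: cphi].
  by apply: (@cvg_comp _ _ _ snd psi _ (nbhs y)); [exact: cvg_snd|exact: cpsi].
have := integrable_cMrect c (hi _ _ ax xb).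
by apply: eq_integrable => [|p _]; [exact: measurable_rect|rewrite /= mulrC].
Qed.

Let pairDl a b x1 x2 h1 h2 (phi psi : R -> R) : strip_int a b h1 -> strip_int a b h2 ->
  a < x1 -> x2 < b -> continuous phi -> continuous psi ->
  pair x1 x2 (fun p => h1 p + h2 p) phi psi = pair x1 x2 h1 phi psi + pair x1 x2 h2 phi psi.
Proof.
move=> i1 i2 ax xb c1 c2; rewrite /pair -RintegralD//; first last.
- exact: (pair_int i2 ax xb c1 c2).
- exact: (pair_int i1 ax xb c1 c2).
- exact: measurable_rect.
by apply: eq_Rintegral => p _; rewrite mulrDl.
Qed.

Let pairDr a b x1 x2 h (phi1 phi2 psi : R -> R) (c : R) : strip_int a b h ->
  a < x1 -> x2 < b -> continuous phi1 -> continuous phi2 -> continuous psi ->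
  pair x1 x2 h (fun x => phi1 x + c * phi2 x) psi =
  pair x1 x2 h phi1 psi + c * pair x1 x2 h phi2 psi.
Proof.
move=> i1 ax xb c1 c2 c3.
have I1 := pair_int i1 ax xb c1 c3; have I2 := pair_int i1 ax xb c2 c3.
rewrite /pair -RintegralZl//; last exact: measurable_rect.
rewrite -RintegralD//; first last.
- exact: integrable_funZ (measurable_rect _ _ _ _) _ _ I2.
- exact: measurable_rect.
by apply: eq_Rintegral => p _; ring.
Qed.

Let pairM x1 x2 h (beta phi psi : R -> R) :
  pair x1 x2 (fun p => beta p.1 * h p) phi psi = pair x1 x2 h (fun x => beta x * phi x) psi.
Proof. by apply: eq_Rintegral => p _; ring. Qed.

Lemma tens_weakD a b i j f1 g1 f2 g2 : tens_weak a b i j f1 g1 -> tens_weak a b i j f2 g2 ->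
  tens_weak a b i j (fun p => f1 p + f2 p) (fun p => g1 p + g2 p).
Proof.
move=> [fi1 gi1 H1] [fi2 gi2 H2]; split; [exact: strip_intD|exact: strip_intD|].
move=> F G x1 x2 dF dG ax xb F0 pG.
have cF k : continuous (F k) by exact: dfamily_continuous.
have cG k : continuous (G k) by exact: dfamily_continuous.
have := pairDl fi1 fi2 ax xb (cF i) (cG j); rewrite /pair => ->.
have := pairDl gi1 gi2 ax xb (cF 0%N) (cG 0%N); rewrite /pair => ->.
by rewrite mulrDr H1// H2.
Qed.

Definition weak2 (a b : R) (D : nat -> nat -> R * R -> R) : Prop :=
  forall i j, (i + j <= 2)%N -> tens_weak a b i j (D 0%N 0%N) (D i j).

Lemma weak2D a b D1 D2 : weak2 a b D1 -> weak2 a b D2 ->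
  weak2 a b (fun i j p => D1 i j p + D2 i j p).
Proof. by move=> H1 H2 i j ij; apply: tens_weakD; [exact: H1|exact: H2]. Qed.

Lemma weak2_shift a b D r : weak2 a b D ->
  weak2 (a + r) (b + r) (fun i j p => D i j (p.1 - r, p.2)).
Proof. by move=> H i j ij; apply: tens_weak_shift; exact: H. Qed.

(** The jet up to order two of B(s) times a function; B depends on s alone, so t-derivatives pass
    through. *)
Definition leibD (B : nat -> R -> R) (D : nat -> nat -> R * R -> R) (i j : nat) (p : R * R) : R :=
  match i with
  | 0 => B 0%N p.1 * D 0%N j p
  | 1 => B 1%N p.1 * D 0%N j p + B 0%N p.1 * D 1%N j p
  | _ => B 2%N p.1 * D 0%N j p + (2 * B 1%N p.1) * D 1%N j p + B 0%N p.1 * D 2%N j p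
  end.

(** The product rule is carried out on the test function. With K the family of B F and K' that of B'
    F, one has B F' = K_1 - K'_0 and B F'' = K_2 - 2 K'_1 + B'' F, and every term is again an
    admissible test function or its derivative. *)
Lemma weak2_leib a b B D : dfamily B -> weak2 a b D -> weak2 a b (leibD B D).
Proof.
move=> dB H i j ij.
have cB k : continuous (B k) by exact: dfamily_continuous.
have cB2 : continuous (fun x => 2 * B 1%N x).
  by move=> x; apply: cvgM; [exact: cvg_cst|exact: cB].
have [f00 _ _] := H 0%N 0%N isT.
have fi k l : (k + l <= 2)%N -> strip_int a b (D k l) by move=> /H[].
split.
- exact: strip_intM.
- case: i ij => [|[|[|i]]] ij //=.
  + by apply: strip_intM => //; exact: fi.
  + apply: strip_intD; apply: strip_intM => //; apply: fi => //.
    by rewrite add0n; rewrite ltnS in ij; rewrite (leq_trans ij).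
  + case: j ij => [|j] // _.
    exact: (strip_intD (strip_intD (strip_intM (cB 2%N) (fi 0%N 0%N isT))
      (strip_intM cB2 (fi 1%N 0%N isT))) (strip_intM (cB 0%N) (fi 2%N 0%N isT))).
move=> F G x1 x2 dF dG ax xb F0 pG.
have cF k : continuous (F k) by exact: dfamily_continuous.
have cG k : continuous (G k) by exact: dfamily_continuous.
pose K k := leib B F k 0 0; pose K' k := leib (fun l => B l.+1) F k 0 0.
have dK : dfamily K by exact: leib_dfamily.
have dK' : dfamily K' by apply: leib_dfamily => //; exact: dfamilyS.
have K0 k s : s < x1 \/ x2 < s -> K k s = 0 by move=> hs; apply: leib_out => l; exact: F0.
have K'0 k s : s < x1 \/ x2 < s -> K' k s = 0 by move=> hs; apply: leib_out => l; exact: F0.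
have cK k : continuous (K k) by exact: dfamily_continuous.
have cK' k : continuous (K' k) by exact: dfamily_continuous.
have cBF k l : continuous (fun x => B k x * F l x).
  by move=> x; apply: cvgM; [exact: cB|exact: cF].
have T k l : (k + l <= 2)%N -> pair x1 x2 (D 0%N 0%N) (K k) (G l) =
    (-1) ^+ (k + l) * pair x1 x2 (D k l) (K 0%N) (G 0%N).
  by move=> kl; have [_ _ h] := H k l kl; exact: h.
have T' k l : (k + l <= 2)%N -> pair x1 x2 (D 0%N 0%N) (K' k) (G l) =
    (-1) ^+ (k + l) * pair x1 x2 (D k l) (K' 0%N) (G 0%N).
  by move=> kl; have [_ _ h] := H k l kl; exact: h.
rewrite -!/(pair x1 x2 _ _ _) [LHS]/pair.
rewrite -[LHS]/(pair x1 x2 (fun p => B 0%N p.1 * D 0%N 0%N p) (F i) (G j)) pairM.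
rewrite -[X in _ = _ * X]/(pair x1 x2 (leibD B D i j) (F 0%N) (G 0%N)).
have D01 k l c h : c * pair x1 x2 h (fun x => B k x * F l x) (G 0%N) =
  c * pair x1 x2 (fun p => B k p.1 * h p) (F l) (G 0%N) by rewrite pairM.
case: i ij => [|[|[|i]]] ij //=.
- by have := T 0%N j ij; rewrite /K/= => ->; rewrite D01.
- have -> : (fun x => B 0%N x * F 1%N x) = (fun x => K 1%N x + (-1) * K' 0%N x).
    by apply/funext => x; rewrite /K /K'/=; ring.
  rewrite (pairDr (-1) f00 ax xb (cK 1%N) (cK' 0%N) (cG j)).
  rewrite ltnS in ij; have ij' : (0 + j <= 2)%N by rewrite (leq_trans ij).
  rewrite (T 1%N j)// (T' 0%N j)//.
  have i0 := fi 0%N j ij'; have i1 := fi 1%N j ij.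
  rewrite (pairDl (strip_intM (cB 1%N) i0) (strip_intM (cB 0%N) i1) ax xb (cF 0%N) (cG 0%N)).
  by rewrite !pairM /K /K'/= exprS; ring.
- case: j ij => [|j] // _.
  have -> : (fun x => B 0%N x * F 2%N x) =
      (fun x => (K 2%N x + (- 2) * K' 1%N x) + 1 * (B 2%N x * F 0%N x)).
    by apply/funext => x; rewrite /K /K'/=; ring.
  have cKK : continuous (fun x => K 2%N x + (- 2) * K' 1%N x).
    move=> x; apply: cvgD; first exact: cK.
    by apply: cvgM; [exact: cvg_cst|exact: cK'].
  rewrite (pairDr 1 f00 ax xb cKK (cBF 2%N 0%N) (cG 0%N)) (pairDr (- 2) f00 ax xb (cK 2%N) (cK' 1%N) (cG 0%N)).
  rewrite T// T'//.
  have i0 := fi 0%N 0%N isT; have i1 := fi 1%N 0%N isT; have i2 := fi 2%N 0%N isT.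
  rewrite (pairDl (strip_intD (strip_intM (cB 2%N) i0) (strip_intM cB2 i1)) (strip_intM (cB 0%N) i2)
    ax xb (cF 0%N) (cG 0%N)).
  rewrite (pairDl (strip_intM (cB 2%N) i0) (strip_intM cB2 i1) ax xb (cF 0%N) (cG 0%N)).
  rewrite !pairM /K /K'/=.
  have -> : pair x1 x2 (fun p => 2 * B 1%N p.1 * D 1%N 0%N p) (F 0%N) (G 0%N) =
      2 * pair x1 x2 (D 1%N 0%N) (fun x => B 1%N x * F 0%N x) (G 0%N).
    rewrite /pair -RintegralZl//; first by apply: eq_Rintegral => p _; ring.
      exact: measurable_rect.
    exact: (pair_int i1 ax xb (cBF 1%N 0%N) (cG 0%N)).
  by rewrite !exprS expr0; ring.
Qed.

End WeakLeibniz.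

(** * Extension to closed intervals and uniqueness of derivatives on a line *)

Section OneDimensional.
Variable R : realType.
Local Notation RR := (measurableTypeR R).
Local Notation mu := (@lebesgue_measure R).

Lemma ae_neq (c : R) : {ae mu, forall y, y <> c}.
Proof.
exists [set c]; split; [exact: measurable_set1|exact: lebesgue_measure_set1|].
by move=> x /= /contrapT ->.
Qed.

Lemma itv_const_closed (a b c : R) (F : R -> R) : a < b -> {within `[a, b], continuous F} ->
  (forall x, a < x < b -> F x = c) -> F a = c /\ F b = c.
Proof.
move=> ab /(continuous_within_itvP _ ab)[_ ca cb] Fc; split.
- apply: (@cvg_unique _ (@Rhausdorff R) (F @ a^'+)) => //; apply: cvg_near_cst.
  by apply: filterS2 (nbhs_right_gt a) (nbhs_right_lt ab) => x h1 h2; apply: Fc; rewrite h1.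
- apply: (@cvg_unique _ (@Rhausdorff R) (F @ b^'-)) => //; apply: cvg_near_cst.
  by apply: filterS2 (nbhs_left_lt b) (nbhs_left_gt ab) => x h1 h2; apply: Fc; rewrite h1 h2.
Qed.

(** The difference of g and the primitive of h is constant in the interior and continuous up to the
    endpoints. *)
Lemma ac1_closed (g h : R -> R) : {within `[0, 1], continuous g} ->
  mu.-integrable `[0, 1] (EFin \o h) ->
  (forall y1 y2, 0 < y1 -> y1 <= y2 -> y2 < 1 -> ac1 y1 y2 g h) -> ac1 0 1 g h.
Proof.
move=> cg hi H; split => // x /andP[x0 x1].
pose F y := g y - \int[mu]_(z in `[0, y]) h z.
have cF : {within `[0, 1], continuous F}.
  move=> y; apply: cvgB; first exact: cg.
  exact: (int_continuous ler01 hi).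
have Fle y1 y2 : 0 < y1 -> y1 <= y2 -> y2 < 1 -> F y2 = F y1.
  move=> y10 y12 y21; apply/eqP; rewrite -subr_eq0 /F.
  have := ac1_int (H _ _ y10 y12 y21) (lexx _) y12 (lexx _).
  have hi' : mu.-integrable `[0, y2] (EFin \o h) by apply: integrable_itvS hi => //; exact: ltW.
  rewrite (Rintegral_itv_cat (ltW y10) y12 hi') => e.
  by apply/eqP; rewrite -e; ring.
have Fc y : 0 < y < 1 -> F y = F 2^-1.
  move=> /andP[y0 y1]; have [h1|h1] := leP y 2^-1.
    by apply/esym/Fle => //; rewrite invf_lt1// ltr1n.
  by apply: Fle => //; exact: ltW.
have [F0 F1] := itv_const_closed ltr01 cF Fc.
have Fx : F x = F 0.
  move: x0; rewrite le_eqVlt => /predU1P[<- //|x0].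
  move: x1; rewrite le_eqVlt => /predU1P[->|x1]; first by rewrite F1 F0.
  by rewrite Fc ?x0// F0.
have := Fx; rewrite /F set_itv1 Rintegral_set1 subr0 => <-.
by rewrite subrK.
Qed.

Lemma ae_itv_count (a b : R) (P : R -> Prop) :
  (forall q1 q2 : rat, a < ratr q1 -> ratr q2 < b ->
    {ae mu, forall x, ratr q1 < x < ratr q2 -> P x}) ->
  {ae mu, forall x, a < x < b -> P x}.
Proof.
move=> H; have A : {ae mu, forall x, forall i : rat * rat, a < ratr i.1 -> ratr i.2 < b ->
    ratr i.1 < x < ratr i.2 -> P x}.
  apply: ae_forall_count => -[q1 q2] /=.
  have [h1|h1] := pselect (a < ratr q1 /\ ratr q2 < b); last first.
    by apply: aeW => x h2 h3; case: h1.
  case: h1 => h1 h2; apply: (@filterS _ _ (ae_filter_ringOfSetsType mu) _ _ _ (H q1 q2 h1 h2)).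
  by move=> x hx _ _; exact: hx.
apply: (@filterS _ _ (ae_filter_ringOfSetsType mu) _ _ _ A) => x hx /andP[ax xb].
have /rat_in_itvoo[q1] := ax; rewrite in_itv/= => /andP[aq1 q1x].
have /rat_in_itvoo[q2] := xb; rewrite in_itv/= => /andP[xq2 q2b].
by apply: (hx (q1, q2)) => //=; rewrite q1x.
Qed.

(** Both Wd and D integrate to the increments of W, so the primitive of their difference
    vanishes. *)
Lemma ac1_derive_ae (a b : R) (W Wd D : R -> R) :
  (forall x, a < x < b -> is_derive x 1 W (Wd x)) ->
  (forall x, a < x < b -> {for x, continuous Wd}) ->
  (forall x1 x2, a < x1 -> x1 <= x2 -> x2 < b -> ac1 x1 x2 W D) ->
  {ae mu, forall x, a < x < b -> Wd x = D x}.
Proof.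
move=> dW cW H; apply: ae_itv_count => q1 q2 aq qb.
have [q21|q12] := leP (ratr q2 : R) (ratr q1).
  by apply: aeW => x /andP[h1 h2]; lra.
have Hd : ac1 (ratr q1) (ratr q2) W Wd.
  apply: ac1_derive => [x /andP[h1 h2]|].
    by apply: dW; rewrite (lt_le_trans aq)// (le_lt_trans h2).
  apply: continuous_in_subspaceT => x; rewrite inE/= in_itv/= => /andP[h1 h2].
  by apply: cW; rewrite (lt_le_trans aq)// (le_lt_trans h2).
have [di _] := Hd; have Hq := H _ _ aq (ltW q12) qb; have [Di _] := Hq.
have ik := integrable_funB (measurable_itv _ : measurable (`[ratr q1, ratr q2]%classic : set RR)) di Di.
have k0 x : ratr q1 <= x <= ratr q2 -> \int[mu]_(y in `[ratr q1, x]) (Wd y - D y) = 0.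
  move=> /andP[h1 h2]; rewrite RintegralB//; [|exact: integrable_itvS di|exact: integrable_itvS Di].
  rewrite -(ac1_int Hd (lexx _) h1 h2) -(ac1_int Hq (lexx _) h1 h2).
  by rewrite subrr.
have := ae_eq0_itv ik k0; apply: (@filterS _ _ (ae_filter_ringOfSetsType mu)) => x hx xx.
by apply/eqP; rewrite -subr_eq0; apply/eqP; exact: hx.
Qed.

End OneDimensional.

(** * Absolute continuity on the lines and circles of the cylinder *)

Section WeakToClassical.
Variable R : realType.
Local Notation RR := (measurableTypeR R).
Local Notation mu := (@lebesgue_measure R).
Local Notation leb2 := (@leb2 R).
Variable B : nat -> R -> R.
Hypothesis dB : dfamily B.
Hypothesis B1 : forall y, 1 <= y -> B 0%N y = 1.
Hypothesis B0 : forall y, y <= -1 -> B 0%N y = 0.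
Implicit Types f g h : R * R -> R.

Definition strip_cont (a b : R) f : Prop :=
  forall s t, a < s < b -> {for (s, t), continuous f}.

Lemma strip_cont_rect a b f x1 x2 c d : strip_cont a b f -> a < x1 -> x2 < b ->
  cont_rect x1 x2 c d f.
Proof.
by move=> cf ax xb x y /andP[h1 h2] _; apply: cf; rewrite (lt_le_trans ax)// (le_lt_trans h2).
Qed.

Lemma strip_cont_int a b f : strip_cont a b f -> strip_int a b f.
Proof. by move=> cf x1 x2 ax xb; apply: cont_rect_integrable; exact: strip_cont_rect cf ax xb. Qed.

Let bump_perf y1 y2 Y e : 0 < y1 -> y1 <= y2 -> y2 + 2 * e <= Y -> Y < 1 -> 0 < e ->
  [/\ dfamily (fun k => perf (bumpf B y1 y2 e k)),
      forall k t, perf (bumpf B y1 y2 e k) (t + 1) = perf (bumpf B y1 y2 e k) t &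
      forall k t, 0 <= t <= 1 -> perf (bumpf B y1 y2 e k) t = bumpf B y1 y2 e k t].
Proof.
move=> y10 y12 yY Y1 e0.
have out k x : x < y1 \/ y2 + 2 * e < x -> bumpf B y1 y2 e k x = 0.
  by move=> hx; exact: bumpf_out.
split.
- apply: (@perf_dfamily _ (bumpf B y1 y2 e) y1 (y2 + 2 * e)) => //; last exact: le_lt_trans Y1.
  exact: bumpf_dfamily.
- by move=> k t; exact: perf_periodic.
- move=> k t; apply: perf01; rewrite !out//; [right|left] => //.
  exact: le_lt_trans Y1.
Qed.

Let tens_bump a b i j g h x1 x2 X y1 y2 Y e : tens_weak a b i j g h ->
  a < x1 -> x1 <= x2 -> x2 + 2 * e <= X -> X < b ->
  0 < y1 -> y1 <= y2 -> y2 + 2 * e <= Y -> Y < 1 -> 0 < e ->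
  \int[leb2]_(p in rect x1 X y1 Y) (g p * (bumpf B x1 x2 e i p.1 * bumpf B y1 y2 e j p.2)) =
  (-1) ^+ (i + j) *
  \int[leb2]_(p in rect x1 X y1 Y) (h p * (bumpf B x1 x2 e 0 p.1 * bumpf B y1 y2 e 0 p.2)).
Proof.
move=> [_ _ H] ax x12 xX Xb y10 y12 yY Y1 e0.
have [dG pG GE] := bump_perf y10 y12 yY Y1 e0.
have dF := bumpf_dfamily x1 x2 e dB.
have F0 k s : s < x1 \/ X < s -> bumpf B x1 x2 e k s = 0.
  move=> hs; apply: bumpf_out => //; case: hs => hs; [by left|right].
  exact: le_lt_trans hs.
have G0 k s : s < y1 \/ Y < s -> bumpf B y1 y2 e k s = 0.
  move=> hs; apply: bumpf_out => //; case: hs => hs; [by left|right].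
  exact: le_lt_trans hs.
have E (u : R * R -> R) k l :
    \int[leb2]_(p in rect x1 X 0 1) (u p * (bumpf B x1 x2 e k p.1 * perf (bumpf B y1 y2 e l) p.2)) =
    \int[leb2]_(p in rect x1 X y1 Y) (u p * (bumpf B x1 x2 e k p.1 * bumpf B y1 y2 e l p.2)).
  transitivity (\int[leb2]_(p in rect x1 X 0 1)
      (u p * (bumpf B x1 x2 e k p.1 * bumpf B y1 y2 e l p.2))).
    apply: eq_Rintegral => -[x y]; rewrite inE => -[_ /=]; rewrite in_itv/= => yy.
    by rewrite GE.
  apply: rect_suppE => //; try exact: ltW.
    by move=> x y hx; rewrite F0// mul0r mulr0.
  by move=> x y _ hy; rewrite G0// !mulr0.
by have := H _ _ _ _ dF dG ax Xb F0 pG; rewrite !E.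
Qed.

Let strip_int_sub a b f x1 x2 y1 y2 : strip_int a b f -> a < x1 -> x2 < b ->
  0 < y1 -> y2 < 1 -> leb2.-integrable (rect x1 x2 y1 y2) (EFin \o f).
Proof.
move=> fi ax xb y0 y1'; apply: integrableS (fi _ _ ax xb); try exact: measurable_rect.
move=> [x y] [h1 /=]; rewrite !in_itv/= => /andP[h2 h3]; split => //=.
by rewrite in_itv/= (le_trans (ltW y0) h2) (le_trans h3 (ltW y1')).
Qed.

Lemma tens_ac_s a b g h : tens_weak a b 1 0 g h -> strip_cont a b g ->
  {ae mu, forall y, 0 < y < 1 -> forall x1 x2, a < x1 -> x1 <= x2 -> x2 < b ->
    ac1 x1 x2 (fun x => g (x, y)) (fun x => h (x, y))}.
Proof.
move=> H cg; have [_ hi _] := H; apply: (weak_ac dB B1 B0).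
  move=> x1 x2 y1 y2 ax xb y10 y21; split; first exact: strip_cont_rect cg ax xb.
  exact: (strip_int_sub hi ax xb y10 y21).
move=> x1 x2 X y1 y2 Y e ax x12 xX Xb y10 y12 yY Y1 e0.
by rewrite (tens_bump H)// addn0 expr1 mulN1r.
Qed.

(** The statement for horizontal lines with the coordinates exchanged gives open subintervals of ]0,
    1[. The whole of [0, 1] is reached by continuity and is what integration by parts around the
    circle requires. *)
Lemma tens_ac_t a b g h : tens_weak a b 0 1 g h -> strip_cont a b g ->
  {ae mu, forall x, a < x < b -> ac1 0 1 (fun y => g (x, y)) (fun y => h (x, y))}.
Proof.
move=> H cg; have [gi hi _] := H.
have A : {ae mu, forall x, a < x < b -> forall y1 y2, 0 < y1 -> y1 <= y2 -> y2 < 1 ->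
    ac1 y1 y2 (fun y => g (x, y)) (fun y => h (x, y))}.
  apply: (@weak_ac _ _ dB B1 B0 (fun p => g (p.2, p.1)) (fun p => h (p.2, p.1))).
    move=> y1 y2 x1 x2 y10 y21 ax xb; split.
      move=> y x yy xx; have := strip_cont_rect (c := y1) (d := y2) cg ax xb xx yy.
      apply: (@cvg_comp _ _ _ (fun p : R * R => (p.2, p.1)) g).
      by apply: cvg_pair2; [exact: cvg_snd|exact: cvg_fst].
    exact: (integrable_swap2 (measurable_itv _) (measurable_itv _) (strip_int_sub hi ax xb y10 y21)).
  move=> y1 y2 Y x1 x2 X e y10 y12 yY Y1 ax x12 xX Xb e0.
  have mX : measurable (`[x1, X]%classic : set RR) by exact: measurable_itv.
  have mY : measurable (`[y1, Y]%classic : set RR) by exact: measurable_itv.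
  have S u i j : strip_int a b u ->
      \int[leb2]_(p in rect y1 Y x1 X) (u (p.2, p.1) * (bumpf B y1 y2 e j p.1 * bumpf B x1 x2 e i p.2)) =
      \int[leb2]_(p in rect x1 X y1 Y) (u p * (bumpf B x1 x2 e i p.1 * bumpf B y1 y2 e j p.2)).
    move=> ui; rewrite -[RHS](Rintegral_swap2 mX mY).
      by apply: eq_Rintegral => -[y x] _; rewrite /swap2/=; ring.
    have c := @tens_cont_rect _ _ _ i j x1 X y1 Y (bumpf_dfamily x1 x2 e dB) (bumpf_dfamily y1 y2 e dB).
    have := integrable_cMrect c (strip_int_sub ui ax Xb y10 Y1).
    by apply: eq_integrable => [|p _]; [exact: measurable_rect|rewrite /= mulrC].
  by rewrite !S// (tens_bump H)// expr1 mulN1r.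
have I : {ae mu, forall x, a < x < b -> mu.-integrable `[0, 1] (fun y => (h (x, y))%:E)}.
  apply: ae_itv_count => q1 q2 aq qb.
  have := leb2_ae_slice1 (measurable_itv _) (measurable_itv _) (hi _ _ aq qb).
  apply: (@filterS _ _ (ae_filter_ringOfSetsType mu)) => x hx /andP[h1 h2].
  by apply: hx; rewrite /= in_itv/= !ltW.
apply: (@filterS2 _ _ (ae_filter_ringOfSetsType mu) _ _ _ _ A I) => x h1 h2 xx.
apply: ac1_closed; [|exact: h2|exact: h1].
apply: continuous_in_subspaceT => y _; apply: slice2_continuous; exact: cg.
Qed.

End WeakToClassical.

(** * Jets of order two: closure properties and integration by parts *)

Section AC2.
Variable R : realType.
Local Notation RR := (measurableTypeR R).
Local Notation mu := (@lebesgue_measure R).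
Local Notation leb2 := (@leb2 R).
Implicit Types (f g h : R * R -> R) (D E : nat -> nat -> R * R -> R).

(* D i j is d^(i+j) D 0 0 / ds^i dt^j for i + j <= 2 on ]a, b[ x (R/Z); first
   derivatives are classical, second derivatives exist in the sense of absolute
   continuity on almost every line. *)
Record ac2 (a b : R) D : Prop := AC2 {
  ac2_per : forall i j, (i + j <= 1)%N -> forall s t, a < s < b -> D i j (s, t + 1) = D i j (s, t);
  ac2_cont : forall i j, (i + j <= 1)%N -> strip_cont a b (D i j);
  ac2_ds : forall s t : R, a < s < b -> is_derive s 1 (fun x => D 0%N 0%N (x, t)) (D 1%N 0%N (s, t));
  ac2_dt : forall s t : R, a < s < b -> is_derive t 1 (fun y => D 0%N 0%N (s, y)) (D 0%N 1%N (s, t));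
  ac2_int : forall i j, (i + j <= 2)%N -> strip_int a b (D i j);
  ac2_ss : {ae mu, forall t, 0 < t < 1 -> forall x1 x2, a < x1 -> x1 <= x2 -> x2 < b ->
    ac1 x1 x2 (fun x => D 1%N 0%N (x, t)) (fun x => D 2%N 0%N (x, t))};
  ac2_st : {ae mu, forall s, a < s < b ->
    ac1 0 1 (fun y => D 1%N 0%N (s, y)) (fun y => D 1%N 1%N (s, y))};
  ac2_tt : {ae mu, forall s, a < s < b ->
    ac1 0 1 (fun y => D 0%N 1%N (s, y)) (fun y => D 0%N 2%N (s, y))} }.

Lemma ac2_s a b D t x1 x2 : ac2 a b D -> a < x1 -> x2 < b ->
  ac1 x1 x2 (fun x => D 0%N 0%N (x, t)) (fun x => D 1%N 0%N (x, t)).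
Proof.
move=> H ax xb.
have I x : x1 <= x <= x2 -> a < x < b.
  by move=> /andP[h1 h2]; rewrite (lt_le_trans ax)// (le_lt_trans h2).
apply: ac1_derive => [x /I xx|]; first exact: ac2_ds H _ _ xx.
apply: continuous_in_subspaceT => x; rewrite inE/= in_itv/= => /I xx.
have c : {for (x, t), continuous (D 1%N 0%N)} by apply: (ac2_cont H).
exact: (slice1_continuous c).
Qed.

Lemma ac2_t a b D s : ac2 a b D -> a < s < b ->
  ac1 0 1 (fun y => D 0%N 0%N (s, y)) (fun y => D 0%N 1%N (s, y)).
Proof.
move=> H ss; apply: ac1_derive => [y _|]; first exact: ac2_dt H _ _ ss.
apply: continuous_in_subspaceT => y _.
have c : {for (s, y), continuous (D 0%N 1%N)} by apply: (ac2_cont H).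
exact: (slice2_continuous c).
Qed.

Lemma strip_intMc a b f g : strip_cont a b f -> strip_int a b g ->
  strip_int a b (fun p => f p * g p).
Proof.
move=> cf gi x1 x2 ax xb; apply: (@integrable_cMrect R x1 x2 0 1 f g).
  exact: strip_cont_rect cf ax xb.
exact: gi.
Qed.

Lemma strip_contD a b f g : strip_cont a b f -> strip_cont a b g ->
  strip_cont a b (fun p => f p + g p).
Proof. by move=> cf cg s t ss; apply: cvgD; [exact: cf|exact: cg]. Qed.

Lemma strip_contM a b f g : strip_cont a b f -> strip_cont a b g ->
  strip_cont a b (fun p => f p * g p).
Proof. by move=> cf cg s t ss; apply: cvgM; [exact: cf|exact: cg]. Qed.

Lemma strip_int_ext a b f g : f =1 g -> strip_int a b f -> strip_int a b g.
Proof. by move=> /funext ->. Qed.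

Lemma ac1_ext (a b : R) (g h g' h' : R -> R) : g =1 g' -> h =1 h' -> ac1 a b g h -> ac1 a b g' h'.
Proof. by move=> /funext -> /funext ->. Qed.

Definition sumD D E i j p : R := D i j p + E i j p.

Lemma ac2D a b D E : ac2 a b D -> ac2 a b E -> ac2 a b (sumD D E).
Proof.
move=> HD HE; split.
- by move=> i j ij s t ss; rewrite /sumD (ac2_per HD)// (ac2_per HE).
- by move=> i j ij; apply: strip_contD; [exact: (ac2_cont HD)|exact: (ac2_cont HE)].
- move=> s t ss; have h1 := ac2_ds HD t ss; have h2 := ac2_ds HE t ss.
  exact: is_deriveD.
- move=> s t ss; have h1 := ac2_dt HD t ss; have h2 := ac2_dt HE t ss.
  exact: is_deriveD.
- by move=> i j ij; apply: strip_intD; [exact: (ac2_int HD)|exact: (ac2_int HE)].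
- apply: (@filterS2 _ _ (ae_filter_ringOfSetsType mu) _ _ _ _ (ac2_ss HD) (ac2_ss HE)).
  move=> t h1 h2 tt x1 x2 ax x12 xb; exact: ac1D (h1 tt _ _ ax x12 xb) (h2 tt _ _ ax x12 xb).
- apply: (@filterS2 _ _ (ae_filter_ringOfSetsType mu) _ _ _ _ (ac2_st HD) (ac2_st HE)).
  by move=> s h1 h2 ss; exact: ac1D (h1 ss) (h2 ss).
- apply: (@filterS2 _ _ (ae_filter_ringOfSetsType mu) _ _ _ _ (ac2_tt HD) (ac2_tt HE)).
  by move=> s h1 h2 ss; exact: ac1D (h1 ss) (h2 ss).
Qed.

Definition cstD (c : R) (i j : nat) (p : R * R) : R := c *+ (i + j == 0)%N.

Lemma ac2_cst a b c : ac2 a b (cstD c).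
Proof.
have cont i j : strip_cont a b (cstD c i j) by move=> s t _; exact: cvg_cst.
split => //.
- by move=> s t _; exact: is_derive_cst.
- by move=> s t _; exact: is_derive_cst.
- by move=> i j _; exact: strip_cont_int.
- by apply: aeW => t _ x1 x2 _ _ _; exact: ac1_cst.
- by apply: aeW => t _; exact: ac1_cst.
- by apply: aeW => t _; exact: ac1_cst.
Qed.

Lemma ac2_ext a b D E : (forall i j, (i + j <= 2)%N -> D i j =1 E i j) -> ac2 a b D -> ac2 a b E.
Proof.
move=> DE H.
have e i j : (i + j <= 2)%N -> D i j = E i j by move=> /DE/funext.
have [h1 h2 h3 h4 h5 h6 h7 h8] := H.
rewrite !e// in h3 h4 h6 h7 h8.
split => //.
- move=> i j ij; have ij2 : (i + j <= 2)%N by exact: leq_trans ij _.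
  by rewrite -e//; exact: h1.
- move=> i j ij; have ij2 : (i + j <= 2)%N by exact: leq_trans ij _.
  by rewrite -e//; exact: h2.
- by move=> i j ij; rewrite -e//; exact: h5.
Qed.

Lemma ac2_sum a b (I : Type) (r : seq I) (D : I -> nat -> nat -> R * R -> R) :
  (forall x, ac2 a b (D x)) -> ac2 a b (fun i j p => \sum_(x <- r) D x i j p).
Proof.
move=> H; elim: r => [|x r ih].
  apply: (ac2_ext _ (ac2_cst a b 0)) => i j _ p.
  by rewrite big_nil /cstD mul0rn.
by apply: (ac2_ext _ (ac2D (H x) ih)) => i j _ p; rewrite big_cons.
Qed.

(** The second-order terms are grouped as the product rule yields them when applied to each
    first-order term, so that sums of [ac1M] match them without rearrangement. *)
Definition prodD D E i j p : R :=
  match i, j with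
  | 0, 0 => D 0%N 0%N p * E 0%N 0%N p
  | 1, 0 => D 1%N 0%N p * E 0%N 0%N p + D 0%N 0%N p * E 1%N 0%N p
  | 0, 1 => D 0%N 1%N p * E 0%N 0%N p + D 0%N 0%N p * E 0%N 1%N p
  | 2, _ => (D 2%N 0%N p * E 0%N 0%N p + D 1%N 0%N p * E 1%N 0%N p) +
            (D 1%N 0%N p * E 1%N 0%N p + D 0%N 0%N p * E 2%N 0%N p)
  | 1, _ => (D 1%N 1%N p * E 0%N 0%N p + D 1%N 0%N p * E 0%N 1%N p) +
            (D 0%N 1%N p * E 1%N 0%N p + D 0%N 0%N p * E 1%N 1%N p)
  | _, _ => (D 0%N 2%N p * E 0%N 0%N p + D 0%N 1%N p * E 0%N 1%N p) +
            (D 0%N 1%N p * E 0%N 1%N p + D 0%N 0%N p * E 0%N 2%N p)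
  end.

Lemma ac2M a b D E : ac2 a b D -> ac2 a b E -> ac2 a b (prodD D E).
Proof.
move=> HD HE.
have cD := ac2_cont HD; have cE := ac2_cont HE.
have [D00 D10 D01] : [/\ strip_cont a b (D 0%N 0%N), strip_cont a b (D 1%N 0%N) &
  strip_cont a b (D 0%N 1%N)] by split; exact: cD.
have [E00 E10 E01] : [/\ strip_cont a b (E 0%N 0%N), strip_cont a b (E 1%N 0%N) &
  strip_cont a b (E 0%N 1%N)] by split; exact: cE.
have cP i j : (i + j <= 1)%N -> strip_cont a b (prodD D E i j).
  by case: i => [|[|i]]; case: j => [|[|j]] //= _;
    do ?apply: strip_contD; (apply: strip_contM; assumption).
have intDE i j : (i + j <= 2)%N -> strip_int a b (fun p => D i j p * E 0%N 0%N p).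
  move=> ij; apply: (@strip_int_ext _ _ (fun p => E 0%N 0%N p * D i j p)).
    by move=> p; rewrite mulrC.
  by apply: strip_intMc => //; exact: (ac2_int HD).
have intED i j : (i + j <= 2)%N -> strip_int a b (fun p => D 0%N 0%N p * E i j p).
  by move=> ij; apply: strip_intMc => //; exact: (ac2_int HE).
have mc f g : strip_cont a b f -> strip_cont a b g -> strip_int a b (fun p => f p * g p).
  by move=> cf cg; apply: strip_cont_int; exact: strip_contM.
split => //.
- move=> i j ij s t ss; case: i ij => [|[|i]]; case: j => [|[|j]] //= _;
  by rewrite ?(ac2_per HD (i := 0) (j := 0))// ?(ac2_per HD (i := 1) (j := 0))//
    ?(ac2_per HD (i := 0) (j := 1))// ?(ac2_per HE (i := 0) (j := 0))//
    ?(ac2_per HE (i := 1) (j := 0))// ?(ac2_per HE (i := 0) (j := 1)).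
- move=> s t ss /=; have h1 := ac2_ds HD t ss; have h2 := ac2_ds HE t ss.
  by apply: is_derive_eq; rewrite /GRing.scale/=; ring.
- move=> s t ss /=; have h1 := ac2_dt HD t ss; have h2 := ac2_dt HE t ss.
  by apply: is_derive_eq; rewrite /GRing.scale/=; ring.
- move=> i j ij; have [ij1|ij1] := leqP (i + j)%N 1; first exact/strip_cont_int/cP.
  case: i ij ij1 => [|[|[|i]]]; case: j => [|[|[|j]]] //= _ _;
  by apply: strip_intD; apply: strip_intD; (exact: intDE || exact: intED || exact: mc).
- apply: (@filterS2 _ _ (ae_filter_ringOfSetsType mu) _ _ _ _ (ac2_ss HD) (ac2_ss HE)).
  move=> t h1 h2 tt x1 x2 ax x12 xb.
  have k1 := ac1M (h1 tt _ _ ax x12 xb) (ac2_s t HE ax xb).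
  have k2 := ac1M (ac2_s t HD ax xb) (h2 tt _ _ ax x12 xb).
  exact: ac1D k1 k2.
- apply: (@filterS2 _ _ (ae_filter_ringOfSetsType mu) _ _ _ _ (ac2_st HD) (ac2_st HE)).
  move=> s h1 h2 ss.
  have k1 := ac1M (h1 ss) (ac2_t HE ss); have k2 := ac1M (ac2_t HD ss) (h2 ss).
  exact: ac1D k1 k2.
- apply: (@filterS2 _ _ (ae_filter_ringOfSetsType mu) _ _ _ _ (ac2_tt HD) (ac2_tt HE)).
  move=> s h1 h2 ss.
  have k1 := ac1M (h1 ss) (ac2_t HE ss); have k2 := ac1M (ac2_t HD ss) (h2 ss).
  exact: ac1D k1 k2.
Qed.

Lemma Rintegral_ae_eq0 (S : set RR) (f : R -> R) : measurable S ->
  mu.-integrable S (EFin \o f) -> {ae mu, forall x, S x -> f x = 0} ->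
  \int[mu]_(x in S) f x = 0.
Proof.
move=> mS fi f0; rewrite /Rintegral (ae_eq_integral (fun=> 0%E))//.
- by rewrite integral0.
- exact: measurable_int fi.
- by apply: (@filterS _ _ (ae_filter_ringOfSetsType mu) _ _ _ f0) => x hx /hx /= ->.
Qed.

(** By Fubini the two sides differ by an integral, over almost every horizontal line, of the
    derivative of g phi, which is zero at both ends. *)
Lemma ibp_s a b g h (phi phi' : R * R -> R) x1 x2 : strip_int a b g -> strip_int a b h ->
  a < x1 -> x1 <= x2 -> x2 < b ->
  {ae mu, forall t, 0 < t < 1 -> ac1 x1 x2 (fun x => g (x, t)) (fun x => h (x, t))} ->
  continuous phi -> continuous phi' ->
  (forall s t : R, is_derive s 1 (fun x => phi (x, t)) (phi' (s, t))) ->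
  (forall t, phi (x1, t) = 0 /\ phi (x2, t) = 0) ->
  \int[leb2]_(p in rect x1 x2 0 1) (g p * phi' p) =
  - \int[leb2]_(p in rect x1 x2 0 1) (h p * phi p).
Proof.
move=> gi hi ax x12 xb H cphi cphi' dphi phi0.
have mr := measurable_rect x1 x2 0 1.
have I u v : strip_int a b u -> continuous v ->
    leb2.-integrable (rect x1 x2 0 1) (EFin \o (fun p => u p * v p)).
  move=> ui cv.
  have c : cont_rect x1 x2 0 1 v by move=> x y _ _; exact: cv.
  have := integrable_cMrect c (ui _ _ ax xb).
  by apply: eq_integrable => // p _; rewrite /= mulrC.
have I1 := I _ _ gi cphi'; have I2 := I _ _ hi cphi.
apply/eqP; rewrite -addr_eq0 -RintegralD//; apply/eqP.
have I12 := integrable_funD mr I1 I2.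
have mX : measurable (`[x1, x2]%classic : set RR) by exact: measurable_itv.
have mY : measurable (`[0, 1]%classic : set RR) by exact: measurable_itv.
rewrite (Rintegral_fubini2 mX mY I12).
apply: Rintegral_ae_eq0 => //; first exact: (integrable_inner2 mX mY I12).
apply: (@filterS3 _ _ (ae_filter_ringOfSetsType mu) _ _ _ _ _ (ae_neq (0 : R)) (ae_neq (1 : R)) H) => t t0 t1 ht.
rewrite /= in_itv/= => /andP[tt0 tt1].
have tt : 0 < t < 1 by rewrite !lt_neqAle tt0 tt1 eq_sym !andbT; apply/andP; split; apply/eqP.
have ap : ac1 x1 x2 (fun x => phi (x, t)) (fun x => phi' (x, t)).
  apply: (@ac1_derive _ x1 x2 (fun x => phi (x, t)) (fun x => phi' (x, t))).
  by apply: continuous_subspaceT => x; exact: (slice1_continuous (cphi' (x, t))).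
have := ac1_int (ac1M (ht tt) ap) (lexx _) x12 (lexx _).
have [-> ->] := phi0 t; rewrite !mulr0 subrr => e; rewrite [RHS]e.
by apply: eq_Rintegral => x _; rewrite addrC.
Qed.

Lemma ibp_t a b g h (phi phi' : R * R -> R) x1 x2 : strip_int a b g -> strip_int a b h ->
  a < x1 -> x1 <= x2 -> x2 < b ->
  {ae mu, forall s, a < s < b -> ac1 0 1 (fun y => g (s, y)) (fun y => h (s, y))} ->
  continuous phi -> continuous phi' ->
  (forall s t : R, is_derive t 1 (fun y => phi (s, y)) (phi' (s, t))) ->
  (forall s, a < s < b -> g (s, 1) * phi (s, 1) = g (s, 0) * phi (s, 0)) ->
  \int[leb2]_(p in rect x1 x2 0 1) (g p * phi' p) =
  - \int[leb2]_(p in rect x1 x2 0 1) (h p * phi p).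
Proof.
move=> gi hi ax x12 xb H cphi cphi' dphi phi0.
have mr := measurable_rect x1 x2 0 1.
have I u v : strip_int a b u -> continuous v ->
    leb2.-integrable (rect x1 x2 0 1) (EFin \o (fun p => u p * v p)).
  move=> ui cv.
  have c : cont_rect x1 x2 0 1 v by move=> x y _ _; exact: cv.
  have := integrable_cMrect c (ui _ _ ax xb).
  by apply: eq_integrable => // p _; rewrite /= mulrC.
have I1 := I _ _ gi cphi'; have I2 := I _ _ hi cphi.
apply/eqP; rewrite -addr_eq0 -RintegralD//; apply/eqP.
have I12 := integrable_funD mr I1 I2.
have mX : measurable (`[x1, x2]%classic : set RR) by exact: measurable_itv.
have mY : measurable (`[0, 1]%classic : set RR) by exact: measurable_itv.
rewrite (Rintegral_fubini1 mX mY I12).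
apply: Rintegral_ae_eq0 => //; first exact: (integrable_inner1 mX mY I12).
apply: (@filterS _ _ (ae_filter_ringOfSetsType mu) _ _ _ H) => s hs.
rewrite /= in_itv/= => /andP[s0 s1].
have ss : a < s < b by rewrite (lt_le_trans ax)// (le_lt_trans s1).
have ap : ac1 0 1 (fun x => phi (s, x)) (fun x => phi' (s, x)).
  apply: (@ac1_derive _ 0 1 (fun y => phi (s, y)) (fun y => phi' (s, y))).
  by apply: continuous_subspaceT => x; exact: (slice2_continuous (cphi' (s, x))).
have := ac1_int (ac1M (hs ss) ap) (lexx _) ler01 (lexx _).
rewrite phi0// subrr => e; rewrite [RHS]e.
by apply: eq_Rintegral => x _; rewrite addrC.
Qed.

End AC2.

(** * Test functions and mixed partial derivatives *)

Section TestFunctions.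
Variable R : realType.

Lemma smooth_is_derive_s (W : normedModType R) (phi : R * R -> W) (s t : R) : smooth phi ->
  is_derive s 1 (fun x => phi (x, t)) ('D_((1, 0) : R * R) phi (s, t)).
Proof.
move=> /(smooth_is_derive (s, t) ((1, 0) : R * R))[d _].
by rewrite slice1E; split; rewrite -?slice1E.
Qed.

Lemma smooth_is_derive_t (W : normedModType R) (phi : R * R -> W) (s t : R) : smooth phi ->
  is_derive t 1 (fun y => phi (s, y)) ('D_((0, 1) : R * R) phi (s, t)).
Proof.
move=> /(smooth_is_derive (s, t) ((0, 1) : R * R))[d _].
by rewrite slice2E; split; rewrite -?slice2E.
Qed.

Definition vanish (y1 y2 : R) (phi : R * R -> R) : Prop :=
  forall s t, s < y1 \/ y2 < s -> phi (s, t) = 0.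

Lemma vanish_derive y1 y2 phi v : vanish y1 y2 phi -> vanish y1 y2 (fun p => 'D_v phi p).
Proof.
move=> H s t st; rewrite -(derive_cst (0 : R) ((s, t) : R * R) v).
apply: near_eq_derive.
have U : \forall x \near s, x < y1 \/ y2 < x.
  case: st => st; [apply: filterS (lt_nbhsl st)|apply: filterS (lt_nbhsr st)].
    by move=> x; left.
  by move=> x; right.
have : \forall p \near (s, t), p.1 < y1 \/ y2 < p.1 by exact: (cvg_fst (G := nbhs t) U).
by apply: filterS => -[x y] /= hx; rewrite H.
Qed.

Lemma periodic_derive (W : normedModType R) (phi : R * R -> W) v :
  (forall s t, phi (s, t + 1) = phi (s, t)) ->
  forall s t, 'D_v phi (s, t + 1) = 'D_v phi (s, t).
Proof.
move=> H s t; rewrite /derive.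
have -> : (fun h : R => h^-1 *: ((phi \o shift (s, t + 1)) (h *: v) - phi (s, t + 1))) =
          (fun h : R => h^-1 *: ((phi \o shift (s, t)) (h *: v) - phi (s, t))).
  apply/funext => h /=; rewrite H; congr (_ *: (_ - _)).
  by rewrite -[RHS]H; congr phi; congr pair; rewrite /= addrA.
by [].
Qed.

Lemma compact_subset_itv (K : set R) (a b : R) : compact K -> (forall s, K s -> a < s < b) ->
  a < b -> exists x1 x2, [/\ a < x1, x1 <= x2, x2 < b & forall s, K s -> x1 < s < x2].
Proof.
move=> cK Kab ab.
have H (f : R -> R) : (forall x, K x -> 0 < f x) -> continuous f ->
    exists2 e, 0 < e & forall x, K x -> e < f x.
  move=> f0 cf.
  have cw : {within K, continuous (fun x => (f x)^-1)}.
    apply: continuous_in_subspaceT => x; rewrite inE => Kx.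
    by apply: cvgV; [rewrite gt_eqF// f0|exact: cf].
  have [M [_ hM]] := compact_bounded (continuous_compact cw cK).
  exists (`|M| + 1)^-1; first by rewrite invr_gt0 ltr_wpDl.
  move=> x Kx; have fx := f0 x Kx.
  have M0 : 0 < `|M| + 1 by rewrite ltr_wpDl.
  rewrite -[f x]invrK ltf_pV2 ?posrE ?invr_gt0//.
  have h : `|(f x)^-1| <= `|M| + 2^-1.
    apply: hM; last by exists x.
    by have := ler_norm M; have : (0 : R) < 2^-1 by []; lra.
  apply: le_lt_trans (ler_norm _) _; apply: le_lt_trans h _.
  by have : (0 : R) < 2^-1 by []; lra.
have [||e1 e10 h1] := H (fun x => x - a).
- by move=> x /Kab /andP[]; rewrite subr_gt0.
- by move=> x; apply: cvgB; [exact: cvg_id|exact: cvg_cst].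
have [||e2 e20 h2] := H (fun x => b - x).
- by move=> x /Kab /andP[]; rewrite subr_gt0.
- by move=> x; apply: cvgB; [exact: cvg_cst|exact: cvg_id].
pose e := Num.min (Num.min e1 e2) ((b - a) / 2).
have e0 : 0 < e by rewrite !lt_min e10 e20/= divr_gt0// subr_gt0.
have ee1 : e <= e1 by rewrite !ge_min lexx.
have ee2 : e <= e2 by rewrite !ge_min lexx orbT.
have eab : e <= (b - a) / 2 by rewrite ge_min lexx orbT.
exists (a + e), (b - e); split; [lra|lra|lra|] => s Ks.
by have := h1 s Ks; have := h2 s Ks; move=> /= ? ?; apply/andP; split; lra.
Qed.

Let corner (A B C D : R) : A - B - (C - D) = A - C - (B - D).
Proof. by ring. Qed.

(** [partial_st] differentiates in t first, whereas [ac2] asks for the mixed entry as the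
    t-derivative of the s-derivative; the exchange makes smooth functions instances of [ac2]. *)
Lemma clairaut (phi : R * R -> R) p : smooth phi ->
  'D_((0, 1) : R * R) (fun q => 'D_((1, 0) : R * R) phi q) p =
  'D_((1, 0) : R * R) (fun q => 'D_((0, 1) : R * R) phi q) p.
Proof.
case: p => x y sm; have sp v := smooth_derive v sm.
set Dts := fun q => 'D_((0, 1) : R * R) (fun q => 'D_((1, 0) : R * R) phi q) q.
set Dst := fun q => 'D_((1, 0) : R * R) (fun q => 'D_((0, 1) : R * R) phi q) q.
rewrite -/(Dts _) -/(Dst _).
have cts : continuous Dts by exact/smooth_continuous/smooth_derive/sp.
have cst' : continuous Dst by exact/smooth_continuous/smooth_derive/sp.
have cslice (f : R -> R) (f' : R -> R) u v : (forall z : R, is_derive z 1 f (f' z)) ->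
    {within `[u, v], continuous f}.
  move=> df; apply: continuous_subspaceT => z; have [d _] := df z.
  by apply: differentiable_continuous; apply/derivable1_diffP.
(* both mixed derivatives take the value of the corner quotient in the square *)
have key e : 0 < e -> exists q q' : R * R, [/\ x < q.1 < x + e, y < q.2 < y + e,
    x < q'.1 < x + e, y < q'.2 < y + e & Dts q = Dst q'].
  move=> e0; have xe : x < x + e by rewrite ltrDl.
  have ye : y < y + e by rewrite ltrDl.
  have d1 (z : R) : is_derive z 1 (fun z => phi (z, y + e) - phi (z, y))
      ('D_((1, 0) : R * R) phi (z, y + e) - 'D_((1, 0) : R * R) phi (z, y)).
    by apply: is_deriveB; exact: smooth_is_derive_s.
  have d2 (z : R) : is_derive z 1 (fun z => phi (x + e, z) - phi (x, z))
      ('D_((0, 1) : R * R) phi (x + e, z) - 'D_((0, 1) : R * R) phi (x, z)).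
    by apply: is_deriveB; exact: smooth_is_derive_t.
  have [u ux e1] := MVT xe (fun z _ => d1 z) (cslice _ _ _ _ d1).
  have [v vy e2] := MVT ye (fun z _ => d2 z) (cslice _ _ _ _ d2).
  have d3 (z : R) : is_derive z 1 (fun z => 'D_((1, 0) : R * R) phi (u, z)) (Dts (u, z)).
    exact: (smooth_is_derive_t _ _ (sp _)).
  have d4 (z : R) : is_derive z 1 (fun z => 'D_((0, 1) : R * R) phi (z, v)) (Dst (z, v)).
    exact: (smooth_is_derive_s _ _ (sp _)).
  have [u' uy e3] := MVT ye (fun z _ => d3 z) (cslice _ _ _ _ d3).
  have [v' vx e4] := MVT xe (fun z _ => d4 z) (cslice _ _ _ _ d4).
  rewrite !in_itv/= in ux vy uy vx.
  exists (u, u'); exists (v', v); split; [exact: ux|exact: uy|exact: vx|exact: vy|].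
  have ee : e * e != 0 by rewrite mulf_neq0// gt_eqF.
  apply: (mulIf ee).
  have E1 : Dts (u, u') * (e * e) = phi (x + e, y + e) - phi (x + e, y) - (phi (x, y + e) - phi (x, y)).
    by rewrite e1 e3; ring.
  have E2 : Dst (v', v) * (e * e) = phi (x + e, y + e) - phi (x, y + e) - (phi (x + e, y) - phi (x, y)).
    by rewrite e2 e4; ring.
  exact: (etrans E1 (etrans (corner _ _ _ _) (esym E2))).
move: Dts Dst cts cst' key => Dts Dst cts cst' key.
apply/eqP; rewrite -subr_eq0; apply/eqP; apply/normr0_eq0; apply/eqP.
apply: contraT => ne; set d := `|Dts (x, y) - Dst (x, y)| in ne.
have d0 : 0 < d by rewrite lt_neqAle eq_sym ne /d normr_ge0.
have d2 : 0 < d / 2 by rewrite divr_gt0.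
have /cvgrPdist_lt/(_ _ d2)/nbhs_ballP[r1 /= r10 h1] := cts (x, y).
have /cvgrPdist_lt/(_ _ d2)/nbhs_ballP[r2 /= r20 h2] := cst' (x, y).
have e0 : 0 < Num.min r1 r2 by rewrite lt_min r10.
have [[q1 q2] [[p1 p2] [/= a1 a2 b1 b2 qq]]] := key _ e0.
have A1 : `|Dts (x, y) - Dts (q1, q2)| < d / 2.
  apply: h1; move/andP: a1 => [? ?]; move/andP: a2 => [? ?].
  have : Num.min r1 r2 <= r1 by rewrite ge_min lexx.
  by move=> ?; split; rewrite /= /ball/= distrC ger0_norm; lra.
have A2 : `|Dst (x, y) - Dst (p1, p2)| < d / 2.
  apply: h2; move/andP: b1 => [? ?]; move/andP: b2 => [? ?].
  have : Num.min r1 r2 <= r2 by rewrite ge_min lexx orbT.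
  by move=> ?; split; rewrite /= /ball/= distrC ger0_norm; lra.
have : d < d.
  rewrite {1}/d (_ : Dts (x, y) - Dst (x, y) = (Dts (x, y) - Dts (q1, q2)) - (Dst (x, y) - Dst (p1, p2))).
    by apply: le_lt_trans (ler_normB _ _) _; lra.
  by rewrite qq; ring.
by rewrite ltxx.
Qed.

End TestFunctions.

(** * From jets back to weak derivatives *)

Section AC2Weak.
Variable R : realType.
Local Notation RR := (measurableTypeR R).
Local Notation mu := (@lebesgue_measure R).
Local Notation leb2 := (@leb2 R).

Let ds (phi : R * R -> R) : R * R -> R := fun p => 'D_((1, 0) : R * R) phi p.
Let dt (phi : R * R -> R) : R * R -> R := fun p => 'D_((0, 1) : R * R) phi p.

(** Derivatives are taken off phi one at a time, those in s first. The rectangle is strictly wider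
    than the support, so there are no boundary terms in s; those in t cancel by periodicity. *)
Lemma ac2_pairing a b D (phi : R * R -> R) x1 x2 y1 y2 i j :
  ac2 a b D -> smooth phi -> (forall s t, phi (s, t + 1) = phi (s, t)) ->
  vanish y1 y2 phi -> a < x1 -> x1 < y1 -> y1 <= y2 -> y2 < x2 -> x2 < b -> (i + j <= 2)%N ->
  \int[leb2]_(p in rect x1 x2 0 1) (D 0%N 0%N p * partial_st i j phi p) =
  (-1) ^+ (i + j) * \int[leb2]_(p in rect x1 x2 0 1) (D i j p * phi p).
Proof.
move=> H sm per van ax xy1 y12 yx2 xb ij.
have x12 : x1 <= x2 by lra.
have I i' j' : (i' + j' <= 2)%N -> strip_int a b (D i' j') := fun h => ac2_int H h.
have ibps g h (psi : R * R -> R) : strip_int a b g -> strip_int a b h -> smooth psi ->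
    vanish y1 y2 psi ->
    {ae mu, forall t, 0 < t < 1 -> ac1 x1 x2 (fun x => g (x, t)) (fun x => h (x, t))} ->
    \int[leb2]_(p in rect x1 x2 0 1) (g p * ds psi p) =
    - \int[leb2]_(p in rect x1 x2 0 1) (h p * psi p).
  move=> gi hi spsi vpsi A; apply: (ibp_s gi hi ax x12 xb A).
  - exact: smooth_continuous.
  - exact/smooth_continuous/smooth_derive.
  - by move=> s t; exact: smooth_is_derive_s.
  - by move=> t; split; apply: vpsi; [left|right].
have ibpt g h (psi : R * R -> R) : strip_int a b g -> strip_int a b h -> smooth psi ->
    (forall s t, psi (s, t + 1) = psi (s, t)) ->
    (forall s t, a < s < b -> g (s, t + 1) = g (s, t)) ->
    {ae mu, forall s, a < s < b -> ac1 0 1 (fun x => g (s, x)) (fun x => h (s, x))} ->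
    \int[leb2]_(p in rect x1 x2 0 1) (g p * dt psi p) =
    - \int[leb2]_(p in rect x1 x2 0 1) (h p * psi p).
  move=> gi hi spsi ppsi pg A; apply: (ibp_t gi hi ax x12 xb A).
  - exact: smooth_continuous.
  - exact/smooth_continuous/smooth_derive.
  - by move=> s t; exact: smooth_is_derive_t.
  - by move=> s ss; rewrite -{1 2}(add0r (1 : R)) pg// ppsi.
have A10 : {ae mu, forall t, 0 < t < 1 ->
    ac1 x1 x2 (fun x => D 0%N 0%N (x, t)) (fun x => D 1%N 0%N (x, t))}.
  by apply: aeW => t _; exact: ac2_s H ax xb.
have A01 : {ae mu, forall s, a < s < b ->
    ac1 0 1 (fun x => D 0%N 0%N (s, x)) (fun x => D 0%N 1%N (s, x))}.
  by apply: aeW => s; exact: ac2_t H.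
have A20 : {ae mu, forall t, 0 < t < 1 ->
    ac1 x1 x2 (fun x => D 1%N 0%N (x, t)) (fun x => D 2%N 0%N (x, t))}.
  apply: (@filterS _ _ (ae_filter_ringOfSetsType mu) _ _ _ (ac2_ss H)) => t ht tt.
  exact: ht.
have sd v psi : smooth psi -> smooth (fun p => 'D_v psi p : R) by exact: smooth_derive.
case: i ij => [|[|[|i]]]; case: j => [|[|[|j]]] //= _; rewrite /partial_st/=.
- by rewrite expr0 mul1r.
- rewrite addn1 expr1 mulN1r; apply: ibpt => //; [exact: I|exact: I|].
  by move=> s t; exact: (ac2_per H).
- rewrite (ibpt (D 0%N 0%N) (D 0%N 1%N) (dt phi))//; first last.
  + by move=> s t; exact: (ac2_per H).
  + exact: (periodic_derive ((0, 1) : R * R) per).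
  + exact: sd.
  + exact: I.
  + exact: I.
  rewrite (ibpt (D 0%N 1%N) (D 0%N 2%N) phi)//; first by rewrite opprK sqrrN expr1n mul1r.
  + exact: I.
  + exact: I.
  + by move=> s t; exact: (ac2_per H).
  + exact: (ac2_tt H).
- rewrite addn0 expr1 mulN1r; apply: ibps => //; [exact: I|exact: I].
- rewrite (ibps (D 0%N 0%N) (D 1%N 0%N) (dt phi))//; first last.
  + exact: vanish_derive.
  + exact: sd.
  + exact: I.
  + exact: I.
  rewrite (ibpt (D 1%N 0%N) (D 1%N 1%N) phi)//; first by rewrite opprK sqrrN expr1n mul1r.
  + exact: I.
  + exact: I.
  + by move=> s t; exact: (ac2_per H).
  + exact: (ac2_st H).
- rewrite (ibps (D 0%N 0%N) (D 1%N 0%N) (ds phi))//; first last.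
  + exact: vanish_derive.
  + exact: sd.
  + exact: I.
  + exact: I.
  rewrite (ibps (D 1%N 0%N) (D 2%N 0%N) phi)//; first by rewrite opprK sqrrN expr1n mul1r.
  + exact: I.
  + exact: I.
Qed.

(** This makes an explicit jet an admissible competitor in the infimum that defines [sob_norm]. *)
Lemma ac2_weak_partial m n (A : set R) (a b : R) (F : R * R -> 'M[R]_(m, n))
    (D : 'I_m -> 'I_n -> nat -> nat -> R * R -> R) i j :
  a < b -> A° = [set s | a < s < b] -> (forall u v, ac2 a b (D u v)) ->
  (forall p u v, a < p.1 < b -> F p u v = D u v 0%N 0%N p) -> (i + j <= 2)%N ->
  weak_partial A i j F (fun p => \matrix_(u, v) D u v i j p).
Proof.
move=> ab AE H FD ij.
have loc (u : R * R -> R) (K : set R) : strip_int a b u -> compact K -> K `<=` A° ->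
    leb2.-integrable (K `*` `[0%R, 1%R]) (EFin \o u).
  move=> ui cK KA.
  have Kab s : K s -> a < s < b by move=> /KA; rewrite AE.
  have [x1 [x2 [ax x12 xb Kx]]] := compact_subset_itv cK Kab ab.
  apply: integrableS (ui _ _ ax xb).
  - exact: measurable_rect.
  - by apply: measurableX; [exact: compact_measurable|exact: measurable_itv].
  - by move=> [s t] [/= /Kx/andP[h1 h2] h3]; split => //=; rewrite in_itv/= !ltW.
split.
- move=> K cK KA u v; have := loc _ _ (ac2_int (H u v) (i := 0) (j := 0) isT) cK KA.
  apply: eq_integrable.
  + by apply: measurableX; [exact: compact_measurable|exact: measurable_itv].
  + move=> [s t]; rewrite inE => -[/= /KA]; rewrite AE/= => ss _.
    by rewrite /= FD.
- move=> K cK KA u v; under [X in integrable _ _ X]eq_fun do rewrite mxE.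
  exact: loc (ac2_int (H u v) ij) cK KA.
move=> phi [sm per [K [cK KA Kphi]]] u v.
have Kab s : K s -> a < s < b by move=> /KA; rewrite AE.
have [y1 [y2 [ay y12 yb Ky]]] := compact_subset_itv cK Kab ab.
have van : vanish y1 y2 phi.
  move=> s t st; apply: Kphi => /Ky/andP[h1 h2]; by case: st => ?; lra.
have per' s t : phi (s, t + 1) = phi (s, t) by exact: per.
(* Midpoints leave room between the support of phi and the ends of the rectangle, and between the
   rectangle and the ends of the strip. *)
pose x1 := (a + y1) / 2; pose x2 := (y2 + b) / 2.
have ax : a < x1 by rewrite /x1; lra.
have xy : x1 < y1 by rewrite /x1; lra.
have yx : y2 < x2 by rewrite /x2; lra.
have xb : x2 < b by rewrite /x2; lra.
have P := ac2_pairing (H u v) sm per' van ax xy y12 yx xb ij.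
have vand (k l : nat) : vanish y1 y2 (partial_st k l phi).
  rewrite /partial_st; elim: k => [|k ih] /=; last exact: vanish_derive.
  by elim: l => [|l ih] //=; exact: vanish_derive.
have sup (g h psi : R * R -> R) : (forall p, a < p.1 < b -> g p = h p) -> vanish y1 y2 psi ->
   (\int[leb2]_(p in (A°) `*` `[0%R, 1%R]%classic) (g p * psi p)%:E =
    \int[leb2]_(p in rect x1 x2 0 1) (h p * psi p)%:E)%E.
  move=> gh v0.
  transitivity (\int[leb2]_(p in rect x1 x2 0 1) (g p * psi p)%:E)%E.
    apply: integral_suppE => [[x y] [/= h1 h2]|[x y] [/= h1 h2] nD].
      split => //=; rewrite AE/=; move: h1; rewrite in_itv/= => /andP[h3 h4].
      by rewrite (lt_le_trans ax)// (le_lt_trans h4).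
    rewrite v0 ?mulr0//.
    have [h3|h3] := ltP x y1; first by left.
    have [h4|h4] := ltP y2 x; first by right.
    by case: nD; split => //=; rewrite in_itv/=; apply/andP; split; lra.
  apply: eq_integral => -[x y]; rewrite inE => -[/= h1 _]; congr EFin; congr (_ * _).
  by apply: gh => /=; move: h1; rewrite in_itv/= => /andP[? ?]; lra.
rewrite (sup _ (D u v 0%N 0%N) _ _ (vand i j)); last by move=> p pp; exact: FD.
rewrite (sup _ (D u v i j) _ _ van); last by move=> p _; rewrite mxE.
have EI (f psi : R * R -> R) : strip_int a b f -> continuous psi ->
    (\int[leb2]_(p in rect x1 x2 0 1) (f p * psi p)%:E =
     (\int[leb2]_(p in rect x1 x2 0 1) (f p * psi p))%:E)%E.
  move=> fi cpsi; rewrite /Rintegral fineK//; apply: integrable_fin_num; first exact: measurable_rect.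
  have c : cont_rect x1 x2 0 1 psi by move=> x y _ _; exact: cpsi.
  have := integrable_cMrect c (fi _ _ ax xb).
  by apply: eq_integrable => [|p _]; [exact: measurable_rect|rewrite /= mulrC].
rewrite EI; last 2 first.
- exact: (ac2_int (H u v) (i := 0) (j := 0)).
- exact/smooth_continuous/smooth_partial.
rewrite EI; last 2 first.
- exact: (ac2_int (H u v)).
- exact: smooth_continuous.
by rewrite P EFinM.
Qed.

End AC2Weak.

(** * Weak jets with classical first derivatives *)

Section AeSlices.
Variable R : realType.
Local Notation RR := (measurableTypeR R).
Local Notation mu := (@lebesgue_measure R).
Local Notation leb2 := (@leb2 R).

Let slice_ae0 (D : set RR) (f : R -> R) : measurable D ->
  mu.-integrable D (fun x => (f x)%:E) -> {ae mu, forall x, D x -> f x = 0} ->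
  (\int[mu]_(x in D) `|(f x)%:E| = 0)%E.
Proof.
move=> mD fi f0; apply/(ae_eq_integral_abs _ mD (measurable_int _ fi)).
by apply: (@filterS _ _ (ae_filter_ringOfSetsType mu) _ _ _ f0) => x h /h /= ->.
Qed.

Let outer_ae0 (E : set RR) (F : R -> \bar R) : measurable E -> measurable_fun E F ->
  {ae mu, forall y, E y -> F y = 0%E} -> (\int[mu]_(y in E) F y = 0)%E.
Proof.
move=> mE mF F0; rewrite (ae_eq_integral (fun=> 0%E))//; first by rewrite integral0.
Qed.

(** Tonelli's theorem for |f - g|: its integral vanishes because almost every slice integral
    does. *)
Lemma ae_eq_slice2 (D E : set RR) (f g : RR * RR -> R) : measurable D -> measurable E ->
  leb2.-integrable (D `*` E) (EFin \o f) -> leb2.-integrable (D `*` E) (EFin \o g) ->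
  {ae mu, forall y, E y -> {ae mu, forall x, D x -> f (x, y) = g (x, y)}} ->
  ae_eq leb2 (D `*` E) (EFin \o f) (EFin \o g).
Proof.
move=> mD mE fi gi H; have mDE := measurableX mD mE.
have hi := integrable_funB mDE fi gi; have mh := measurable_int _ hi.
have mah : measurable_fun (D `*` E) (fun p => `|(f p - g p)%:E|)%E.
  exact: (measurableT_comp (@abse_measurable R setT) mh).
suff : ae_eq leb2 (D `*` E) (fun p => (f p - g p)%:E) (cst 0%E).
  apply: filterS => p h /h /= [] /eqP; rewrite subr_eq0 => /eqP ->.
  by [].
apply/(ae_eq_integral_abs _ mDE mh).
have [mF ->] := ge0_integral_slice2 mD mE mah (fun _ => abse_ge0 _).
apply: outer_ae0 => //.
apply: (@filterS2 _ _ (ae_filter_ringOfSetsType mu) _ _ _ _ (leb2_ae_slice2 mD mE hi) H).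
move=> y h1 h2 Ey; apply: (slice_ae0 mD (h1 Ey)).
by apply: (@filterS _ _ (ae_filter_ringOfSetsType mu) _ _ _ (h2 Ey)) => x h /h ->; rewrite subrr.
Qed.

Lemma ae_eq_slice1 (D E : set RR) (f g : RR * RR -> R) : measurable D -> measurable E ->
  leb2.-integrable (D `*` E) (EFin \o f) -> leb2.-integrable (D `*` E) (EFin \o g) ->
  {ae mu, forall x, D x -> {ae mu, forall y, E y -> f (x, y) = g (x, y)}} ->
  ae_eq leb2 (D `*` E) (EFin \o f) (EFin \o g).
Proof.
move=> mD mE fi gi H; have mDE := measurableX mD mE.
have hi := integrable_funB mDE fi gi; have mh := measurable_int _ hi.
have mah : measurable_fun (D `*` E) (fun p => `|(f p - g p)%:E|)%E.
  exact: (measurableT_comp (@abse_measurable R setT) mh).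
suff : ae_eq leb2 (D `*` E) (fun p => (f p - g p)%:E) (cst 0%E).
  apply: filterS => p h /h /= [] /eqP; rewrite subr_eq0 => /eqP ->.
  by [].
apply/(ae_eq_integral_abs _ mDE mh).
have [mF ->] := ge0_integral_slice1 mD mE mah (fun _ => abse_ge0 _).
apply: outer_ae0 => //.
apply: (@filterS2 _ _ (ae_filter_ringOfSetsType mu) _ _ _ _ (leb2_ae_slice1 mD mE hi) H).
move=> y h1 h2 Ey; apply: (slice_ae0 mE (h1 Ey)).
by apply: (@filterS _ _ (ae_filter_ringOfSetsType mu) _ _ _ (h2 Ey)) => x h /h ->; rewrite subrr.
Qed.

End AeSlices.

Section WeakAC2.
Variable R : realType.
Local Notation RR := (measurableTypeR R).
Local Notation mu := (@lebesgue_measure R).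
Local Notation leb2 := (@leb2 R).

(** The derivatives F^(k) and G^(l) are themselves test functions for the pair f, g; this turns the
    pairing of g with the test derivatives into a pairing of f of order (k + i, l + j). *)
Lemma tens_weakS a b i j k l (f g h : R * R -> R) :
  tens_weak a b i j f g -> tens_weak a b (k + i) (l + j) f h -> tens_weak a b k l g h.
Proof.
move=> [fi gi H1] [_ hi H2]; split => // F G x1 x2 dF dG ax xb F0 pG.
have dFk k' : dfamily (fun m => F (k' + m)%N).
  by move=> m x; rewrite addnS; exact: dF.
have dGk k' : dfamily (fun m => G (k' + m)%N).
  by move=> m x; rewrite addnS; exact: dG.
have := H1 _ _ _ _ (dFk k) (dGk l) ax xb (fun m => F0 (k + m)%N) (fun m => pG (l + m)%N).
rewrite !addn0 (H2 _ _ _ _ dF dG ax xb F0 pG) => /esym.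
set X := Rintegral _ _ _; set Y := Rintegral _ _ _.
move=> e; have /(congr1 (fun z => (-1) ^+ (i + j) * z)) := e.
rewrite !mulrA -!exprD addnn -mul2n exprM sqrrN expr1n expr1n mul1r => ->.
congr (_ * _); rewrite (_ : (i + j + (k + i + (l + j)) = (i + j).*2 + (k + l))%N).
  by rewrite exprD -mul2n exprM sqrrN expr1n expr1n mul1r.
by rewrite -addnn; ring.
Qed.

Lemma tens_weak_ae a b i j (f g h : R * R -> R) : tens_weak a b i j g h -> strip_int a b f ->
  (forall x1 x2, a < x1 -> x2 < b ->
    ae_eq leb2 (rect x1 x2 0 1) (EFin \o f) (EFin \o g)) -> tens_weak a b i j f h.
Proof.
move=> [gi hi H] fi fg; split => // F G x1 x2 dF dG ax xb F0 pG.
rewrite -(H _ _ _ _ dF dG ax xb F0 pG) /Rintegral; congr fine; apply: ae_eq_integral.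
- exact: measurable_rect.
- exact: (measurable_int _ (strip_int_tens i j fi dF dG ax xb)).
- exact: (measurable_int _ (strip_int_tens i j gi dF dG ax xb)).
- by apply: filterS (fg _ _ ax xb) => p h1 /h1 /= [->].
Qed.

(** The classical first derivatives replace the weak ones, which agree with them only almost
    everywhere; the second derivatives stay the weak ones. *)
Definition jet2 (W Ws Wt : R * R -> R) (D : nat -> nat -> R * R -> R) (i j : nat) :=
  match i, j with
  | 0, 0 => W | 1, 0 => Ws | 0, 1 => Wt | _, _ => D i j
  end.

Variable B : nat -> R -> R.
Hypothesis dB : dfamily B.
Hypothesis B1 : forall y, 1 <= y -> B 0%N y = 1.
Hypothesis B0 : forall y, y <= -1 -> B 0%N y = 0.

(** On almost every line the classical and the weak first derivative have the same primitives, hence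
    they agree almost everywhere on the strip. *)
Lemma weak2_ac2 a b D Ws Wt : weak2 a b D ->
  (forall s t, a < s < b -> D 0%N 0%N (s, t + 1) = D 0%N 0%N (s, t)) ->
  strip_cont a b (D 0%N 0%N) -> strip_cont a b Ws -> strip_cont a b Wt ->
  (forall s t : R, a < s < b -> is_derive s 1 (fun x => D 0%N 0%N (x, t)) (Ws (s, t))) ->
  (forall s t : R, a < s < b -> is_derive t 1 (fun y => D 0%N 0%N (s, y)) (Wt (s, t))) ->
  ac2 a b (jet2 (D 0%N 0%N) Ws Wt D) /\
  (forall x1 x2, a < x1 -> x2 < b -> forall i j, (i + j <= 2)%N ->
    ae_eq leb2 (rect x1 x2 0 1) (EFin \o jet2 (D 0%N 0%N) Ws Wt D i j) (EFin \o D i j)).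
Proof.
move=> H per c0 cs ct ds dt.
have is' := strip_cont_int cs; have it := strip_cont_int ct.
have fi k l : (k + l <= 2)%N -> strip_int a b (D k l) by move=> /H[].
have As := tens_ac_s dB B1 B0 (H 1%N 0%N isT) c0.
have At := tens_ac_t dB B1 B0 (H 0%N 1%N isT) c0.
have itv01 (x1 x2 x : R) : `[x1, x2]%classic x -> a < x1 -> x2 < b -> a < x < b.
  by rewrite /= in_itv/= => /andP[h1 h2] ax xb; rewrite (lt_le_trans ax)// (le_lt_trans h2).
have m01 : measurable (`[0, 1]%classic : set RR) by exact: measurable_itv.
have Es x1 x2 : a < x1 -> x2 < b ->
    ae_eq leb2 (rect x1 x2 0 1) (EFin \o Ws) (EFin \o D 1%N 0%N).
  move=> ax xb; apply: ae_eq_slice2; [exact: measurable_itv|exact: m01|exact: is'|exact: fi|].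
  apply: (@filterS3 _ _ (ae_filter_ringOfSetsType mu) _ _ _ _ _ (ae_neq (0 : R)) (ae_neq (1 : R)) As).
  move=> t t0 t1 ht; rewrite /= in_itv/= => /andP[tt0 tt1].
  have tt : 0 < t < 1.
    by rewrite !lt_neqAle tt0 tt1 eq_sym !andbT; apply/andP; split; apply/eqP.
  have /= := @ac1_derive_ae _ a b (fun x => D 0%N 0%N (x, t)) (fun x => Ws (x, t))
    (fun x => D 1%N 0%N (x, t)) (fun x => ds x t).
  move=> K; apply: (@filterS _ _ (ae_filter_ringOfSetsType mu) _ _ _ (K _ _)).
  - by move=> x h /itv01 xx; apply: h; exact: xx.
  - by move=> x xx; apply: slice1_continuous; exact: cs.
  - exact: ht.
have Et x1 x2 : a < x1 -> x2 < b ->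
    ae_eq leb2 (rect x1 x2 0 1) (EFin \o Wt) (EFin \o D 0%N 1%N).
  move=> ax xb; apply: ae_eq_slice1; [exact: measurable_itv|exact: m01|exact: it|exact: fi|].
  apply: (@filterS _ _ (ae_filter_ringOfSetsType mu) _ _ _ At) => s hs sx.
  have ss : a < s < b by exact: itv01 sx ax xb.
  have /= := @ac1_derive_ae _ 0 1 (fun y => D 0%N 0%N (s, y)) (fun y => Wt (s, y))
    (fun y => D 0%N 1%N (s, y)) (fun y _ => dt s y ss).
  move=> K; apply: (@filterS3 _ _ (ae_filter_ringOfSetsType mu) _ _ _ _ _ (ae_neq (0 : R)) (ae_neq (1 : R)) (K _ _)).
  - move=> t t0 t1 ht; rewrite /= in_itv/= => /andP[tt0 tt1]; apply: ht.
    by rewrite !lt_neqAle tt0 tt1 eq_sym !andbT; apply/andP; split; apply/eqP.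
  - by move=> x xx; apply: slice2_continuous; exact: ct.
  - move=> y1 y2 y10 y12 y21; apply: ac1_sub (hs ss) => //; exact: ltW.
split; last first.
  move=> x1 x2 ax xb i j ij.
  case: i ij => [|[|i]]; case: j => [|[|j]] //= _;
    by [exact: Et|exact: Es|apply: aeW].
have perD v s t : v = ((1, 0) : R * R) \/ v = ((0, 1) : R * R) -> a < s < b ->
    'D_v (D 0%N 0%N) (s, t + 1) = 'D_v (D 0%N 0%N) (s, t).
  move=> hv ss.
  have -> : 'D_v (D 0%N 0%N) (s, t) = 'D_v (fun p : R * R => D 0%N 0%N (p.1, p.2 + 1)) (s, t).
    apply: near_eq_derive.
    have U : \forall x \near s, a < x < b.
      by move/andP: ss => [h1 h2]; apply: filterS2 (lt_nbhsr h1) (lt_nbhsl h2) => x -> ->.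
    have : \forall p \near (s, t), a < p.1 < b by exact: (cvg_fst (G := nbhs t) U).
    by apply: filterS => -[x y] /= hx; rewrite per.
  have e : (fun h : R => h^-1 *: ((D 0%N 0%N \o shift (s, t + 1)) (h *: v) - D 0%N 0%N (s, t + 1))) =
      (fun h : R => h^-1 *: (((fun p : R * R => D 0%N 0%N (p.1, p.2 + 1)) \o shift (s, t)) (h *: v) -
        D 0%N 0%N (s, t + 1))).
    apply/funext => h /=; congr (_ *: (D 0%N 0%N _ - _)).
    by congr pair; rewrite /= addrA.
  by rewrite /derive e.
have WsE s t : a < s < b -> Ws (s, t) = 'D_((1, 0) : R * R) (D 0%N 0%N) (s, t).
  by move=> ss; have [_] := ds s t ss; rewrite slice1E.
have WtE s t : a < s < b -> Wt (s, t) = 'D_((0, 1) : R * R) (D 0%N 0%N) (s, t).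
  by move=> ss; have [_] := dt s t ss; rewrite slice2E.
split.
- have h1 s t : a < s < b -> Wt (s, t + 1) = Wt (s, t) by move=> ss; rewrite !WtE// perD//; right.
  have h2 s t : a < s < b -> Ws (s, t + 1) = Ws (s, t) by move=> ss; rewrite !WsE// perD//; left.
  case=> [|[|i]]; case=> [|[|j]] // _ s t; by [exact: per|exact: h1|exact: h2].
- by case=> [|[|i]]; case=> [|[|j]] //=.
- exact: ds.
- exact: dt.
- by case=> [|[|[|i]]]; case=> [|[|[|j]]] //= _; try exact: fi; exact: strip_cont_int.
(* The classical first derivative inherits the weak derivatives of the weak one; being continuous,
   it is in turn absolutely continuous on lines. *)
- have := tens_weak_ae (tens_weakS (H 1%N 0%N isT) (H 2%N 0%N isT : tens_weak a b (1 + 1) (0 + 0) _ _)) is' Es.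
  by move=> /(tens_ac_s dB B1 B0)/(_ cs).
- have := tens_weak_ae (tens_weakS (H 1%N 0%N isT) (H 1%N 1%N isT : tens_weak a b (0 + 1) (1 + 0) _ _)) is' Es.
  by move=> /(tens_ac_t dB B1 B0)/(_ cs).
- have := tens_weak_ae (tens_weakS (H 0%N 1%N isT) (H 0%N 2%N isT : tens_weak a b (0 + 0) (1 + 1) _ _)) it Et.
  by move=> /(tens_ac_t dB B1 B0)/(_ ct).
Qed.

End WeakAC2.

(** * Jets of smooth functions, exponentials and cosines *)

Section SmoothAC2.
Variable R : realType.
Local Notation RR := (measurableTypeR R).
Local Notation mu := (@lebesgue_measure R).

Lemma add_le1 i j : (i + j <= 1)%N -> [\/ i = 0%N /\ j = 0%N, i = 0%N /\ j = 1%N | i = 1%N /\ j = 0%N].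
Proof.
by case: i => [|[|i]]; case: j => [|[|j]] // _; [constructor 1|constructor 2|constructor 3].
Qed.

Lemma ac2_classical a b (D : nat -> nat -> R * R -> R) :
  (forall i j, (i + j <= 1)%N -> forall s t, a < s < b -> D i j (s, t + 1) = D i j (s, t)) ->
  (forall i j, (i + j <= 2)%N -> strip_cont a b (D i j)) ->
  (forall s t : R, a < s < b -> [/\
    is_derive s 1 (fun x => D 0%N 0%N (x, t)) (D 1%N 0%N (s, t)),
    is_derive t 1 (fun y => D 0%N 0%N (s, y)) (D 0%N 1%N (s, t)),
    is_derive s 1 (fun x => D 1%N 0%N (x, t)) (D 2%N 0%N (s, t)),
    is_derive t 1 (fun y => D 1%N 0%N (s, y)) (D 1%N 1%N (s, t)) &
    is_derive t 1 (fun y => D 0%N 1%N (s, y)) (D 0%N 2%N (s, t))]) -> ac2 a b D.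
Proof.
move=> per cD dD.
have cs i j x1 x2 t : (i + j <= 2)%N -> a < x1 -> x2 < b ->
    {within `[x1, x2], continuous (fun x => D i j (x, t))}.
  move=> ij ax xb; apply: continuous_in_subspaceT => x; rewrite inE/= in_itv/= => /andP[h1 h2].
  by apply: slice1_continuous; apply: cD => //; rewrite (lt_le_trans ax)// (le_lt_trans h2).
have ct i j s : (i + j <= 2)%N -> a < s < b -> {within `[0, 1], continuous (fun y => D i j (s, y))}.
  by move=> ij ss; apply: continuous_in_subspaceT => y _; apply: slice2_continuous; exact: cD.
split => //.
- by move=> i j ij; apply: cD; rewrite (leq_trans ij).
- by move=> s t /(dD s t)[].
- by move=> s t /(dD s t)[].
- by move=> i j ij; apply: strip_cont_int; exact: cD.
- apply: aeW => t _ x1 x2 ax x12 xb; apply: ac1_derive; last exact: cs.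
  move=> x /andP[h1 h2]; have xx : a < x < b by rewrite (lt_le_trans ax)// (le_lt_trans h2).
  by have [] := dD x t xx.
- apply: aeW => s ss; apply: ac1_derive; last exact: ct.
  by move=> y _; have [] := dD s y ss.
- apply: aeW => s ss; apply: ac1_derive; last exact: ct.
  by move=> y _; have [] := dD s y ss.
Qed.

Lemma ac2_smooth a b (h : R * R -> R) : smooth h ->
  (forall s t, a < s < b -> h (s, t + 1) = h (s, t)) ->
  ac2 a b (fun i j => partial_st i j h).
Proof.
move=> sm per.
have sp i j : smooth (partial_st i j h) by exact: smooth_partial.
apply: ac2_classical.
- have perD v s t : a < s < b -> 'D_v h (s, t + 1) = 'D_v h (s, t).
    move=> ss; have -> : 'D_v h (s, t) = 'D_v (fun p : R * R => h (p.1, p.2 + 1)) (s, t).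
      apply: near_eq_derive.
      have U : \forall x \near s, a < x < b.
        by move/andP: ss => [h1 h2]; apply: filterS2 (lt_nbhsr h1) (lt_nbhsl h2) => x -> ->.
      have : \forall p \near (s, t), a < p.1 < b by exact: (cvg_fst (G := nbhs t) U).
      by apply: filterS => -[x y] /= hx; rewrite per.
    have e : (fun k : R => k^-1 *: ((h \o shift (s, t + 1)) (k *: v) - h (s, t + 1))) =
        (fun k : R => k^-1 *: (((fun p : R * R => h (p.1, p.2 + 1)) \o shift (s, t)) (k *: v) -
          h (s, t + 1))).
      by apply/funext => k /=; congr (_ *: (h _ - _)); congr pair; rewrite /= addrA.
    by rewrite /derive e.
  move=> i j /add_le1[[-> ->]|[-> ->]|[-> ->]] s t ss.
  + exact: per.
  + exact: (perD ((0, 1) : R * R)).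
  + exact: (perD ((1, 0) : R * R)).
- by move=> i j _ s t _; exact: smooth_continuous.
- move=> s t _; split.
  + exact: smooth_is_derive_s.
  + exact: smooth_is_derive_t.
  + exact: (smooth_is_derive_s s t (sp 1%N 0%N)).
  + have := smooth_is_derive_t s t (sp 1%N 0%N); rewrite /partial_st/= clairaut//.
  + exact: (smooth_is_derive_t s t (sp 0%N 1%N)).
Qed.

Definition tensD (F G : nat -> R -> R) (i j : nat) (p : R * R) : R := F i p.1 * G j p.2.

Lemma ac2_tens a b F G : dfamily F -> dfamily G -> (forall k t, G k (t + 1) = G k t) ->
  ac2 a b (tensD F G).
Proof.
move=> dF dG per; have cont i j : continuous (tensD F G i j).
  exact: (smooth_continuous (smooth_tensor i j dF dG)).
apply: ac2_classical.
- by move=> i j _ s t _; rewrite /tensD/= per.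
- by move=> i j _ s t _; exact: cont.
- have ds i j (s t : R) : is_derive s 1 (fun x => tensD F G i j (x, t)) (tensD F G i.+1 j (s, t)).
    have h := dF i s; have : is_derive s 1 (fun x => F i x * G j t) (F i.+1 s * G j t) => //.
    by apply: is_derive_eq; rewrite /GRing.scale/=; ring.
  have dt i j (s t : R) : is_derive t 1 (fun y => tensD F G i j (s, y)) (tensD F G i j.+1 (s, t)).
    have h := dG j t; have : is_derive t 1 (fun y => F i s * G j y) (F i s * G j.+1 t) => //.
    by apply: is_derive_eq; rewrite /GRing.scale/=; ring.
  by move=> s t _; split; [exact: ds|exact: dt|exact: ds|exact: dt|exact: dt].
Qed.

Definition expF (c k r : R) (i : nat) (s : R) : R := c * (k ^+ i * expR (k * (s + r))).

Lemma expF_dfamily c k r : dfamily (expF c k r).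
Proof.
move=> i s; rewrite /expF.
have h : is_derive s 1 (fun x => expR (k * (x + r))) (expR (k * (s + r)) *: k).
  apply: (@is_derive1_comp _ expR (fun x => k * (x + r)) s).
  apply: is_derive_eq; rewrite /GRing.scale/=; ring.
by apply: is_derive_eq; rewrite /GRing.scale/= exprS; ring.
Qed.

(** Each derivative of the cosine advances the phase by pi / 2. The initial phase r = pi / 2 gives
    minus the sine. *)
Definition cosF (k r : R) (j : nat) (t : R) : R := k ^+ j * cos (k * t + r + j%:R * (pi / 2)).

Lemma cosF_dfamily k r : dfamily (cosF k r).
Proof.
move=> j t; rewrite /cosF.
have h : is_derive t 1 (fun x => cos (k * x + r + j%:R * (pi / 2)))
    (- sin (k * t + r + j%:R * (pi / 2)) *: k).
  apply: (@is_derive1_comp _ cos (fun x => k * x + r + j%:R * (pi / 2)) t).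
  apply: is_derive_eq; rewrite /GRing.scale/=; ring.
apply: is_derive_eq; rewrite /GRing.scale/= -[j.+1%:R]natr1 [(_ + 1) * _]mulrDl mul1r addrA cosDpihalf exprS; ring.
Qed.

Lemma cosF_periodic r j t : cosF (2 * pi) r j (t + 1) = cosF (2 * pi) r j t.
Proof.
rewrite /cosF (_ : 2 * pi * (t + 1) + r + j%:R * (pi / 2) = (2 * pi * t + r + j%:R * (pi / 2)) + pi *+ 2).
  by rewrite cosD2pi.
by rewrite -mulr_natl; ring.
Qed.

Lemma cosF_bound k r j t : `|cosF k r j t| <= `|k| ^+ j.
Proof.
by rewrite /cosF normrM normrX ler_piMr ?exprn_ge0// ler_norml cos_geN1 cos_le1.
Qed.

End SmoothAC2.

(** * Chain rule for jets *)

Section Composition.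
Variables (R : realType) (m : nat).
Local Notation RR := (measurableTypeR R).
Local Notation mu := (@lebesgue_measure R).
Implicit Types (G : 'cV[R]_m -> R) (F : 'I_m -> nat -> nat -> R * R -> R).

Definition pd (a : 'I_m) G (x : 'cV[R]_m) : R := 'D_(delta_mx a 0 : 'cV[R]_m) G x.

Lemma pd_smooth a G : smooth G -> smooth (pd a G).
Proof. exact: smooth_derive. Qed.

Lemma is_derive_comp_mx G (g : R -> 'cV[R]_m) (g' : 'I_m -> R) (x : R) : smooth G ->
  (forall a, is_derive x 1 (fun y => g y a 0) (g' a)) ->
  is_derive x 1 (fun y => G (g y)) (\sum_a pd a G (g x) * g' a).
Proof.
move=> sG dg.
have dgx : derivable g x 1.
  by apply/derivable_mxP => a j; rewrite [j]ord1; have [] := dg a.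
have e : 'D_1 g x = \col_a g' a.
  rewrite derive_mx//; apply/matrixP => a j; rewrite !mxE [j]ord1.
  by have [_ ->] := dg a.
have Dg : differentiable g x by apply/derivable1_diffP.
have DG : differentiable G (g x) by exact: smooth_differentiable.
have Dc : differentiable (G \o g) x by exact: differentiable_comp.
split; first by apply/derivable1_diffP.
have -> : 'D_1 (fun y => G (g y)) x = 'd G (g x) ('D_1 g x).
  by rewrite -[LHS]/('D_1 (G \o g) x) (deriveE _ Dc) diff_comp// (deriveE _ Dg).
rewrite e.
have -> : \col_a g' a = \sum_a g' a *: (delta_mx a 0 : 'cV[R]_m).
  apply/matrixP => i j; rewrite summxE !mxE (bigD1 i)//= big1 => [|k ki].
    by rewrite !mxE [j]ord1 !eqxx addr0 mulr1.
  by rewrite !mxE eq_sym (negbTE ki) mulr0.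
rewrite linear_sum/=; apply: eq_bigr => a _.
by rewrite linearZ/= -deriveE// mulrC.
Qed.

Definition colF F (p : R * R) : 'cV[R]_m := \col_a F a 0%N 0%N p.

(** [qF] is the Hessian term, in the order in which the product rule for the first-order term
    produces it. It is quadratic in the first derivatives, whence the need for their fourth
    powers. *)
Definition compD F G (i j : nat) (p : R * R) : R :=
  let dF k l := \sum_a pd a G (colF F p) * F a k l p in
  let qF k l k' l' := \sum_a ((\sum_b pd b (pd a G) (colF F p) * F b k' l' p) * F a k l p) in
  match i, j with
  | 0, 0 => G (colF F p)
  | 1, 0 => dF 1%N 0%N
  | 0, 1 => dF 0%N 1%N
  | 2, _ => qF 1%N 0%N 1%N 0%N + dF 2%N 0%N
  | 1, _ => qF 1%N 0%N 0%N 1%N + dF 1%N 1%N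
  | _, _ => qF 0%N 1%N 0%N 1%N + dF 0%N 2%N
  end.

Lemma ac1_sum (I : Type) (r : seq I) (u1 u2 : R) (g h : I -> R -> R) :
  (forall i, ac1 u1 u2 (g i) (h i)) ->
  ac1 u1 u2 (fun y : R => \sum_(i <- r) g i y) (fun y : R => \sum_(i <- r) h i y).
Proof.
move=> H; elim: r => [|i r ih].
  by apply: ac1_ext (ac1_cst u1 u2 0) => y; rewrite big_nil.
by apply: ac1_ext (ac1D (H i) ih) => y; rewrite big_cons.
Qed.

Lemma strip_cont_sum (I : Type) (r : seq I) a b (f : I -> R * R -> R) :
  (forall i, strip_cont a b (f i)) -> strip_cont a b (fun p => \sum_(i <- r) f i p).
Proof.
move=> H; elim: r => [|i r ih].
  have -> : (fun p : R * R => \sum_(i <- [::]) f i p) = (fun=> 0).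
    by apply/funext => p; rewrite big_nil.
  by move=> s t _; exact: cvg_cst.
by under eq_fun do rewrite big_cons; exact: strip_contD.
Qed.

Lemma strip_int_sum (I : Type) (r : seq I) a b (f : I -> R * R -> R) :
  (forall i, strip_int a b (f i)) -> strip_int a b (fun p => \sum_(i <- r) f i p).
Proof.
move=> H; elim: r => [|i r ih].
  apply: (@strip_int_ext _ _ _ (fun=> 0)) => [p|]; first by rewrite big_nil.
  by apply: strip_cont_int => s t _; exact: cvg_cst.
apply: (@strip_int_ext _ _ _ (fun p => f i p + \sum_(i <- r) f i p)) => [p|].
  by rewrite big_cons.
exact: strip_intD.
Qed.

Section Chain.
Variables (a b : R) (F : 'I_m -> nat -> nat -> R * R -> R).
Hypothesis HF : forall i, ac2 a b (F i).

Let comp_cont G : smooth G -> strip_cont a b (fun p => G (colF F p)).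
Proof.
move=> sG s t ss; apply: (@continuous_comp _ _ _ (colF F) G); last exact: smooth_continuous.
apply/cvgrPdist_le => e e0; near=> q.
rewrite [leLHS]/Num.Def.normr/= mx_normrE (bigmax_le _ (ltW e0))//= => -[i j] _.
rewrite !mxE/=; move: i {j}; near: q; apply: filter_forall => i.
have c : strip_cont a b (F i 0%N 0%N) by exact: (ac2_cont (HF i)).
exact: (cvgrPdist_le _ _).1 (c s t ss) e e0.
Unshelve. all: by end_near. Qed.

Let I2 i k l (kl : (k + l <= 2)%N) : strip_int a b (F i k l) := ac2_int (HF i) kl.
Let C1 i k l (kl : (k + l <= 1)%N) : strip_cont a b (F i k l) := ac2_cont (HF i) kl.

Let perF s t : a < s < b -> colF F (s, t + 1) = colF F (s, t).
Proof.
by move=> ss; apply/matrixP => i j; rewrite !mxE; apply: (ac2_per (HF i)).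
Qed.

Let dFcont G k l : smooth G -> (k + l <= 1)%N ->
  strip_cont a b (fun p => \sum_i pd i G (colF F p) * F i k l p).
Proof.
move=> sG kl; apply: strip_cont_sum => i; apply: strip_contM; last exact: C1.
by apply: comp_cont; exact: pd_smooth.
Qed.

Let comp_ds G (s t : R) : smooth G -> a < s < b ->
  is_derive s 1 (fun x => G (colF F (x, t))) (\sum_i pd i G (colF F (s, t)) * F i 1%N 0%N (s, t)).
Proof.
move=> sG ss; apply: is_derive_comp_mx => // i.
under eq_fun do rewrite mxE; exact: (ac2_ds (HF i)).
Qed.

Let comp_dt G (s t : R) : smooth G -> a < s < b ->
  is_derive t 1 (fun y => G (colF F (s, y))) (\sum_i pd i G (colF F (s, t)) * F i 0%N 1%N (s, t)).
Proof.
move=> sG ss; apply: is_derive_comp_mx => // i.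
under eq_fun do rewrite mxE; exact: (ac2_dt (HF i)).
Qed.

Let comp_ac_s G t x1 x2 : smooth G -> a < x1 -> x2 < b ->
  ac1 x1 x2 (fun x => G (colF F (x, t))) (fun x => \sum_i pd i G (colF F (x, t)) * F i 1%N 0%N (x, t)).
Proof.
move=> sG ax xb.
have I x : x1 <= x <= x2 -> a < x < b.
  by move=> /andP[h1 h2]; rewrite (lt_le_trans ax)// (le_lt_trans h2).
apply: ac1_derive => [x /I xx|]; first exact: comp_ds.
apply: continuous_in_subspaceT => x; rewrite inE/= in_itv/= => /I xx.
have c : {for (x, t), continuous (fun p : R * R => \sum_i pd i G (colF F p) * F i 1%N 0%N p)}.
  exact: (dFcont (k := 1) (l := 0) sG isT).
exact: (slice1_continuous c).
Qed.

Let comp_ac_t G s : smooth G -> a < s < b ->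
  ac1 0 1 (fun y => G (colF F (s, y))) (fun y => \sum_i pd i G (colF F (s, y)) * F i 0%N 1%N (s, y)).
Proof.
move=> sG ss; apply: ac1_derive => [y _|]; first exact: comp_dt.
apply: continuous_in_subspaceT => y _.
have c : {for (s, y), continuous (fun p : R * R => \sum_i pd i G (colF F p) * F i 0%N 1%N p)}.
  exact: (dFcont (k := 0) (l := 1) sG isT).
exact: (slice2_continuous c).
Qed.

Lemma ac2_comp G : smooth G -> ac2 a b (compD F G).
Proof.
move=> sG.
have sp i : smooth (pd i G) by exact: pd_smooth.
have cp i : strip_cont a b (fun p => pd i G (colF F p)) by exact: comp_cont.
have ac1MS (u1 u2 : R) (g g' h h' : R -> R) : ac1 u1 u2 g g' -> ac1 u1 u2 h h' ->
    ac1 u1 u2 (fun x => g x * h x) (fun x => g' x * h x + g x * h' x).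
  exact: ac1M.
have sumE (g h : 'I_m -> R) : \sum_i (g i + h i) = \sum_i g i + \sum_i h i by rewrite big_split.
have intd k l : (k + l <= 2)%N -> strip_int a b (fun p => \sum_i pd i G (colF F p) * F i k l p).
  by move=> kl; apply: strip_int_sum => i; apply: strip_intMc => //; exact: I2.
have intq k l k' l' : (k + l <= 1)%N -> (k' + l' <= 1)%N ->
    strip_int a b (fun p => \sum_i ((\sum_j pd j (pd i G) (colF F p) * F j k' l' p) * F i k l p)).
  move=> kl kl'; apply: strip_cont_int; apply: strip_cont_sum => i; apply: strip_contM; last exact: C1.
  exact: dFcont.
split.
- case=> [|[|i]]; case=> [|[|j]] // _ s t ss /=; rewrite perF//.
  + by apply: eq_bigr => i _; rewrite (ac2_per (HF i) (i := 0) (j := 1)).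
  + by apply: eq_bigr => i _; rewrite (ac2_per (HF i) (i := 1) (j := 0)).
- by case=> [|[|i]]; case=> [|[|j]] // _; [exact: comp_cont|exact: dFcont|exact: dFcont].
- by move=> s t ss; exact: comp_ds.
- by move=> s t ss; exact: comp_dt.
- case=> [|[|[|i]]]; case=> [|[|[|j]]] // _.
  + by apply: strip_cont_int; exact: comp_cont.
  + exact: intd.
  + by apply: strip_intD; [exact: intq|exact: intd].
  + exact: intd.
  + by apply: strip_intD; [exact: intq|exact: intd].
  + by apply: strip_intD; [exact: intq|exact: intd].
- have H : {ae mu, forall t, forall i, 0 < t < 1 -> forall x1 x2, a < x1 -> x1 <= x2 -> x2 < b ->
      ac1 x1 x2 (fun x => F i 1%N 0%N (x, t)) (fun x => F i 2%N 0%N (x, t))}.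
    by apply: ae_forall_count => i; exact: (ac2_ss (HF i)).
  apply: (@filterS _ _ (ae_filter_ringOfSetsType mu) _ _ _ H) => t ht tt x1 x2 ax x12 xb.
  have := ac1_sum (index_enum 'I_m) (fun i => ac1MS _ _ _ _ _ _ (comp_ac_s t (sp i) ax xb) (ht i tt _ _ ax x12 xb)).
  by apply: ac1_ext => // x; rewrite sumE.
- have H : {ae mu, forall s, forall i, a < s < b ->
      ac1 0 1 (fun y => F i 1%N 0%N (s, y)) (fun y => F i 1%N 1%N (s, y))}.
    by apply: ae_forall_count => i; exact: (ac2_st (HF i)).
  apply: (@filterS _ _ (ae_filter_ringOfSetsType mu) _ _ _ H) => s hs ss.
  have := ac1_sum (index_enum 'I_m) (fun i => ac1MS _ _ _ _ _ _ (comp_ac_t (sp i) ss) (hs i ss)).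
  by apply: ac1_ext => // x; rewrite sumE.
- have H : {ae mu, forall s, forall i, a < s < b ->
      ac1 0 1 (fun y => F i 0%N 1%N (s, y)) (fun y => F i 0%N 2%N (s, y))}.
    by apply: ae_forall_count => i; exact: (ac2_tt (HF i)).
  apply: (@filterS _ _ (ae_filter_ringOfSetsType mu) _ _ _ H) => s hs ss.
  have := ac1_sum (index_enum 'I_m) (fun i => ac1MS _ _ _ _ _ _ (comp_ac_t (sp i) ss) (hs i ss)).
  by apply: ac1_ext => // x; rewrite sumE.
Qed.

End Chain.

End Composition.

(** * Pointwise bounds on jets *)

Section PointwiseBounds.
Variable R : realType.
Implicit Types (K T Y : R) (D E : nat -> nat -> R * R -> R) (p : R * R).

Let sq2 (x y X Y : R) : x ^+ 2 <= X -> y ^+ 2 <= Y -> (x + y) ^+ 2 <= 2 * X + 2 * Y.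
Proof. by move=> hx hy; have := sqr_ge0 (x - y); nra. Qed.

Let sqM (x y X Y : R) : 0 <= Y -> x ^+ 2 <= X -> y ^+ 2 <= Y -> (x * y) ^+ 2 <= X * Y.
Proof. by move=> Y0 hx hy; rewrite exprMn; apply: ler_pM => //; exact: sqr_ge0. Qed.

Let pow4 (x : R) : x ^+ 4 = (x ^+ 2) ^+ 2.
Proof. by rewrite -exprM. Qed.

Let sq4 (x y X Y : R) : x ^+ 4 <= X -> y ^+ 4 <= Y -> (x + y) ^+ 4 <= 8 * X + 8 * Y.
Proof.
rewrite !pow4 => hx hy; have h := sq2 (lexx (x ^+ 2)) (lexx (y ^+ 2)).
have h1 : ((x + y) ^+ 2) ^+ 2 <= (2 * x ^+ 2 + 2 * y ^+ 2) ^+ 2.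
  by rewrite ler_pXn2r// nnegrE; [exact: sqr_ge0|have := sqr_ge0 x; have := sqr_ge0 y; lra].
apply: le_trans h1 _; have := sq2 (lexx ((2 * x ^+ 2) ^+ 2)) (lexx ((2 * y ^+ 2) ^+ 2)).
by rewrite ![(2 * _) ^+ 2]exprMn; lra.
Qed.

Let M4 (x y X Y : R) : 0 <= Y -> x ^+ 4 <= X -> y ^+ 4 <= Y -> (x * y) ^+ 4 <= X * Y.
Proof. by rewrite !pow4 [(x * y) ^+ 2]exprMn => Y0 hx hy; apply: sqM. Qed.

Let cross (x y X Y : R) : x ^+ 4 <= X -> y ^+ 4 <= Y -> (x * y) ^+ 2 <= X + Y.
Proof.
by rewrite !pow4 exprMn => hx hy; have := sqr_ge0 (x ^+ 2 - y ^+ 2);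
  have := sqr_ge0 (x ^+ 2); have := sqr_ge0 (y ^+ 2); nra.
Qed.

(** T is a control function, later the jet of w - c. First derivatives are bounded in square and in
    fourth power, since product and chain rules multiply two of them. The value itself is only
    bounded by K; a bound by T is the separate condition [small]. *)
Record tame K T D p : Prop := Tame {
  tame0 : D 0%N 0%N p ^+ 2 <= K;
  tame1 : forall i j, (i + j = 1)%N -> D i j p ^+ 2 <= K * T /\ D i j p ^+ 4 <= K * T;
  tame2 : forall i j, (i + j = 2)%N -> D i j p ^+ 2 <= K * T }.

Definition small K T D p : Prop := D 0%N 0%N p ^+ 2 <= K * T.

Definition all2 Y D p : Prop := forall i j, (i + j <= 2)%N -> D i j p ^+ 2 <= Y.

(** One loss that covers sums and products alike, so that all later constants are iterates of it.
    The largest case is a second derivative of a product, with 8 K^2 T + 16 K T. *)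
Definition blow K : R := 24 * K ^+ 3.

Lemma blow_ge K : 1 <= K -> K <= blow K.
Proof.
move=> K1; rewrite /blow; have h : K ^+ 1 <= K ^+ 3 by exact: ler_weXn2l.
by rewrite expr1 in h; lra.
Qed.

Lemma iter_blow_ge K n : 1 <= K -> K <= iter n blow K.
Proof.
by move=> K1; elim: n => //= n ih; apply: (le_trans ih); apply: blow_ge; exact: le_trans ih.
Qed.

Lemma tame_le K K' T D p : 0 <= T -> K <= K' -> tame K T D p -> tame K' T D p.
Proof.
move=> T0 KK [h0 h1 h2]; have KT : K * T <= K' * T by exact: ler_wpM2r.
split.
- exact: le_trans KK.
- by move=> i j /h1[a1 a2]; split; exact: le_trans KT.
- by move=> i j /h2 a1; exact: le_trans KT.
Qed.

Lemma small_le K K' T D p : 0 <= T -> K <= K' -> small K T D p -> small K' T D p.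
Proof. by move=> T0 KK h; apply: le_trans h _; exact: ler_wpM2r. Qed.

Let pw K : 1 <= K -> [/\ 0 <= K, K <= K ^+ 3 & K ^+ 2 <= K ^+ 3].
Proof.
move=> K1; split; first by lra.
- by rewrite -{1}(expr1 K); exact: ler_weXn2l.
- exact: ler_weXn2l.
Qed.

Lemma tameD K T D E p : 1 <= K -> 0 <= T -> tame K T D p -> tame K T E p ->
  tame (blow K) T (sumD D E) p.
Proof.
move=> K1 T0 [h0 h1 h2] [k0 k1 k2]; have [K0 a1 a2] := pw K1.
have b1 : K * T <= K ^+ 3 * T by exact: ler_wpM2r.
have b0 : 0 <= K * T by exact: mulr_ge0.
rewrite /blow /sumD; split.
- by have := sq2 h0 k0; lra.
- move=> i j ij; have [x1 x2] := h1 _ _ ij; have [y1 y2] := k1 _ _ ij; split.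
    by have := sq2 x1 y1; rewrite -mulrA; lra.
  by have := sq4 x2 y2; rewrite -mulrA; lra.
- by move=> i j ij; have := sq2 (h2 _ _ ij) (k2 _ _ ij); rewrite -mulrA; lra.
Qed.

Lemma smallD K T D E p : 1 <= K -> 0 <= T -> small K T D p -> small K T E p ->
  small (blow K) T (sumD D E) p.
Proof.
move=> K1 T0 h0 k0; have [K0 a1 a2] := pw K1.
have b1 : K * T <= K ^+ 3 * T by exact: ler_wpM2r.
have b0 : 0 <= K * T by exact: mulr_ge0.
by rewrite /small /blow /sumD; have := sq2 h0 k0; rewrite -mulrA; lra.
Qed.

Lemma tameM K T D E p : 1 <= K -> 0 <= T -> tame K T D p -> tame K T E p ->
  tame (blow K) T (prodD D E) p.
Proof.
move=> K1 T0 [h0 h1 h2] [k0 k1 k2]; have [K0 a1 a2] := pw K1.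
have b1 : K * T <= K ^+ 3 * T by exact: ler_wpM2r.
have b2 : K ^+ 2 * T <= K ^+ 3 * T by exact: ler_wpM2r.
have b0 : 0 <= K * T by exact: mulr_ge0.
have KK : K * (K * T) = K ^+ 2 * T by rewrite mulrA -expr2.
have KK' : K * T * K = K ^+ 2 * T by rewrite mulrAC -expr2.
have b3 : 0 <= K ^+ 2 * T by rewrite mulr_ge0// sqr_ge0.
have h04 : D 0%N 0%N p ^+ 4 <= K ^+ 2.
  by rewrite pow4 ler_pXn2r// nnegrE; exact: sqr_ge0.
have k04 : E 0%N 0%N p ^+ 4 <= K ^+ 2.
  by rewrite pow4 ler_pXn2r// nnegrE; exact: sqr_ge0.
have P1 i j : (i + j = 1)%N ->
    (D i j p * E 0%N 0%N p + D 0%N 0%N p * E i j p) ^+ 2 <= blow K * T /\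
    (D i j p * E 0%N 0%N p + D 0%N 0%N p * E i j p) ^+ 4 <= blow K * T.
  move=> ij; have [x1 x2] := h1 _ _ ij; have [y1 y2] := k1 _ _ ij; split.
    have := sq2 (sqM K0 x1 k0) (sqM b0 h0 y1).
    by rewrite KK KK' /blow -mulrA; lra.
  have := sq4 (M4 (sqr_ge0 K) x2 k04) (M4 b0 h04 y2).
  have -> : K * T * K ^+ 2 = K ^+ 3 * T by ring.
  have -> : K ^+ 2 * (K * T) = K ^+ 3 * T by ring.
  by rewrite /blow -mulrA; lra.
have P2 i j i1 j1 i2 j2 : (i + j = 2)%N -> (i1 + j1 = 1)%N -> (i2 + j2 = 1)%N ->
    ((D i j p * E 0%N 0%N p + D i1 j1 p * E i2 j2 p) +
     (D i2 j2 p * E i1 j1 p + D 0%N 0%N p * E i j p)) ^+ 2 <= blow K * T.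
  move=> ij ij1 ij2; have x1 := h2 _ _ ij; have y1 := k2 _ _ ij.
  have [_ x3] := h1 _ _ ij1; have [_ y3] := k1 _ _ ij1.
  have [_ x4] := h1 _ _ ij2; have [_ y4] := k1 _ _ ij2.
  have := sq2 (sq2 (sqM K0 x1 k0) (cross x3 y4)) (sq2 (cross x4 y3) (sqM b0 h0 y1)).
  by rewrite KK KK' /blow -mulrA; lra.
split.
- rewrite /prodD; apply: le_trans (sqM K0 h0 k0) _; rewrite /blow -expr2.
  have K30 : 0 <= K ^+ 3 by rewrite exprn_ge0.
  by lra.
- by case=> [|[|i]]; case=> [|[|j]] // _; exact: P1.
- by case=> [|[|[|i]]]; case=> [|[|[|j]]] // _; rewrite /prodD; exact: P2.
Qed.

(** One small factor suffices: J(w) is merely tame, xi(w) - xi(c) is small. *)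
Lemma smallM K T D E p : 1 <= K -> 0 <= T -> tame K T D p -> small K T E p ->
  small (blow K) T (prodD D E) p.
Proof.
move=> K1 T0 [h0 _ _] k0; have [K0 a1 a2] := pw K1.
have b2 : K ^+ 2 * T <= K ^+ 3 * T by exact: ler_wpM2r.
have b0 : 0 <= K * T by exact: mulr_ge0.
have b3 : 0 <= K ^+ 3 * T by rewrite mulr_ge0// exprn_ge0.
rewrite /small /prodD /blow; apply: le_trans (sqM b0 h0 k0) _.
by rewrite mulrA -expr2 -mulrA; lra.
Qed.

Lemma tame_cst K T c p : 0 <= T -> 0 <= K -> c ^+ 2 <= K -> tame K T (cstD c) p.
Proof.
move=> T0 K0 cK; have b0 : 0 <= K * T by exact: mulr_ge0.
by split; rewrite /cstD // => i j ->; rewrite mulr0n !expr0n.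
Qed.

Lemma tame_sum (I : Type) (r : seq I) K T (D : I -> nat -> nat -> R * R -> R) p :
  1 <= K -> 0 <= T -> (forall x, tame K T (D x) p) ->
  tame (iter (size r) blow K) T (fun i j p => \sum_(x <- r) D x i j p) p.
Proof.
move=> K1 T0 H; elim: r => [|x r ih] /=.
  have K0 : 0 <= K by lra.
  have b0 : 0 <= K * T by exact: mulr_ge0.
  by split => [|i j _|i j _]; rewrite big_nil !expr0n.
have [h0 h1 h2] := tameD (le_trans K1 (iter_blow_ge (size r) K1)) T0
  (tame_le T0 (iter_blow_ge (size r) K1) (H x)) ih.
by split => [|i j /h1|i j /h2]; rewrite big_cons.
Qed.

Lemma small_sum (I : Type) (r : seq I) K T (D : I -> nat -> nat -> R * R -> R) p :
  1 <= K -> 0 <= T -> (forall x, small K T (D x) p) ->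
  small (iter (size r) blow K) T (fun i j p => \sum_(x <- r) D x i j p) p.
Proof.
move=> K1 T0 H; elim: r => [|x r ih] /=.
  have K0 : 0 <= K by lra.
  by rewrite /small big_nil expr0n mulr_ge0.
have := smallD (le_trans K1 (iter_blow_ge (size r) K1)) T0
  (small_le T0 (iter_blow_ge (size r) K1) (H x)) ih.
by rewrite /small big_cons.
Qed.

Lemma tame_all2 K T D p : tame K T D p -> small K T D p -> all2 (K * T) D p.
Proof.
move=> [_ h1 h2] h0 i j; rewrite leq_eqVlt => /predU1P[/h2//|].
by rewrite ltnS => /add_le1[[-> ->]|[-> ->]|[-> ->]] //; [exact: (h1 0%N 1%N erefl).1|exact: (h1 1%N 0%N erefl).1].
Qed.

Lemma all2D Y D E p : all2 Y D p -> all2 Y E p -> all2 (4 * Y) (sumD D E) p.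
Proof. by move=> h k i j ij; have := sq2 (h _ _ ij) (k _ _ ij); rewrite /sumD; lra. Qed.

(** The factor E is an exponential or a cut-off, for which all derivatives have a common bound. The
    16 stands for the four terms of a second derivative, each with coefficient 4. *)
Lemma all2M Y1 Y D E p : 0 <= Y -> all2 Y1 E p -> all2 Y D p -> all2 (16 * (Y1 * Y)) (prodD E D) p.
Proof.
move=> Y0 h k.
have P i j k' l : (i + j <= 2)%N -> (k' + l <= 2)%N -> (E i j p * D k' l p) ^+ 2 <= Y1 * Y.
  by move=> ij kl; apply: sqM => //; [exact: h|exact: k].
have Y10 : 0 <= Y1 by apply: le_trans (h 0%N 0%N isT); exact: sqr_ge0.
have YY : 0 <= Y1 * Y by exact: mulr_ge0.
case=> [|[|[|i]]]; case=> [|[|[|j]]] // _; rewrite /prodD.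
- by apply: le_trans (P _ _ _ _ _ _) _ => //; lra.
- by have := sq2 (P 0%N 1%N 0%N 0%N isT isT) (P 0%N 0%N 0%N 1%N isT isT); lra.
- by have := sq2 (sq2 (P 0%N 2%N 0%N 0%N isT isT) (P 0%N 1%N 0%N 1%N isT isT))
    (sq2 (P 0%N 1%N 0%N 1%N isT isT) (P 0%N 0%N 0%N 2%N isT isT)); lra.
- by have := sq2 (P 1%N 0%N 0%N 0%N isT isT) (P 0%N 0%N 1%N 0%N isT isT); lra.
- by have := sq2 (sq2 (P 1%N 1%N 0%N 0%N isT isT) (P 1%N 0%N 0%N 1%N isT isT))
    (sq2 (P 0%N 1%N 1%N 0%N isT isT) (P 0%N 0%N 1%N 1%N isT isT)); lra.
- by have := sq2 (sq2 (P 2%N 0%N 0%N 0%N isT isT) (P 1%N 0%N 1%N 0%N isT isT))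
    (sq2 (P 1%N 0%N 1%N 0%N isT isT) (P 0%N 0%N 2%N 0%N isT isT)); lra.
Qed.

Lemma sq_sum m (x : 'I_m -> R) Y : (forall a, x a ^+ 2 <= Y) -> (\sum_a x a) ^+ 2 <= m%:R ^+ 2 * Y.
Proof.
move=> H; have [Y0|Y0] := leP 0 Y; last first.
  (* A negative [Y] leaves only the empty sum. *)
  case: m x H => [|m] x H; last by have := H ord0; have := sqr_ge0 (x ord0); lra.
  by rewrite big_ord0 !expr0n/= mul0r.
have S : `|\sum_a x a| <= m%:R * Num.sqrt Y.
  apply: le_trans (ler_norm_sum _ _ _) _.
  apply: (@le_trans _ _ (\sum_(a < m) Num.sqrt Y)).
    by apply: ler_sum => a _; rewrite -sqrtr_sqr ler_wsqrtr.
  by rewrite sumr_const card_ord mulr_natl.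
rewrite -real_normK ?num_real// -(sqr_sqrtr Y0) -exprMn ler_pXn2r ?nnegrE//.
Qed.

Lemma pow4_sum m (x : 'I_m -> R) Y : (forall a, x a ^+ 4 <= Y) -> (\sum_a x a) ^+ 4 <= m%:R ^+ 4 * Y.
Proof.
move=> H; have [Y0|Y0] := leP 0 Y; last first.
  case: m x H => [|m] x H; last by have := H ord0; rewrite pow4; have := sqr_ge0 (x ord0 ^+ 2); lra.
  by rewrite big_ord0 !expr0n/= mul0r.
have H2 a : x a ^+ 2 <= Num.sqrt Y.
  rewrite -[x a ^+ 2]ger0_norm ?sqr_ge0// -sqrtr_sqr -pow4.
  by rewrite ler_wsqrtr.
rewrite !pow4 -(sqr_sqrtr Y0) -exprMn ler_pXn2r ?nnegrE ?sqr_ge0//.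
  exact: sq_sum.
Qed.

(** T controls the derivatives of w but not w itself: values enter only through the bounds for G.
    The Hessian term is a product of two first derivatives, so [cross] bounds its square by the sum
    of their fourth powers. *)
Lemma tame_comp m (F : 'I_m -> nat -> nat -> R * R -> R) (G : 'cV[R]_m -> R) M T p :
  0 <= T -> 1 <= M ->
  (forall a i j, (0 < i + j <= 2)%N -> F a i j p ^+ 2 <= T) ->
  (forall a i j, (i + j = 1)%N -> F a i j p ^+ 4 <= T) ->
  `|G (colF F p)| <= M -> (forall a, `|pd a G (colF F p)| <= M) ->
  (forall a b, `|pd b (pd a G) (colF F p)| <= M) ->
  tame (8 * (1 + m%:R) ^+ 8 * M ^+ 4) T (compD F G) p.
Proof.
move=> T0 M1 F2 F4 G0 G1 G2.
have sqn (x : R) : `|x| <= M -> x ^+ 2 <= M ^+ 2.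
  by move=> h; rewrite -real_normK ?num_real// ler_pXn2r ?nnegrE// (le_trans _ h).
have p4n (x : R) : `|x| <= M -> x ^+ 4 <= M ^+ 4.
  by move=> /sqn h; rewrite !pow4 ler_pXn2r ?nnegrE// sqr_ge0.
have M0 : 0 <= M by lra.
pose u : R := 1 + m%:R; have u1 : 1 <= u by rewrite /u lerDl.
have mu : m%:R <= u by rewrite /u; lra.
have m0 : (0 : R) <= m%:R by exact: ler0n.
have M24 : M ^+ 2 <= M ^+ 4 by exact: ler_weXn2l.
have mu2 : m%:R ^+ 2 <= u ^+ 8.
  apply: (@le_trans _ _ (u ^+ 2)); last exact: ler_weXn2l.
  by rewrite ler_pXn2r// nnegrE; lra.
have mu4 : m%:R ^+ 4 <= u ^+ 8.
  apply: (@le_trans _ _ (u ^+ 4)); last exact: ler_weXn2l.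
  by rewrite ler_pXn2r// nnegrE; lra.
have mu6 : m%:R ^+ 2 * (m%:R ^+ 4 * M ^+ 4 + 1) <= 2 * (u ^+ 8 * M ^+ 4).
  have h6 : m%:R ^+ 6 <= u ^+ 8.
    apply: (@le_trans _ _ (u ^+ 6)); last exact: ler_weXn2l.
    by rewrite ler_pXn2r// nnegrE; lra.
  have M41 : 1 <= M ^+ 4 by exact: exprn_ege1.
  have h7 : m%:R ^+ 6 * M ^+ 4 <= u ^+ 8 * M ^+ 4 by apply: ler_wpM2r => //; rewrite exprn_ge0.
  have h8 : m%:R ^+ 2 <= u ^+ 8 * M ^+ 4.
    by apply: le_trans mu2 _; rewrite ler_peMr// exprn_ge0//; lra.
  rewrite mulrDr mulr1 mulrA -exprD; lra.
have MT4 : 0 <= M ^+ 4 * T by rewrite mulr_ge0// exprn_ge0.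
have B2 : m%:R ^+ 2 * (M ^+ 2 * T) <= u ^+ 8 * M ^+ 4 * T.
  rewrite -(mulrA (u ^+ 8)); apply: ler_pM => //; last exact: ler_wpM2r.
  by rewrite mulr_ge0// sqr_ge0.
have B4 : m%:R ^+ 4 * (M ^+ 4 * T) <= u ^+ 8 * M ^+ 4 * T.
  by rewrite -(mulrA (u ^+ 8)); apply: ler_wpM2r.
have dF2 k l : (0 < k + l <= 2)%N -> (\sum_a pd a G (colF F p) * F a k l p) ^+ 2 <= u ^+ 8 * M ^+ 4 * T.
  move=> kl; apply: le_trans B2; apply: sq_sum => a; apply: sqM => //; last exact: F2.
  exact: sqn.
have dF4 k l : (k + l = 1)%N -> (\sum_a pd a G (colF F p) * F a k l p) ^+ 4 <= u ^+ 8 * M ^+ 4 * T.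
  move=> kl; apply: le_trans B4; apply: pow4_sum => a; apply: M4 => //; last exact: F4.
  exact: p4n.
have qF k l k' l' : (k + l = 1)%N -> (k' + l' = 1)%N ->
   (\sum_a (\sum_b pd b (pd a G) (colF F p) * F b k' l' p) * F a k l p) ^+ 2 <=
     2 * (u ^+ 8 * M ^+ 4) * T.
  move=> kl kl'; apply: (@le_trans _ _ (m%:R ^+ 2 * (m%:R ^+ 4 * M ^+ 4 * T + T))).
    apply: sq_sum => a; apply: cross; last exact: F4.
    rewrite -mulrA; apply: pow4_sum => b; apply: M4 => //; last exact: F4.
    exact: p4n.
  rewrite -[X in _ + X]mul1r -mulrDl mulrA; exact: ler_wpM2r.
have Y0 : 0 <= u ^+ 8 * M ^+ 4 * T by rewrite -mulrA mulr_ge0// exprn_ge0//; lra.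
rewrite -/u; split.
- apply: le_trans (sqn _ G0) _; apply: le_trans M24 _.
  rewrite ler_peMl ?exprn_ge0//.
  have : 1 <= u ^+ 8 by exact: exprn_ege1.
  lra.
- have E k l : (k + l = 1)%N -> (\sum_a pd a G (colF F p) * F a k l p) ^+ 2 <= 8 * u ^+ 8 * M ^+ 4 * T /\
     (\sum_a pd a G (colF F p) * F a k l p) ^+ 4 <= 8 * u ^+ 8 * M ^+ 4 * T.
    move=> kl; have h1 := dF4 _ _ kl; have h2 : (0 < k + l <= 2)%N by rewrite kl.
    by have h3 := dF2 _ _ h2; rewrite -!(mulrA 8); split; lra.
  by case=> [|[|i]]; case=> [|[|j]] // _; exact: E.
- have E k l k1 l1 k2 l2 : (k + l = 2)%N -> (k1 + l1 = 1)%N -> (k2 + l2 = 1)%N ->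
      ((\sum_a (\sum_b pd b (pd a G) (colF F p) * F b k2 l2 p) * F a k1 l1 p) +
       \sum_a pd a G (colF F p) * F a k l p) ^+ 2 <= 8 * u ^+ 8 * M ^+ 4 * T.
    move=> kl kl1 kl2; have h2 : (0 < k + l <= 2)%N by rewrite kl.
    have := sq2 (qF _ _ _ _ kl1 kl2) (dF2 _ _ h2).
    by rewrite -!(mulrA 8) -!(mulrA 2); lra.
  by case=> [|[|[|i]]]; case=> [|[|[|j]]] // _; exact: E.
Qed.

End PointwiseBounds.

(** * Bounds for smooth functions on cubes *)

Section Cube.
Variables (R : realType) (m : nat).
Implicit Types G : 'cV[R]_m -> R.

Definition cube (r : R) : set 'cV[R]_m := [set x | forall a, `|x a 0| <= r].

Let trmx_continuous : continuous (fun v : 'rV[R]_m => v^T : 'cV[R]_m).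
Proof.
move=> v A [P hP PA]; exists (fun i j => P j i) => [i j|w hw].
  by have := hP j i; rewrite mxE.
by apply: PA => i j; rewrite mxE; exact: hw.
Qed.

Lemma cube_compact r : compact (cube r).
Proof.
have c : compact [set v : 'rV[R]_m | forall i, `[- r, r]%classic (v ord0 i)].
  by apply: (@rV_compact _ _ (fun=> `[- r, r]%classic)) => _; exact: segment_compact.
have -> : cube r = (fun v : 'rV[R]_m => v^T : 'cV[R]_m) @`
    [set v : 'rV[R]_m | forall i, `[- r, r]%classic (v ord0 i)].
  apply/seteqP; split => [x xr|_ [v vr <-] a].
    exists x^T; last by rewrite trmxK.
    by move=> i; rewrite /= mxE in_itv/= -ler_norml; exact: xr.
  by rewrite mxE; have := vr a; rewrite /= in_itv/= -ler_norml.
apply: (continuous_compact _ c); exact: continuous_subspaceT.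
Qed.

Let bound1 G r : smooth G -> exists2 M, 0 <= M & forall x, cube r x -> `|G x| <= M.
Proof.
move=> sG; have cG : {within cube r, continuous G}.
  by apply: continuous_subspaceT; exact: smooth_continuous.
have [M [_ hM]] := compact_bounded (continuous_compact cG (@cube_compact r)).
exists (`|M| + 1); first by rewrite addr_ge0.
move=> x xr; apply: hM; last by exists x.
by have := ler_norm M; lra.
Qed.

Definition C2bound r M G : Prop := forall x, cube r x ->
  [/\ `|G x| <= M, forall a, `|pd a G x| <= M & forall a b, `|pd b (pd a G) x| <= M].

Lemma smooth_C2bound G r : smooth G -> exists2 M, 1 <= M & C2bound r M G.
Proof.
move=> sG; have [M0 M00 h0] := bound1 r sG.
have s1 a : smooth (pd a G) by exact: pd_smooth.
have /choice[M1 h1] a : exists M, 0 <= M /\ forall x, cube r x -> `|pd a G x| <= M.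
  by have [M ? ?] := bound1 r (s1 a); exists M.
have /choice[M2 h2] (ab : 'I_m * 'I_m) : exists M, 0 <= M /\ forall x, cube r x ->
    `|pd ab.2 (pd ab.1 G) x| <= M.
  by have [M ? ?] := bound1 r (pd_smooth ab.2 (s1 ab.1)); exists M.
have S1 : 0 <= \sum_a M1 a by apply: sumr_ge0 => a _; have [] := h1 a.
have S2 : 0 <= \sum_ab M2 ab by apply: sumr_ge0 => ab _; have [] := h2 ab.
have le1 a : M1 a <= \sum_a M1 a.
  by rewrite (bigD1 a)//= lerDl; apply: sumr_ge0 => b _; have [] := h1 b.
have le2 ab : M2 ab <= \sum_ab M2 ab.
  by rewrite (bigD1 ab)//= lerDl; apply: sumr_ge0 => b _; have [] := h2 b.
exists (1 + M0 + \sum_a M1 a + \sum_ab M2 ab); first by lra.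
move=> x xr; split => [|a|a b].
- by apply: le_trans (h0 x xr) _; lra.
- by have [_ /(_ x xr)] := h1 a; have := le1 a; lra.
- by have [_ /(_ x xr)] := h2 (a, b); have /= := le2 (a, b); lra.
Qed.

Lemma C2bound_le r M M' G : M <= M' -> C2bound r M G -> C2bound r M' G.
Proof.
move=> MM H x /H[h0 h1 h2]; split => [|a|a b].
- exact: le_trans MM.
- exact: le_trans (h1 a) MM.
- exact: le_trans (h2 a b) MM.
Qed.

Lemma C2bound_family (I : finType) (G : I -> 'cV[R]_m -> R) r : (forall i, smooth (G i)) ->
  exists2 M, 1 <= M & forall i, C2bound r M (G i).
Proof.
move=> sG; have /choice[M h] i : exists M, 1 <= M /\ C2bound r M (G i).
  by have [M ? ?] := smooth_C2bound r (sG i); exists M.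
have M0 i : 0 <= M i by have [M1 _] := h i; exact: le_trans M1.
exists (1 + \sum_i M i); first by rewrite lerDl; exact: sumr_ge0.
move=> i; have [_] := h i; apply: C2bound_le.
by rewrite (bigD1 i)//= addrCA lerDl addr_ge0//; exact: sumr_ge0.
Qed.

(** Mean value theorem along the segment from y to x, which stays in the cube by convexity. *)
Lemma C2bound_lipschitz r M T G x y : smooth G -> C2bound r M G -> cube r x -> cube r y ->
  0 <= T -> 1 <= M -> (forall a, (x a 0 - y a 0) ^+ 2 <= T) ->
  (G x - G y) ^+ 2 <= m%:R ^+ 2 * M ^+ 2 * T.
Proof.
move=> sG hG xr yr T0 M1 xy.
pose g (s : R) : 'cV[R]_m := y + s *: (x - y).
have dg (s : R) a : is_derive s 1 (fun s => g s a 0) (x a 0 - y a 0).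
  have -> : (fun s => g s a 0) = (fun s => y a 0 + s * (x a 0 - y a 0)).
    by apply/funext => z; rewrite !mxE.
  by apply: is_derive_eq; rewrite /GRing.scale/=; ring.
have dG (s : R) := is_derive_comp_mx sG (dg s).
have cG : {within `[0, 1], continuous (fun s => G (g s))}.
  apply: continuous_subspaceT => s; have [d _] := dG s.
  by apply: differentiable_continuous; apply/derivable1_diffP.
have [c c01 e] := MVT ltr01 (fun s _ => dG s) cG.
move: e; rewrite subr0 mulr1 /g scale1r scale0r addr0 subrKC => ->.
rewrite -mulrA; apply: sq_sum => a; rewrite exprMn.
have gr : cube r (g c).
  move: c01; rewrite in_itv/= => /andP[c0 c1] b; rewrite /g !mxE.
  have -> : y b 0 + c * (x b 0 - y b 0) = (1 - c) * y b 0 + c * x b 0 by ring.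
  apply: le_trans (ler_normD _ _) _; rewrite !normrM (ger0_norm (x := c)) ?(ltW c0)//.
  rewrite ger0_norm ?subr_ge0 ?(ltW c1)//.
  have -> : r = (1 - c) * r + c * r by ring.
  by apply: lerD; apply: ler_wpM2l; [lra|exact: yr|lra|exact: xr].
have [_ h _] := hG _ gr; apply: ler_pM; rewrite ?sqr_ge0//.
by rewrite -real_normK ?num_real// ler_pXn2r ?nnegrE// (le_trans _ (h a)).
Qed.

End Cube.

(** * Integral bounds for the control function *)

Section StripIntegrals.
Variable R : realType.
Local Notation RR := (measurableTypeR R).
Local Notation mu := (@lebesgue_measure R).
Local Notation leb2 := (@leb2 R).
Implicit Types (D : nat -> nat -> R * R -> R).

(* No measurability: the integral of a nonnegative function is a supremum over
   the simple functions below it. *)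
Lemma ge0_le_integralT d (T : measurableType d) (nu : {measure set T -> \bar R})
    (A B : set T) (f g : T -> \bar R) :
  A `<=` B -> (forall x, A x -> 0 <= f x)%E -> (forall x, B x -> 0 <= g x)%E ->
  (forall x, A x -> f x <= g x)%E ->
  (\int[nu]_(x in A) f x <= \int[nu]_(x in B) g x)%E.
Proof.
move=> AB f0 g0 fg; rewrite !ge0_integralE//; apply: le_ereal_sup => _ [h hf <-].
exists h => // x; apply: le_trans (hf x) _; rewrite !patchE.
case: ifPn => [/set_mem Ax|_]; first by rewrite (mem_set (AB _ Ax)); exact: fg.
by case: ifPn => // /set_mem Bx; exact: g0.
Qed.

(** The one-dimensional inequality on almost every horizontal line, integrated in t. The constant
    depends on M and k but not on the rectangle, which makes the later bounds uniform in rho. *)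
Lemma gn_s a b D (M k x1 x2 : R) : ac2 a b D -> (forall p, a < p.1 < b -> `|D 0%N 0%N p| <= M) ->
  a < x1 -> x1 + 1 <= x2 -> x2 < b ->
  (\int[leb2]_(p in rect x1 x2 0 1) (expR (k * p.1) * D 1%N 0%N p ^+ 4)%:E <=
   (2 * ((2 * M * (1 + `|k|)) ^+ 2 + 36 * M ^+ 2) + 1)%:E *
   \int[leb2]_(p in rect x1 x2 0 1) (expR (k * p.1) * (D 1%N 0%N p ^+ 2 + D 2%N 0%N p ^+ 2))%:E)%E.
Proof.
move=> H DM ax x12 xb; set C := (_ + 1)%:E.
have C0 : (0 <= C)%E.
  by rewrite lee_fin addr_ge0// mulr_ge0// addr_ge0 ?sqr_ge0// mulr_ge0// sqr_ge0.
have mX : measurable (`[x1, x2]%classic : set RR) by exact: measurable_itv.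
have mY : measurable (`[0, 1]%classic : set RR) by exact: measurable_itv.
have mD i j (ij : (i + j <= 2)%N) : measurable_fun (rect x1 x2 0 1 : set (RR * RR)) (D i j).
  by apply/measurable_EFinP; exact: measurable_int (ac2_int H ij ax xb).
have me : measurable_fun (rect x1 x2 0 1 : set (RR * RR)) (fun p => expR (k * p.1)).
  apply: cont_rect_measurable => x y _ _.
  apply: (@cvg_comp _ _ _ fst (fun z => expR (k * z)) _ (nbhs x)); first exact: cvg_fst.
  apply: continuous_comp; last exact: continuous_expR.
  by apply: cvgM; [exact: cvg_cst|exact: cvg_id].
have mf : measurable_fun (rect x1 x2 0 1 : set (RR * RR))
    (fun p => (expR (k * p.1) * D 1%N 0%N p ^+ 4)%:E).
  by apply/measurable_EFinP; apply: measurable_funM => //; apply: measurable_funX; exact: mD.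
have mg : measurable_fun (rect x1 x2 0 1 : set (RR * RR))
    (fun p => (expR (k * p.1) * (D 1%N 0%N p ^+ 2 + D 2%N 0%N p ^+ 2))%:E).
  apply/measurable_EFinP; apply: measurable_funM => //.
  by apply: measurable_funD; apply: measurable_funX; exact: mD.
have f0 p : (0 <= (expR (k * p.1) * D 1%N 0%N p ^+ 4)%:E)%E.
  by rewrite lee_fin mulr_ge0 ?expR_ge0// exprn_even_ge0.
have g0 p : (0 <= (expR (k * p.1) * (D 1%N 0%N p ^+ 2 + D 2%N 0%N p ^+ 2))%:E)%E.
  by rewrite lee_fin mulr_ge0 ?expR_ge0// addr_ge0// sqr_ge0.
have [mF ->] := ge0_integral_slice2 mX mY mf f0.
have [mG ->] := ge0_integral_slice2 mX mY mg g0.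
rewrite -ge0_integralZl//; last by move=> y _; exact: integral_ge0.
apply: ae_ge0_le_integral => //.
- by move=> y _; exact: integral_ge0.
- by move=> y _; apply: mule_ge0 => //; exact: integral_ge0.
- exact: emeasurable_funM.
apply: (@filterS3 _ _ (ae_filter_ringOfSetsType mu) _ _ _ _ _ (ae_neq (0 : R)) (ae_neq (1 : R)) (ac2_ss H)).
move=> t t0 t1 ht; rewrite /= in_itv/= => /andP[tt0 tt1].
have tt : 0 < t < 1.
  by rewrite !lt_neqAle tt0 tt1 eq_sym !andbT; apply/andP; split; apply/eqP.
have x12' : x1 <= x2 by lra.
have dE : dfamily (expF 1 k 0) by exact: expF_dfamily.
have eE i x : expF 1 k 0 i x = k ^+ i * expR (k * x) by rewrite /expF mul1r addr0.
apply: (@gagliardo_nirenberg _ x1 x2 M `|k| (fun x => D 0%N 0%N (x, t)) (fun x => D 1%N 0%N (x, t))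
  (fun x => D 2%N 0%N (x, t)) (fun x => expR (k * x)) (fun x => k * expR (k * x))) => //.
- exact: ac2_s H ax xb.
- exact: ht.
- apply: ac1_ext (@ac1_derive _ x1 x2 (expF 1 k 0 0%N) (expF 1 k 0 1%N) _ _).
  + by move=> x; rewrite eE expr0 mul1r.
  + by move=> x; rewrite eE expr1.
  + by move=> x _; exact: dE.
  + by apply: continuous_subspaceT; exact: dfamily_continuous.
- apply: continuous_subspaceT => x; have := @dfamily_continuous _ _ 1%N dE x.
  by have -> : expF 1 k 0 1%N = (fun x => k * expR (k * x)) by apply/funext => z; rewrite eE expr1.
- by move=> x /andP[h1 h2]; apply: DM; rewrite /= (lt_le_trans ax)// (le_lt_trans h2).
- by move=> x _; rewrite expR_gt0 normrM (ger0_norm (expR_ge0 _)).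
Qed.

(** On vertical segments, of length exactly 1, the weight is constant, so its logarithmic derivative
    is bounded by 0. *)
Lemma gn_t a b D (M k x1 x2 : R) : ac2 a b D -> (forall p, a < p.1 < b -> `|D 0%N 0%N p| <= M) ->
  a < x1 -> x2 < b ->
  (\int[leb2]_(p in rect x1 x2 0 1) (expR (k * p.1) * D 0%N 1%N p ^+ 4)%:E <=
   (2 * ((2 * M * (1 + 0)) ^+ 2 + 36 * M ^+ 2) + 1)%:E *
   \int[leb2]_(p in rect x1 x2 0 1) (expR (k * p.1) * (D 0%N 1%N p ^+ 2 + D 0%N 2%N p ^+ 2))%:E)%E.
Proof.
move=> H DM ax xb; set C := (_ + 1)%:E.
have C0 : (0 <= C)%E.
  by rewrite lee_fin addr_ge0// mulr_ge0// addr_ge0 ?sqr_ge0// mulr_ge0// sqr_ge0.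
have mX : measurable (`[x1, x2]%classic : set RR) by exact: measurable_itv.
have mY : measurable (`[0, 1]%classic : set RR) by exact: measurable_itv.
have mD i j (ij : (i + j <= 2)%N) : measurable_fun (rect x1 x2 0 1 : set (RR * RR)) (D i j).
  by apply/measurable_EFinP; exact: measurable_int (ac2_int H ij ax xb).
have me : measurable_fun (rect x1 x2 0 1 : set (RR * RR)) (fun p => expR (k * p.1)).
  apply: cont_rect_measurable => x y _ _.
  apply: (@cvg_comp _ _ _ fst (fun z => expR (k * z)) _ (nbhs x)); first exact: cvg_fst.
  apply: continuous_comp; last exact: continuous_expR.
  by apply: cvgM; [exact: cvg_cst|exact: cvg_id].
have mf : measurable_fun (rect x1 x2 0 1 : set (RR * RR))
    (fun p => (expR (k * p.1) * D 0%N 1%N p ^+ 4)%:E).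
  by apply/measurable_EFinP; apply: measurable_funM => //; apply: measurable_funX; exact: mD.
have mg : measurable_fun (rect x1 x2 0 1 : set (RR * RR))
    (fun p => (expR (k * p.1) * (D 0%N 1%N p ^+ 2 + D 0%N 2%N p ^+ 2))%:E).
  apply/measurable_EFinP; apply: measurable_funM => //.
  by apply: measurable_funD; apply: measurable_funX; exact: mD.
have f0 p : (0 <= (expR (k * p.1) * D 0%N 1%N p ^+ 4)%:E)%E.
  by rewrite lee_fin mulr_ge0 ?expR_ge0// exprn_even_ge0.
have g0 p : (0 <= (expR (k * p.1) * (D 0%N 1%N p ^+ 2 + D 0%N 2%N p ^+ 2))%:E)%E.
  by rewrite lee_fin mulr_ge0 ?expR_ge0// addr_ge0// sqr_ge0.
have [mF ->] := ge0_integral_slice1 mX mY mf f0.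
have [mG ->] := ge0_integral_slice1 mX mY mg g0.
rewrite -ge0_integralZl//; last by move=> y _; exact: integral_ge0.
apply: ae_ge0_le_integral => //.
- by move=> y _; exact: integral_ge0.
- by move=> y _; apply: mule_ge0 => //; exact: integral_ge0.
- exact: emeasurable_funM.
apply: (@filterS _ _ (ae_filter_ringOfSetsType mu) _ _ _ (ac2_tt H)).
move=> s hs; rewrite /= in_itv/= => /andP[h1 h2].
have ss : a < s < b by rewrite (lt_le_trans ax)// (le_lt_trans h2).
apply: (@gagliardo_nirenberg _ 0 1 M 0 (fun y => D 0%N 0%N (s, y)) (fun y => D 0%N 1%N (s, y))
  (fun y => D 0%N 2%N (s, y)) (fun=> expR (k * s)) (fun=> 0)) => //.
- exact: ac2_t H ss.
- exact: hs.
- exact: ac1_cst.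
- by move=> x; exact: cvg_cst.
- by move=> y _; exact: DM.
- by move=> y _; rewrite expR_gt0 normr0 mul0r.
Qed.

End StripIntegrals.

Section BoundedIntegrals.
Variable R : realType.
Local Notation RR := (measurableTypeR R).
Local Notation mu := (@lebesgue_measure R).
Local Notation leb2 := (@leb2 R).
Implicit Types (D : nat -> nat -> R * R -> R) (f g : R * R -> R) (S : set (RR * RR)).

Record bint S (A : R) f : Prop := Bint {
  bint_meas : measurable_fun S (f : RR * RR -> R);
  bint_ge0 : forall p, 0 <= f p;
  bint_le : (\int[leb2]_(p in S) (f p)%:E <= A%:E)%E }.

Lemma bintD S A B f g : measurable S -> bint S A f -> bint S B g ->
  bint S (A + B) (fun p => f p + g p).
Proof.
move=> mS [mf f0 fA] [mg g0 gB]; split.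
- exact: measurable_funD.
- by move=> p; rewrite addr_ge0.
- under eq_integral do rewrite EFinD.
  rewrite ge0_integralD//.
  + by rewrite EFinD; exact: leeD.
  + by move=> p _; rewrite lee_fin.
  + exact/measurable_EFinP.
  + by move=> p _; rewrite lee_fin.
  + exact/measurable_EFinP.
Qed.

Lemma bintZ S A k f : measurable S -> 0 <= k -> bint S A f -> bint S (k * A) (fun p => k * f p).
Proof.
move=> mS k0 [mf f0 fA]; split.
- by apply: measurable_funM => //; exact: measurable_cst.
- by move=> p; rewrite mulr_ge0.
- under eq_integral do rewrite EFinM.
  rewrite ge0_integralZl//.
  + by rewrite EFinM; apply: lee_wpmul2l; rewrite ?lee_fin.
  + exact/measurable_EFinP.
  + by move=> p _; rewrite lee_fin.
Qed.

Lemma bint_sum S A m (f : 'I_m -> R * R -> R) : measurable S -> (forall a, bint S A (f a)) ->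
  bint S (m%:R * A) (fun p => \sum_a f a p).
Proof.
move=> mS H; split.
- by apply: measurable_sum => a; exact: (bint_meas (H a)).
- by move=> p; apply: sumr_ge0 => a _; exact: (bint_ge0 (H a)).
- under eq_integral do rewrite -sumEFin.
  rewrite ge0_integral_sum//.
  + have -> : m%:R * A = \sum_(a < m) A by rewrite sumr_const card_ord mulr_natl.
    by rewrite -sumEFin; apply: lee_sum => a _; exact: (bint_le (H a)).
  + by move=> a; apply/measurable_EFinP; exact: (bint_meas (H a)).
  + by move=> a p _; rewrite lee_fin; exact: (bint_ge0 (H a)).
Qed.

Lemma bint_ext S A f g : f =1 g -> bint S A f -> bint S A g.
Proof. by move=> /funext ->. Qed.

(** The control function of one component: the squares that make it small, and the fourth powers
    that the chain rule requires. *)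
Definition theta D p : R :=
  (D 0%N 0%N p ^+ 2 + (D 1%N 0%N p ^+ 2 + D 2%N 0%N p ^+ 2)) +
  ((D 0%N 1%N p ^+ 2 + D 0%N 2%N p ^+ 2) + D 1%N 1%N p ^+ 2) +
  (D 1%N 0%N p ^+ 4 + D 0%N 1%N p ^+ 4).

Definition gn_const (M k : R) : R := 2 * ((2 * M * (1 + k)) ^+ 2 + 36 * M ^+ 2) + 1.

Lemma gn_const_ge0 M k : 0 <= gn_const M k.
Proof. by rewrite addr_ge0// mulr_ge0// addr_ge0 ?sqr_ge0// mulr_ge0// sqr_ge0. Qed.

(** Six squares, and two fourth powers each of which costs a Gagliardo-Nirenberg constant times two
    squares. *)
Definition theta_const (M k : R) : R := 6 + gn_const M `|k| * 2 + gn_const M 0 * 2.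

Lemma bint_theta a b D (M k E x1 x2 : R) : ac2 a b D ->
  (forall p, a < p.1 < b -> `|D 0%N 0%N p| <= M) -> a < x1 -> x1 + 1 <= x2 -> x2 < b ->
  (forall i j, (i + j <= 2)%N ->
    (\int[leb2]_(p in rect x1 x2 0 1) (expR (k * p.1) * D i j p ^+ 2)%:E <= E%:E)%E) ->
  bint (rect x1 x2 0 1) (theta_const M k * E) (fun p => expR (k * p.1) * theta D p).
Proof.
move=> H DM ax x12 xb hE.
have mr := measurable_rect x1 x2 0 1.
have me : measurable_fun (rect x1 x2 0 1 : set (RR * RR)) (fun p => expR (k * p.1)).
  apply: cont_rect_measurable => x y _ _.
  apply: (@cvg_comp _ _ _ fst (fun z => expR (k * z)) _ (nbhs x)); first exact: cvg_fst.
  apply: continuous_comp; last exact: continuous_expR.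
  by apply: cvgM; [exact: cvg_cst|exact: cvg_id].
have mD i j (ij : (i + j <= 2)%N) : measurable_fun (rect x1 x2 0 1 : set (RR * RR)) (D i j).
  by apply/measurable_EFinP; exact: measurable_int (ac2_int H ij ax xb).
have B2 i j (ij : (i + j <= 2)%N) : bint (rect x1 x2 0 1) E (fun p => expR (k * p.1) * D i j p ^+ 2).
  split; last exact: hE.
    by apply: measurable_funM => //; apply: measurable_funX; exact: mD.
  by move=> p; rewrite mulr_ge0 ?expR_ge0// sqr_ge0.
have B22 i j i' j' (ij : (i + j <= 2)%N) (ij' : (i' + j' <= 2)%N) :
    bint (rect x1 x2 0 1) (E + E) (fun p => expR (k * p.1) * (D i j p ^+ 2 + D i' j' p ^+ 2)).
  by apply: (bint_ext _ (bintD mr (B2 _ _ ij) (B2 _ _ ij'))) => p; rewrite mulrDr.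
have B4 i j i' j' C (ij : (i + j <= 2)%N) (ij' : (i' + j' <= 2)%N) : 0 <= C ->
    (\int[leb2]_(p in rect x1 x2 0 1) (expR (k * p.1) * D i j p ^+ 4)%:E <=
     C%:E * \int[leb2]_(p in rect x1 x2 0 1)
       (expR (k * p.1) * (D i j p ^+ 2 + D i' j' p ^+ 2))%:E)%E ->
    bint (rect x1 x2 0 1) (C * (E + E)) (fun p => expR (k * p.1) * D i j p ^+ 4).
  move=> C0 h; split.
  - by apply: measurable_funM => //; apply: measurable_funX; exact: mD.
  - by move=> p; rewrite mulr_ge0 ?expR_ge0// exprn_even_ge0.
  - apply: le_trans h _; rewrite EFinM; apply: lee_wpmul2l; first by rewrite lee_fin.
    exact: (bint_le (B22 _ _ _ _ ij ij')).
have S10 := B4 1%N 0%N 2%N 0%N _ isT isT (gn_const_ge0 M `|k|) (gn_s k H DM ax x12 xb).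
have S01 := B4 0%N 1%N 0%N 2%N _ isT isT (gn_const_ge0 M 0) (gn_t k H DM ax xb).
have := bintD mr (bintD mr (bintD mr (B2 0%N 0%N isT) (B22 1%N 0%N 2%N 0%N isT isT))
   (bintD mr (B22 0%N 1%N 0%N 2%N isT isT) (B2 1%N 1%N isT))) (bintD mr S10 S01).
rewrite (_ : _ + _ + _ = theta_const M k * E); last by rewrite /theta_const; ring.
by apply: bint_ext => p; rewrite /theta; ring.
Qed.

(** Jets are controlled on closed rectangles inside the open strip only; monotone convergence passes
    to the strip. *)
Lemma bint_exhaust a b A f : a + 1 < b ->
  (forall x1 x2, a < x1 -> x1 + 1 <= x2 -> x2 < b -> bint (rect x1 x2 0 1) A f) ->
  (\int[leb2]_(p in `]a, b[%classic `*` `[0%R, 1%R]%classic) (f p)%:E <= A%:E)%E.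
Proof.
(* With margins at most r on both sides the rectangles keep length at least 1. *)
move=> ab H; pose r := (b - a - 1) / 2; have r0 : 0 < r by rewrite /r; lra.
pose e n : R := r / n.+1%:R.
have e0 n : 0 < e n by rewrite divr_gt0.
have er n : e n <= r by apply: ler_piMr; [exact: ltW|rewrite invf_le1// ler1n].
have rE : r * 2 = b - a - 1 by rewrite /r; field.
have Hn n : bint (rect (a + e n) (b - e n) 0 1) A f.
  by apply: H; have := e0 n; have := er n; lra.
have U : \bigcup_n (rect (a + e n) (b - e n) 0 1) = `]a, b[%classic `*` `[0%R, 1%R]%classic.
  apply/seteqP; split => [[x y] [n _ [/= h1 h2]]|[x y] [/= h1 h2]].
    split => //=; move: h1; rewrite !in_itv/= => /andP[? ?].
    by have := e0 n; move=> ?; apply/andP; split; lra.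
  move: h1; rewrite in_itv/= => /andP[ax xb].
  pose d := Num.min (x - a) (b - x).
  have d0 : 0 < d by rewrite lt_min !subr_gt0 ax.
  have [n hn] : exists n : nat, r / d < n.+1%:R.
    exists (Num.trunc (r / d)); exact: truncnS_gt.
  have ed : e n <= d.
    by rewrite ltW// /e ltr_pdivrMr// mulrC -ltr_pdivrMr.
  have d1 : d <= x - a by rewrite ge_min lexx.
  have d2 : d <= b - x by rewrite ge_min lexx orbT.
  exists n => //; split => //=; rewrite in_itv/=; apply/andP; split; lra.
rewrite -U; have C : (\int[leb2]_(p in rect (a + e n) (b - e n) 0 1) (f p)%:E @[n --> \oo] -->
    \int[leb2]_(p in \bigcup_n rect (a + e n) (b - e n) 0 1) (f p)%:E)%E.
  apply: (@ge0_nondecreasing_set_cvg_integral _ _ R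
    (fun n => rect (a + e n) (b - e n) 0 1 : set (RR * RR)) (fun p => (f p)%:E) leb2).
  - move=> n n' nn; apply/subsetPset => -[x y] [/= h1 h2]; split => //=.
    have : e n' <= e n by rewrite /e ler_pM2l// lef_pV2 ?posrE// ler_nat.
    by move: h1; rewrite !in_itv/= => /andP[? ?] ?; apply/andP; split; lra.
  - by move=> n; exact: measurable_rect.
  - by move=> n; apply/measurable_EFinP; exact: (bint_meas (Hn n)).
  - by move=> n p _; rewrite lee_fin; exact: (bint_ge0 (Hn n)).
rewrite -(cvg_lim (@ereal_hausdorff R) C); apply: lime_le.
  by apply/cvg_ex; eexists; exact: C.
by apply: nearW => n; exact: (bint_le (Hn n)).
Qed.

End BoundedIntegrals.

(** * Sobolev norms of matrix-valued functions *)

Section SobolevNorms.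
Variable R : realType.
Local Notation RR := (measurableTypeR R).
Local Notation mu := (@lebesgue_measure R).
Local Notation leb2 := (@leb2 R).

Lemma weak_partial_ext m n (A : set R) i j (f g g' : R * R -> 'M[R]_(m, n)) :
  (forall p, A° p.1 -> g p = g' p) -> weak_partial A i j f g -> weak_partial A i j f g'.
Proof.
move=> gg [fi gi H]; split => //.
- move=> K cK KA a b; apply: eq_integrable (gi K cK KA a b).
    by apply: measurableX; [exact: compact_measurable|exact: measurable_itv].
  by move=> p; rewrite inE => -[/= /KA pA _]; rewrite gg.
- move=> phi tphi a b; rewrite (H phi tphi a b); congr (_ * _)%E.
  by apply: eq_integral => p; rewrite inE => -[/= pA _]; rewrite gg.
Qed.

Lemma normsq_ge0 m n (x : 'M[R]_(m, n)) : 0 <= normsq x.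
Proof. by apply: sumr_ge0 => a _; apply: sumr_ge0 => b _; exact: sqr_ge0. Qed.

Lemma normsq_entry m n (x : 'M[R]_(m, n)) a b : x a b ^+ 2 <= normsq x.
Proof.
rewrite /normsq (bigD1 a)//= (bigD1 b)//= -addrA lerDl addr_ge0//.
  by apply: sumr_ge0 => ? _; exact: sqr_ge0.
by apply: sumr_ge0 => ? _; apply: sumr_ge0 => ? _; exact: sqr_ge0.
Qed.

Lemma normsq_le m n (x : 'M[R]_(m, n)) Y : (forall a b, x a b ^+ 2 <= Y) ->
  normsq x <= m%:R * (n%:R * Y).
Proof.
move=> H; apply: (@le_trans _ _ (\sum_(a < m) (n%:R * Y))).
  apply: ler_sum => a _; apply: (@le_trans _ _ (\sum_(b < n) Y)).
    by apply: ler_sum => b _.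
  by rewrite sumr_const card_ord -[_ *+ n]mulr_natl.
by rewrite sumr_const card_ord -[_ *+ m]mulr_natl.
Qed.

Lemma jet_normsq_ge0 m n k (D : nat -> nat -> R * R -> 'M[R]_(m, n)) p : 0 <= jet_normsq k D p.
Proof.
by apply: sumr_ge0 => l _; apply: sumr_ge0 => i _; rewrite mulr_ge0// normsq_ge0.
Qed.

Lemma jet_entry m n k (D : nat -> nat -> R * R -> 'M[R]_(m, n)) p i j a b : (i + j <= k)%N ->
  D i j p a b ^+ 2 <= jet_normsq k D p.
Proof.
move=> ij; have lk : (i + j < k.+1)%N by [].
have il : (i < (i + j).+1)%N by rewrite ltnS leq_addr.
rewrite /jet_normsq (bigD1 (Ordinal lk))//= (bigD1 (Ordinal il))//= -addrA.
rewrite addKn -[leLHS]addr0; apply: lerD; last first.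
  rewrite addr_ge0//; apply: sumr_ge0 => ? _; first by rewrite mulr_ge0// normsq_ge0.
  by apply: sumr_ge0 => ? _; rewrite mulr_ge0// normsq_ge0.
apply: le_trans (normsq_entry _ a b) _; rewrite ler_peMl ?normsq_ge0// ler1n bin_gt0 leq_addr//.
Qed.

(** The 7 is 1 + 2 + 4, the number of entries of the tensors d^0, d^1 and d^2. *)
Lemma jet2_le m n (D : nat -> nat -> R * R -> 'M[R]_(m, n)) p Y :
  (forall i j, (i + j <= 2)%N -> forall a b, D i j p a b ^+ 2 <= Y) ->
  jet_normsq 2 D p <= 7 * (m%:R * (n%:R * Y)).
Proof.
move=> H; rewrite /jet_normsq !big_ord_recl !big_ord0 /= /bump/=.
have N i j : (i + j <= 2)%N -> normsq (D i j p) <= m%:R * (n%:R * Y).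
  by move=> ij; apply: normsq_le; exact: H.
have h00 := N 0%N 0%N isT; have h10 := N 1%N 0%N isT; have h01 := N 0%N 1%N isT.
have h20 := N 2%N 0%N isT; have h11 := N 1%N 1%N isT; have h02 := N 0%N 2%N isT.
rewrite !addn0 ?add0n ?subn0 ?subnn ?bin0 ?binn ?bin1 ?addr0 /= .
have -> : (2 - 1 = 1)%N by []. 
by rewrite ?bin1 ?binn ?mul1r; lra.
Qed.

(** As the norm is an infimum, one family of weak derivatives bounds it; the exponential factor in
    the pointwise bound is there to cancel the weight. *)
Lemma sob_norm_le m n (A : set R) (a b d E : R) (f : R * R -> 'M[R]_(m, n))
    (H : 'I_m -> 'I_n -> nat -> nat -> R * R -> R) (g : R * R -> R) :
  a + 1 < b -> A° = [set s | a < s < b] ->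
  (forall u v, ac2 a b (H u v)) ->
  (forall p u v, a < p.1 < b -> f p u v = H u v 0%N 0%N p) ->
  (forall p, a < p.1 < b -> 0 <= g p /\ forall u v,
     all2 (expR (- (2 * d * `|p.1|)) * g p) (H u v) p) ->
  (\int[leb2]_(p in `]a, b[%classic `*` `[0%R, 1%R]%classic)
      (7 * (m%:R * (n%:R * g p)))%:E <= E%:E)%E ->
  (sob_norm 2 d A f <= (E `^ 2^-1)%:E)%E.
Proof.
move=> ab AE acH fH Hg gE; have ab' : a < b by lra.
(* Zero outside the open strip: the endpoints of [A] then contribute nothing to the integral. *)
pose D i j (p : R * R) : 'M[R]_(m, n) := if a < p.1 < b then \matrix_(u, v) H u v i j p else 0.
have wD i j : (i + j <= 2)%N -> weak_partial A i j f (D i j).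
  move=> ij; apply: weak_partial_ext (ac2_weak_partial ab' AE acH fH ij).
  by move=> p; rewrite AE/= /D => ->.
set I := (\int[leb2]_(p in A `*` `[0%R, 1%R]%classic)
      (jet_normsq 2 D p * expR (2 * d * `|p.1|))%:E)%E.
have IE : (I <= E%:E)%E.
  apply: le_trans gE; rewrite /I (@integral_suppE _ (`]a, b[%classic `*` `[0%R, 1%R]%classic)).
  - apply: ge0_le_integralT => //.
    + by move=> p _; rewrite lee_fin mulr_ge0 ?expR_ge0// jet_normsq_ge0.
    + move=> p [/=]; rewrite in_itv/= => /Hg[g0 _] _.
      by rewrite lee_fin !mulr_ge0.
    + move=> p [/=]; rewrite in_itv/= => pp _; have [g0 hp] := Hg p pp.
      have : jet_normsq 2 D p <= 7 * (m%:R * (n%:R * (expR (- (2 * d * `|p.1|)) * g p))).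
        by apply: jet2_le => i j ij u v; rewrite /D pp mxE; exact: hp.
      rewrite lee_fin expRN => h.
      rewrite -ler_pdivlMr ?expR_gt0//; apply: le_trans h _.
      by rewrite le_eqVlt; apply/orP; left; apply/eqP; ring.
  - move=> [s t] [/=]; rewrite in_itv/= => ss tt; split => //=.
    by apply: (@interior_subset _ A); rewrite AE.
  - move=> [s t] [/= _ tt] nS; rewrite (_ : jet_normsq 2 D (s, t) = 0) ?mul0r//.
    have D0 i j : D i j (s, t) = 0.
      by rewrite /D/=; case: ifP => // ss; case: nS; split => //=; rewrite in_itv.
    rewrite /jet_normsq big1// => l _; rewrite big1// => i _.
    by rewrite D0 /normsq big1 ?mulr0// => u _; rewrite big1// => v _; rewrite mxE expr0n.
have I0 : (0 <= I)%E.
  by apply: integral_ge0 => p _; rewrite lee_fin mulr_ge0 ?expR_ge0// jet_normsq_ge0.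
apply: (@le_trans _ _ (I `^ 2^-1)%E).
  by apply: ereal_inf_lbound; exists D.
rewrite -poweR_EFin; apply: gt0_ler_poweR => //; rewrite in_itv/= ?leey ?andbT//.
exact: le_trans IE.
Qed.

Lemma sob_norm_lt m n k (d : R) (A : set R) (f : R * R -> 'M[R]_(m, n)) (C : R) :
  (0 < C) -> (sob_norm k d A f < C%:E)%E ->
  exists2 D : nat -> nat -> R * R -> 'M[R]_(m, n),
    forall i j, (i + j <= k)%N -> weak_partial A i j f (D i j) &
    (\int[leb2]_(p in A `*` `[0%R, 1%R]%classic)
      (jet_normsq k D p * expR (2 * d * `|p.1|))%:E <= (C ^+ 2)%:E)%E.
Proof.
move=> C0 /ereal_inf_lt[_ [D wD ->] h]; exists D => //.
rewrite leNgt; apply/negP => hC; move: h; apply/negP; rewrite -leNgt.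
have -> : (C%:E = (C ^+ 2)%:E `^ 2^-1)%E.
  by rewrite poweR_EFin powR12_sqrt ?sqr_ge0// sqrtr_sqr gtr0_norm.
apply: gt0_ler_poweR => //; rewrite ?in_itv/= ?leey ?andbT ?lee_fin ?sqr_ge0//.
  by apply: le_trans (ltW hC); rewrite lee_fin sqr_ge0.
exact: ltW.
Qed.

End SobolevNorms.

Section SmoothEntries.
Variable R : realType.

Lemma Ck_entry (V : normedModType R) m n k (f : V -> 'M[R]_(m, n)) u v : Ck k f ->
  Ck k (fun x => f x u v).
Proof.
elim: k f => [|k ih] f /=.
  move=> cf x; apply/cvgrPdist_le => e e0.
  have /cvgrPdist_le/(_ e e0) := cf x; apply: filterS => y; apply: le_trans.
  rewrite [leRHS]/Num.Def.normr/= mx_normrE.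
  have := le_bigmax 0 (fun k : 'I_m * 'I_n => `|(f x - f y) k.1 k.2|) (u, v).
  by rewrite /= !mxE.
move=> [df cf]; have d1 x w : derivable f x w by exact: diff_derivable.
have dentry x : differentiable (fun M : 'M[R]_(m, n) => M u v) (f x).
  exact: differentiable_coord.
split => [x|w].
  exact: (differentiable_comp (df x) (dentry x)).
have -> : (fun x => 'D_w (fun x => f x u v) x) = (fun x => 'D_w f x u v).
  by apply/funext => x; rewrite derive_mx// mxE.
exact: ih.
Qed.

Lemma smooth_entry (V : normedModType R) m n (f : V -> 'M[R]_(m, n)) u v : smooth f ->
  smooth (fun x => f x u v).
Proof. by move=> sf k; exact: Ck_entry. Qed.

End SmoothEntries.

(** * Jets of the (0,1)-forms of the perturbation *)

Section FormFamilies.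
Variables (R : realType) (m : nat).
Local Notation RR := (measurableTypeR R).
Local Notation mu := (@lebesgue_measure R).
Implicit Types (F : 'I_m -> nat -> nat -> R * R -> R) (J : 'cV[R]_m -> 'M[R]_m)
  (xi : 'cV[R]_m -> 'cV[R]_m) (q : 'cV[R]_m).

(** The vector q is xi(c) on the ends and 0 on the neck. *)
Definition xiD F xi q (b : 'I_m) := sumD (compD F (fun x => xi x b 0)) (cstD (- q b 0)).

Definition jxiD F J xi q (u : 'I_m) (i j : nat) (p : R * R) : R :=
  \sum_b prodD (compD F (fun x => J x u b)) (xiD F xi q b) i j p.

(** With [esD], the two parts of the complex exponential in dzbar: here the cosine with the sign c,
    there minus the sine, by a phase shift. *)
Definition ecD (c k r : R) := tensD (expF c k r) (cosF (2 * pi) 0).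
Definition esD (k r : R) := tensD (expF 1 k r) (cosF (2 * pi) (pi / 2)).

(* The (u, v) entry of x \otimes dzbar at x = xi (w p) - q, in the coordinate
   p.1 + r of the plus end (c = 1) or of the minus end (c = -1). *)
Definition formD F J xi q (c r : R) (u : 'I_m) (v : 'I_(1 + 1)) :=
  if (v == 0 :> nat)%N
  then sumD (prodD (ecD c (c * (2 * pi)) r) (xiD F xi q u))
            (prodD (esD (c * (2 * pi)) r) (jxiD F J xi q u))
  else sumD (prodD (ecD (- c) (c * (2 * pi)) r) (jxiD F J xi q u))
            (prodD (esD (c * (2 * pi)) r) (xiD F xi q u)).

Lemma ac2_formD a b F J xi q c r u v : (forall i, ac2 a b (F i)) -> smooth J -> smooth xi ->
  ac2 a b (formD F J xi q c r u v).
Proof.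
move=> HF sJ sxi.
have aX w : ac2 a b (xiD F xi q w).
  by apply: ac2D; [apply: ac2_comp => //; exact: smooth_entry|exact: ac2_cst].
have aJ w : ac2 a b (jxiD F J xi q w).
  by apply: ac2_sum => z; apply: ac2M => //; apply: ac2_comp => //; exact: smooth_entry.
have aE k r' s c' : ac2 a b (tensD (expF c' k r') (cosF (2 * pi) s)).
  by apply: ac2_tens; [exact: expF_dfamily|exact: cosF_dfamily|exact: cosF_periodic].
have h1 c' := aE (c * (2 * pi)) r 0 c'; have h2 := aE (c * (2 * pi)) r (pi / 2) 1.
rewrite /formD; case: ifP => _.
  exact: (ac2D (ac2M (h1 _) (aX u)) (ac2M h2 (aJ u))).
exact: (ac2D (ac2M (h1 _) (aJ u)) (ac2M h2 (aX u))).
Qed.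

Let two_pi_ge1 : 1 <= 2 * (pi : R).
Proof. by have := pi_ge2 R; lra. Qed.

(** Each derivative, in s or in t, costs a factor 2 pi; there are at most two of them and the result
    is squared. *)
Lemma tens_exp_bound (c k r s : R) p : `|c| <= 1 -> `|k| = 2 * pi ->
  all2 ((2 * pi) ^+ 4 * expR (2 * k * (p.1 + r))) (tensD (expF c k r) (cosF (2 * pi) s)) p.
Proof.
move=> c1 kp i j ij.
have e2 : expR (2 * k * (p.1 + r)) = expR (k * (p.1 + r)) ^+ 2.
  by rewrite -expRM_natl; congr expR; ring.
rewrite e2 /tensD /expF -real_normK ?num_real//.
have -> : (2 * pi : R) ^+ 4 = ((2 * pi) ^+ 2) ^+ 2 by rewrite -exprM.
rewrite -[leRHS]exprMn ler_pXn2r ?nnegrE//; last first.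
  by rewrite mulr_ge0 ?expR_ge0// exprn_ge0// (le_trans _ two_pi_ge1).
rewrite normrM (normrM c) (normrM (k ^+ i)) normrX kp (ger0_norm (expR_ge0 _)).
have h := cosF_bound (2 * pi) s j p.2.
rewrite (ger0_norm (le_trans ler01 two_pi_ge1)) in h.
apply: (@le_trans _ _ (1 * ((2 * pi) ^+ i * expR (k * (p.1 + r))) * (2 * pi) ^+ j)).
  apply: ler_pM => //; last by apply: ler_wpM2r => //; rewrite mulr_ge0 ?expR_ge0// exprn_ge0// (le_trans _ two_pi_ge1).
  by rewrite mulr_ge0// mulr_ge0 ?expR_ge0// exprn_ge0// (le_trans _ two_pi_ge1).
rewrite mul1r mulrAC -exprD; apply: ler_wpM2r; first exact: expR_ge0.
exact: ler_weXn2l.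
Qed.

Definition comp_const (M : R) : R := 8 * (1 + m%:R) ^+ 8 * M ^+ 4.

Lemma comp_const_ge1 M : 1 <= M -> [/\ 1 <= comp_const M, M ^+ 2 <= comp_const M &
  m%:R ^+ 2 * M ^+ 2 <= comp_const M].
Proof.
move=> M1; have u1 : 1 <= 1 + m%:R :> R by rewrite lerDl.
have m0 : 0 <= m%:R :> R by exact: ler0n.
have M24 : M ^+ 2 <= M ^+ 4 by exact: ler_weXn2l.
have M21 : 1 <= M ^+ 2 by exact: exprn_ege1.
have u28 : (1 + m%:R) ^+ 2 <= (1 + m%:R) ^+ 8 :> R by exact: ler_weXn2l.
have mu : m%:R ^+ 2 <= (1 + m%:R) ^+ 2 :> R by rewrite ler_pXn2r// ?nnegrE; lra.
have u81 : 1 <= (1 + m%:R) ^+ 8 :> R by exact: exprn_ege1.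
rewrite /comp_const; set U := (1 + m%:R) ^+ 8 in u28 u81 *.
have H : M ^+ 2 <= U * M ^+ 4 by apply: (le_trans M24); rewrite ler_peMl//; lra.
have H2 : m%:R ^+ 2 * M ^+ 2 <= U * M ^+ 4 by apply: ler_pM => //; rewrite ?sqr_ge0//; lra.
by rewrite -mulrA; split; lra.
Qed.

(** One [blow] for subtracting q, one for the product with J, and m for the sum over the
    components. *)
Definition form_const (M : R) : R := iter m.+2 (@blow R) (comp_const M).

(* A bound depending only on m and on a bound M for J, xi and their first two
   derivatives. *)
Lemma formD_tame F J xi q r M (T : R) p :
  1 <= M -> 0 <= T ->
  (forall u b, C2bound r M (fun x => J x u b)) -> (forall b, C2bound r M (fun x => xi x b 0)) ->
  cube r (colF F p) -> (forall b, `|q b 0| <= M) ->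
  (forall a i j, (0 < i + j <= 2)%N -> F a i j p ^+ 2 <= T) ->
  (forall a i j, (i + j = 1)%N -> F a i j p ^+ 4 <= T) ->
  (forall u, tame (form_const M) T (xiD F xi q u) p /\ tame (form_const M) T (jxiD F J xi q u) p) /\
  ((forall b, (xi (colF F p) b 0 - q b 0) ^+ 2 <= comp_const M * T) ->
   forall u, small (form_const M) T (xiD F xi q u) p /\ small (form_const M) T (jxiD F J xi q u) p).
Proof.
move=> M1 T0 hJ hxi wr qM F2 F4.
have [K1 KM _] := comp_const_ge1 M1; set K := comp_const M in K1 KM *.
have tJ u b : tame K T (compD F (fun x => J x u b)) p.
  by have [h0 h1 h2] := hJ u b _ wr; exact: tame_comp.
have tX0 b : tame K T (compD F (fun x => xi x b 0)) p.
  by have [h0 h1 h2] := hxi b _ wr; exact: tame_comp.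
have tq b : tame K T (cstD (- q b 0)) p.
  apply: tame_cst => //; first by lra.
  apply: le_trans KM; rewrite -real_normK ?num_real// normrN.
  by rewrite ler_pXn2r ?nnegrE// (le_trans _ (qM b)).
have tX b : tame (blow K) T (xiD F xi q b) p by exact: tameD.
have B1 : 1 <= blow K by exact: le_trans (blow_ge K1).
have B2 : 1 <= blow (blow K) by exact: le_trans (blow_ge B1).
have KB := blow_ge K1; have KB2 := blow_ge B1.
have fE : form_const M = iter m (@blow R) (blow (blow K)).
  by rewrite /form_const -/K -!iterSr.
have BF : blow K <= form_const M.
  by rewrite fE; apply: le_trans (iter_blow_ge m B2).
have sz : size (index_enum 'I_m) = m by rewrite -[RHS](card_ord m) cardT enumT.
split => [u|hs u].
  split; first exact: tame_le BF (tX u).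
  rewrite fE -{1}sz; apply: tame_sum => // b; apply: tameM => //.
  exact: tame_le KB (tJ u b).
have sX b : small (blow K) T (xiD F xi q b) p.
  by apply: (small_le T0 KB); exact: hs.
split; first exact: small_le BF (sX u).
rewrite fE -{1}sz; apply: small_sum => // b; apply: smallM => //.
exact: tame_le KB (tJ u b).
Qed.

Lemma formD_all2 F J xi q (c r K T : R) p u v : `|c| = 1 -> 0 <= K -> 0 <= T ->
  (forall u, tame K T (xiD F xi q u) p /\ tame K T (jxiD F J xi q u) p) ->
  (forall u, small K T (xiD F xi q u) p /\ small K T (jxiD F J xi q u) p) ->
  all2 (64 * ((2 * pi) ^+ 4 * expR (2 * (c * (2 * pi)) * (p.1 + r)) * (K * T)))
    (formD F J xi q c r u v) p.
Proof.
move=> c1 K0 T0 ht hs; have KT : 0 <= K * T by exact: mulr_ge0.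
have kp : `|c * (2 * pi)| = 2 * pi.
  by rewrite normrM c1 mul1r ger0_norm// (le_trans _ two_pi_ge1).
have aX w : all2 (K * T) (xiD F xi q w) p.
  by have [h1 _] := ht w; have [h2 _] := hs w; exact: tame_all2.
have aJ w : all2 (K * T) (jxiD F J xi q w) p.
  by have [_ h1] := ht w; have [_ h2] := hs w; exact: tame_all2.
set B := _ * expR _.
have e1 c' : `|c'| <= 1 -> all2 B (ecD c' (c * (2 * pi)) r) p by move=> ?; exact: tens_exp_bound.
have e2 : all2 B (esD (c * (2 * pi)) r) p by apply: tens_exp_bound; rewrite ?normr1.
have -> : 64 * (B * (K * T)) = 4 * (16 * (B * (K * T))) by ring.
rewrite /formD; case: ifP => _; apply: all2D; apply: all2M => //; apply: e1;
  by rewrite ?normrN c1.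
Qed.

Lemma formD_value_bound F J xi q (c r K T : R) p u v : `|c| = 1 -> 0 <= K ->
  (forall u, tame K T (xiD F xi q u) p /\ tame K T (jxiD F J xi q u) p) ->
  formD F J xi q c r u v 0%N 0%N p ^+ 2 <=
  4 * ((2 * pi) ^+ 4 * expR (2 * (c * (2 * pi)) * (p.1 + r)) * K).
Proof.
move=> c1 K0 ht.
have kp : `|c * (2 * pi)| = 2 * pi.
  by rewrite normrM c1 mul1r ger0_norm// (le_trans _ two_pi_ge1).
set B := _ * expR _.
have e1 c' : `|c'| <= 1 -> ecD c' (c * (2 * pi)) r 0%N 0%N p ^+ 2 <= B.
  by move=> h; apply: (tens_exp_bound r 0 p h kp).
have e2 : esD (c * (2 * pi)) r 0%N 0%N p ^+ 2 <= B.
  by apply: (@tens_exp_bound 1 _ r (pi / 2) p _ kp) => //; rewrite normr1.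
have [[hX _ _] [hJ _ _]] := ht u.
have B0 : 0 <= B by apply: le_trans e2; exact: sqr_ge0.
have P (x y : R) : x ^+ 2 <= B -> y ^+ 2 <= K -> (x * y) ^+ 2 <= B * K.
  by move=> h1 h2; rewrite exprMn; apply: ler_pM => //; exact: sqr_ge0.
have S (x y : R) : x ^+ 2 <= B * K -> y ^+ 2 <= B * K -> (x + y) ^+ 2 <= 4 * (B * K).
  by move=> h1 h2; have := sqr_ge0 (x - y); nra.
rewrite /formD; case: ifP => _; apply: S; apply: P => //; apply: e1;
  by rewrite ?normrN c1.
Qed.

End FormFamilies.

(** * Comparison of the jets with the forms themselves *)

Section FormValues.
Variables (R : realType) (n : nat).
Local Notation vec := ('cV[R]_(n.*2)).
Implicit Types (F : 'I_(n.*2) -> nat -> nat -> R * R -> R) (J : vec -> 'M[R]_(n.*2)).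

Let addE k l (A B : 'M[R]_(k, l)) i j : (A + B) i j = A i j + B i j.
Proof. by rewrite mxE. Qed.

Let oppE k l (A : 'M[R]_(k, l)) i j : (- A) i j = - A i j.
Proof. by rewrite mxE. Qed.

Let scaleE k l c (A : 'M[R]_(k, l)) i j : (c *: A) i j = c * A i j.
Proof. by rewrite mxE. Qed.

Let cexp_entry (Jw : 'M[R]_(n.*2)) a th (x : vec) u v : Jw *m Jw = - 1%:M ->
  cexp_scale Jw a th (tens_ds_idt Jw x) u v =
  if (v == 0 :> nat)%N then expR a * cos th * x u 0 + expR a * sin th * (Jw *m x) u 0
  else - (expR a * cos th) * (Jw *m x) u 0 + expR a * sin th * x u 0.
Proof.
move=> JJ; rewrite /cexp_scale /tens_ds_idt mul_mx_row mulmxN mulmxA JJ mulNmx mul1mx opprK.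
rewrite scaleE addE !scaleE.
by case: (split_ordP v) => k ->; rewrite [k]ord1 /= ?row_mxEl ?row_mxEr ?oppE; ring.
Qed.

Let formD_value F J xi (q : vec) c r u v p :
  formD F J xi q c r u v 0%N 0%N p =
  let e := expR (c * (2 * pi) * (p.1 + r)) in
  let w := colF F p in
  if (v == 0 :> nat)%N
  then c * e * cos (2 * pi * p.2) * (xi w - q) u 0 - e * sin (2 * pi * p.2) * (J w *m (xi w - q)) u 0
  else - (c * e * cos (2 * pi * p.2)) * (J w *m (xi w - q)) u 0 - e * sin (2 * pi * p.2) * (xi w - q) u 0.
Proof.
have X w : xiD F xi q w 0%N 0%N p = (xi (colF F p) - q) w 0.
  by rewrite /xiD /sumD /compD /cstD/= !mxE.
have JX w : jxiD F J xi q w 0%N 0%N p = (J (colF F p) *m (xi (colF F p) - q)) w 0.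
  by rewrite /jxiD mxE; apply: eq_bigr => b _; rewrite /prodD X.
have E0 c' k : ecD c' k r 0%N 0%N p = c' * expR (k * (p.1 + r)) * cos (2 * pi * p.2).
  by rewrite /ecD /tensD /expF /cosF !expr0 !mul1r mul0r !addr0.
have E1 k : esD k r 0%N 0%N p = - (expR (k * (p.1 + r)) * sin (2 * pi * p.2)).
  by rewrite /esD /tensD /expF /cosF !expr0 !mul1r mul0r !addr0 cosDpihalf mulrN.
by rewrite /formD/=; case: ifP => _; rewrite /sumD /prodD X JX E0 E1; ring.
Qed.

Lemma formD_plus F J xi (q : vec) r u v p : (forall x, J x *m J x = - 1%:M) ->
  formD F J xi q 1 r u v 0%N 0%N p =
  dzbar_plus (J (colF F p)) (xi (colF F p) - q) (p.1 + r, p.2) u v.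
Proof.
move=> JJ; rewrite formD_value /dzbar_plus cexp_entry//= cosN sinN !mul1r.
by case: ifP => _; ring.
Qed.

Lemma formD_minus F J xi (q : vec) r u v p : (forall x, J x *m J x = - 1%:M) ->
  formD F J xi q (-1) r u v 0%N 0%N p =
  dzbar_minus (J (colF F p)) (xi (colF F p) - q) (p.1 + r, p.2) u v.
Proof.
move=> JJ; rewrite formD_value /dzbar_minus [RHS]mxE cexp_entry//= !mulN1r.
have -> : - (2 * pi) * (p.1 + r) = - (2 * pi * (p.1 + r)) by ring.
by case: ifP => _; ring.
Qed.

Lemma dzbar_plusB (Jw : 'M[R]_(n.*2)) x y p : Jw *m Jw = - 1%:M ->
  dzbar_plus Jw (x - y) p = dzbar_plus Jw x p - dzbar_plus Jw y p.
Proof.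
move=> JJ; apply/matrixP => u v; rewrite /dzbar_plus addE oppE !cexp_entry//.
by case: ifP => _; rewrite mulmxBr !addE !oppE; ring.
Qed.

Lemma dzbar_minusB (Jw : 'M[R]_(n.*2)) x y p : Jw *m Jw = - 1%:M ->
  dzbar_minus Jw (x - y) p = dzbar_minus Jw x p - dzbar_minus Jw y p.
Proof.
move=> JJ; apply/matrixP => u v; rewrite /dzbar_minus addE !oppE !cexp_entry//.
by case: ifP => _; rewrite mulmxBr !addE !oppE; ring.
Qed.

End FormValues.

(** * Weighted energies of weak jets *)

Section WeakEnergy.
Variable R : realType.
Local Notation RR := (measurableTypeR R).
Local Notation mu := (@lebesgue_measure R).
Local Notation leb2 := (@leb2 R).
Implicit Types (D : nat -> nat -> R * R -> R) (f g : R * R -> R).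

(** The difference f - g is a weak s-derivative of the zero function, so it vanishes on almost every
    line. This is needed because the competitors in [sob_norm] may have an order-zero term that
    differs from f on a null set. *)
Lemma tens_weak00_ae (B : nat -> R -> R) a b f g : dfamily B ->
  (forall y, 1 <= y -> B 0%N y = 1) -> (forall y, y <= -1 -> B 0%N y = 0) ->
  tens_weak a b 0 0 f g -> forall x1 x2, a < x1 -> x2 < b ->
  ae_eq leb2 (rect x1 x2 0 1) (EFin \o f) (EFin \o g).
Proof.
move=> dB B1 B0 [fi gi H].
have c0 : strip_cont a b (fun=> 0) by move=> s t _; exact: cvg_cst.
have di : strip_int a b (fun p => f p - g p).
  by move=> x1 x2 ax xb; apply: integrable_funB; [exact: measurable_rect|exact: fi|exact: gi].
have W : tens_weak a b 1 0 (fun=> 0) (fun p => f p - g p).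
  split => [||F G x1 x2 dF dG ax xb F0 pG]; [exact: strip_cont_int|exact: di|].
  have -> : \int[leb2]_(p in rect x1 x2 0 1) (0 * (F 1%N p.1 * G 0%N p.2)) = 0.
    by under eq_Rintegral do rewrite mul0r; rewrite /Rintegral integral0.
  have := H F G x1 x2 dF dG ax xb F0 pG; rewrite expr0 mul1r => e.
  rewrite (_ : \int[leb2]_(p in _) _ = 0) ?mulr0//.
  under eq_Rintegral do rewrite mulrBl.
  rewrite RintegralB ?e ?subrr//; first exact: measurable_rect.
    exact: (strip_int_tens 0 0 fi dF dG ax xb).
  exact: (strip_int_tens 0 0 gi dF dG ax xb).
have A := tens_ac_s dB B1 B0 W c0.
move=> x1 x2 ax xb; apply: ae_eq_slice2; [exact: measurable_itv|exact: measurable_itv|exact: fi|exact: gi|].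
apply: (@filterS3 _ _ (ae_filter_ringOfSetsType mu) _ _ _ _ _ (ae_neq (0 : R)) (ae_neq (1 : R)) A).
move=> t t0 t1 ht; rewrite /= in_itv/= => /andP[tt0 tt1].
have tt : 0 < t < 1.
  by rewrite !lt_neqAle tt0 tt1 eq_sym !andbT; apply/andP; split; apply/eqP.
have /= K := @ac1_derive_ae _ a b (fun=> 0) (fun=> 0) (fun x => f (x, t) - g (x, t))
  (fun x _ => is_derive_cst (0 : R) x 1) (fun x _ => @cst_continuous _ _ (0 : R) x) (ht tt).
apply: (@filterS _ _ (ae_filter_ringOfSetsType mu) _ _ _ K) => x h.
rewrite /= in_itv/= => /andP[h1 h2].
by apply/eqP; rewrite -subr_eq0 -h// (lt_le_trans ax)// (le_lt_trans h2).
Qed.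

(** The weight is e^(k s), with no absolute value: s has a constant sign on each end, where k s = 2
    delta |s|, and k = 0 on the neck. *)
Record wen (a b k E : R) D : Prop := Wen {
  wen_weak : weak2 a b D;
  wen_bint : forall i j, (i + j <= 2)%N -> forall x1 x2, a < x1 -> x2 < b ->
    bint (rect x1 x2 0 1) E (fun p => expR (k * p.1) * D i j p ^+ 2) }.

Lemma bint_mono S A A' f g : measurable S -> A <= A' ->
  measurable_fun S (f : RR * RR -> R) -> (forall p, 0 <= f p) ->
  (forall p, S p -> f p <= g p) -> bint S A g -> bint S A' f.
Proof.
move=> mS AA mf f0 fg [mg g0 gA]; split => //.
apply: (@le_trans _ _ A%:E); last by rewrite lee_fin.
apply: le_trans gA; apply: ge0_le_integralT => //.
- by move=> p _; rewrite lee_fin.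
- by move=> p _; rewrite lee_fin.
Qed.

Lemma exp_weight_meas (k x1 x2 : R) :
  measurable_fun (rect x1 x2 0 1 : set (RR * RR)) (fun p => expR (k * p.1)).
Proof.
apply: cont_rect_measurable => x y _ _.
apply: (@cvg_comp _ _ _ fst (fun z => expR (k * z)) _ (nbhs x)); first exact: cvg_fst.
apply: continuous_comp; last exact: continuous_expR.
by apply: cvgM; [exact: cvg_cst|exact: cvg_id].
Qed.

Lemma weight_sq_meas a b (k x1 x2 : R) f : strip_int a b f -> a < x1 -> x2 < b ->
  measurable_fun (rect x1 x2 0 1 : set (RR * RR)) (fun p => expR (k * p.1) * f p ^+ 2).
Proof.
move=> fi ax xb; apply: measurable_funM; first exact: exp_weight_meas.
by apply: measurable_funX; apply/measurable_EFinP; exact: measurable_int (fi _ _ ax xb).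
Qed.

Lemma weight_sq_ge0 (k : R) f p : 0 <= expR (k * p.1) * f p ^+ 2.
Proof. by rewrite mulr_ge0 ?expR_ge0// sqr_ge0. Qed.

Let sq2 (x y : R) : (x + y) ^+ 2 <= 2 * x ^+ 2 + 2 * y ^+ 2.
Proof. by have := sqr_ge0 (x - y); nra. Qed.

Lemma weak2_int a b D i j : weak2 a b D -> (i + j <= 2)%N -> strip_int a b (D i j).
Proof. by move=> H /H[]. Qed.

Lemma wenD a b k E1 E2 D1 D2 : wen a b k E1 D1 -> wen a b k E2 D2 ->
  wen a b k (2 * E1 + 2 * E2) (fun i j p => D1 i j p + D2 i j p).
Proof.
move=> [w1 e1] [w2 e2]; have w := weak2D w1 w2; split => // i j ij x1 x2 ax xb.
have mr := measurable_rect x1 x2 0 1.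
apply: (bint_mono mr (lexx _) _ _ _ (bintD mr (bintZ mr _ (e1 i j ij _ _ ax xb))
  (bintZ mr _ (e2 i j ij _ _ ax xb)))) => //.
- exact: (weight_sq_meas k (weak2_int w ij) ax xb).
- by move=> p; exact: (weight_sq_ge0 k (fun p => D1 i j p + D2 i j p)).
- move=> p _; have := ler_wpM2l (expR_ge0 (k * p.1)) (sq2 (D1 i j p) (D2 i j p)).
  by rewrite mulrDr !(mulrCA (expR _) 2).
Qed.

Lemma wen_ext a b k E D D' : (forall i j, D i j =1 D' i j) -> wen a b k E D -> wen a b k E D'.
Proof.
by move=> h; have -> : D = D' by apply/funext => i; apply/funext => j; apply/funext => p; exact: h.
Qed.

Lemma wen_shift a b k E D r : (forall s, a < s < b -> 0 <= k * s) -> wen a b k E D ->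
  wen (a + r) (b + r) 0 E (fun i j p => D i j (p.1 - r, p.2)).
Proof.
move=> k0 [w e]; have w' := weak2_shift r w; split => // i j ij x1 x2 ax xb.
have ax' : a < x1 - r by rewrite ltrBrDr.
have xb' : x2 - r < b by rewrite ltrBlDr.
have mr := measurable_rect (x1 - r) (x2 - r) 0 1.
split.
- exact: (weight_sq_meas 0 (weak2_int w' ij) ax xb).
- by move=> p; rewrite mulr_ge0 ?expR_ge0// sqr_ge0.
have [m1 p1 b1] := e i j ij _ _ ax' xb'.
apply: le_trans b1; rewrite -(shift2_rect r x1 x2 0 1).
have m2 : measurable_fun (rect (x1 - r) (x2 - r) 0 1 : set (RR * RR)) (fun p => (D i j p ^+ 2)%:E).
  apply/measurable_EFinP; apply: measurable_funX; apply/measurable_EFinP.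
  exact: measurable_int (weak2_int w ij ax' xb').
rewrite (_ : \int[leb2]_(p in _) _ = \int[leb2]_(p in rect (x1 - r) (x2 - r) 0 1) (D i j p ^+ 2)%:E)%E.
  apply: ge0_le_integralT => //.
  - by move=> p _; rewrite lee_fin sqr_ge0.
  - by move=> p _; rewrite lee_fin.
  move=> p [/=]; rewrite in_itv/= => /andP[h1 h2] _; rewrite lee_fin ler_peMl ?sqr_ge0//.
  by rewrite -expR0 ler_expR; apply: k0; rewrite (lt_le_trans ax')// (le_lt_trans h2).
rewrite -(ge0_integral_shift2 (- r) mr m2); last by move=> p _; rewrite lee_fin sqr_ge0.
by apply: eq_integral => -[x y] _ /=; rewrite mul0r expR0 mul1r.
Qed.

Lemma wen_leib a b E D (B : nat -> R -> R) M : dfamily B -> 0 <= M ->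
  (forall l s, (l <= 2)%N -> a < s < b -> B l s ^+ 2 <= M) -> wen a b 0 E D ->
  wen a b 0 (22 * (M * E)) (leibD B D).
Proof.
move=> dB M0 hB [w e]; have w' := weak2_leib dB w; split => // i j ij x1 x2 ax xb.
have mr := measurable_rect x1 x2 0 1.
(* The terms with l + j > 2 do not occur in the jet; [D 0 j] fills their places so that one bound
   serves all cases. *)
pose D' l := if (l + j <= 2)%N then D l j else D 0%N j.
have ij' : (0 + j <= 2)%N by apply: leq_trans ij; rewrite leq_add2r.
have eD l : bint (rect x1 x2 0 1) E (fun p => expR (0 * p.1) * D' l p ^+ 2).
  by rewrite /D'; case: ifP => lj; exact: e.
have b0 l (c : R) (c0 : 0 <= c) := bintZ mr c0 (eD l).
(* The worst case is the second s-derivative: splitting its three terms two at a time gives the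
   factors 4, 4 and 2, and the middle one also carries 2^2; hence 4 + 16 + 2 = 22. *)
have M2 : 0 <= 2 * M by lra. have M4 : 0 <= 4 * M by lra. have M16 : 0 <= 16 * M by lra.
have := bintD mr (bintD mr (b0 0%N _ M4) (b0 1%N _ M16)) (b0 2%N _ M2).
apply: bint_mono => //.
- by lra.
- exact: (weight_sq_meas 0 (weak2_int w' ij) ax xb).
- by move=> p; exact: weight_sq_ge0.
move=> [s t] [/=]; rewrite in_itv/= => /andP[h1 h2] _.
have ss : a < s < b by rewrite (lt_le_trans ax)// (le_lt_trans h2).
rewrite mul0r expR0 !mul1r.
have B0 := hB 0%N s isT ss; have B1 := hB 1%N s isT ss; have B2 := hB 2%N s isT ss.
have P (x y : R) : x ^+ 2 <= M -> (x * y) ^+ 2 <= M * y ^+ 2.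
  by move=> h; rewrite exprMn; apply: ler_wpM2r => //; exact: sqr_ge0.
have q0 := mulr_ge0 M0 (sqr_ge0 (D' 0%N (s, t))).
have q1 := mulr_ge0 M0 (sqr_ge0 (D' 1%N (s, t))).
have q2 := mulr_ge0 M0 (sqr_ge0 (D' 2%N (s, t))).
have D'0 : D' 0%N = D 0%N j by rewrite /D' ij'.
rewrite -!mulrA; case: i ij => [|[|i]] ij /=.
- by rewrite -D'0; have := P _ (D' 0%N (s, t)) B0; lra.
- have D'1 : D' 1%N = D 1%N j by rewrite /D' ij.
  rewrite -D'0 -D'1; have := P _ (D' 0%N (s, t)) B1; have := P _ (D' 1%N (s, t)) B0.
  by have := sq2 (B 1%N s * D' 0%N (s, t)) (B 0%N s * D' 1%N (s, t)); lra.
case: i j ij @D' ij' eD b0 q0 q1 q2 D'0 => [|i] [|j] // _ D' _ _ _ q0 q1 q2 _.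
rewrite /D'/= in q0 q1 q2 *.
have := P _ (D 0%N 0%N (s, t)) B2; have := P _ (D 1%N 0%N (s, t)) B1; have := P _ (D 2%N 0%N (s, t)) B0.
have := sq2 (B 2%N s * D 0%N 0%N (s, t) + 2 * B 1%N s * D 1%N 0%N (s, t)) (B 0%N s * D 2%N 0%N (s, t)).
have := sq2 (B 2%N s * D 0%N 0%N (s, t)) (2 * B 1%N s * D 1%N 0%N (s, t)).
have -> : (2 * B 1%N s * D 1%N 0%N (s, t)) ^+ 2 = 4 * (B 1%N s * D 1%N 0%N (s, t)) ^+ 2 by ring.
by lra.
Qed.

(** Puts the function itself, and not an almost everywhere equal one, at order zero: continuity and
    pointwise identities refer to it. *)
Definition fix00 f D (i j : nat) : R * R -> R := if (i + j == 0)%N then f else D i j.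

Lemma wen_sob (B : nat -> R -> R) m n (A : set R) (a b k d E : R) (f : R * R -> 'M[R]_(m, n))
    (D : nat -> nat -> R * R -> 'M[R]_(m, n)) u v : dfamily B ->
  (forall y, 1 <= y -> B 0%N y = 1) -> (forall y, y <= -1 -> B 0%N y = 0) ->
  (forall s, a < s < b -> (A°) s /\ k * s = 2 * d * `|s|) ->
  (forall i j, (i + j <= 3)%N -> weak_partial A i j f (D i j)) ->
  (\int[leb2]_(p in A `*` `[0%R, 1%R]%classic)
      (jet_normsq 3 D p * expR (2 * d * `|p.1|))%:E <= E%:E)%E ->
  wen a b k E (fix00 (fun p => f p u v) (fun i j p => D i j p u v)).
Proof.
move=> dB B1 B0 hA wD hE.
have TW i j : (i + j <= 2)%N -> tens_weak a b i j (fun p => f p u v) (fun p => D i j p u v).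
  move=> ij; apply: weak_partial_tens (wD i j _); last exact: leq_trans ij _.
  by move=> s ss; have [] := hA s ss.
have W2 : weak2 a b (fix00 (fun p => f p u v) (fun i j p => D i j p u v)).
  move=> i j ij; rewrite /fix00 eqxx; case: ifP => [/eqP/eqP|_]; last exact: TW.
  rewrite addn_eq0 => /andP[/eqP -> /eqP ->]; have [fi _ _] := TW 0%N 0%N isT.
  by split => // F G x1 x2 _ _ _ _ _ _; rewrite expr0 mul1r.
split => // i j ij x1 x2 ax xb; split.
- exact: (weight_sq_meas k (weak2_int W2 ij) ax xb).
- by move=> p; exact: weight_sq_ge0.
apply: le_trans hE.
apply: (@le_trans _ _ (\int[leb2]_(p in rect x1 x2 0 1) (expR (k * p.1) * D i j p u v ^+ 2)%:E)%E).
  rewrite /fix00; case: ifP => // /eqP/eqP; rewrite addn_eq0 => /andP[/eqP -> /eqP ->].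
  have [fi gi _] := TW 0%N 0%N isT.
  rewrite le_eqVlt; apply/orP; left; apply/eqP; apply: ae_eq_integral.
  - exact: measurable_rect.
  - by apply/measurable_EFinP; exact: (weight_sq_meas k fi ax xb).
  - by apply/measurable_EFinP; exact: (weight_sq_meas k gi ax xb).
  by apply: filterS (tens_weak00_ae dB B1 B0 (TW 0%N 0%N isT) ax xb) => p h /h /= [->].
apply: ge0_le_integralT => //.
- move=> [s t] [/=]; rewrite !in_itv/= => /andP[h1 h2] tt; split; rewrite /= ?in_itv//.
  by apply: interior_subset; have [] := hA s _; rewrite // (lt_le_trans ax)// (le_lt_trans h2).
- by move=> p _; rewrite lee_fin (weight_sq_ge0 k (fun p => D i j p u v)).
- by move=> p _; rewrite lee_fin mulr_ge0 ?expR_ge0// jet_normsq_ge0.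
move=> [s t] [/=]; rewrite !in_itv/= => /andP[h1 h2] tt.
have [] := hA s; first by rewrite (lt_le_trans ax)// (le_lt_trans h2).
move=> _ ->; rewrite lee_fin mulrC; apply: ler_wpM2r; first exact: expR_ge0.
by apply: jet_entry; exact: leq_trans ij _.
Qed.

Lemma wen_ac2 (B : nat -> R -> R) a b k E D Ws Wt : dfamily B ->
  (forall y, 1 <= y -> B 0%N y = 1) -> (forall y, y <= -1 -> B 0%N y = 0) ->
  wen a b k E D ->
  (forall s t, a < s < b -> D 0%N 0%N (s, t + 1) = D 0%N 0%N (s, t)) ->
  strip_cont a b (D 0%N 0%N) -> strip_cont a b Ws -> strip_cont a b Wt ->
  (forall s t : R, a < s < b -> is_derive s 1 (fun x => D 0%N 0%N (x, t)) (Ws (s, t))) ->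
  (forall s t : R, a < s < b -> is_derive t 1 (fun y => D 0%N 0%N (s, y)) (Wt (s, t))) ->
  ac2 a b (jet2 (D 0%N 0%N) Ws Wt D) /\
  forall i j, (i + j <= 2)%N -> forall x1 x2, a < x1 -> x2 < b ->
    (\int[leb2]_(p in rect x1 x2 0 1)
       (expR (k * p.1) * jet2 (D 0%N 0%N) Ws Wt D i j p ^+ 2)%:E <= E%:E)%E.
Proof.
move=> dB B1 B0 [w e] per c0 cs ct ds dt.
have [H1 H2] := weak2_ac2 dB B1 B0 w per c0 cs ct ds dt; split => // i j ij x1 x2 ax xb.
apply: le_trans (bint_le (e i j ij _ _ ax xb)); rewrite le_eqVlt; apply/orP; left; apply/eqP.
apply: ae_eq_integral.
- exact: measurable_rect.
- by apply/measurable_EFinP; exact: (weight_sq_meas k (ac2_int H1 ij) ax xb).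
- by apply/measurable_EFinP; exact: (weight_sq_meas k (weak2_int w ij) ax xb).
by apply: filterS (H2 _ _ ax xb i j ij) => p h /h /= [->].
Qed.

End WeakEnergy.

(** * Classical first derivatives on a strip *)

Section ClassicalDerivatives.
Variable R : realType.
Implicit Types f g : R * R -> R.

Record c1strip (a b : R) f fs ft : Prop := C1strip {
  c1_cont : strip_cont a b f;
  c1_conts : strip_cont a b fs;
  c1_contt : strip_cont a b ft;
  c1_ds : forall s t : R, a < s < b -> is_derive s 1 (fun x => f (x, t)) (fs (s, t));
  c1_dt : forall s t : R, a < s < b -> is_derive t 1 (fun y => f (s, y)) (ft (s, t)) }.

Lemma c1strip_sub a b a' b' f fs ft : a <= a' -> b' <= b -> c1strip a b f fs ft ->
  c1strip a' b' f fs ft.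
Proof.
move=> aa bb [h1 h2 h3 h4 h5].
have S s : a' < s < b' -> a < s < b.
  by move=> /andP[k1 k2]; rewrite (le_lt_trans aa)// (lt_le_trans k2).
split; [exact: (fun s t ss => h1 s t (S s ss))|exact: (fun s t ss => h2 s t (S s ss))
  |exact: (fun s t ss => h3 s t (S s ss))|exact: (fun s t ss => h4 s t (S s ss))
  |exact: (fun s t ss => h5 s t (S s ss))].
Qed.

Let near_strip (a b s t : R) : a < s < b -> \forall p \near (s, t), a < p.1 < b.
Proof.
move=> ss; have U : \forall x \near s, a < x < b.
  by move/andP: ss => [h1 h2]; apply: filterS2 (lt_nbhsr h1) (lt_nbhsl h2) => x -> ->.
exact: (cvg_fst (G := nbhs t) U).
Qed.

Lemma strip_cont_eq a b f g : (forall p, a < p.1 < b -> f p = g p) -> strip_cont a b f ->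
  strip_cont a b g.
Proof.
move=> fg cf s t ss; have -> : {for (s, t), continuous g} = (g p @[p --> (s, t)] --> f (s, t)).
  by rewrite /prop_for/= /continuous_at fg.
apply: cvg_trans (cf s t ss); apply: near_eq_cvg.
by apply: filterS (near_strip t ss) => p pp; rewrite fg.
Qed.

Lemma c1strip_eq a b f g fs ft : (forall p, a < p.1 < b -> f p = g p) ->
  c1strip a b f fs ft -> c1strip a b g fs ft.
Proof.
move=> fg [h1 h2 h3 h4 h5]; split => //; first exact: strip_cont_eq h1.
- move=> s t ss; apply: near_eq_is_derive (h4 s t ss).
  have /andP[k1 k2] := ss; apply: filterS2 (lt_nbhsr k1) (lt_nbhsl k2) => x xa xb.
  by apply: fg; rewrite /= xa.
- move=> s t ss; have -> : (fun y => g (s, y)) = (fun y => f (s, y)).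
    by apply/funext => y; rewrite fg.
  exact: h5.
Qed.

Lemma c1strip_shift a b f fs ft r : c1strip a b f fs ft ->
  c1strip (a - r) (b - r) (cyl_shift r f) (cyl_shift r fs) (cyl_shift r ft).
Proof.
move=> [h1 h2 h3 h4 h5].
have S s : a - r < s < b - r -> a < s + r < b by rewrite ltrBlDr ltrBrDr.
have C g : strip_cont a b g -> strip_cont (a - r) (b - r) (cyl_shift r g).
  move=> cg s t /S ss; apply: (@cvg_comp _ _ _ (fun p : R * R => (p.1 + r, p.2)) g _ _ _ _ (cg (s + r) t ss)).
  apply: cvg_pair2; last exact: cvg_snd.
  by apply: cvgD; [exact: cvg_fst|exact: cvg_cst].
split; [exact: C|exact: C|exact: C| |]; last first.
  by move=> s t /S ss; have := h5 (s + r) t ss.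
move=> s t /S ss; rewrite -[cyl_shift r fs (s, t)]mulr1.
apply: (@is_derive1_comp _ (fun x => f (x, t)) (fun x => x + r)); first exact: h4.
by apply: is_derive_eq; rewrite addr0.
Qed.

Lemma c1strip_addc a b f fs ft (c : R) : c1strip a b f fs ft ->
  c1strip a b (fun p => f p + c) fs ft.
Proof.
move=> [h1 h2 h3 h4 h5]; split => //.
- by move=> s t ss; apply: cvgD; [exact: h1|exact: cvg_cst].
- by move=> s t ss; have d := h4 s t ss; rewrite -[fs (s, t)]addr0; exact: is_deriveD.
- by move=> s t ss; have d := h5 s t ss; rewrite -[ft (s, t)]addr0; exact: is_deriveD.
Qed.

(** The continuous extension of the differential coincides with it in the interior, which gives
    continuous first partial derivatives there; the two columns of [dmap] are the s- and
    t-derivatives. *)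
Lemma cyl_C1_strip m rho (w : R * R -> 'cV[R]_m) u : cyl_C1 `[- rho, rho] w ->
  c1strip (- rho) rho (fun p => w p u 0)
    (fun p => dmap w p u (lshift 1 ord0)) (fun p => dmap w p u (rshift 1 ord0)).
Proof.
rewrite /cyl_C1 !interior_itv; move=> [cw dw [g cg gE]].
have W (V : topologicalType) (h : R * R -> V) s t : - rho < s < rho ->
    {within `[- rho, rho]%classic `*` [set: R], continuous h} -> {for (s, t), continuous h}.
  move=> ss ch; have I : (`[- rho, rho]%classic `*` [set: R])° (s, t).
    apply: filterS (near_strip t ss) => -[x y] /= /andP[h1 h2]; split => //=.
    by rewrite in_itv/= !ltW.
  by have := ch (s, t); rewrite /prop_for/= /continuous_at -(nbhs_subspace_interior I).
have dE p : - rho < p.1 < rho -> dmap w p = g p by move=> pp; apply: gE; rewrite /= in_itv.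
have C1 v : strip_cont (- rho) rho (fun p => dmap w p u v).
  apply: (@strip_cont_eq _ _ (fun p => g p u v)) => [p pp|s t ss]; first by rewrite dE.
  apply/cvgrPdist_le => e e0.
  have /cvgrPdist_le/(_ e e0) := W _ _ s t ss cg; apply: filterS => q; apply: le_trans.
  rewrite [leRHS]/Num.Def.normr/= mx_normrE.
  have := le_bigmax 0 (fun k : 'I_m * 'I_(1 + 1) => `|(g (s, t) - g q) k.1 k.2|) (u, v).
  by rewrite /= !mxE.
have D v s t : - rho < s < rho -> derivable w (s, t) v /\ 'D_v (fun p => w p u 0) (s, t) = ('D_v w (s, t)) u 0.
  move=> ss; have dv : derivable w (s, t) v.
    by apply: diff_derivable; apply: dw; rewrite /= in_itv.
  by split => //; rewrite derive_mx// mxE.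
split; [|exact: C1|exact: C1| |].
- move=> s t ss; apply/cvgrPdist_le => e e0.
  have /cvgrPdist_le/(_ e e0) := W _ _ s t ss cw; apply: filterS => q; apply: le_trans.
  rewrite [leRHS]/Num.Def.normr/= mx_normrE.
  have := le_bigmax 0 (fun k : 'I_m * 'I_1 => `|(w (s, t) - w q) k.1 k.2|) (u, 0).
  by rewrite /= !mxE.
- move=> s t ss; have [d e] := D ((1, 0) : R * R) s t ss.
  rewrite /dmap row_mxEl; split; last by rewrite -e slice1E.
  by move/derivable_mxP : d => /(_ u 0); rewrite slice1E.
- move=> s t ss; have [d e] := D ((0, 1) : R * R) s t ss.
  rewrite /dmap row_mxEr; split; last by rewrite -e slice2E.
  by move/derivable_mxP : d => /(_ u 0); rewrite slice2E.
Qed.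

Lemma derive_shift (W : normedModType R) (f : R * R -> W) r v p :
  'D_v (cyl_shift r f) p = 'D_v f (p.1 + r, p.2).
Proof.
have e : (fun h : R => h^-1 *: ((cyl_shift r f \o shift p) (h *: v) - cyl_shift r f p)) =
    (fun h : R => h^-1 *: ((f \o shift (p.1 + r, p.2)) (h *: v) - f (p.1 + r, p.2))).
  by apply/funext => h /=; congr (_ *: (f _ - _)); congr pair; rewrite /= addrA.
by rewrite /derive e.
Qed.

Lemma dbar_shift n (J : 'cV[R]_(n.*2) -> 'M[R]_(n.*2)) r w p :
  dbar J (cyl_shift r w) p = dbar J w (p.1 + r, p.2).
Proof. by rewrite /dbar /dmap !derive_shift. Qed.

End ClassicalDerivatives.

(** * The estimates on the ends and on the neck *)

Section CoreEstimates.
Variables (R : realType) (m : nat).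
Local Notation RR := (measurableTypeR R).
Local Notation mu := (@lebesgue_measure R).
Local Notation leb2 := (@leb2 R).
Implicit Types (F : 'I_m -> nat -> nat -> R * R -> R) (J : 'cV[R]_m -> 'M[R]_m)
  (xi : 'cV[R]_m -> 'cV[R]_m) (c : 'cV[R]_m).

Lemma leb2_rect (x1 x2 : R) : x1 <= x2 -> (leb2 (rect x1 x2 0 1) = (x2 - x1)%:E)%E.
Proof.
move=> x12; rewrite /leb2 /rect product_measure1E ?measurable_itv//.
rewrite /= !lebesgue_measure_itv/= !lte_fin ltr01 oppr0 adde0 mule1.
by case: ltP => // x21; rewrite (le_anti (introT andP (conj x12 x21))) subrr.
Qed.

Lemma theta_parts (D : nat -> nat -> R * R -> R) p : [/\ 0 <= theta D p,
  forall i j, (i + j <= 2)%N -> D i j p ^+ 2 <= theta D p &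
  forall i j, (i + j = 1)%N -> D i j p ^+ 4 <= theta D p].
Proof.
have h (x : R) := sqr_ge0 x; have e4 (x : R) : x ^+ 4 = (x ^+ 2) ^+ 2 by rewrite -exprM.
have h00 := h (D 0%N 0%N p); have h10 := h (D 1%N 0%N p); have h01 := h (D 0%N 1%N p).
have h20 := h (D 2%N 0%N p); have h11 := h (D 1%N 1%N p); have h02 := h (D 0%N 2%N p).
have k10 := h (D 1%N 0%N p ^+ 2); have k01 := h (D 0%N 1%N p ^+ 2).
rewrite -!e4 in k10 k01; rewrite /theta; split; first by lra.
- by case=> [|[|[|i]]]; case=> [|[|[|j]]] // _; lra.
- by case=> [|[|i]]; case=> [|[|j]] // _; lra.
Qed.

(** F is the jet of w - c, whose weighted energy is finite; [shiftF] is the jet of w, to which J and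
    xi are applied. *)
Definition shiftF F c (a : 'I_m) := sumD (F a) (cstD (c a 0)).

Definition Theta F p : R := \sum_a theta (F a) p.

Lemma Theta_ge0 F p : 0 <= Theta F p.
Proof. by apply: sumr_ge0 => a _; have [] := theta_parts (F a) p. Qed.

Lemma theta_le_Theta F a p : theta (F a) p <= Theta F p.
Proof.
rewrite /Theta (bigD1 a)//= lerDl; apply: sumr_ge0 => b _.
by have [] := theta_parts (F b) p.
Qed.

Lemma shiftF_high F c a i j p : (0 < i + j)%N -> shiftF F c a i j p = F a i j p.
Proof. by rewrite /shiftF /sumD /cstD => /prednK <-; rewrite addr0. Qed.

Lemma shiftF_bounds F c T p : Theta F p <= T ->
  (forall a i j, (0 < i + j <= 2)%N -> shiftF F c a i j p ^+ 2 <= T) /\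
  (forall a i j, (i + j = 1)%N -> shiftF F c a i j p ^+ 4 <= T).
Proof.
move=> hT; split => a i j ij.
  have /andP[ij0 ij2] := ij; rewrite shiftF_high//; have [_ h _] := theta_parts (F a) p.
  exact: le_trans (h _ _ ij2) (le_trans (theta_le_Theta F a p) hT).
rewrite shiftF_high ?ij//; have [_ _ h] := theta_parts (F a) p.
exact: le_trans (h _ _ ij) (le_trans (theta_le_Theta F a p) hT).
Qed.

Lemma ac2_shiftF a b F c i : ac2 a b (F i) -> ac2 a b (shiftF F c i).
Proof. by move=> h; apply: ac2D => //; exact: ac2_cst. Qed.

Lemma bint_Theta a b F (M k E x1 x2 : R) : (forall i, ac2 a b (F i)) ->
  (forall i p, a < p.1 < b -> `|F i 0%N 0%N p| <= M) -> a < x1 -> x1 + 1 <= x2 -> x2 < b ->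
  (forall u i j, (i + j <= 2)%N ->
    (\int[leb2]_(p in rect x1 x2 0 1) (expR (k * p.1) * F u i j p ^+ 2)%:E <= E%:E)%E) ->
  bint (rect x1 x2 0 1) (m%:R * (theta_const M k * E)) (fun p => expR (k * p.1) * Theta F p).
Proof.
move=> HF FM ax x12 xb hE.
have := bint_sum (measurable_rect x1 x2 0 1)
  (fun i => bint_theta (HF i) (FM i) ax x12 xb (hE i)).
by apply: bint_ext => p; rewrite /Theta mulr_sumr.
Qed.

Definition end_const (M M0 k E : R) : R :=
  7 * (m%:R * (2 * (64 * ((2 * pi) ^+ 4 * form_const m M) * (m%:R * (theta_const M0 k * E))))).

Lemma form_const_ge0 (M : R) : 1 <= M -> 0 <= form_const m M.
Proof.
move=> M1; have [K1 _ _] := comp_const_ge1 m M1.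
by apply: le_trans (iter_blow_ge m.+2 K1); lra.
Qed.

(* The weight e^(4 pi |s|) of the norm cancels |dzbar|^2. *)
Lemma end_estimate (a b s d r M M0 E : R) (A : set R) F J xi c (f : R * R -> 'M[R]_(m, 1 + 1)) :
  `|s| = 1 -> a + 1 < b -> A° = [set x | a < x < b] ->
  (forall x, a < x < b -> s * x = - `|x|) ->
  1 <= M -> smooth J -> smooth xi ->
  (forall u v, C2bound r M (fun x => J x u v)) -> (forall u, C2bound r M (fun x => xi x u 0)) ->
  (forall i, ac2 a b (F i)) -> (forall i p, a < p.1 < b -> `|F i 0%N 0%N p| <= M0) ->
  (forall p, a < p.1 < b -> cube r (colF (shiftF F c) p)) -> cube r c ->
  (forall u i j, (i + j <= 2)%N -> forall x1 x2, a < x1 -> x2 < b ->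
    (\int[leb2]_(p in rect x1 x2 0 1) (expR (- (2 * d * s) * p.1) * F u i j p ^+ 2)%:E <= E%:E)%E) ->
  (forall p u v, a < p.1 < b -> f p u v = formD (shiftF F c) J xi (xi c) s 0 u v 0%N 0%N p) ->
  (sob_norm 2 (2 * pi + d) A f <= (end_const M M0 (- (2 * d * s)) E `^ 2^-1)%:E)%E.
Proof.
move=> s1 ab AE sx M1 sJ sxi hJ hxi HF FM wr cr hE fE.
have K0 := form_const_ge0 M1.
set K := form_const m M in K0 *; set k := - (2 * d * s) in hE *.
pose G := 64 * ((2 * pi) ^+ 4 * K) : R.
have G0 : 0 <= G by rewrite mulr_ge0// mulr_ge0// exprn_ge0// mulr_ge0// pi_ge0.
pose g p := G * (expR (k * p.1) * Theta F p).
apply: (@sob_norm_le _ _ _ A a b _ _ f (fun u v => formD (shiftF F c) J xi (xi c) s 0 u v) g) => //.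
- by move=> u v; apply: ac2_formD => // i; exact: ac2_shiftF.
- move=> p pp; split; first by rewrite mulr_ge0// mulr_ge0 ?expR_ge0// Theta_ge0.
  move=> u v; have [F2 F4] := shiftF_bounds c (lexx (Theta F p)).
  have xicM b' : `|xi c b' 0| <= M by have [] := hxi b' _ cr.
  have [ht hs] := formD_tame (q := xi c) M1 (Theta_ge0 F p) hJ hxi (wr p pp) xicM F2 F4.
  have {}hs := hs _; have hsm : forall u, small K (Theta F p) (xiD (shiftF F c) xi (xi c) u) p /\
      small K (Theta F p) (jxiD (shiftF F c) J xi (xi c) u) p.
    (* The value of xi(w) - xi(c) is Lipschitz in w - c, whose square is part of [Theta]: this makes
       the form small and not merely bounded. *)
    apply: hs => b'; have [_ _ Kc] := comp_const_ge1 m M1.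
    apply: le_trans (ler_wpM2r (Theta_ge0 F p) Kc).
    apply: (C2bound_lipschitz (smooth_entry b' 0 sxi) (hxi b') (wr p pp) cr (Theta_ge0 F p) M1).
    move=> i; rewrite mxE /shiftF /sumD /cstD/= mulr1n addrK.
    have [_ h _] := theta_parts (F i) p; apply: le_trans (theta_le_Theta F i p); exact: h.
  have := @formD_all2 _ _ (shiftF F c) J xi (xi c) s 0 K (Theta F p) p u v s1 K0 (Theta_ge0 F p) ht hsm.
  congr (all2 _ _ _); rewrite addr0 /g /G.
  (* The exponent of |dzbar|^2 is -4 pi |s|; it splits into the inverse of the weight of the norm
     and the weight e^(k s) of the energy. *)
  have -> : 2 * (s * (2 * pi)) * p.1 = - (2 * (2 * pi + d) * `|p.1|) + k * p.1.
    have e1 : s * p.1 = - `|p.1| by exact: sx.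
    have -> : 2 * (s * (2 * pi)) * p.1 = 4 * pi * (s * p.1) by ring.
    have -> : k * p.1 = - (2 * d) * (s * p.1) by rewrite /k; ring.
    by rewrite e1; ring.
  by rewrite expRD; ring.
have B x1 x2 : a < x1 -> x1 + 1 <= x2 -> x2 < b ->
    bint (rect x1 x2 0 1) (end_const M M0 k E) (fun p => 7 * (m%:R * ((1 + 1)%:R * g p))).
  move=> ax x12 xb; have mr := measurable_rect x1 x2 0 1.
  have BT := bint_Theta HF FM ax x12 xb (fun u i j ij => hE u i j ij x1 x2 ax xb).
  have c7 : 0 <= 7 * (m%:R * 2) * G by rewrite mulr_ge0// mulr_ge0// mulr_ge0.
  have := bintZ mr c7 BT; rewrite (_ : 7 * (m%:R * 2) * G * _ = end_const M M0 k E); last first.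
    by rewrite /end_const /G -/K; ring.
  by apply: bint_ext => p; rewrite /g; ring.
exact: bint_exhaust ab B.
Qed.

Let sq2 (x y X Y : R) : x ^+ 2 <= X -> y ^+ 2 <= Y -> (x + y) ^+ 2 <= 2 * X + 2 * Y.
Proof. by move=> hx hy; have := sqr_ge0 (x - y); nra. Qed.

Let dbl (X : R) : 2 * (4 * X) + 2 * (4 * X) <= 16 * X.
Proof. by lra. Qed.

(** Nothing is subtracted from xi on the neck, where the decay comes from dzbar alone. *)
Definition neckD F J (xip xim : 'cV[R]_m -> 'cV[R]_m) (gp gm : R * R -> R) (rho : R) u v :=
  sumD (prodD (fun i j => partial_st i j gp) (formD F J xip 0 1 (- rho) u v))
       (prodD (fun i j => partial_st i j gm) (formD F J xim 0 (-1) rho u v)).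

Lemma ac2_neckD F J xip xim (gp gm : R * R -> R) rho u v : smooth J -> smooth xip -> smooth xim ->
  smooth gp -> smooth gm ->
  (forall s t, -1 < s < 1 -> gp (s, t + 1) = gp (s, t)) ->
  (forall s t, -1 < s < 1 -> gm (s, t + 1) = gm (s, t)) ->
  (forall i, ac2 (-1) 1 (F i)) -> ac2 (-1) 1 (neckD F J xip xim gp gm rho u v).
Proof.
move=> sJ sp sm gps gms pp pm HF; apply: ac2D; apply: ac2M.
- exact: ac2_smooth.
- exact: ac2_formD.
- exact: ac2_smooth.
- exact: ac2_formD.
Qed.

(** That is e^(-4 pi (rho - 1)): the square of the exponential in dzbar at points of the neck, whose
    coordinate on either end has absolute value at least rho - 1. *)
Definition decay (rho : R) : R := expR (4 * pi) * expR (- (4 * pi * rho)).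

Let decay_bound (s rho x : R) : `|s| = 1 -> -1 < x < 1 ->
  expR (2 * (s * (2 * pi)) * (x + - (s * rho))) <= decay rho.
Proof.
move=> s1 /andP[x0 x1]; rewrite /decay -expRD ler_expR.
have ss : s * s = 1 by rewrite -expr2 -real_normK ?num_real// s1 expr1n.
have -> : 2 * (s * (2 * pi)) * (x + - (s * rho)) = 4 * pi * (s * x) - 4 * pi * rho * (s * s) by ring.
rewrite ss mulr1; apply: lerB => //; rewrite -[leRHS]mulr1; apply: ler_wpM2l.
  by rewrite mulr_ge0// pi_ge0.
apply: le_trans (ler_norm _) _; rewrite normrM s1 mul1r ler_norml; apply/andP; split; exact: ltW.
Qed.

Definition neck_const (M M0 E : R) : R :=
  7 * (m%:R * (2 * (64 * 64 * ((2 * pi) ^+ 4 * form_const m M) *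
    (2 + m%:R * (theta_const M0 0 * E))))).

Section Neck.
Variables (r M M0 E rho : R).
Variables (F : 'I_m -> nat -> nat -> R * R -> R) (J : 'cV[R]_m -> 'M[R]_m)
  (xip xim : 'cV[R]_m -> 'cV[R]_m) (c : 'cV[R]_m) (gp gm : R * R -> R).
Variable f : R * R -> 'M[R]_(m, 1 + 1).
Hypotheses (M1 : 1 <= M) (sJ : smooth J) (sp : smooth xip) (sm : smooth xim).
Hypotheses (hJ : forall u v, C2bound r M (fun x => J x u v))
  (hp : forall u, C2bound r M (fun x => xip x u 0)) (hm : forall u, C2bound r M (fun x => xim x u 0)).
Hypotheses (HF : forall i, ac2 (-1) 1 (F i))
  (wr : forall p, -1 < p.1 < 1 -> cube r (colF (shiftF F c) p)).
Hypotheses (sgp : smooth gp) (sgm : smooth gm)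
  (pgp : forall s t, -1 < s < 1 -> gp (s, t + 1) = gp (s, t))
  (pgm : forall s t, -1 < s < 1 -> gm (s, t + 1) = gm (s, t)).
Hypothesis fE : forall p u v, -1 < p.1 < 1 ->
  f p u v = neckD (shiftF F c) J xip xim gp gm rho u v 0%N 0%N p.

Let q0 (b : 'I_m) : `|(0 : 'cV[R]_m) b 0| <= M.
Proof. by rewrite mxE normr0; exact: le_trans ler01 M1. Qed.

Let K0 := form_const_ge0 M1.

Lemma neck_estimate (B : R) : 0 <= B ->
  (forall i p, -1 < p.1 < 1 -> `|F i 0%N 0%N p| <= M0) ->
  (forall u i j, (i + j <= 2)%N -> forall x1 x2, -1 < x1 -> x2 < 1 ->
    (\int[leb2]_(p in rect x1 x2 0 1) (expR (0 * p.1) * F u i j p ^+ 2)%:E <= E%:E)%E) ->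
  (forall p, -1 < p.1 < 1 -> all2 B (fun i j => partial_st i j gp) p /\
                             all2 B (fun i j => partial_st i j gm) p) ->
  (sob_norm 2 0 `[(-1)%R, 1%R]%classic f <= ((B * decay rho * neck_const M M0 E) `^ 2^-1)%:E)%E.
Proof.
move=> B0 FM hE hB; set K := form_const m M.
have [K1 KM _] := comp_const_ge1 m M1.
(* Without subtraction xi(w) is only bounded, so it is small relative to 1 + Theta; the additional
   constant is integrable because the neck has area 2. *)
pose T p : R := 1 + Theta F p.
have T0 p : 0 <= T p by rewrite addr_ge0// Theta_ge0.
have ThT p : Theta F p <= T p by rewrite lerDr.
have d0 : 0 <= decay rho by rewrite mulr_ge0 ?expR_ge0.
have P4 : 0 <= (2 * pi) ^+ 4 :> R by rewrite exprn_ge0// mulr_ge0// pi_ge0.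
pose G := 64 * 64 * ((2 * pi) ^+ 4 * K) * (B * decay rho) : R.
have KK : 0 <= K := K0.
have G0 : 0 <= G.
  by apply: mulr_ge0; [apply: mulr_ge0 => //; exact: mulr_ge0|exact: mulr_ge0].
pose g p := G * T p.
apply: (@sob_norm_le _ _ _ _ (-1) 1 _ _ f (neckD (shiftF F c) J xip xim gp gm rho) g) => //.
- by rewrite interior_itv; apply/seteqP; split => x /=; rewrite in_itv.
- by move=> u v; apply: ac2_neckD => // i; exact: ac2_shiftF.
- move=> p pp; split; first by rewrite mulr_ge0.
  move=> u v; rewrite mulr0 mul0r oppr0 expR0 mul1r.
  have [F2 F4] := shiftF_bounds c (ThT p); have [Bp Bm] := hB p pp.
  have form s (xi : 'cV[R]_m -> 'cV[R]_m) : `|s| = 1 -> (forall u, C2bound r M (fun x => xi x u 0)) ->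
      all2 (64 * ((2 * pi) ^+ 4 * decay rho * (K * T p))) (formD (shiftF F c) J xi 0 s (- (s * rho)) u v) p.
    move=> s1 hxi.
    have [ht hs] := formD_tame (q := 0) M1 (T0 p) hJ hxi (wr pp) q0 F2 F4.
    have hsm : forall u, small K (T p) (xiD (shiftF F c) xi 0 u) p /\
        small K (T p) (jxiD (shiftF F c) J xi 0 u) p.
      apply: hs => b'; rewrite [(0 : 'cV[R]_m) b' 0]mxE subr0.
      have [h0 _ _] := hxi b' _ (wr pp).
      apply: (@le_trans _ _ (comp_const m M)).
        by apply: le_trans KM; rewrite -real_normK ?num_real// ler_pXn2r ?nnegrE// (le_trans _ h0).
      rewrite ler_peMr ?(le_trans _ K1)// /T lerDl Theta_ge0//.
    have h := formD_all2 (- (s * rho)) u v s1 K0 (T0 p) ht hsm.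
    move=> i j ij; apply: le_trans (h i j ij) _; apply: ler_wpM2l => //.
    apply: ler_wpM2r; first by rewrite mulr_ge0.
    by apply: ler_wpM2l => //; exact: decay_bound.
  have Y0 : 0 <= 64 * ((2 * pi) ^+ 4 * decay rho * (K * T p)).
    by apply: mulr_ge0 => //; apply: mulr_ge0; exact: mulr_ge0.
  have f1 := form 1 xip (normr1 _) hp; have f2 := form (-1) xim (etrans (normrN _) (normr1 _)) hm.
  rewrite mul1r in f1; rewrite mulN1r opprK in f2.
  have := all2D (all2M Y0 Bp f1) (all2M Y0 Bm f2).
  by congr (all2 _ _ _); rewrite /g /G; ring.
have Bd x1 x2 : -1 < x1 -> x1 + 1 <= x2 -> x2 < 1 ->
    bint (rect x1 x2 0 1) (B * decay rho * neck_const M M0 E) (fun p => 7 * (m%:R * ((1 + 1)%:R * g p))).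
  move=> ax x12 xb; have mr := measurable_rect x1 x2 0 1.
  have BT := bint_Theta HF FM ax x12 xb (fun u i j ij => hE u i j ij x1 x2 ax xb).
  have B1 : bint (rect x1 x2 0 1) 2 (fun=> 1 : R).
    split => //; rewrite integral_cst// mul1e.
    have h : (leb2 (rect x1 x2 0 1) <= 2%:E)%E by rewrite leb2_rect ?lee_fin; lra.
    exact: h.
  have c7 : 0 <= 7 * (m%:R * 2) * G by rewrite mulr_ge0// mulr_ge0// mulr_ge0.
  have := bintZ mr c7 (bintD mr B1 BT).
  rewrite (_ : 7 * (m%:R * 2) * G * _ = B * decay rho * neck_const M M0 E); last first.
    by rewrite /neck_const /G -/K; ring.
  by apply: bint_ext => p; rewrite /g /T mul0r expR0 mul1r; ring.
by apply: bint_exhaust Bd; lra.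
Qed.

Definition value_const (M : R) : R := m%:R * (2 * (16 * ((2 * pi) ^+ 4 * form_const m M))).

(** Only values of the cut-offs enter, so no power of rho appears; that would spoil the rate e^(-2
    pi rho) of the L^2 norm. *)
Lemma neck_value p : -1 < p.1 < 1 -> `|gp p| <= 1 -> `|gm p| <= 1 ->
  normsq (f p) <= value_const M * decay rho.
Proof.
move=> pp gp1 gm1; set K := form_const m M.
pose T : R := Theta F p; have T0 : 0 <= T by exact: Theta_ge0.
have [F2 F4] := shiftF_bounds c (lexx T).
have sq1 (x y : R) : `|x| <= 1 -> (x * y) ^+ 2 <= y ^+ 2.
  move=> h; rewrite exprMn ler_piMl ?sqr_ge0//.
  by rewrite -real_normK ?num_real// expr_le1.
have form s (xi : 'cV[R]_m -> 'cV[R]_m) u v : `|s| = 1 -> (forall u, C2bound r M (fun x => xi x u 0)) ->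
    formD (shiftF F c) J xi 0 s (- (s * rho)) u v 0%N 0%N p ^+ 2 <= 4 * ((2 * pi) ^+ 4 * decay rho * K).
  move=> s1 hxi; have [ht _] := formD_tame (q := 0) M1 T0 hJ hxi (wr pp) q0 F2 F4.
  apply: le_trans (formD_value_bound (- (s * rho)) u v s1 K0 ht) _.
  apply: ler_wpM2l => //; apply: ler_wpM2r => //; apply: ler_wpM2l; last exact: decay_bound.
  by rewrite exprn_ge0// mulr_ge0// pi_ge0.
apply: le_trans (normsq_le (Y := 16 * ((2 * pi) ^+ 4 * decay rho * K)) _) _; last first.
  by rewrite le_eqVlt; apply/orP; left; apply/eqP; rewrite /value_const -/K; ring.
move=> u v; rewrite fE// /neckD /sumD /prodD.
have f1 := form 1 xip u v (normr1 _) hp; have f2 := form (-1) xim u v (etrans (normrN _) (normr1 _)) hm.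
rewrite mul1r in f1; rewrite mulN1r opprK in f2.
have := sq2 (le_trans (sq1 _ _ gp1) f1) (le_trans (sq1 _ _ gm1) f2).
by move=> h; rewrite /partial_st/=; exact: le_trans h (dbl _).
Qed.

End Neck.

End CoreEstimates.

(** * The L^2 norm on the neck, supports and derivatives of the cut-offs *)

Section Cutoffs.
Variable R : realType.
Local Notation RR := (measurableTypeR R).
Local Notation mu := (@lebesgue_measure R).
Local Notation leb2 := (@leb2 R).

(** A pointwise bound times the area 2 h of the two strips where f may be nonzero. The jets H serve
    to make f an admissible weak derivative of order zero of itself. *)
Lemma sob_norm0_le m n (h C : R) (f : R * R -> 'M[R]_(m, n))
    (H : 'I_m -> 'I_n -> nat -> nat -> R * R -> R) :
  0 <= h <= 1 -> 0 <= C -> (forall u v, ac2 (-1) 1 (H u v)) ->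
  (forall p u v, -1 < p.1 < 1 -> f p u v = H u v 0%N 0%N p) ->
  (forall p, -1 < p.1 < 1 -> normsq (f p) <= C) ->
  (forall p, -1 < p.1 < 1 -> `|p.1| < 1 - h -> f p = 0) ->
  (sob_norm 0 0 `[(-1)%R, 1%R]%classic f <= ((C * (2 * h)) `^ 2^-1)%:E)%E.
Proof.
move=> /andP[h0 h1] C0 acH fH fC f0.
pose A := `[(-1)%R, 1%R]%classic : set R.
have AE : A° = [set s | -1 < s < 1].
  by rewrite interior_itv; apply/seteqP; split => x /=; rewrite in_itv.
pose D (i j : nat) (p : R * R) : 'M[R]_(m, n) := if -1 < p.1 < 1 then f p else 0.
have lt11 : (-1 : R) < 1 by lra.
have wD i j : (i + j <= 0)%N -> weak_partial A i j f (D i j).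
  rewrite leqn0 addn_eq0 => /andP[/eqP -> /eqP ->].
  apply: weak_partial_ext (ac2_weak_partial lt11 AE acH fH (isT : (0 + 0 <= 2)%N)).
  move=> p; rewrite AE/= /D => pp; rewrite pp; apply/matrixP => u v; rewrite mxE.
  by rewrite fH.
set I := (\int[leb2]_(p in A `*` `[0%R, 1%R]%classic)
      (jet_normsq 0 D p * expR (2 * 0 * `|p.1|))%:E)%E.
have JE p : jet_normsq 0 D p = normsq (D 0%N 0%N p).
  by rewrite /jet_normsq !big_ord_recl !big_ord0 /= !addr0 bin0 mul1r.
have mr x1 x2 : measurable (rect x1 x2 0 1 : set (RR * RR)) by exact: measurable_rect.
pose S : set (RR * RR) := rect (-1) (-1 + h) 0 1 `|` rect (1 - h) 1 0 1.
have mS : measurable S by apply: measurableU; exact: mr.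
have D0 p : D 0%N 0%N p = 0 -> jet_normsq 0 D p = 0.
  by move=> e; rewrite JE e /normsq big1// => u _; rewrite big1// => v _; rewrite mxE expr0n.
have IE : (I <= (C * (2 * h))%:E)%E.
  rewrite /I (@integral_suppE _ S).
  - apply: (@le_trans _ _ (\int[leb2]_(p in S) C%:E)%E).
      apply: ge0_le_integralT => //.
      + by move=> p _; rewrite lee_fin mulr_ge0 ?expR_ge0// jet_normsq_ge0.
      + by move=> p _; rewrite lee_fin mulr0 mul0r expR0 mulr1 JE /D; case: ifP => [/fC//|_];
          rewrite /normsq big1// => u _; rewrite big1// => v _; rewrite mxE expr0n.
    rewrite integral_cst// EFinM; apply: lee_wpmul2l; first by rewrite lee_fin.
    apply: (@le_trans _ _ (leb2 (rect (-1) (-1 + h) 0 1) + leb2 (rect (1 - h) 1 0 1))%E).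
      by apply: measureU2; exact: mr.
    by rewrite !leb2_rect -?EFinD ?lee_fin; lra.
  - move=> [s t] [[/= a12 tt]|[/= a12 tt]]; split => //=; move: a12; rewrite /A/= !in_itv/= => /andP[a1 a2];
      by clear -h0 h1 a1 a2; apply/andP; split; lra.
  - move=> [s t] [/=]; rewrite !in_itv/= => /andP[a1 a2] tt nS.
    rewrite D0 ?mul0r// /D/=; case: ifP => // ss; apply: f0 => //=.
    rewrite ltr_norml; apply/andP; split; rewrite ltNge; apply/negP => b1; apply: nS.
      by left; split => //=; rewrite in_itv/=; apply/andP; split; lra.
    by right; split => //=; rewrite in_itv/=; apply/andP; split; lra.
have I0 : (0 <= I)%E.
  by apply: integral_ge0 => p _; rewrite lee_fin mulr_ge0 ?expR_ge0// jet_normsq_ge0.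
apply: (@le_trans _ _ (I `^ 2^-1)%E).
  by apply: ereal_inf_lbound; exists D.
rewrite -poweR_EFin; apply: gt0_ler_poweR => //; rewrite in_itv/= ?leey ?andbT//.
exact: le_trans IE.
Qed.

Let smooth_const (g : R * R -> R) t (x y : R) : smooth g -> x < y ->
  (forall s, x < s < y -> 'D_((1, 0) : R * R) g (s, t) = 0) -> g (y, t) = g (x, t).
Proof.
move=> sg xy g0; have d (s : R) := smooth_is_derive_s s t sg.
have [|z] := MVT xy (fun s _ => d s).
  apply: continuous_subspaceT => s; have [e _] := d s.
  by apply: differentiable_continuous; apply/derivable1_diffP.
rewrite in_itv/= => zz /eqP; rewrite g0// mul0r subr_eq0 => /eqP; exact.
Qed.

(** The cut-off is zero at s = 0 and its differential vanishes up to 1 - 1/rho, so it remains zero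
    that far. *)
Lemma gamma_plus_zero (rho : R) g s t : 1 <= rho -> gamma_plus_spec rho g ->
  -1 < s < 1 - rho^-1 -> g (s, t) = 0.
Proof.
move=> r1 [[sg _] _ _ g0 dg] /andP[s1 s2]; have r0 : 0 < rho^-1 by rewrite invr_gt0; lra.
have [s0|s0] := leP s 0; first by apply: g0; apply/andP; split; lra.
rewrite (smooth_const (t := t) sg s0); first by apply: g0; rewrite lexx andbT; lra.
move=> z /andP[z0 zs]; apply: dg; first by apply/andP; split; lra.
by apply/negP => /andP[z1 _]; lra.
Qed.

Lemma gamma_minus_zero (rho : R) g s t : 1 <= rho -> gamma_minus_spec rho g ->
  -1 + rho^-1 < s < 1 -> g (s, t) = 0.
Proof.
move=> r1 [[sg _] _ _ g0 dg] /andP[s1 s2]; have r0 : 0 < rho^-1 by rewrite invr_gt0; lra.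
have [s0|s0] := leP 0 s; first by apply: g0; apply/andP; split; lra.
rewrite -(smooth_const (t := t) sg s0); first by apply: g0; rewrite lexx; lra.
move=> z /andP[z0 zs]; apply: dg; first by apply/andP; split; lra.
by apply/negP => /andP[_ z1]; lra.
Qed.

(** Finitely many orders occur, so squared constants and doubled exponents can be added up into a
    single polynomial bound. *)
Lemma poly_derivs_all2 (rho0 : R) gamma : poly_derivs rho0 gamma -> exists (C : R) (N : nat),
  0 <= C /\ forall rho p, rho0 <= rho -> 1 <= rho -> - rho <= p.1 <= rho ->
    all2 (C * rho ^+ N) (fun i j => partial_st i j (gamma rho)) p.
Proof.
move=> H; have /choice[CN hCN] (ij : 'I_3 * 'I_3) : exists CN : R * nat, forall rho s t,
    rho0 <= rho -> - rho <= s <= rho ->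
    `|partial_st ij.1 ij.2 (gamma rho) (s, t)| <= CN.1 * rho ^+ CN.2.
  by have [C [N h]] := H ij.1 ij.2; exists (C, N).
exists (\sum_ij (CN ij).1 ^+ 2), (\sum_ij 2 * (CN ij).2)%N; split.
  by apply: sumr_ge0 => ij _; exact: sqr_ge0.
move=> rho [s t] r0 r1 /= ss i j ij.
have i3 : (i < 3)%N by rewrite ltnS (leq_trans _ ij)// leq_addr.
have j3 : (j < 3)%N by rewrite ltnS (leq_trans _ ij)// leq_addl.
pose q : 'I_3 * 'I_3 := (Ordinal i3, Ordinal j3).
have h := hCN q rho s t r0 ss.
apply: (@le_trans _ _ ((CN q).1 ^+ 2 * rho ^+ (2 * (CN q).2))).
  rewrite mulnC exprM -exprMn -real_normK ?num_real//.
  by rewrite ler_pXn2r ?nnegrE// (le_trans _ h).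
apply: ler_pM; rewrite ?sqr_ge0 ?exprn_ge0//; first by lra.
  by rewrite (bigD1 q)//= lerDl; apply: sumr_ge0 => ? _; exact: sqr_ge0.
by apply: ler_weXn2l => //; rewrite (bigD1 q)//= leq_addr.
Qed.

Lemma exp_dominates (N : nat) : exists2 C : R, 0 <= C & forall x, 0 <= x -> x ^+ N <= C * expR x.
Proof.
(* With y = x / (N + 1) one has y^N <= e^(N y) <= e^x; dividing by N + 1 rather than N covers N =
   0. *)
exists (N.+1%:R ^+ N); first by rewrite exprn_ge0.
move=> x x0; pose y := x / N.+1%:R.
have y0 : 0 <= y by rewrite divr_ge0.
have xE : x = N.+1%:R * y by rewrite /y mulrC divfK.
have ye : y <= expR y by apply: le_trans (expR_ge1Dx y); lra.
rewrite [in leLHS]xE exprMn; apply: ler_wpM2l; first by rewrite exprn_ge0.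
apply: (@le_trans _ _ (expR y ^+ N)).
  by apply: lerXn2r; rewrite ?nnegrE ?expR_ge0.
rewrite -expRM_natl ler_expR [leRHS]xE; apply: ler_wpM2r => //.
by rewrite ler_nat.
Qed.

End Cutoffs.

(** * Energy bounds uniform in alpha *)

Section Ends.
Variable R : realType.
Local Notation RR := (measurableTypeR R).
Local Notation mu := (@lebesgue_measure R).
Local Notation leb2 := (@leb2 R).

Lemma sob_norm_fin m n (d : R) (A : set R) (f : R * R -> 'M[R]_(m, n)) :
  (sob_norm 3 d A f < +oo)%E -> exists2 E : R, 0 <= E &
  exists2 D : nat -> nat -> R * R -> 'M[R]_(m, n),
    forall i j, (i + j <= 3)%N -> weak_partial A i j f (D i j) &
    (\int[leb2]_(p in A `*` `[0%R, 1%R]%classic)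
      (jet_normsq 3 D p * expR (2 * d * `|p.1|))%:E <= E%:E)%E.
Proof.
move=> fin; have [C C0 fC] : exists2 C : R, 0 < C & (sob_norm 3 d A f < C%:E)%E.
  case: (sob_norm 3 d A f) fin => [x _|//|_]; last by exists 1 => //; exact: ltNyr.
  exists (`|x| + 1); first by rewrite ltr_wpDl.
  by rewrite lte_fin; have := ler_norm x; lra.
by have [D wD hD] := sob_norm_lt C0 fC; exists (C ^+ 2); [exact: sqr_ge0|exists D].
Qed.

(** Write u + v_alpha as (u + v) + (v_alpha - v). By convergence the last norm is eventually below
    1, so E does not depend on alpha. *)
Lemma end_wen (B : nat -> R -> R) m (d k : R) (A : set R) (up vp : R * R -> 'cV[R]_m)
    (va : nat -> R * R -> 'cV[R]_m) : dfamily B ->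
  (forall y, 1 <= y -> B 0%N y = 1) -> (forall y, y <= -1 -> B 0%N y = 0) ->
  (sob_norm 3 d A up < +oo)%E -> (sob_norm 3 d A vp < +oo)%E -> H3_cvg d A va vp ->
  exists2 E : R, 0 <= E & \forall l \near \oo, exists D : 'I_m -> nat -> nat -> R * R -> R,
    (forall u p, D u 0%N 0%N p = up p u 0 + va l p u 0) /\
    forall a b, (forall s, a < s < b -> (A°) s /\ k * s = 2 * d * `|s|) ->
      forall u, wen a b k E (D u).
Proof.
move=> dB B1 B0 /sob_norm_fin[E1 E10 [D1 w1 h1]] /sob_norm_fin[E2 E20 [D2 w2 h2]] cv.
(* Two applications of [wenD], with energy 1 for the difference v_alpha - v. *)
exists (2 * (2 * E1 + 2 * E2) + 2 * 1); first by lra.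
have : \forall l \near \oo, (sob_norm 3 d A (fun p => (va l p - vp p)%R) < 1%:E)%E.
  apply: (cv [set x | x < 1%:E]%E); apply: open_nbhs_nbhs; split; [exact: open_ereal_lt_ereal|exact: lte01].
apply: filterS => l /(sob_norm_lt ltr01)[D3 w3]; rewrite expr1n => h3.
exists (fun u i j p => (fix00 (fun p => up p u 0) (fun i j p => D1 i j p u 0) i j p +
    fix00 (fun p => vp p u 0) (fun i j p => D2 i j p u 0) i j p) +
    fix00 (fun p => (va l p - vp p) u 0) (fun i j p => D3 i j p u 0) i j p); split.
  by move=> u p; rewrite /fix00/= !mxE; ring.
move=> a b hA u; apply: wenD; [apply: wenD|].
- exact: wen_sob hA w1 h1.
- exact: wen_sob hA w2 h2.
- exact: wen_sob hA w3 h3.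
Qed.

End Ends.

Section Assembly.
Variables (R : realType).
Local Notation RR := (measurableTypeR R).
Local Notation mu := (@lebesgue_measure R).
Local Notation leb2 := (@leb2 R).
Variable B : nat -> R -> R.
Hypothesis dB : dfamily B.
Hypothesis B1 : forall y, 1 <= y -> B 0%N y = 1.
Hypothesis B0 : forall y, y <= -1 -> B 0%N y = 0.

Lemma wen_family m (a b k E : R) (D : 'I_m -> nat -> nat -> R * R -> R) (V : R * R -> 'cV[R]_m)
    (c : 'cV[R]_m) (fs ft : 'I_m -> R * R -> R) :
  (forall u, wen a b k E (D u)) ->
  (forall u p, a < p.1 < b -> D u 0%N 0%N p = V p u 0 - c u 0) ->
  (forall s t, a < s < b -> V (s, t + 1) = V (s, t)) ->
  (forall u, c1strip a b (fun p => V p u 0) (fs u) (ft u)) ->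
  exists F : 'I_m -> nat -> nat -> R * R -> R, [/\ forall u, ac2 a b (F u),
    forall u i j, (i + j <= 2)%N -> forall x1 x2, a < x1 -> x2 < b ->
      (\int[leb2]_(p in rect x1 x2 0 1) (expR (k * p.1) * F u i j p ^+ 2)%:E <= E%:E)%E,
    forall u p, a < p.1 < b -> F u 0%N 0%N p = V p u 0 - c u 0 &
    forall p, a < p.1 < b -> colF (shiftF F c) p = V p].
Proof.
move=> wD D0 perV cV; exists (fun u => jet2 (D u 0%N 0%N) (fs u) (ft u) (D u)).
have key u : ac2 a b (jet2 (D u 0%N 0%N) (fs u) (ft u) (D u)) /\
  forall i j, (i + j <= 2)%N -> forall x1 x2, a < x1 -> x2 < b ->
    (\int[leb2]_(p in rect x1 x2 0 1)
       (expR (k * p.1) * jet2 (D u 0%N 0%N) (fs u) (ft u) (D u) i j p ^+ 2)%:E <= E%:E)%E.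
  have cD : c1strip a b (D u 0%N 0%N) (fs u) (ft u).
    apply: (c1strip_eq _ (c1strip_addc (- c u 0) (cV u))) => p pp.
    by rewrite D0.
  have [h1 h2 h3 h4 h5] := cD.
  apply: (wen_ac2 dB B1 B0 (wD u)) => // s t ss.
  by rewrite !D0// perV.
split => [u|u|u p pp|p pp]; [by have [] := key u|by have [] := key u|exact: D0|].
by apply/matrixP => i j; rewrite !mxE /shiftF /sumD /cstD/= D0// mulr1n subrK [j]ord1.
Qed.

(** The sign s treats both ends at once: it is 1 on the plus and -1 on the minus end, so that s x =
    -|x| and the end map is w at x + s rho. *)
Lemma end_bound m (a b s d r M M0 E rho : R) (A : set R) (J : 'cV[R]_m -> 'M[R]_m)
    (xi : 'cV[R]_m -> 'cV[R]_m) (c : 'cV[R]_m) (w : R * R -> 'cV[R]_m)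
    (D : 'I_m -> nat -> nat -> R * R -> R) (f : R * R -> 'M[R]_(m, 1 + 1)) :
  `|s| = 1 -> a + 1 < b -> A° = [set x | a < x < b] ->
  (forall x, a < x < b -> s * x = - `|x|) ->
  - rho - s * rho <= a -> b <= rho - s * rho ->
  1 <= M -> smooth J -> smooth xi ->
  (forall u v, C2bound r M (fun x => J x u v)) -> (forall u, C2bound r M (fun x => xi x u 0)) ->
  cyl_C1 `[- rho, rho]%classic w -> cyl_periodic `[- rho, rho]%classic w ->
  (forall u, wen a b (- (2 * d * s)) E (D u)) ->
  (forall u p, a < p.1 < b -> D u 0%N 0%N p = w (p.1 + s * rho, p.2) u 0 - c u 0) ->
  (forall t x, - rho < x < rho -> cube r (w (x, t)) /\ forall u, `|w (x, t) u 0 - c u 0| <= M0) ->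
  cube r c ->
  (forall F p u v, a < p.1 < b -> colF F p = w (p.1 + s * rho, p.2) ->
    f p u v = formD F J xi (xi c) s 0 u v 0%N 0%N p) ->
  (sob_norm 2 (2 * pi + d) A f <= (end_const m M M0 (- (2 * d * s)) E `^ 2^-1)%:E)%E.
Proof.
move=> s1 ab AE sx la lb M1 sJ sxi hJ hxi cw pw wD D0 wr cr fE.
have I x : a < x < b -> - rho < x + s * rho < rho by move=> /andP[h1 h2]; apply/andP; split; lra.
have cV u : c1strip a b (fun p => cyl_shift (s * rho) w p u 0)
    (cyl_shift (s * rho) (fun p => dmap w p u (lshift 1 ord0)))
    (cyl_shift (s * rho) (fun p => dmap w p u (rshift 1 ord0))).
  exact: (c1strip_sub la lb (c1strip_shift (s * rho) (cyl_C1_strip u cw))).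
have [F [HF hE F0 FV]] := wen_family (V := cyl_shift (s * rho) w) wD D0
  (fun x t xx => pw _ _ (subset_itv_oo_cc (I x xx))) cV.
apply: (end_estimate (F := F) (c := c) s1 ab AE sx M1 sJ sxi hJ hxi) => //.
- by move=> i p /[dup] pp /I ps; rewrite F0//; have [_] := wr p.2 _ ps; exact.
- by move=> p /[dup] pp /I ps; rewrite FV//; have [] := wr p.2 _ ps.
- by move=> p u v pp; apply: fE => //; rewrite FV.
Qed.

Let onesubB (l : nat) (x : R) : R := if l is 0 then 1 - B 0%N x else - B l x.

Let onesubB_dfamily : dfamily onesubB.
Proof.
move=> l x; case: l => [|l] /=.
  by have := is_deriveB (is_derive_cst (1 : R) x 1) (dB 0%N x); rewrite sub0r.
by have h := dB l.+1 x; exact: is_deriveN.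
Qed.

(** The neck, shifted by -rho or rho, lies inside the plus or the minus end. There w - c_alpha is
    the combination of both end functions with coefficients beta and 1 - beta, so the product rule
    transfers their energies. *)
Lemma neck_wen m (E1 E2 rho d : R) (Dp Dm : 'I_m -> nat -> nat -> R * R -> R) : 1 < rho -> 0 <= d ->
  (forall a b, b <= 0 -> forall u, wen a b (- (2 * d)) E1 (Dp u)) ->
  (forall a b, 0 <= a -> forall u, wen a b (2 * d) E2 (Dm u)) ->
  forall Mb, 0 <= Mb -> (forall l s, (l <= 2)%N -> -1 < s < 1 -> B l s ^+ 2 <= Mb) ->
  (forall s, -1 < s < 1 -> (1 - B 0%N s) ^+ 2 <= Mb) ->
  forall u, wen (-1) 1 0 (2 * (22 * (Mb * E1)) + 2 * (22 * (Mb * E2)))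
    (fun i j p => leibD B (fun i j p => Dp u i j (p.1 - rho, p.2)) i j p +
      leibD onesubB (fun i j p => Dm u i j (p.1 + rho, p.2)) i j p).
Proof.
move=> r1 d0 hp hm Mb Mb0 hB hB' u; apply: wenD; apply: wen_leib => //.
- have := wen_shift rho (k := - (2 * d)) (a := - 1 - rho) (b := 1 - rho) _ (hp _ _ _ u).
  rewrite !subrK; apply; last by lra.
  by move=> s /andP[s1 s2]; rewrite mulNr -mulrN mulr_ge0 ?mulr_ge0//; lra.
- by move=> [|l] s l2 ss /=; [exact: hB'|rewrite sqrrN; exact: hB].
- have := wen_shift (- rho) (k := 2 * d) (a := - 1 + rho) (b := 1 + rho) _ (hm _ _ _ u).
  rewrite !addrK => H; apply: wen_ext (H _ _).
  + by move=> i j p; rewrite opprK.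
  + by move=> s /andP[s1 s2]; rewrite mulr_ge0 ?mulr_ge0//; lra.
  + by lra.
Qed.

Lemma dfamily_sq_bound : exists2 Mb, 0 <= Mb & (forall l s, (l <= 2)%N -> -1 < s < 1 -> B l s ^+ 2 <= Mb) /\
  (forall s, -1 < s < 1 -> (1 - B 0%N s) ^+ 2 <= Mb).
Proof.
have bd (h : R -> R) : continuous h -> exists2 K, 0 <= K & forall s, -1 < s < 1 -> h s ^+ 2 <= K.
  move=> ch; have cw : {within `[-1, 1], continuous h} by exact: continuous_subspaceT.
  have [K [_ hK]] := compact_bounded (continuous_compact cw (@segment_compact R (-1) 1)).
  exists ((`|K| + 1) ^+ 2); first exact: sqr_ge0.
  move=> s /andP[s1 s2]; rewrite -real_normK ?num_real// ler_pXn2r ?nnegrE ?addr_ge0//.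
  apply: hK; last by exists s => //=; rewrite in_itv/= !ltW.
  by have := ler_norm K; lra.
have cB l : continuous (B l) by exact: dfamily_continuous.
have [K0 p0 h0] := bd _ (cB 0%N); have [K1 p1 h1] := bd _ (cB 1%N); have [K2 p2 h2] := bd _ (cB 2%N).
have [K3 p3 h3] := bd (fun x => 1 - B 0%N x) (fun x => cvgB (cvg_cst _) (cB 0%N x)).
exists (K0 + K1 + K2 + K3); first by rewrite !addr_ge0.
split; last by move=> s /h3 h; lra.
by move=> [|[|[|l]]] // s _ ss; [have := h0 s ss|have := h1 s ss|have := h2 s ss]; lra.
Qed.

End Assembly.

(** * Rates of decay *)

Section Rates.
Variable R : realType.

Lemma value_const_ge0 m (M : R) : 1 <= M -> 0 <= value_const m M.
Proof.
move=> M1; apply: mulr_ge0 => //; apply: mulr_ge0 => //; apply: mulr_ge0 => //.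
by apply: mulr_ge0; [rewrite exprn_ge0// mulr_ge0// pi_ge0|exact: form_const_ge0].
Qed.

Lemma mx_entry_le m (x : 'cV[R]_m) u : `|x u 0| <= `|x|.
Proof.
rewrite [leRHS]/Num.Def.normr/= mx_normrE.
exact: (le_bigmax 0 (fun k : 'I_m * 'I_1 => `|x k.1 k.2|) (u, 0)).
Qed.

Lemma normsq_entry_lt m (x : 'cV[R]_m) (e : R) u : 0 < e -> normsq x < e ^+ 2 -> `|x u 0| <= e.
Proof.
move=> e0 h; have := le_lt_trans (normsq_entry x u 0) h.
rewrite -real_normK ?num_real// ltr_pXn2r ?nnegrE ?(ltW e0)//; exact: ltW.
Qed.

Lemma neck_const_ge0 m (M M0 E : R) : 1 <= M -> 0 <= E -> 0 <= neck_const m M M0 E.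
Proof.
move=> M1 E0; have K0 := form_const_ge0 m M1.
have t0 : 0 <= theta_const M0 0 :> R.
  by rewrite /theta_const normr0 addr_ge0 ?addr_ge0// mulr_ge0// gn_const_ge0.
have P0 : 0 <= (2 * pi : R) ^+ 4 * form_const m M.
  by apply: mulr_ge0 => //; rewrite exprn_ge0// mulr_ge0// pi_ge0.
have S0 : 0 <= 2 + m%:R * (theta_const M0 0 * E) by rewrite addr_ge0// !mulr_ge0.
rewrite /neck_const; apply: mulr_ge0 => //; apply: mulr_ge0 => //; apply: mulr_ge0 => //.
by apply: mulr_ge0 => //; exact: mulr_ge0.
Qed.

(** The polynomial is absorbed by e^(pi rho), which leaves e^(-3 pi rho) under the square root;
    hence the exponent 3 pi / 2. *)
Lemma neck_rate (C K : R) (N : nat) : 0 <= C -> 0 <= K -> exists G : R, forall rho, 1 <= rho ->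
  ((C * rho ^+ N * decay rho * K) `^ 2^-1 <= G * expR (- (3 * pi / 2 * rho))).
Proof.
move=> C0 K0; have [X X0 hX] := exp_dominates R N.
pose Z := C * X * expR (4 * pi) * K.
have Z0 : 0 <= Z by rewrite !mulr_ge0 ?expR_ge0.
exists (Num.sqrt Z) => rho r1.
have r0 : 0 <= rho by lra.
have h1 : rho ^+ N <= X * expR (pi * rho).
  apply: le_trans (hX rho r0) _; apply: ler_wpM2l => //; rewrite ler_expR ler_peMl//.
  by have := pi_ge2 R; lra.
have h2 : C * rho ^+ N * decay rho * K <= Z * expR (- (3 * pi / 2 * rho)) ^+ 2.
  rewrite -expRM_natl.
  have -> : Z * expR (2%:R * - (3 * pi / 2 * rho)) =
      C * (X * expR (pi * rho)) * decay rho * K.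
    have -> : 2%:R * - (3 * pi / 2 * rho) = pi * rho + - (4 * pi * rho) by field.
    by rewrite expRD /Z /decay; ring.
  apply: ler_wpM2r => //; apply: ler_wpM2r; first by rewrite mulr_ge0 ?expR_ge0.
  exact: ler_wpM2l.
have e0 := expR_ge0 (- (3 * pi / 2 * rho)).
have x0 : 0 <= C * rho ^+ N * decay rho * K.
  by rewrite mulr_ge0// mulr_ge0 ?mulr_ge0 ?exprn_ge0 ?expR_ge0.
rewrite powR12_sqrt//; apply: le_trans (ler_wsqrtr h2) _.
by rewrite sqrtrM// sqrtr_sqr ger0_norm.
Qed.

Lemma value_rate (V e : R) : 0 <= V -> 0 < e -> exists r0 : R, forall rho, r0 <= rho -> 1 <= rho ->
  (V * decay rho * (2 * rho^-1)) `^ 2^-1 <= e * expR (- (2 * pi * rho)).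
Proof.
(* Solves 2 V e^(4 pi) / rho <= e^2, the inequality left after squaring and dividing by e^(-4 pi
   rho). *)
move=> V0 e0; exists (2 * V * expR (4 * pi) / e ^+ 2) => rho hr r1.
have r0 : 0 < rho by lra.
have D0 : 0 <= decay rho by rewrite mulr_ge0 ?expR_ge0.
rewrite powR12_sqrt; last first.
  by rewrite mulr_ge0 ?mulr_ge0// invr_ge0 ltW.
have E0 := expR_ge0 (- (2 * pi * rho)).
rewrite -[leRHS]ger0_norm; last by rewrite mulr_ge0// ltW.
rewrite -sqrtr_sqr; apply: ler_wsqrtr; rewrite exprMn -expRM_natl.
have -> : 2%:R * - (2 * pi * rho) = - (4 * pi * rho) by ring.
have -> : V * decay rho * (2 * rho^-1) = (2 * V * expR (4 * pi)) / rho * expR (- (4 * pi * rho)).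
  by rewrite /decay; ring.
apply: ler_wpM2r; first exact: expR_ge0.
by rewrite ler_pdivrMr// -ler_pdivrMl ?exprn_gt0// mulrC.
Qed.

End Rates.

(** * The preglued map and the perturbation on the ends and on the neck *)

Section Gluing.
Variable R : realType.

Lemma preglue_plus m (beta : R -> R) (up um vp vm : R * R -> 'cV[R]_m) c rho p :
  (forall s, 1 <= s -> beta s = 1) -> 1 <= p.1 + rho ->
  preglue beta up um vp vm c rho (p.1 + rho, p.2) = up p + vp p + c.
Proof.
move=> b1 p1; rewrite /preglue /cyl_shift/= b1// addrK subrr scale0r addr0 scale1r.
by case: p p1.
Qed.

Lemma preglue_minus m (beta : R -> R) (up um vp vm : R * R -> 'cV[R]_m) c rho p :
  (forall s, s <= -1 -> beta s = 0) -> p.1 - rho <= -1 ->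
  preglue beta up um vp vm c rho (p.1 - rho, p.2) = um p + vm p + c.
Proof.
move=> b0 p1; rewrite /preglue /cyl_shift/= b0// subrK subr0 scale0r add0r scale1r.
by case: p p1.
Qed.

Lemma perturbation_plus n (J : 'cV[R]_(n.*2) -> 'M[R]_(n.*2)) xip xim gp gm rho w s t :
  gamma_plus_spec rho (gp rho) -> gamma_minus_spec rho (gm rho) -> 1 <= s <= rho ->
  perturbation J xip xim gp gm rho w (s, t) =
  dzbar_plus (J (w (s, t))) (xip (w (s, t))) (s - rho, t).
Proof.
move=> [_ _ gp1 _ _] [_ _ _ gm0 _] /andP[s1 s2]; rewrite /perturbation.
by rewrite gp1 ?s1// gm0 ?s2 ?andbT ?(le_trans ler01)// scale1r scale0r addr0.
Qed.

Lemma perturbation_minus n (J : 'cV[R]_(n.*2) -> 'M[R]_(n.*2)) xip xim gp gm rho w s t :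
  gamma_plus_spec rho (gp rho) -> gamma_minus_spec rho (gm rho) -> - rho <= s <= -1 ->
  perturbation J xip xim gp gm rho w (s, t) =
  dzbar_minus (J (w (s, t))) (xim (w (s, t))) (s + rho, t).
Proof.
move=> [_ _ _ gp0 _] [_ _ gm1 _ _] /andP[s1 s2]; rewrite /perturbation.
by rewrite gm1 ?s1// gp0 ?s1 ?(le_trans s2)// ?lerN10// scale1r scale0r add0r.
Qed.

Lemma perturbation_neck0 n (J : 'cV[R]_(n.*2) -> 'M[R]_(n.*2)) xip xim gp gm rho w s t :
  gamma_plus_spec rho (gp rho) -> gamma_minus_spec rho (gm rho) -> 1 <= rho ->
  `|s| < 1 - rho^-1 -> perturbation J xip xim gp gm rho w (s, t) = 0.
Proof.
move=> hp hm r1; rewrite ltr_norml => /andP[s1 s2].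
have r0 : 0 < rho^-1 by rewrite invr_gt0; lra.
rewrite /perturbation (gamma_plus_zero t r1 hp) ?(gamma_minus_zero t r1 hm).
- by rewrite !scale0r addr0.
- by apply/andP; split; lra.
- by apply/andP; split; lra.
Qed.

Lemma neck_itv (rho x : R) : 2 <= rho -> -1 < x < 1 -> - rho < x < rho.
Proof. by move=> r2 /andP[x1 x2]; apply/andP; split; lra. Qed.

Lemma neck_itvW (rho x : R) : 2 <= rho -> -1 < x < 1 -> - rho <= x <= rho.
Proof. by move=> r2 /(neck_itv r2)/andP[x1 x2]; rewrite !ltW. Qed.

Lemma inv_itv (rho : R) : 2 <= rho -> 0 <= rho^-1 <= 1.
Proof. by move=> r2; rewrite invr_ge0 invf_le1; [apply/andP; split; lra|lra]. Qed.

End Gluing.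

(** * The three estimates *)

Unset Implicit Arguments.

Theorem proposition10p2 (R : realType) (n : nat)
  (J : 'cV[R]_(n.*2) -> 'M[R]_(n.*2)) (hJ : almost_complex J)
  (delta : R) (hdelta : 0 < delta)
  (up um : R * R -> 'cV[R]_(n.*2))
  (hup : H3_map delta `]-oo, 0] up) (hum : H3_map delta `[0, +oo[ um)
  (hup0 : asymptotic_const -oo%R up 0) (hum0 : asymptotic_const +oo%R um 0)
  (beta : R -> R) (hbeta : gluing_cutoff beta)
  (rho0 : R) (hrho0 : 0 < rho0)
  (xip xim : 'cV[R]_(n.*2) -> 'cV[R]_(n.*2))
  (hxip : smooth xip /\ compact_support xip)
  (hxim : smooth xim /\ compact_support xim)
  (gammap gammam : R -> R * R -> R)
  (hgammap : forall rho, rho0 <= rho -> gamma_plus_spec rho (gammap rho))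
  (hgammam : forall rho, rho0 <= rho -> gamma_minus_spec rho (gammam rho))
  (hgammap_bd : poly_derivs rho0 gammap) (hgammam_bd : poly_derivs rho0 gammam)
  (vap vam : nat -> R * R -> 'cV[R]_(n.*2)) (ca : nat -> 'cV[R]_(n.*2))
  (rhoa : nat -> R)
  (vp vm : R * R -> 'cV[R]_(n.*2)) (c : 'cV[R]_(n.*2))
  (hvap : forall k, H3_map delta `]-oo, 0] (vap k))
  (hvam : forall k, H3_map delta `[0, +oo[ (vam k))
  (hrhoa : forall k, rho0 <= rhoa k)
  (hvp : H3_map delta `]-oo, 0] vp) (hvm : H3_map delta `[0, +oo[ vm)
  (hvap_cvg : H3_cvg delta `]-oo, 0] vap vp)
  (hvam_cvg : H3_cvg delta `[0, +oo[ vam vm)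
  (hca_cvg : ca k @[k --> \oo] --> c)
  (hrhoa_cvg : rhoa k @[k --> \oo] --> +oo%R)
  (eps : R) (heps : 0 < eps) :
  let w := fun k => preglue beta up um (vap k) (vam k) (ca k) (rhoa k) in
  let wap := fun k => cyl_shift (rhoa k) (w k) in
  let wam := fun k => cyl_shift (- rhoa k) (w k) in
  nodal_degeneration eps rhoa w
    (fun p => up p + vp p + c) (fun p => um p + vm p + c) ->
  (forall k s t, - rhoa k < s < rhoa k ->
     dbar J (w k) (s, t) =
     perturbation J xip xim gammap gammam (rhoa k) (w k) (s, t)) ->
  [/\ is_littleo (fun k => sob_norm 0 0 `[-1, 1] (dbar J (w k)))
        (fun k => expR (- (2 * pi * rhoa k))),
      exists2 delta' : R, 0 < delta' &
        exists xiap xiam : nat -> 'cV[R]_(n.*2),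
          is_bigO (fun k => adde
            (sob_norm 2 (2 * pi + delta') `[- rhoa k + 1, 0]
               (fun p => dbar J (wap k) p -
                         dzbar_plus (J (wap k p)) (xiap k) p))
            (sob_norm 2 (2 * pi + delta') `[0, rhoa k - 1]
               (fun p => dbar J (wam k) p -
                         dzbar_minus (J (wam k p)) (xiam k) p)))
            (fun=> 1) &
      exists2 delta'' : R, pi < delta'' &
        is_bigO (fun k => sob_norm 2 0 `[-1, 1] (dbar J (w k)))
          (fun k => expR (- (delta'' * rhoa k)))].
Proof.
move=> w wap wam [_ [hw _ _] [wball _ _] _ _] dbarE.
have [sJ JJ] := hJ; have [[sxip _] [sxim _]] := (hxip, hxim).
have [sbeta _ beta1 beta0] := hbeta.
have [B dB BE] := smooth_dfamily sbeta.
have B1 y : 1 <= y -> B 0%N y = 1 by rewrite BE; exact: beta1.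
have B0 y : y <= -1 -> B 0%N y = 0 by rewrite BE; exact: beta0.
have [_ _ fup] := hup; have [_ _ fum] := hum; have [_ _ fvp] := hvp; have [_ _ fvm] := hvm.
have [E1 E10 ends_p] := @end_wen R B _ delta (- (2 * delta)) _ _ _ _ dB B1 B0 fup fvp hvap_cvg.
have [E2 E20 ends_m] := @end_wen R B _ delta (2 * delta) _ _ _ _ dB B1 B0 fum fvm hvam_cvg.
(* The maps take values in the ball of radius eps, and eventually |c_alpha| <= |c| + 1; so both w
   and c_alpha lie in the cube of radius r, and the entries of w - c_alpha are bounded by M0. *)
pose r := eps + (`|c| + 1); pose M0 := eps + (`|c| + 1).
have c1 : 0 <= `|c| + 1 by rewrite addr_ge0.
have [M1 M11 hJ1] := C2bound_family r
  (fun uv : 'I_(n.*2) * 'I_(n.*2) => smooth_entry uv.1 uv.2 sJ).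
have [M2 M21 hp1] := C2bound_family r (fun u : 'I_(n.*2) => smooth_entry u 0 sxip).
have [M3 M31 hm1] := C2bound_family r (fun u : 'I_(n.*2) => smooth_entry u 0 sxim).
pose M := M1 + M2 + M3; have M_ge1 : 1 <= M by rewrite /M; lra.
have hJM u v : C2bound r M (fun x => J x u v).
  by apply: C2bound_le (hJ1 (u, v)); rewrite /M; lra.
have hpM u : C2bound r M (fun x => xip x u 0) by apply: C2bound_le (hp1 u); rewrite /M; lra.
have hmM u : C2bound r M (fun x => xim x u 0) by apply: C2bound_le (hm1 u); rewrite /M; lra.
have rho_ge A : \forall k \near \oo, A <= rhoa k by move: A; exact/cvgryPge.
have ca_near : \forall k \near \oo, `|ca k| <= `|c| + 1.
  have : \forall k \near \oo, `|c - ca k| < 1 by exact: cvgr_dist_lt.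
  apply: filterS => k h; have := ler_normB c (c - ca k).
  by rewrite opprB addrC subrK; lra.
have cube_ca k : `|ca k| <= `|c| + 1 -> cube r (ca k).
  by move=> h u; apply: le_trans (mx_entry_le _ _) _; rewrite /r; lra.
have wcube k t x : `|ca k| <= `|c| + 1 -> - rhoa k < x < rhoa k ->
    cube r (w k (x, t)) /\ forall u, `|w k (x, t) u 0 - ca k u 0| <= M0.
  move=> hc /andP[x1 x2]; have wx u : `|w k (x, t) u 0| <= eps.
    by apply: normsq_entry_lt => //; apply: wball; rewrite !ltW.
  split => u; first by apply: le_trans (wx u) _; rewrite /r lerDl.
  apply: le_trans (ler_normB _ _) _; apply: lerD => //.
  exact: le_trans (mx_entry_le _ _) hc.
have [Mb Mb0 [hMb hMb']] := dfamily_sq_bound dB.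
pose E3 := 2 * (22 * (Mb * E1)) + 2 * (22 * (Mb * E2)).
have E30 : 0 <= E3 by rewrite addr_ge0// !mulr_ge0.
(* One jet on the neck, with an energy bound independent of alpha, serves for both (1) and (3). *)
have neck : \forall k \near \oo, exists F : 'I_(n.*2) -> nat -> nat -> R * R -> R,
  [/\ forall u, ac2 (-1) 1 (F u),
      forall u i j, (i + j <= 2)%N -> forall x1 x2, -1 < x1 -> x2 < 1 ->
        (\int[@leb2 R]_(p in rect x1 x2 0 1) (expR (0 * p.1) * F u i j p ^+ 2)%:E <= E3%:E)%E,
      forall u p, -1 < p.1 < 1 -> `|F u 0%N 0%N p| <= M0,
      forall p, -1 < p.1 < 1 -> cube r (colF (shiftF F (ca k)) p) &
      forall p u v, -1 < p.1 < 1 -> dbar J (w k) p u v =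
        neckD (shiftF F (ca k)) J xip xim (gammap (rhoa k)) (gammam (rhoa k)) (rhoa k) u v 0%N 0%N p].
  apply: filterS2 (filterI (rho_ge 2) ca_near) (filterI ends_p ends_m).
  move=> k [rho2 hc] [[Dp [Dp0 hDp]] [Dm [Dm0 hDm]]].
  have [pw cw] := hw k.
  have wp a b : b <= 0 -> forall u, wen a b (- (2 * delta)) E1 (Dp u).
    move=> b0; apply: hDp => s /andP[_ sb]; have s0 : s < 0 by exact: lt_le_trans b0.
    by rewrite interior_itv /= in_itv/= s0 ltr0_norm// mulNr mulrN.
  have wm a b : 0 <= a -> forall u, wen a b (2 * delta) E2 (Dm u).
    move=> a0; apply: hDm => s /andP[sa _]; have s0 : 0 < s by exact: le_lt_trans sa.
    by rewrite interior_itv /= in_itv/= s0 gtr0_norm.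
  have rho1 : 1 < rhoa k by apply: lt_le_trans rho2; rewrite ltr1n.
  have wN := neck_wen dB rho1 (ltW hdelta) wp wm Mb0 hMb hMb'.
  have I x := @neck_itv _ _ x rho2.
  have cI x : -1 < x < 1 -> `[- rhoa k, rhoa k]%classic x.
    by move=> /(neck_itvW rho2); rewrite /= in_itv.
  have cN u : c1strip (-1) 1 (fun p => w k p u 0)
      (fun p => dmap (w k) p u (lshift 1 ord0)) (fun p => dmap (w k) p u (rshift 1 ord0)).
    have rhoN : - rhoa k <= -1 by rewrite lerN2 ltW.
    exact: c1strip_sub rhoN (ltW rho1) (cyl_C1_strip u cw).
  (* This is the pregluing formula: subtracting c_alpha leaves beta and 1 - beta times the two end
     functions. *)
  have D0 u p : -1 < p.1 < 1 -> leibD B (fun i j p => Dp u i j (p.1 - rhoa k, p.2)) 0 0 p +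
      (1 - B 0%N p.1) * Dm u 0%N 0%N (p.1 + rhoa k, p.2) = w k p u 0 - ca k u 0.
    by move=> _; rewrite /leibD Dp0 Dm0 BE /w /preglue /cyl_shift !mxE; ring.
  have [F [HF hE F0 FV]] := wen_family dB B1 B0 (V := w k) (c := ca k) wN
    D0 (fun s t ss => pw s t (cI s ss)) cN.
  exists F; split => //.
  - by move=> u p /[dup] pp /I ps; rewrite F0//; case: p pp ps => x t pp ps; apply: (wcube k t x hc ps).2.
  - by move=> [x t] /[dup] pp /I ps; rewrite FV//; exact: (wcube k t x hc ps).1.
  - move=> [s t] u v pp; rewrite dbarE; last exact: I.
    rewrite /neckD /sumD /prodD formD_plus// formD_minus// !subr0 /partial_st /= FV//.
    by rewrite /perturbation /cyl_shift [LHS]mxE [X in X + _]mxE [X in _ + X]mxE.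
have V0 : 0 <= value_const n.*2 M by exact: value_const_ge0.
split.
- move=> e e0; have [r0 hr0] := value_rate V0 e0.
  apply: filterS2 (filterI (rho_ge r0) (rho_ge 2)) neck => k [hr rho2] [F [HF hE FM Fr fE]].
  have [sgp gp01 _ _ _] := hgammap _ (hrhoa k); have [sgm gm01 _ _ _] := hgammam _ (hrhoa k).
  have rho1 : 1 <= rhoa k by apply: le_trans rho2; rewrite ler1n.
  have I x := @neck_itvW _ _ x rho2.
  (* The strips where the perturbation can be nonzero on the neck have width 1/rho. *)
  have ri := inv_itv rho2.
  have D0 : 0 <= value_const n.*2 M * decay (rhoa k).
    by apply: mulr_ge0 => //; rewrite mulr_ge0 ?expR_ge0.
  have acN u v := @ac2_neckD R _ (shiftF F (ca k)) J xip xim _ _ (rhoa k) u v sJ sxip sxim sgp.1 sgm.1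
    (fun s t ss => sgp.2 s t (I s ss)) (fun s t ss => sgm.2 s t (I s ss))
    (fun i => ac2_shiftF (ca k) (HF i)).
  apply: le_trans (sob_norm0_le ri D0 acN fE _ _) _.
  + move=> [s t] pp; apply: (neck_value M_ge1 hJM hpM hmM Fr fE pp).
      by have /andP[h1 h2] := gp01 s t (I s pp); rewrite ger0_norm.
    by have /andP[h1 h2] := gm01 s t (I s pp); rewrite ger0_norm.
  + move=> [s t] /= ss hs; rewrite dbarE; last exact: neck_itv.
    by apply: perturbation_neck0 => //; [exact: hgammap|exact: hgammam].
  by rewrite lee_fin; exact: hr0.
- exists delta => //; exists (fun k => xip (ca k)), (fun k => xim (ca k)).
  pose C1 := (end_const n.*2 M M0 (- (2 * delta * 1)) E1) `^ 2^-1.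
  pose C2 := (end_const n.*2 M M0 (- (2 * delta * -1)) E2) `^ 2^-1.
  (* [rho >= 3] gives the intervals of length rho - 1 more than the length 1 that the interpolation
     requires. *)
  exists (C1 + C2); apply: filterS2 (filterI (rho_ge 3) ca_near) (filterI ends_p ends_m).
  move=> k [rho3 hc] [[Dp [Dp0 hDp]] [Dm [Dm0 hDm]]].
  have [pw cw] := hw k.
  rewrite mulr1 EFinD; apply: leeD.
  + apply: (@end_bound R B dB B1 B0 _ (- rhoa k + 1) 0 1 delta r M M0 E1 (rhoa k) _ J xip (ca k) (w k) Dp) => //.
    * by rewrite normr1.
    * by clear -rho3; lra.
    * by rewrite interior_itv; apply/seteqP; split => x /=; rewrite in_itv.
    * by move=> x /andP[_ x0]; rewrite mul1r ltr0_norm// opprK.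
    * by clear -rho3; lra.
    * by clear -rho3; lra.
    * move=> u; rewrite mulr1; apply: hDp => s /andP[_ s0].
      by rewrite interior_itv /= in_itv/= s0 ltr0_norm// mulNr mulrN.
    * move=> u p /andP[p1 _]; rewrite mul1r Dp0 /w preglue_plus ?mxE; first by ring.
        exact: beta1.
      by clear -p1; lra.
    * by move=> t x xx; exact: wcube.
    * exact: cube_ca.
    * move=> F p u v /andP[p1 p2] FE; rewrite formD_plus// FE mul1r addr0 dzbar_plusB//.
      rewrite -surjective_pairing [LHS]mxE [RHS]mxE; congr (_ u v + _).
      (* For p.1 between 1 - rho and 0 the original coordinate p.1 + rho lies between 1 and rho,
         where the plus cut-off is 1 and the minus one is 0. *)
      rewrite /wap dbar_shift dbarE; last by clear -p1 p2 rho3; apply/andP; split; lra.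
      rewrite perturbation_plus ?addrK -?surjective_pairing//; [exact: hgammap|exact: hgammam|].
      by clear -p1 p2; apply/andP; split; lra.
  + apply: (@end_bound R B dB B1 B0 _ 0 (rhoa k - 1) (-1) delta r M M0 E2 (rhoa k) _ J xim (ca k) (w k) Dm) => //.
    * by rewrite normrN normr1.
    * by clear -rho3; lra.
    * by rewrite interior_itv; apply/seteqP; split => x /=; rewrite in_itv.
    * by move=> x /andP[x0 _]; rewrite mulN1r gtr0_norm.
    * by clear -rho3; lra.
    * by clear -rho3; lra.
    * move=> u; rewrite mulrN1 opprK; apply: hDm => s /andP[s0 _].
      by rewrite interior_itv /= in_itv/= s0 gtr0_norm.
    * move=> u p /andP[_ p1]; rewrite mulN1r Dm0 /w preglue_minus ?mxE; first by ring.
        exact: beta0.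
      by clear -p1; lra.
    * by move=> t x xx; exact: wcube.
    * exact: cube_ca.
    * move=> F p u v /andP[p1 p2] FE; rewrite formD_minus// FE mulN1r addr0 dzbar_minusB//.
      rewrite -surjective_pairing [LHS]mxE [RHS]mxE; congr (_ u v + _).
      rewrite /wam dbar_shift dbarE; last by clear -p1 p2 rho3; apply/andP; split; lra.
      rewrite perturbation_minus ?subrK -?surjective_pairing//; [exact: hgammap|exact: hgammam|].
      by clear -p1 p2; apply/andP; split; lra.
- exists (3 * pi / 2); first by clear; have := pi_gt0 R; lra.
  have [C [N1 [C0 hC]]] := poly_derivs_all2 hgammap_bd.
  have [C' [N2 [C'0 hC']]] := poly_derivs_all2 hgammam_bd.
  have [G hG] := neck_rate (N1 + N2) (addr_ge0 C0 C'0) (neck_const_ge0 n.*2 M0 M_ge1 E30).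
  exists G; apply: filterS2 (rho_ge 2) neck => k rho2 [F [HF hE FM Fr fE]].
  have [sgp _ _ _ _] := hgammap _ (hrhoa k); have [sgm _ _ _ _] := hgammam _ (hrhoa k).
  have rho1 : 1 <= rhoa k by apply: le_trans rho2; rewrite ler1n.
  have I x := @neck_itvW _ _ x rho2.
  (* A common bound for the two cut-offs, valid since rho >= 1. *)
  pose Bk := (C + C') * rhoa k ^+ (N1 + N2).
  have pow1 l : (l <= N1 + N2)%N -> rhoa k ^+ l <= rhoa k ^+ (N1 + N2) by move=> h; exact: ler_weXn2l.
  have pow0 l : 0 <= rhoa k ^+ l by apply: exprn_ge0; exact: le_trans rho1.
  have Bk0 : 0 <= Bk by rewrite mulr_ge0// addr_ge0.
  apply: le_trans (neck_estimate M_ge1 sJ sxip sxim hJM hpM hmM HF Fr sgp.1 sgm.1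
    (fun s t ss => sgp.2 s t (I s ss)) (fun s t ss => sgm.2 s t (I s ss)) fE Bk0 FM hE _) _.
  + move=> p pp; split => i j ij.
      apply: le_trans (hC _ p (hrhoa k) rho1 (I _ pp) i j ij) _.
      by apply: ler_pM => //; [lra|apply: pow1; exact: leq_addr].
    apply: le_trans (hC' _ p (hrhoa k) rho1 (I _ pp) i j ij) _.
    by apply: ler_pM => //; [lra|apply: pow1; exact: leq_addl].
  + by rewrite lee_fin; exact: hG.
Qed.
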